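(* Suppose that $Y=\Gamma\backslash\mathcal T$ has $r$ cusps, and put $W=\operatorname{diag}(w_1,\dots,w_r)$. Then $$L^2(Y,\lambda)=L^2_{\mathrm{disc}}(Y)\oplus L^2_{\mathrm{Eis}}(Y),\qquad \operatorname{Spec}_{\mathrm{ess}}(A)=[-2\sqrt q,2\sqrt q],$$ where $L^2_{\mathrm{disc}}(Y)$ is the pure point subspace of $A$ and is finite-dimensional, $L^2_{\mathrm{Eis}}(Y)$ is the absolutely continuous subspace, there is no singular continuous spectrum, and the multiplicity of the absolutely continuous spectrum on the open band $(-2\sqrt q,2\sqrt q)$ is $r$ almost everywhere. If $\{\varphi_j\}_{j=1}^N$ is an orthonormal basis of $L^2_{\mathrm{disc}}(Y)$, then $$I=\sum_{j=1}^N\varphi_j\varphi_j^*+\int_0^\pi\mathcal E_s\,\frac{1}{2\pi(q+1)}W^{-1}\,\mathcal E_s^*\,d\theta,\qquad s=\frac12+\frac{i\theta}{\log q},$$ as a weak identity first on finitely supported functions and then by density.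
   Context: Let $k$ be a global function field with constant field $\mathbb F_q$, $\infty$ a place of degree one, and identify $k_\infty$ with $K=\mathbb F_q(\!(t^{-1})\!)$. Let $\mathbf G=\mathrm{PGL}_2$, $G_f=\mathbf G(\mathbb A_{k,f})$ (finite adeles, i.e. away from $\infty$), $K_f<G_f$ compact open, $g_0\in G_f$ a representative of a class in $\mathbf G(k)\backslash G_f/K_f$, and $\Gamma=\mathbf G(k)\cap g_0K_fg_0^{-1}$, viewed as a subgroup of $\mathbf G(k_\infty)=\mathrm{PGL}_2(K)$ (a non-uniform arithmetic lattice). Let $\mathcal T$ be the $(q+1)$-regular Bruhat–Tits tree of $\mathrm{PGL}_2(K)$ and $Y=\Gamma\backslash\mathcal T$. For a quotient vertex $v$ with lift $\widetilde v$ let $\Gamma_v=\operatorname{Stab}_\Gamma(\widetilde v)$ and $\lambda(v)=|\Gamma_v|^{-1}$; $L^2(Y,\lambda)$ has norm $\|f\|^2=\sum_v|f(v)|^2\lambda(v)$. The adjacency operator is $(Af)(v)=\sum_e[\Gamma_v:\Gamma_e]f(t(e))$, the sum over representatives $e$ of $\Gamma_v$-orbits of oriented tree edges issuing from $\widetilde v$, $\Gamma_e=\operatorname{Stab}_{\Gamma_v}(e)$, $t(e)$ the terminal quotient vertex; it is bounded and self-adjoint on $L^2(Y,\lambda)$ and is also applied to arbitrary functions on $V(Y)$. By reduction theory $Y$ has finitely many cusps, which are cut in their homogeneous part so that $V(Y)$ is the disjoint union of a finite core and rays of vertices $(c,n)$, $1\le c\le r$, $n\ge1$, increasing away from the core,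 with $(Af)(c,n)=qf(c,n-1)+f(c,n+1)$ for $n\ge2$, $(c,1)$ joined only to the core and (with index $1$) to $(c,2)$, and $\lambda(c,n)=w_c(q+1)q^{-n}$. The number $w_c>0$ is the cusp width. Constant-term-normalized Eisenstein family: for $b\in\mathbb C^r$, $\mathcal E_s(b)$ is the generalized eigenfunction of $A$ with eigenvalue $q^s+q^{1-s}$ and cusp expansion $\mathcal E_s(b)(c,n)=q^{ns}b_c+q^{n(1-s)}(\mathcal S_{\mathrm{aut}}(s)b)_c$ for some $r\times r$ matrix $\mathcal S_{\mathrm{aut}}(s)$; it exists and is unique away from a discrete set of parameters and is continued meromorphically elsewhere. For finitely supported $f$, $\mathcal E_s^*f=(\langle f,\mathcal E_s(e_c)\rangle)_{c=1}^r$ (pairings in $L^2(Y,\lambda)$, linear in the first variable; $e_c$ the standard vectors of $\mathbb C^r$), and $\varphi\varphi^*$ denotes $f\mapsto\langle f,\varphi\rangle\varphi$. *)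

(* Defs.v *)
From HB Require Import structures.
From mathcomp Require Import all_boot all_order all_algebra all_field.
From mathcomp Require Import generic_quotient fraction.
From mathcomp Require Import finmap.
From mathcomp Require Import all_classical all_reals all_analysis.
From mathcomp Require Import measurable_realfun complex.

Set Implicit Arguments.
Unset Strict Implicit.
Unset Printing Implicit Defensive.

Import Order.TTheory GRing.Theory Num.Theory.
Import numFieldNormedType.Exports.
Local Open Scope classical_set_scope.
Local Open Scope quotient_scope.
Local Open Scope ring_scope.

Section PGL2.
Variable K : fieldType.

Definition GL2 := {g : 'M[K]_2 | g \in unitmx}.
HB.instance Definition _ := Choice.on GL2.

Definition GL2_one : GL2 := Sub 1%:M (unitmx1 K 2).

Lemma GL2_mul_subproof (g h : GL2) : val g *m val h \in unitmx.
Proof. by rewrite unitmx_mul (valP g) (valP h). Qed.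
Definition GL2_mul (g h : GL2) : GL2 := Sub (val g *m val h) (GL2_mul_subproof g h).

Lemma GL2_inv_subproof (g : GL2) : invmx (val g) \in unitmx.
Proof. by rewrite unitmx_inv (valP g). Qed.
Definition GL2_inv (g : GL2) : GL2 := Sub (invmx (val g)) (GL2_inv_subproof g).

Definition proportional (g h : GL2) : bool :=
  `[< exists2 c : K, c != 0 & val g = c *: val h >].

Lemma proportional_refl : reflexive proportional.
Proof. by move=> g; apply/asboolP; exists 1; rewrite ?oner_eq0 ?scale1r. Qed.

Lemma proportional_symW g h : proportional g h -> proportional h g.
Proof.
move=> /asboolP[c c0 e]; apply/asboolP; exists c^-1; rewrite ?invr_eq0//.
by rewrite e scalerA mulVf// scale1r.
Qed.

Lemma proportional_sym : symmetric proportional.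
Proof. by move=> g h; apply/idP/idP; apply: proportional_symW. Qed.

Lemma proportional_trans : transitive proportional.
Proof.
move=> h g l /asboolP[c c0 e] /asboolP[d d0 e']; apply/asboolP.
by exists (c * d); rewrite ?mulf_neq0// e e' scalerA.
Qed.

Canonical proportional_equiv :=
  EquivRel proportional proportional_refl proportional_sym proportional_trans.

Definition PGL2 := {eq_quot proportional}.
HB.instance Definition _ := Choice.on PGL2.

Definition PGL2_class (g : GL2) : PGL2 := \pi_PGL2 g.

Lemma PGL2_classP (g h : GL2) :
  PGL2_class g = PGL2_class h <-> exists2 c : K, c != 0 & val g = c *: val h.
Proof.
rewrite /PGL2_class; split=> [/eqP|e].
  by rewrite -[_ == _]/(_ == _ %[mod PGL2]) eqmodE => /asboolP.
by apply/eqP; rewrite -[_ == _]/(_ == _ %[mod PGL2]) eqmodE; apply/asboolP.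
Qed.

Lemma PGL2_reprK (x : PGL2) : PGL2_class (repr x) = x.
Proof. exact: reprK. Qed.

Lemma repr_PGL2_class (g : GL2) :
  exists2 c : K, c != 0 & val (repr (PGL2_class g)) = c *: val g.
Proof. by apply/PGL2_classP; rewrite PGL2_reprK. Qed.

Definition PGL2_one : PGL2 := PGL2_class GL2_one.
Definition PGL2_mul (x y : PGL2) : PGL2 := PGL2_class (GL2_mul (repr x) (repr y)).
Definition PGL2_inv (x : PGL2) : PGL2 := PGL2_class (GL2_inv (repr x)).

Lemma PGL2_mulE g h :
  PGL2_mul (PGL2_class g) (PGL2_class h) = PGL2_class (GL2_mul g h).
Proof.
apply/PGL2_classP => /=.
have [c c0 ->] := repr_PGL2_class g; have [d d0 ->] := repr_PGL2_class h.
by exists (d * c); rewrite ?mulf_neq0// -scalemxAr -scalemxAl scalerA.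
Qed.

Lemma PGL2_invE g : PGL2_inv (PGL2_class g) = PGL2_class (GL2_inv g).
Proof.
apply/PGL2_classP => /=.
have [c c0 ->] := repr_PGL2_class g.
by exists c^-1; rewrite ?invr_eq0// invmxZ// -?unitfE// unitmxZ ?unitfE// (valP g).
Qed.

Lemma PGL2_mulA : associative PGL2_mul.
Proof.
move=> x y z; rewrite -(PGL2_reprK x) -(PGL2_reprK y) -(PGL2_reprK z) !PGL2_mulE.
by congr PGL2_class; apply: val_inj; rewrite /= mulmxA.
Qed.

Lemma PGL2_mul1 : left_id PGL2_one PGL2_mul.
Proof.
move=> x; rewrite -(PGL2_reprK x) PGL2_mulE.
by congr PGL2_class; apply: val_inj; rewrite /= mul1mx.
Qed.

Lemma PGL2_mulr1 : right_id PGL2_one PGL2_mul.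
Proof.
move=> x; rewrite -(PGL2_reprK x) PGL2_mulE.
by congr PGL2_class; apply: val_inj; rewrite /= mulmx1.
Qed.

Lemma PGL2_mulV : left_inverse PGL2_one PGL2_inv PGL2_mul.
Proof.
move=> x; rewrite -(PGL2_reprK x) PGL2_invE PGL2_mulE.
by congr PGL2_class; apply: val_inj; rewrite /= mulVmx// (valP (repr x)).
Qed.

Lemma PGL2_mulrV : right_inverse PGL2_one PGL2_inv PGL2_mul.
Proof.
move=> x; rewrite -(PGL2_reprK x) PGL2_invE PGL2_mulE.
by congr PGL2_class; apply: val_inj; rewrite /= mulmxV// (valP (repr x)).
Qed.

HB.instance Definition _ :=
  isGroup.Build PGL2 PGL2_mulA PGL2_mul1 PGL2_mulr1 PGL2_mulV PGL2_mulrV.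

End PGL2.

Section PGL2map.
Variables (K L : fieldType) (f : {rmorphism K -> L}).

Lemma GL2_map_subproof (g : GL2 K) : map_mx f (val g) \in unitmx.
Proof. by rewrite map_unitmx (valP g). Qed.

Definition GL2_map (g : GL2 K) : GL2 L := Sub (map_mx f (val g)) (GL2_map_subproof g).
Definition PGL2_map (x : PGL2 K) : PGL2 L := PGL2_class (GL2_map (repr x)).
End PGL2map.

Section Valuation.
Variable K : fieldType.

(* Normalized: the value group is all of Z.  The value at 0 (mathematically
   +oo) is the dummy 0, so that a valuation is determined as a function. *)
Record is_discrete_valuation (w : K -> int) : Prop := IsDiscreteValuation {
  valuation0 : w 0 = 0;
  valuationM : forall x y, x != 0 -> y != 0 -> w (x * y) = w x + w y;
  valuationD : forall x y, x != 0 -> y != 0 -> x + y != 0 ->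
    Order.min (w x) (w y) <= w (x + y);
  valuation_onto : exists p, w p = 1 }.

(* v(x) >= n, with the convention v(0) = +oo *)
Definition val_ge (w : K -> int) (n : int) : set K := [set x | x = 0 \/ n <= w x].

Definition integral (w : K -> int) (m n : nat) (A : 'M[K]_(m, n)) : Prop :=
  forall i j, val_ge w 0 (A i j).

Variable w : K -> int.

Definition GL2_integral : set (GL2 K) :=
  [set g | integral w (val g) /\ w (\det (val g)) = 0].

(* Image in PGL_2 of the principal congruence subgroup of level n of GL_2(O);
   level 0 is the image of GL_2(O), that is PGL_2(O). *)
Definition congruence_subgroup (n : nat) : set (PGL2 K) :=
  [set PGL2_class g | g in
     [set g | GL2_integral g /\ forall i j, val_ge w n%:Z ((val g - 1%:M) i j)]].

Hypothesis wP : is_discrete_valuation w.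

Lemma val_geD n x y : val_ge w n x -> val_ge w n y -> val_ge w n (x + y).
Proof.
have [->|x0] := eqVneq x 0; first by rewrite add0r.
have [->|y0] := eqVneq y 0; first by rewrite addr0.
have [->|s0] := eqVneq (x + y) 0; first by move=> _ _; left.
move=> [/eqP|nx]; first by rewrite (negbTE x0).
move=> [/eqP|ny]; first by rewrite (negbTE y0).
right; apply: le_trans (valuationD wP x0 y0 s0).
by rewrite le_min nx ny.
Qed.

Lemma val_geM n x y : val_ge w 0 x -> val_ge w n y -> val_ge w n (x * y).
Proof.
move=> [->|nx]; first by rewrite mul0r; left.
move=> [->|ny]; first by rewrite mulr0; left.
have [->|x0] := eqVneq x 0; first by rewrite mul0r; left.
have [->|y0] := eqVneq y 0; first by rewrite mulr0; left.
by right; rewrite (valuationM wP)// -[n]add0r lerD.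
Qed.

Lemma valuation1 : w 1 = 0.
Proof.
have /eqP := valuationM wP (oner_neq0 K) (oner_neq0 K).
by rewrite mulr1 -subr_eq0 opprD addrA subrr add0r oppr_eq0 => /eqP.
Qed.

Lemma valuationN1 : w (-1) = 0.
Proof.
have N1 : (-1 : K) != 0 by rewrite oppr_eq0 oner_eq0.
have /esym/eqP := valuationM wP N1 N1.
by rewrite mulrNN mulr1 valuation1 -mulr2n mulrn_eq0 /= => /eqP.
Qed.

Lemma valuationV x : x != 0 -> w x^-1 = - w x.
Proof.
move=> x0; have := valuationM wP x0 (_ : x^-1 != 0).
rewrite divff// valuation1 invr_eq0 => /(_ x0) /esym/eqP.
by rewrite addrC addr_eq0 => /eqP.
Qed.

Lemma val_ge_le (m n : int) x : m <= n -> val_ge w n x -> val_ge w m x.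
Proof. by move=> mn [->|nx]; [left|right; exact: le_trans nx]. Qed.

Lemma val_ge_sum n (I : Type) (r : seq I) (F : I -> K) :
  (forall i, val_ge w n (F i)) -> val_ge w n (\sum_(i <- r) F i).
Proof.
move=> nF; elim/big_ind: _ => //; first by left.
by move=> x y; exact: val_geD.
Qed.

Lemma GL2_integralM g h : GL2_integral g -> GL2_integral h ->
  GL2_integral (GL2_mul g h).
Proof.
move=> [ig dg] [ih dh]; split=> /=.
  by move=> i j; rewrite mxE; apply: val_ge_sum => l; exact: val_geM.
by rewrite det_mulmx (valuationM wP) ?dg ?dh// -unitfE -unitmxE (valP g, valP h).
Qed.

Lemma val_ge_sign n x : val_ge w 0 x -> val_ge w 0 ((-1) ^+ n * x).
Proof.
move=> x0; apply: val_geM => //; right; elim: n => [|n IH].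
  by rewrite expr0 valuation1.
by rewrite exprS (valuationM wP) ?valuationN1 ?add0r// ?signr_eq0// oppr_eq0 oner_eq0.
Qed.

Lemma GL2_integralV g : GL2_integral g -> GL2_integral (GL2_inv g).
Proof.
move=> [ig dg]; have d0 : \det (val g) != 0 by rewrite -unitfE -unitmxE (valP g).
split=> /=; last by rewrite det_inv valuationV// dg oppr0.
move=> i j; rewrite /invmx (valP g) !mxE; apply: val_geM.
  by right; rewrite valuationV// dg oppr0.
rewrite /cofactor; apply: val_ge_sign; rewrite det_mx11 !mxE.
exact: ig.
Qed.

Lemma PGL2_integralP x : congruence_subgroup 0 x <->
  exists2 g, GL2_integral g & PGL2_class g = x.
Proof.
split=> [[g [ig _] <-]|[g ig <-]]; first by exists g.
exists g => //; split=> // i j; rewrite !mxE.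
apply: val_geD; first exact: ig.1.
rewrite -mulN1r; apply: val_geM; first by right; rewrite valuationN1.
by right; case: (i == j); rewrite ?mulr0n ?mulr1n ?valuation1 ?(valuation0 wP).
Qed.

Lemma PGL2_integral1 : congruence_subgroup 0 (1%g : PGL2 K).
Proof.
apply/PGL2_integralP; exists (GL2_one K) => //; split=> /=; last first.
  by rewrite det1 valuation1.
by move=> i j; rewrite !mxE; right; case: (i == j);
  rewrite ?mulr0n ?mulr1n ?valuation1 ?(valuation0 wP).
Qed.

Lemma PGL2_integralM x y : congruence_subgroup 0 x -> congruence_subgroup 0 y ->
  congruence_subgroup 0 (x * y)%g.
Proof.
move=> /PGL2_integralP[g ig <-] /PGL2_integralP[h ih <-]; apply/PGL2_integralP.
exists (GL2_mul g h); first exact: GL2_integralM.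
by rewrite -PGL2_mulE.
Qed.

Lemma PGL2_integralV x : congruence_subgroup 0 x -> congruence_subgroup 0 x^-1%g.
Proof.
move=> /PGL2_integralP[g ig <-]; apply/PGL2_integralP.
exists (GL2_inv g); first exact: GL2_integralV.
by rewrite -PGL2_invE.
Qed.

Lemma congruence_subgroup_le m n : (m <= n)%N ->
  congruence_subgroup n `<=` congruence_subgroup m.
Proof.
move=> mn x [g [ig ng] <-]; exists g => //; split=> // i j.
by apply: val_ge_le (ng i j); rewrite lez_nat.
Qed.

End Valuation.

Section FunctionField.
Variable F : finFieldType.

(* Global function fields over F are the finite extensions k of F(T). *)
Definition constant (k : fieldExtType {fraction {poly F}}) (c : F) : k :=
  (FracField.tofrac c%:P)%:A.

Definition is_full_constant_field (k : fieldExtType {fraction {poly F}}) : Prop :=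
  forall x : k, algebraicOver (@constant k) x -> exists c, x = constant k c.

Variable k : fieldExtType {fraction {poly F}}.

Record place := Place {
  place_val :> k -> int;
  place_valP : is_discrete_valuation place_val }.

(* The residue field is F. *)
Definition degree_one (v : place) : Prop :=
  forall x, val_ge v 0 x -> exists c, val_ge v 1 (x - constant k c).

(* When v has degree one, a completion at v is isomorphic to F((t^-1)). *)
Record completion (v : place) := Completion {
  completion_field :> fieldType;
  completion_val : completion_field -> int;
  completion_valP : is_discrete_valuation completion_val;
  completion_emb : {rmorphism k -> completion_field};
  completion_val_emb : forall x, completion_val (completion_emb x) = v x;
  completion_dense : forall (y : completion_field) (n : int),
    exists x, val_ge completion_val n (y - completion_emb x);
  completion_complete : forall u : nat -> completion_field,
    (forall n : int, exists N, forall i j, (N <= i)%N -> (N <= j)%N ->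
       val_ge completion_val n (u i - u j)) ->
    exists l, forall n : int, exists N, forall i, (N <= i)%N ->
       val_ge completion_val n (u i - l) }.

End FunctionField.

Section Adeles.
Variables (F : finFieldType) (k : fieldExtType {fraction {poly F}}).
Variables (infty : place k) (kc : forall v : place k, completion v).

Definition finite_place := {v : place k | v <> infty}.

Definition local_val (v : finite_place) : kc (sval v) -> int :=
  @completion_val _ _ _ (kc (sval v)).

(* Restricted product of the PGL_2(k_v) with respect to the PGL_2(O_v). *)
Record adelic_PGL2 := AdelicPGL2 {
  component :> forall v : finite_place, PGL2 (kc (sval v));
  component_integral :
    finite_set [set v | ~ congruence_subgroup (@local_val v) 0 (component v)] }.

Lemma adelic_PGL2_eq (g h : adelic_PGL2) : (forall v, g v = h v) -> g = h.
Proof.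
case: g h => [g gP] [h hP] /= gh.
have e : g = h by apply: functional_extensionality_dep.
by subst h; congr AdelicPGL2; exact: Prop_irrelevance.
Qed.

HB.instance Definition _ := gen_eqMixin adelic_PGL2.
HB.instance Definition _ := gen_choiceMixin adelic_PGL2.

Lemma local_valP v : is_discrete_valuation (@local_val v).
Proof. exact: completion_valP. Qed.

Lemma adelic_one_subproof : finite_set [set v : finite_place |
  ~ congruence_subgroup (@local_val v) 0 (1%g : PGL2 (kc (sval v)))].
Proof.
rewrite (_ : [set _ | _] = set0) //; apply/seteqP; split=> v //=.
by apply; apply: PGL2_integral1; exact: local_valP.
Qed.
Definition adelic_one := AdelicPGL2 adelic_one_subproof.

Lemma adelic_mul_subproof (g h : adelic_PGL2) : finite_set [set v : finite_place |
  ~ congruence_subgroup (@local_val v) 0 (g v * h v)%g].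
Proof.
have gh : finite_set
  ([set v | ~ congruence_subgroup (@local_val v) 0 (g v)] `|`
   [set v | ~ congruence_subgroup (@local_val v) 0 (h v)]).
  by rewrite finite_setU; split; exact: component_integral.
apply: sub_finite_set gh => v /= nv.
apply/not_andP => -[gv hv]; apply: nv.
by apply: PGL2_integralM => //; exact: local_valP.
Qed.
Definition adelic_mul g h := AdelicPGL2 (adelic_mul_subproof g h).

Lemma adelic_inv_subproof (g : adelic_PGL2) : finite_set [set v : finite_place |
  ~ congruence_subgroup (@local_val v) 0 (g v)^-1%g].
Proof.
apply: sub_finite_set (component_integral g) => v /= nv gv; apply: nv.
by apply: PGL2_integralV => //; exact: local_valP.
Qed.
Definition adelic_inv g := AdelicPGL2 (adelic_inv_subproof g).

Lemma adelic_mulA : associative adelic_mul.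
Proof. by move=> x y z; apply: adelic_PGL2_eq => v /=; rewrite mulgA. Qed.
Lemma adelic_mul1 : left_id adelic_one adelic_mul.
Proof. by move=> x; apply: adelic_PGL2_eq => v /=; rewrite mul1g. Qed.
Lemma adelic_mulr1 : right_id adelic_one adelic_mul.
Proof. by move=> x; apply: adelic_PGL2_eq => v /=; rewrite mulg1. Qed.
Lemma adelic_mulV : left_inverse adelic_one adelic_inv adelic_mul.
Proof. by move=> x; apply: adelic_PGL2_eq => v /=; rewrite mulVg. Qed.
Lemma adelic_mulrV : right_inverse adelic_one adelic_inv adelic_mul.
Proof. by move=> x; apply: adelic_PGL2_eq => v /=; rewrite mulgV. Qed.

HB.instance Definition _ := isGroup.Build adelic_PGL2
  adelic_mulA adelic_mul1 adelic_mulr1 adelic_mulV adelic_mulrV.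

(* For N with finite support these subgroups form a neighbourhood basis of the
   identity in the restricted product topology. *)
Definition adelic_congruence (N : finite_place -> nat) : set adelic_PGL2 :=
  [set u | forall v, congruence_subgroup (@local_val v) (N v) (u v)].

Definition adelic_open : set_system adelic_PGL2 :=
  [set O | forall g, O g ->
     exists2 N : finite_place -> nat, finite_set [set v | N v <> 0%N] &
       forall u, adelic_congruence N u -> O (g * u)%g].

Lemma adelic_openT : adelic_open setT.
Proof.
move=> g _; exists (fun=> 0%N) => //.
by rewrite (_ : [set _ | _] = set0) //; apply/seteqP; split=> v //=; apply.
Qed.

Lemma adelic_openI : setI_closed adelic_open.
Proof.
move=> A B oA oB g [/oA[M fM MA] /oB[N fN NB]].
exists (fun v => maxn (M v) (N v)) => [|u uMN].
  have fMN : finite_set ([set v | M v <> 0%N] `|` [set v | N v <> 0%N]).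
    by rewrite finite_setU.
  apply: sub_finite_set fMN => v /= nv; apply/not_andP => -[Mv Nv].
  by apply: nv; rewrite Mv Nv.
split; [apply: MA|apply: NB] => v; apply: congruence_subgroup_le (uMN v).
- exact: leq_maxl.
- exact: leq_maxr.
Qed.

Lemma adelic_open_bigU (I : Type) (f : I -> set adelic_PGL2) :
  (forall i, adelic_open (f i)) -> adelic_open (\bigcup_i f i).
Proof.
move=> of_ g [i _ /of_[N fN Nf]]; exists N => // u /Nf gu.
by exists i.
Qed.

HB.instance Definition _ := isOpenTopological.Build adelic_PGL2
  adelic_openT adelic_openI adelic_open_bigU.

Definition compact_open_subgroup (Kf : set adelic_PGL2) : Prop :=
  [/\ group_closed (mem Kf), compact Kf & open Kf].

(* G(k) `&` g0 Kf g0^-1, inside PGL_2(k_infty). *)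
Definition arithmetic_group (Kf : set adelic_PGL2) (g0 : adelic_PGL2) :
    set (PGL2 (kc infty)) :=
  [set PGL2_map (completion_emb (kc infty)) gamma | gamma in
     [set gamma : PGL2 k | exists2 kappa, Kf kappa &
        forall v : finite_place, PGL2_map (completion_emb (kc (sval v))) gamma =
          (g0 * kappa * g0^-1)%g v]].

End Adeles.

Section Tree.
Variables (K : fieldType) (w : K -> int).

Definition lattice_of (g : 'M[K]_2) : set 'cV[K]_2 :=
  [set g *m x | x in [set x : 'cV[K]_2 | integral w x]].

Definition is_lattice : set (set 'cV[K]_2) :=
  [set L | exists g : GL2 K, L = lattice_of (val g)].

Definition lattice := set_type is_lattice.
HB.instance Definition _ := Choice.on lattice.

Lemma lattice_image_subproof (g : GL2 K) (L : lattice) :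
  (fun x => val g *m x) @` val L \in is_lattice.
Proof.
apply/mem_set; have [h Lh] := set_mem (valP L); exists (GL2_mul g h).
rewrite Lh /lattice_of; apply/seteqP; split=> [y [_ [x ix <-] <-]|y [x ix <-]] /=.
  by exists x => //; rewrite mulmxA.
by exists (val h *m x); [exists x|rewrite mulmxA].
Qed.
Definition lattice_image (g : GL2 K) (L : lattice) : lattice :=
  exist (fun M => M \in is_lattice) _ (lattice_image_subproof g L).

Definition homothetic (L M : lattice) : bool :=
  `[< exists2 c : K, c != 0 & val L = ( *:%R c) @` val M >].

Lemma homothetic_refl : reflexive homothetic.
Proof.
move=> L; apply/asboolP; exists 1; first exact: oner_neq0.
apply/seteqP; split=> [x Lx|_ [x Lx <-]]; last by rewrite scale1r.
by exists x => //; rewrite scale1r.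
Qed.

Lemma homothetic_symW L M : homothetic L M -> homothetic M L.
Proof.
move=> /asboolP[c c0 e]; apply/asboolP; exists c^-1; rewrite ?invr_eq0// e.
apply/seteqP; split=> [x Mx|_ [_ [x Mx <-] <-]].
  by exists (c *: x); [exists x|rewrite scalerA mulVf// scale1r].
by rewrite scalerA mulVf// scale1r.
Qed.

Lemma homothetic_sym : symmetric homothetic.
Proof. by move=> g h; apply/idP/idP; apply: homothetic_symW. Qed.

Lemma homothetic_trans : transitive homothetic.
Proof.
move=> M L P /asboolP[c c0 e] /asboolP[d d0 e']; apply/asboolP.
exists (c * d); rewrite ?mulf_neq0// e e'.
apply/seteqP; split=> [_ [_ [x Px <-] <-]|_ [x Px <-]].
  by exists x => //; rewrite scalerA.
by exists (d *: x); [exists x|rewrite scalerA].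
Qed.

Canonical homothetic_equiv :=
  EquivRel homothetic homothetic_refl homothetic_sym homothetic_trans.

Definition vertex := {eq_quot homothetic}.
HB.instance Definition _ := Choice.on vertex.

Definition vertex_of (L : lattice) : vertex := \pi_vertex L.

Definition act (g : PGL2 K) (x : vertex) : vertex :=
  vertex_of (lattice_image (repr g) (repr x)).

Definition adjacent (x y : vertex) : Prop :=
  exists L M : lattice, [/\ vertex_of L = x, vertex_of M = y &
    exists p : K, [/\ w p = 1, ( *:%R p) @` val L `<` val M & val M `<` val L]].

(* Oriented edges are pairs (origin, terminus) of adjacent vertices. *)
Definition edge : Type := (vertex * vertex)%type.
Definition act_edge (g : PGL2 K) (e : edge) : edge := (act g e.1, act g e.2).
Definition edges_from (x : vertex) : set edge :=
  [set e | e.1 = x /\ adjacent e.1 e.2].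

End Tree.

Section Quotient.
Variables (K : fieldType) (w : K -> int) (Gamma : set (PGL2 K)).
Local Notation vertex := (vertex w).
Local Notation edge := (edge w).

Definition orbit (x : vertex) : set vertex := [set act g x | g in Gamma].

Definition quotient_vertex := set_type (range orbit).
HB.instance Definition _ := Choice.on quotient_vertex.

Definition proj (x : vertex) : quotient_vertex :=
  exist (fun o => o \in range orbit) (orbit x) (mem_set (imageT orbit x)).
Definition lift (v : quotient_vertex) : vertex :=
  projT1 (cid2 (set_mem (valP v))).

Definition stab (x : vertex) : set (PGL2 K) :=
  [set g | Gamma g /\ act g x = x].
Definition edge_stab (e : edge) : set (PGL2 K) :=
  [set g | stab e.1 g /\ act_edge g e = e].

(* [H : H'], counting left cosets (0 if there are infinitely many) *)
Definition group_index (H H' : set (PGL2 K)) : nat :=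
  #|` fset_set [set [set (h * h')%g | h' in H'] | h in H] |.

Definition edge_orbits (x : vertex) : set (set edge) :=
  [set [set act_edge g e | g in stab x] | e in edges_from x].
Definition edge_repr (x : vertex) (O : set edge) : edge := xget (x, x) O.

Variable R : realType.

Definition weight (v : quotient_vertex) : R :=
  (#|` fset_set (stab (lift v)) |%:R)^-1.

Definition adjacency (f : quotient_vertex -> R[i]) (v : quotient_vertex) : R[i] :=
  \sum_(O \in edge_orbits (lift v))
    (group_index (stab (lift v)) (edge_stab (edge_repr (lift v) O)))%:R *
    f (proj (edge_repr (lift v) O).2).

(* Rays are indexed by n >= 1; the value of ray c at 0 is irrelevant. *)
Definition core (r : nat) (ray : 'I_r -> nat -> quotient_vertex) :
    set quotient_vertex :=
  [set v | forall c n, (0 < n)%N -> v <> ray c n].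

Record is_cusp_decomposition (q : nat) (r : nat)
    (ray : 'I_r -> nat -> quotient_vertex) (width : 'I_r -> R) : Prop :=
  IsCuspDecomposition {
  ray_inj : forall c c' n n', (0 < n)%N -> (0 < n')%N ->
    ray c n = ray c' n' -> c = c' /\ n = n';
  core_finite : finite_set (core ray);
  ray_adjacency : forall f c n, (1 < n)%N ->
    adjacency f (ray c n) = q%:R * f (ray c n.-1) + f (ray c n.+1);
  ray_first : forall c y, adjacent (lift (ray c 1)) y ->
    core ray (proj y) \/ proj y = ray c 2;
  ray_first_index : forall c,
    exists! y, adjacent (lift (ray c 1)) y /\ proj y = ray c 2;
  ray_weight : forall c n, (0 < n)%N ->
    weight (ray c n) = width c * (q%:R + 1) * q%:R ^- n;
  width_gt0 : forall c, 0 < width c }.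

End Quotient.

Definition arithmetic_quotient (F : finFieldType)
    (k : fieldExtType {fraction {poly F}}) (infty : place k)
    (kc : forall v : place k, completion v) (Kf : set (adelic_PGL2 infty kc))
    (g0 : adelic_PGL2 infty kc) : choiceType :=
  quotient_vertex (@completion_val _ _ _ (kc infty)) (arithmetic_group Kf g0).

Section Hilbert.
Variables (R : realType) (V : choiceType) (lam : V -> R).
Local Notation C := R[i].
Local Notation normc := ComplexField.Normc.normc.
Local Notation mu := (@lebesgue_measure R).

Definition l2norm2 (f : V -> C) : \bar R :=
  (\esum_(v in setT) (normc (f v) ^+ 2 * lam v)%:E)%E.

Definition L2 : set (V -> C) := [set f | (l2norm2 f < +oo)%E].

(* Sum of an absolutely convergent family. *)
Definition rsum (u : V -> R) : R :=
  fine (\esum_(v in setT) (Num.max (u v) 0)%:E)%E -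
  fine (\esum_(v in setT) (Num.max (- u v) 0)%:E)%E.
Definition csum (u : V -> C) : C :=
  Complex (rsum (fun v => complex.Re (u v))) (rsum (fun v => complex.Im (u v))).

Definition dot (f g : V -> C) : C :=
  csum (fun v => f v * conjc (g v) * (lam v)%:C%C).

Definition finitely_supported (f : V -> C) : Prop :=
  finite_set [set v | f v <> 0].

Definition is_subspace (X : set (V -> C)) : Prop :=
  X (fun=> 0) /\
  forall (a : C) f g, X f -> X g -> X (fun v => a * f v + g v).

Definition orthogonal_direct_sum (H X Y : set (V -> C)) : Prop :=
  [/\ is_subspace X /\ is_subspace Y, X `<=` H /\ Y `<=` H,
      forall f g, X f -> Y g -> dot f g = 0 &
      forall f, H f -> exists g h, [/\ X g, Y h & f = (fun v => g v + h v)]].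

Definition finite_dimensional (X : set (V -> C)) : Prop :=
  exists (n : nat) (e : 'I_n -> V -> C),
    forall f, X f -> exists a : 'I_n -> C, f = (fun v => \sum_i a i * e i v).

Definition orthonormal_basis (X : set (V -> C)) (n : nat) (phi : 'I_n -> V -> C) : Prop :=
  [/\ forall i, X (phi i),
      forall i j, dot (phi i) (phi j) = (i == j)%:R &
      forall f, X f -> exists a : 'I_n -> C, f = (fun v => \sum_i a i * phi i v)].

Variable A : (V -> C) -> (V -> C).

Definition spectrum : set C :=
  [set z | ~ exists B : (V -> C) -> (V -> C),
     [/\ forall f, L2 f -> L2 (B f),
         exists M : R, forall f, L2 f -> (l2norm2 (B f) <= M%:E * l2norm2 f)%E,
         forall f, L2 f -> (fun v => A (B f) v - z * B f v) = f &
         forall f, L2 f -> B (fun v => A f v - z * f v) = f]].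

Definition eigenspace (z : C) : set (V -> C) :=
  [set f | L2 f /\ A f = (fun v => z * f v)].

(* Isolated points of the spectrum that are eigenvalues of finite multiplicity. *)
Definition discrete_spectrum : set C :=
  [set z : C^o | [/\ spectrum z, \forall z' \near z^', ~ spectrum z',
      (exists2 f, eigenspace z f & f <> (fun=> 0)) &
      finite_dimensional (eigenspace z)]].

Definition essential_spectrum : set C := spectrum `\` discrete_spectrum.

(* nu is the spectral measure of f: <p(A) f, f> is the integral of p against nu
   for every monomial p, hence for every continuous p since the support of nu is
   bounded; in particular nu is unique. *)
Definition is_spectral_measure (f : V -> C)
    (nu : {finite_measure set R -> \bar R}) : Prop :=
  (exists M : R, nu (~` `[- M, M]) = 0%E) /\
  forall n, dot (iter n A f) f = (\int[nu]_x (x ^+ n : R))%:C%C.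

Definition pp_subspace : set (V -> C) :=
  [set f | L2 f /\ exists2 nu, is_spectral_measure f nu &
     exists2 S : set R, countable S & nu (~` S) = 0%E].

Definition ac_subspace : set (V -> C) :=
  [set f | L2 f /\ exists2 nu, is_spectral_measure f nu & nu `<< mu].

Definition sc_subspace : set (V -> C) :=
  [set f | L2 f /\ exists2 nu, is_spectral_measure f nu &
     (forall x, nu [set x] = 0%E) /\
     exists S : set R,
       [/\ measurable S, mu S = 0%E & nu (~` S) = 0%E]].

Definition cmeasurable (D : set R) (g : R -> C) : Prop :=
  measurable_fun D (fun x => complex.Re (g x)) /\
  measurable_fun D (fun x => complex.Im (g x)).

(* The direct integral over R of Hilbert spaces of dimension m(x) (at most
   countable): its elements are the sequences (G_j) of functions with
   G_j(x) = 0 unless j < m(x). *)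
Definition direct_integral_norm2 (G : nat -> R -> C) : \bar R :=
  (\sum_(0 <= j <oo) \int[mu]_x (normc (G j x) ^+ 2)%:E)%E.
Definition direct_integral (m : R -> \bar R) : set (nat -> R -> C) :=
  [set G | [/\ forall j, cmeasurable setT (G j),
      forall j x, (m x <= j%:R%:E)%E -> G j x = 0 &
      (direct_integral_norm2 G < +oo)%E]].

(* m is the multiplicity function of the absolutely continuous part of A: that
   part is unitarily equivalent to multiplication by x on the direct integral. *)
Definition is_ac_multiplicity (m : R -> \bar R) : Prop :=
  [/\ measurable_fun [set: R] m,
      forall x, m x = +oo%E \/ exists j : nat, m x = j%:R%:E &
      exists U : (V -> C) -> (nat -> R -> C),
        [/\ forall f, ac_subspace f ->
              direct_integral m (U f) /\ direct_integral_norm2 (U f) = l2norm2 f,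
            forall (a : C) f g, ac_subspace f -> ac_subspace g ->
              forall j, {ae mu, forall x, U (fun v => a * f v + g v) j x =
                                 a * U f j x + U g j x},
            forall f, ac_subspace f ->
              forall j, {ae mu, forall x, U (A f) j x = x%:C%C * U f j x} &
            forall G, direct_integral m G ->
              exists2 f, ac_subspace f & forall j, {ae mu, forall x, U f j x = G j x}]].

Definition cintegrable (D : set R) (g : R -> C) : Prop :=
  mu.-integrable D (fun x => (complex.Re (g x))%:E) /\
  mu.-integrable D (fun x => (complex.Im (g x))%:E).
Definition cintegral (D : set R) (g : R -> C) : C :=
  Complex (\int[mu]_(x in D) complex.Re (g x)) (\int[mu]_(x in D) complex.Im (g x)).

Definition projector (n : nat) (phi : 'I_n -> V -> C) (f : V -> C) : V -> C :=
  fun v => \sum_j dot f (phi j) * phi j v.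

End Hilbert.

Section Eisenstein.
Variables (R : realType) (V : choiceType) (lam : V -> R).
Local Notation C := R[i].

Definition cpow (q : nat) (s : C) : C :=
  Complex (expR (complex.Re s * ln q%:R) * cos (complex.Im s * ln q%:R))
          (expR (complex.Re s * ln q%:R) * sin (complex.Im s * ln q%:R)).

Definition holomorphic_at (g : C^o -> C^o) (s0 : C^o) : Prop :=
  \forall s \near s0, derivable g s 1.

(* Meromorphic on C, with removable singularities removed; the values at the
   poles are irrelevant. *)
Definition meromorphic (f : C^o -> C^o) : Prop :=
  forall s0 : C^o,
    (exists (m : nat) (g : C^o -> C^o), holomorphic_at g s0 /\
       \forall s \near s0^', f s = g s / (s - s0) ^+ m) /\
    (forall l : C^o, f s @[s --> s0^'] --> l -> f s0 = l).

Variables (A : (V -> C) -> (V -> C)) (q r : nat) (ray : 'I_r -> nat -> V).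

Definition is_generalized_eigenfunction (s : C) (f : V -> C) : Prop :=
  A f = (fun v => (cpow q s + cpow q (1 - s)) * f v).

Definition has_cusp_expansion (s : C) (f : V -> C) (b a : 'cV[C]_r) : Prop :=
  forall c n, (0 < n)%N ->
    f (ray c n) = cpow q (n%:R * s) * b c 0 + cpow q (n%:R * (1 - s)) * a c 0.

Definition is_eisenstein_family (Eis : C -> 'cV[C]_r -> V -> C) : Prop :=
  (exists (D : set C) (Saut : C -> 'M[C]_r),
     (forall s0 : C^o, \forall s \near s0^', ~ D s) /\
     forall s, ~ D s -> forall b,
       [/\ is_generalized_eigenfunction s (Eis s b),
           has_cusp_expansion s (Eis s b) b (Saut s *m b) &
           forall f a, is_generalized_eigenfunction s f ->
             has_cusp_expansion s f b a -> f = Eis s b]) /\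
  forall b v, meromorphic (fun s => Eis s b v).

Definition eisenstein_adjoint (Eis : C -> 'cV[C]_r -> V -> C) (s : C) (f : V -> C) :
    'cV[C]_r :=
  \col_c dot lam f (Eis s (delta_mx c 0)).

(* s = 1/2 + i theta / log q *)
Definition critical_line (theta : R) : C := Complex 2^-1 (theta / ln q%:R).

(* (2 pi (q + 1))^-1 W^-1 *)
Definition plancherel_matrix (width : 'I_r -> R) : 'M[C]_r :=
  (2 * (pi : R)%:C%C * (q%:R + 1))^-1 *:
    invmx (diag_mx (\row_c (width c)%:C%C)).

(* T is the continuous extension to L^2(V, lam), with values in
   L^2([0, pi]; C^r), of f |-> (theta |-> Eis_s^* f), s = critical_line theta. *)
Definition is_L2_extension (Eis : C -> 'cV[C]_r -> V -> C)
    (T : (V -> C) -> R -> 'cV[C]_r) : Prop :=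
  forall f, L2 lam f ->
    (forall c, cmeasurable `[0, pi] (fun theta => T f theta c 0)) /\
    (\int[@lebesgue_measure R]_(theta in `[0%R, pi])
       (\sum_c ComplexField.Normc.normc (T f theta c 0) ^+ 2)%R%:E < +oo)%E /\
    forall fn : nat -> V -> C, (forall n, finitely_supported (fn n)) ->
      l2norm2 lam (fun v => fn n v - f v) @[n --> \oo] --> 0%E ->
      (\int[@lebesgue_measure R]_(theta in `[0%R, pi])
         (\sum_c ComplexField.Normc.normc
            (eisenstein_adjoint Eis (critical_line theta) (fn n) c 0 - T f theta c 0)
            ^+ 2)%R%:E)%E @[n --> \oo] --> 0%E.

End Eisenstein.

(* Main.v *)
Require Import Defs.
From HB Require Import structures.
From mathcomp Require Import all_boot all_order all_algebra all_field.
From mathcomp Require Import generic_quotient fraction finmap.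
From mathcomp Require Import all_classical all_reals all_analysis.
From mathcomp Require Import measurable_realfun complex ring lra zify.

Set Implicit Arguments.
Unset Strict Implicit.
Unset Printing Implicit Defensive.

Import Order.TTheory GRing.Theory Num.Theory.
Import numFieldNormedType.Exports.
Local Open Scope classical_set_scope.
Local Open Scope ring_scope.

(**
On the critical line s = 1/2 + i theta / log q the spectral parameter is 2
sqrt q cos theta, and the Eisenstein eigenfunctions are, on the cusps, plane
waves z^n and z^-n (z = e^(i theta)) up to the factor q^(n/2). Solving the
finite linear system of the core makes their values rational functions of z;
the Wronskian identity makes the scattering matrix symmetric and unitary for
the widths, and bounds the eigenfunctions near the apparent poles.

Let T f = E^* f and let S be its adjoint, the wave-packet synthesis, for the
weights kappa_c = (2 pi (q + 1) w_c)^-1. Parseval on the cusps shows that T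
and S are bounded, and both intertwine A with multiplication by 2 sqrt q cos
theta. The defect f - S T f commutes with A. If d is a common denominator of
the scattering matrix, then suitable combinations, with the coefficients of d,
of deg d + 1 consecutive point masses of a cusp have trigonometric polynomials
as transforms, and orthogonality of the exponentials shows that their defect
vanishes on the cusps: the defect has finite rank. Its range is an invariant
finite-dimensional subspace of L^2, hence spanned by eigenfunctions psi_i, and
f = S T f + sum_i <f, psi_i> psi_i.

If S F = 0 then S (p F) = 0 for every polynomial p in 2 sqrt q cos theta, so
sum_c kappa_c F_c E_c(v) = 0 almost everywhere for each vertex v; two vertices
of a cusp then give F_c = 0. Hence S is injective, T S = 1, and T identifies
the orthogonal complement of the psi_i with L^2([0, pi]; C^r). All the
spectral assertions follow: the spectral measure of f is the image of sum_c
kappa_c |T f(c, theta)|^2 d theta under theta |-> 2 sqrt q cos theta, plus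
atoms, and x = 2 sqrt q cos theta turns L^2([0, pi]; C^r) into multiplication
by x on the band with multiplicity r.
*)

(** * Inner product spaces of functions *)

Section ComplexSquare.
Variable R : realType.
Local Notation C := R[i].
Local Notation normc := ComplexField.Normc.normc.

(** Three obstacles shape the argument. The theta-integral runs over half a circle, where the powers
    of z are not orthogonal; but the integral of z^m zbar^n plus its conjugate is 2 pi if m = n and
    0 otherwise. Symmetry and unitarity of the scattering matrix make z and zbar enter in exactly
    this symmetric way, and since the weight of (c,n) times q^n is w_c (q + 1), this fixes kappa_c.
    Next, Cramer's rule may put poles on the circle. Unitarity bounds the eigenfunctions on the
    cusps, but not on the core. There duality serves: a core function orthogonal to all vectors with
    bounded transform would produce an eigenfunction of A supported on the core; its transform
    vanishes off one parameter, hence is bounded, so that it is orthogonal to itself. Finally,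
    spectral measures are known only through moments. One fact handles this: a compactly supported
    finite measure is determined by its moments. It yields the uniqueness of spectral measures, the
    substitution x = 2 sqrt q cos theta, and the vanishing of a function of theta orthogonal to all
    powers of cos theta. *)

Definition nsq (z : C) : R := complex.Re z ^+ 2 + complex.Im z ^+ 2.

Lemma normc_sqr (z : C) : normc z ^+ 2 = nsq z.
Proof. by case: z => a b /=; rewrite sqr_sqrtr// addr_ge0// sqr_ge0. Qed.

Lemma nsq_ge0 (z : C) : 0 <= nsq z.
Proof. by rewrite addr_ge0// sqr_ge0. Qed.

Lemma nsqE (z : C) : (nsq z)%:C%C = z * conjc z.
Proof. by case: z => a b; apply/eqP; rewrite eq_complex /nsq /=; apply/andP; split; apply/eqP; ring. Qed.

Lemma nsqM (z w : C) : nsq (z * w) = nsq z * nsq w.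
Proof. by case: z => a b; case: w => c d; rewrite /nsq /=; ring. Qed.

Lemma nsq_conj (z : C) : nsq (conjc z) = nsq z.
Proof. by case: z => a b; rewrite /nsq /=; ring. Qed.

Lemma nsqR (x : R) : nsq x%:C%C = x ^+ 2.
Proof. by rewrite /nsq /=; ring. Qed.

Lemma nsqN (z : C) : nsq (- z) = nsq z.
Proof. by case: z => a b; rewrite /nsq /=; ring. Qed.

Lemma nsq0 : nsq 0 = 0.
Proof. by rewrite /nsq /=; ring. Qed.

Lemma nsq_eq0 (z : C) : nsq z = 0 -> z = 0.
Proof.
move=> /eqP; rewrite paddr_eq0 ?sqr_ge0// !sqrf_eq0 => /andP[/eqP a0 /eqP b0].
by case: z a0 b0 => a b /= -> ->.
Qed.

Lemma nsqD_le (z w : C) : nsq (z + w) <= 2 * nsq z + 2 * nsq w.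
Proof.
case: z => a b; case: w => c d; rewrite /nsq /=.
have : 0 <= (a - c) ^+ 2 + (b - d) ^+ 2 by rewrite addr_ge0 ?sqr_ge0.
by lra.
Qed.

(** Cauchy-Schwarz against the constant family, from the nonnegativity of the double sum of the
    squares [(u i - u j) ^+ 2]. *)
Lemma nsq_sum_le (I : finType) (F : I -> C) :
  nsq (\sum_i F i) <= #|I|%:R * \sum_i nsq (F i).
Proof.
rewrite /nsq !raddf_sum /=.
have cs (u : I -> R) : (\sum_i u i) ^+ 2 <= #|I|%:R * \sum_i u i ^+ 2.
  have : 0 <= \sum_i \sum_j (u i - u j) ^+ 2.
    by apply: sumr_ge0 => i _; apply: sumr_ge0 => j _; exact: sqr_ge0.
  have -> : \sum_i \sum_j (u i - u j) ^+ 2 =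
      2 * (#|I|%:R * \sum_i u i ^+ 2) - 2 * (\sum_i u i) ^+ 2.
    have E i : \sum_j (u i - u j) ^+ 2 =
        #|I|%:R * u i ^+ 2 + \sum_j u j ^+ 2 - 2 * u i * \sum_j u j.
      rewrite mulr_sumr mulr_natl -[X in X + _ - _]sumr_const -big_split -sumrB /=.
      by apply: eq_bigr => j _; ring.
    under eq_bigr do rewrite E.
    rewrite sumrB big_split /= -mulr_sumr -mulr_suml -mulr_sumr sumr_const.
    by rewrite -[_ *+ _]mulr_natl; ring.
  by lra.
by rewrite big_split /= mulrDr; apply: lerD; exact: cs.
Qed.

End ComplexSquare.

(** * Semidefinite Hermitian forms on spaces of functions *)

Section Inner.
Variables (R : realType) (T : choiceType).
Local Notation C := R[i].
Implicit Types (P X : set (T -> C)) (f g h : T -> C) (a : C).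

(** The laws are asked only on the domain [P], since sums and integrals have default values
    elsewhere. [B f f = 0] may hold for a nonzero [f], as it does for functions vanishing almost
    everywhere on an interval. *)
Record is_inner P (B : (T -> C) -> (T -> C) -> C) : Prop := IsInner {
  inner_subspace : is_subspace P;
  inner_lin : forall a f g h, P f -> P g -> P h ->
    B (fun v => a * f v + g v) h = a * B f h + B g h;
  inner_conj : forall f g, P f -> P g -> B g f = conjc (B f g);
  inner_ge0 : forall f, P f -> 0 <= B f f }.

Lemma subspaceZ X a f : is_subspace X -> X f -> X (fun v => a * f v).
Proof.
move=> [X0 XD] Xf; have := XD a f _ Xf X0.
by congr X; apply/funext => v; rewrite addr0.
Qed.

Lemma subspaceD X f g : is_subspace X -> X f -> X g -> X (fun v => f v + g v).
Proof.
move=> [X0 XD] Xf Xg; have := XD 1 f _ Xf Xg.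
by congr X; apply/funext => v; rewrite mul1r.
Qed.

Lemma subspaceB X f g : is_subspace X -> X f -> X g -> X (fun v => f v - g v).
Proof.
move=> [X0 XD] Xf Xg; have := XD (-1) g _ Xg Xf.
by congr X; apply/funext => v; rewrite mulN1r addrC.
Qed.

Lemma subspace_sum X (I : Type) (r : seq I) (Q : pred I) (c : I -> C)
    (F : I -> T -> C) : is_subspace X -> (forall i, Q i -> X (F i)) ->
  X (fun v => \sum_(i <- r | Q i) c i * F i v).
Proof.
move=> sX XF; elim: r => [|i r IH].
  by rewrite (_ : (fun _ => _) = fun=> 0); [case: sX|apply/funext => v; rewrite big_nil].
case Qi: (Q i); last first.
  by move: IH; congr X; apply/funext => v; rewrite big_cons Qi.
have := sX.2 (c i) (F i) _ (XF _ Qi) IH.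
by congr X; apply/funext => v; rewrite big_cons Qi.
Qed.

Section Theory.
Variables (P : set (T -> C)) (B : (T -> C) -> (T -> C) -> C).
Hypothesis BP : is_inner P B.

Let sP : is_subspace P := inner_subspace BP.

Lemma inner0l h : P h -> B (fun=> 0) h = 0.
Proof.
move=> Ph; have := inner_lin BP 1 sP.1 sP.1 Ph.
rewrite (_ : (fun v => _) = fun=> 0); last by apply/funext => v; rewrite mulr0 addr0.
by rewrite mul1r => /eqP; rewrite -subr_eq subrr eq_sym => /eqP.
Qed.

Lemma innerZl a f h : P f -> P h -> B (fun v => a * f v) h = a * B f h.
Proof.
move=> Pf Ph; have := inner_lin BP a Pf sP.1 Ph.
rewrite (inner0l Ph) addr0 => <-; congr B.
by apply/funext => v; rewrite addr0.
Qed.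

Lemma innerDl f g h : P f -> P g -> P h ->
  B (fun v => f v + g v) h = B f h + B g h.
Proof.
move=> Pf Pg Ph; have := inner_lin BP 1 Pf Pg Ph.
by rewrite mul1r => <-; congr B; apply/funext => v; rewrite mul1r.
Qed.

Lemma innerBl f g h : P f -> P g -> P h ->
  B (fun v => f v - g v) h = B f h - B g h.
Proof.
move=> Pf Pg Ph; have := inner_lin BP (-1) Pg Pf Ph.
rewrite mulN1r addrC => <-; congr B.
by apply/funext => v; rewrite mulN1r addrC.
Qed.

Lemma inner_suml (I : Type) (r : seq I) (Q : pred I) (c : I -> C)
    (F : I -> T -> C) h : (forall i, Q i -> P (F i)) -> P h ->
  B (fun v => \sum_(i <- r | Q i) c i * F i v) h = \sum_(i <- r | Q i) c i * B (F i) h.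
Proof.
move=> PF Ph; elim: r => [|i r IH].
  rewrite (_ : (fun v => _) = fun=> 0); last by apply/funext => v; rewrite big_nil.
  by rewrite big_nil inner0l.
rewrite big_cons; case Qi: (Q i); last first.
  by rewrite -IH; congr B; apply/funext => v; rewrite big_cons Qi.
rewrite -IH -(inner_lin BP) //; last exact: subspace_sum.
- by congr B; apply/funext => v; rewrite big_cons Qi.
- exact: PF.
Qed.

Lemma innerZr a f h : P f -> P h -> B h (fun v => a * f v) = conjc a * B h f.
Proof.
move=> Pf Ph; rewrite (inner_conj BP _ Ph); last exact: subspaceZ.
by rewrite innerZl// rmorphM /= -(inner_conj BP Pf Ph).
Qed.

Lemma innerDr f g h : P f -> P g -> P h ->
  B h (fun v => f v + g v) = B h f + B h g.
Proof.
move=> Pf Pg Ph; rewrite (inner_conj BP _ Ph); last exact: subspaceD.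
by rewrite innerDl// rmorphD /= -(inner_conj BP Pf Ph) -(inner_conj BP Pg Ph).
Qed.

Lemma innerBr f g h : P f -> P g -> P h ->
  B h (fun v => f v - g v) = B h f - B h g.
Proof.
move=> Pf Pg Ph; rewrite (inner_conj BP _ Ph); last exact: subspaceB.
by rewrite innerBl// rmorphB /= -(inner_conj BP Pf Ph) -(inner_conj BP Pg Ph).
Qed.

Lemma inner0r h : P h -> B h (fun=> 0) = 0.
Proof. by move=> Ph; rewrite (inner_conj BP sP.1 Ph) inner0l// conjc0. Qed.

(** The square of the norm. Triangle inequalities therefore appear with factors 2, as in
    [inormD]. *)
Definition inorm f : R := complex.Re (B f f).

Lemma inormE f : P f -> B f f = (inorm f)%:C%C.
Proof.
move=> Pf; have /ger0_Im := inner_ge0 BP Pf.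
by rewrite /inorm; case: (B f f) => a b /= ->.
Qed.

Lemma inorm_ge0 f : P f -> 0 <= inorm f.
Proof. by move=> Pf; have := inner_ge0 BP Pf; rewrite inormE// ler0c. Qed.

Lemma inorm_sub a f g : P f -> P g ->
  inorm (fun v => a * f v + g v) =
  nsq a * inorm f + inorm g + 2 * complex.Re (a * B f g).
Proof.
move=> Pf Pg; have Ph : P (fun v => a * f v + g v) by exact: sP.2.
have aP : P (fun v => a * f v) by exact: subspaceZ.
apply: (@complexI R); rewrite -inormE//.
rewrite (inner_lin BP)// innerDr// innerDr// !innerZr//.
rewrite !inormE// (inner_conj BP Pf Pg).
case: (B f g) => b b'; case: (a) => a1 a2; apply/eqP; rewrite eq_complex /nsq /=.
by apply/andP; split; apply/eqP; ring.
Qed.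

(** The squared norm of [g - s * conjc b * f], with [b = B f g], is a quadratic polynomial in the
    real number [s] that is never negative. *)
Lemma inner_CS f g : P f -> P g -> nsq (B f g) <= inorm f * inorm g.
Proof.
move=> Pf Pg; set b := B f g.
have H (s : R) : 0 <= s ^+ 2 * nsq b * inorm f + inorm g - 2 * s * nsq b.
  have := inorm_ge0 (sP.2 (- (s%:C%C * conjc b)) f g Pf Pg).
  rewrite inorm_sub// nsqN nsqM nsqR nsq_conj -/b.
  suff -> : complex.Re (- (s%:C%C * conjc b) * b) = - (s * nsq b) by lra.
  by case: (b) => b1 b2; rewrite /nsq /=; ring.
have f0 := inorm_ge0 Pf; have b0 := nsq_ge0 b.
have [if0|if0] := eqVneq (inorm f) 0; last first.
  have fp : 0 < inorm f by rewrite lt_def if0.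
  (* The minimum of the quadratic polynomial. *)
  have := H (inorm f)^-1.
  have -> : (inorm f)^-1 ^+ 2 * nsq b * inorm f + inorm g - 2 * (inorm f)^-1 * nsq b
    = inorm g - (inorm f)^-1 * nsq b by field.
  rewrite subr_ge0 -(ler_pM2l fp) mulrA divff// mul1r.
  by [].
rewrite if0 mul0r; rewrite leNgt; apply/negP => bp.
(* Here the polynomial is affine in [s] with slope [- 2 * nsq b]; at this [s] it equals
   [- inorm g - 2 * nsq b]. *)
have := H (inorm g / nsq b + 1); rewrite if0 mulr0 add0r.
have -> : 2 * (inorm g / nsq b + 1) * nsq b = 2 * inorm g + 2 * nsq b.
  by field; rewrite gt_eqF.
have := inorm_ge0 Pg; lra.
Qed.

Lemma inormD f g : P f -> P g ->
  inorm (fun v => f v + g v) <= 2 * inorm f + 2 * inorm g.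
Proof.
move=> Pf Pg.
have e1 := inorm_sub 1 Pf Pg; have e2 := inorm_sub (-1) Pf Pg.
have := inorm_ge0 (sP.2 (-1) f g Pf Pg).
rewrite e2 (_ : (fun v => f v + g v) = (fun v => 1 * f v + g v)); last first.
  by apply/funext => v; rewrite mul1r.
rewrite e1 !mulN1r !mul1r raddfN /= nsqN.
have -> : nsq (1 : C) = 1 by rewrite /nsq /=; ring.
by lra.
Qed.

Lemma inormZ a f : P f -> inorm (fun v => a * f v) = nsq a * inorm f.
Proof.
move=> Pf; have := inorm_sub a Pf sP.1.
rewrite inner0r// mulr0 /= /inorm inner0l//=; last exact: sP.1.
rewrite mulr0 !addr0 => <-; congr (complex.Re (B _ _)); apply/funext => v;
  by rewrite addr0.
Qed.

Lemma inormB f g : P f -> P g ->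
  inorm (fun v => f v - g v) <= 2 * inorm f + 2 * inorm g.
Proof.
move=> Pf Pg; have := inormD Pf (subspaceZ (-1) sP Pg).
rewrite inormZ// nsqN (_ : nsq 1 = 1) ?mul1r; last by rewrite /nsq /=; ring.
by congr (inorm _ <= _); apply/funext => v; rewrite mulN1r.
Qed.

Lemma inorm0_orth f g : P f -> P g -> inorm f = 0 -> B f g = 0.
Proof.
move=> Pf Pg f0; apply: nsq_eq0; apply: le_anti; rewrite nsq_ge0 andbT.
by have := inner_CS Pf Pg; rewrite f0 mul0r.
Qed.

End Theory.

(** A bound on the dimension by linear dependence. It passes to subspaces without a choice of basis,
    which is what the induction of [orthonormal_eigenbasis] needs. *)
Definition dim_le (n : nat) X := forall e : 'I_n.+1 -> T -> C,
  (forall i, X (e i)) -> exists2 a : 'I_n.+1 -> C, (exists i, a i != 0) &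
    (fun v => \sum_i a i * e i v) = fun=> 0.

(** The coefficient matrix of [n.+1] vectors in [n] generators has a nonzero left kernel. *)
Lemma span_dim_le n X (e : 'I_n -> T -> C) :
  (forall f, X f -> exists a : 'I_n -> C, f = (fun v => \sum_i a i * e i v)) ->
  dim_le n X.
Proof.
move=> Xe d Xd; have [c dc] := choice (fun i => Xe _ (Xd i)).
pose M : 'M[C]_(n.+1, n) := \matrix_(i, j) c i j.
have /rowV0Pn[u /sub_kermxP uM u0] : kermx M != 0.
  by rewrite -mxrank_eq0 mxrank_ker subn_eq0 -ltnNge ltnS rank_leq_col.
exists (fun i => u 0 i).
  apply/existsP; apply: contra_neqT u0; rewrite negb_exists => /forallP u0.
  by apply/rowP => i; rewrite mxE; apply/eqP; rewrite -[_ == _]negbK.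
apply/funext => v; under eq_bigr do rewrite dc mulr_sumr.
rewrite exchange_big /=; apply: big1 => j _.
have /rowP/(_ j) := uM; rewrite !mxE => uMj.
transitivity ((\sum_i u 0 i * M i j) * e j v); last by rewrite uMj mul0r.
by rewrite mulr_suml; apply: eq_bigr => i _; rewrite mulrA mxE.
Qed.

(** * Eigenbases of symmetric operators on finite-dimensional spaces *)

Section Eigenbasis.
Variables (P : set (T -> C)) (B : (T -> C) -> (T -> C) -> C).
Hypothesis BP : is_inner P B.
Hypothesis Bdef : forall f, P f -> B f f = 0 -> f = fun=> 0.
Variable A : (T -> C) -> (T -> C).
Hypothesis Alin : forall a f g,
  A (fun v => a * f v + g v) = (fun v => a * A f v + A g v).

Lemma linop0 : A (fun=> 0) = fun=> 0.
Proof.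
have := Alin (-1) (fun=> 0) (fun=> 0).
rewrite (_ : (fun v => _) = fun=> 0); last by apply/funext => v; rewrite mulr0 addr0.
by move=> ->; apply/funext => v; rewrite mulN1r addNr.
Qed.

Lemma linopZ a f : A (fun v => a * f v) = (fun v => a * A f v).
Proof.
have := Alin a f (fun=> 0); rewrite linop0.
rewrite (_ : (fun v => a * f v + 0) = fun v => a * f v).
  by move=> ->; apply/funext => v; rewrite addr0.
by apply/funext => v; rewrite addr0.
Qed.

Lemma linopB f g : A (fun v => f v - g v) = (fun v => A f v - A g v).
Proof.
have := Alin (-1) g f.
rewrite (_ : (fun v => _) = fun v => f v - g v); last first.
  by apply/funext => v; rewrite mulN1r addrC.
by move=> ->; apply/funext => v; rewrite mulN1r addrC.
Qed.

Lemma linop_sum (I : Type) (r : seq I) (Q : pred I) (c : I -> C) (F : I -> T -> C) :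
  A (fun v => \sum_(i <- r | Q i) c i * F i v) =
  (fun v => \sum_(i <- r | Q i) c i * A (F i) v).
Proof.
elim: r => [|i r IH].
  rewrite (_ : (fun v => _) = fun=> 0); last by apply/funext => v; rewrite big_nil.
  by rewrite linop0; apply/funext => v; rewrite big_nil.
case Qi: (Q i).
  rewrite (_ : (fun v => _) =
    fun v => c i * F i v + \sum_(j <- r | Q j) c j * F j v); last first.
    by apply/funext => v; rewrite big_cons Qi.
  by rewrite Alin IH; apply/funext => v; rewrite big_cons Qi.
rewrite (_ : (fun v => _) = fun v => \sum_(j <- r | Q j) c j * F j v); last first.
  by apply/funext => v; rewrite big_cons Qi.
by rewrite IH; apply/funext => v; rewrite big_cons Qi.
Qed.

Definition shift_prod (rs : seq C) f : T -> C :=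
  foldr (fun z g v => A g v - z * g v) f rs.

(** Expands a polynomial in [A], given by its roots, in the iterates of [A]. Read backwards, it
    factors a linear relation among the iterates. *)
Lemma shift_prodE (rs : seq C) f :
  let p := \prod_(z <- rs) ('X - z%:P) in forall n, (size p <= n)%N ->
  shift_prod rs f = (fun v => \sum_(i < n) p`_i * iter i A f v).
Proof.
move=> /=; elim: rs => [|z rs IH] n.
  rewrite big_nil size_poly1 => n0; apply/funext => v /=.
  case: n n0 => // n _; rewrite big_ord_recl coef1 eqxx mul1r.
  by rewrite big1 ?addr0// => i _; rewrite coef1 mul0r.
rewrite big_cons; set p := \prod_(z <- rs) _.
have pm : p \is monic by exact: monic_prod_XsubC.
have p0 : p != 0 by exact: monic_neq0.
rewrite size_monicM ?monicXsubC// size_XsubC => pn.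
have {}pn : ((size p).+1 <= n)%N by exact: pn.
case: n pn => // n pn; rewrite ltnS in pn.
rewrite /= (IH n.+1) ?leqW// -/p.
rewrite linop_sum; apply/funext => v.
rewrite mulrBl.
under [RHS]eq_bigr do rewrite coefB coefXM coefCM mulrBl.
rewrite sumrB; congr (_ - _); last by rewrite mulr_sumr; apply: eq_bigr => i _; rewrite mulrA.
rewrite big_ord_recr /= [RHS]big_ord_recl /= mul0r add0r.
rewrite (nth_default 0) // mul0r addr0.
by apply: eq_bigr => i _.
Qed.

(** Linear dependence of the iterates of [A] on [f] gives a polynomial that kills [f]. Factor it
    over the complex numbers and apply the factors one by one: the last nonzero vector is an
    eigenvector. *)
Lemma eigenvector_exists n X : is_subspace X -> X `<=` P -> dim_le n X ->
  (forall f, X f -> X (A f)) ->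
  (forall f g, X f -> X g -> B (A f) g = B f (A g)) ->
  forall f, X f -> f <> (fun=> 0) ->
  exists g (x : R), [/\ X g, g <> (fun=> 0) & A g = (fun v => x%:C%C * g v)].
Proof.
move=> sX XP dX XA sym f Xf f0.
have Xi i : X (iter i A f) by elim: i => //= i; exact: XA.
have [a [i0 ai0] az] := dX (fun i => iter i A f) (fun i => Xi i).
pose p := \poly_(i < n.+1) (if insub i is Some j then a j else 0).
have pE (i : 'I_n.+1) : p`_i = a i by rewrite coef_poly ltn_ord insubT//= => ?; congr a; apply: val_inj.
have p0 : p != 0.
  by apply: contraNneq ai0 => p0; rewrite -pE p0 coef0.
have [rs prs] := closed_field_poly_normal p.
have l0 : lead_coef p != 0 by rewrite lead_coef_eq0.
have rs0 : shift_prod rs f = fun=> 0.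
  rewrite (@shift_prodE _ _ n.+1); last first.
    have := size_poly n.+1 (fun i => if insub i is Some j then a j else 0).
    by rewrite -/p prs size_scale.
  apply/funext => v; apply: (mulfI l0); rewrite mulr0 mulr_sumr.
  transitivity (\sum_(i < n.+1) a i * iter i A f v); last first.
    exact: (congr1 (fun F => F v) az).
  by apply: eq_bigr => i _; rewrite mulrA -pE {2}prs coefZ.
have : exists g (z : C), [/\ X g, g <> (fun=> 0) & A g = (fun v => z * g v)].
  elim: (rs) rs0 => [|z r IH] //= e.
  have [g0|g0] := pselect (shift_prod r f = fun=> 0); first exact: IH.
  exists (shift_prod r f), z; split => //.
    elim: (r) => //= w s Xs; apply: subspaceB => //; first exact: XA.
    exact: subspaceZ.
  by apply/funext => v; have /(congr1 (fun F => F v)) /= := e => /subr0_eq.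
move=> [g [z [Xg g0 Ag]]]; exists g, (complex.Re z); split => //.
suff -> : (complex.Re z)%:C%C = z by [].
(* Symmetry equates the eigenvalue with its conjugate. *)
have := sym g g Xg Xg; rewrite Ag (innerZl BP) ?(innerZr BP)//; try exact: XP.
move/mulIf => zz.
have /zz : B g g != 0 by apply/eqP => /Bdef h; apply/g0/h/XP.
by case: (z) => u w /= [] w2; apply/eqP; rewrite eq_complex /= eqxx /=; apply/eqP; lra.
Qed.

(** Splits off a normalized eigenvector and continues in its orthogonal complement, which symmetry
    makes invariant. With [A] the identity this is Gram-Schmidt, and [good_bounded_core] uses it
    so. *)
Lemma orthonormal_eigenbasis n X : is_subspace X -> X `<=` P -> dim_le n X ->
  (forall f, X f -> X (A f)) ->
  (forall f g, X f -> X g -> B (A f) g = B f (A g)) ->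
  exists m (e : 'I_m -> T -> C) (x : 'I_m -> R),
    [/\ forall i, X (e i), forall i j, B (e i) (e j) = (i == j)%:R,
        forall i, A (e i) = (fun v => (x i)%:C%C * e i v) &
        forall f, X f -> f = (fun v => \sum_i B f (e i) * e i v)].
Proof.
elim: n X => [|n IH] X sX XP dX XA sym.
  exists 0%N, (fun i => fun=> 0), (fun=> 0); split; try (by case).
  move=> f Xf.
  have [a [i ai] af] := dX (fun=> f) (fun=> Xf).
  apply/funext => v; rewrite big_ord0; apply: (mulfI ai); rewrite mulr0.
  by have /(congr1 (fun F => F v)) := af; rewrite big_ord1 (ord1 i).
have [X0|] := pselect (forall f, X f -> f = fun=> 0).
  exists 0%N, (fun i => fun=> 0), (fun=> 0); split; try (by case).
  move=> f /X0 ->.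
  by apply/funext => v; rewrite big_ord0.
move=> /existsNP[f /not_implyP[Xf f0]].
have [g0 [x [Xg0 g00 Ag0]]] := eigenvector_exists sX XP dX XA sym Xf f0.
have Pg0 := XP _ Xg0.
have ng0 : 0 < inorm B g0.
  rewrite lt_def (inorm_ge0 BP)// andbT; apply/eqP => h; apply: g00.
  by apply: Bdef => //; rewrite (inormE BP)// h.
pose k : C := ((Num.sqrt (inorm B g0))^-1)%:C%C.
pose g v := k * g0 v.
have Xg : X g by exact: subspaceZ.
have Pg := XP _ Xg.
have Ag : A g = fun v => x%:C%C * g v.
  by rewrite linopZ Ag0; apply/funext => v; rewrite mulrCA.
have gg : B g g = 1.
  rewrite (innerZl BP)// (innerZr BP)// (inormE BP)// conjc_real.
  rewrite -!rmorphM /= mulrA -invfM -expr2 sqr_sqrtr ?ltW// mulVf//.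
  by rewrite gt_eqF.
pose X' := [set f | X f /\ B f g = 0].
have sX' : is_subspace X'.
  split; first by split; [case: sX|exact: (inner0l BP)].
  move=> a u w [Xu ug] [Xw wg]; split; first exact: sX.2.
  by rewrite (inner_lin BP) ?ug ?wg ?mulr0 ?addr0//; exact: XP.
have XX' : X' `<=` X by move=> ? [].
have [||||m [e [y [Xe ee Ae eX]]]] := IH X' sX'.
- exact: subset_trans XP.
- move=> d Xd.
  (* Put the eigenvector in front of the given vectors of the complement; pairing a relation with
     [g] shows that its coefficient vanishes. *)
  pose d' (i : 'I_n.+2) := if unlift ord0 i is Some j then d j else g.
  have Xd' i : X (d' i).
    by rewrite /d'; case: unliftP => // j _; exact: (Xd j).1.
  have [a [i0 ai0] ad] := dX d' Xd'.
  have a0 : a ord0 = 0.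
    have : B (fun v => \sum_i a i * d' i v) g = 0 by rewrite ad (inner0l BP).
    rewrite (inner_suml BP) //; last by move=> i _; exact: XP.
    rewrite big_ord_recl {1}/d' unlift_none gg mulr1 big1 ?addr0// => i _.
    by rewrite /d' liftK (Xd i).2 mulr0.
  exists (fun i => a (lift ord0 i)).
    case: (unliftP ord0 i0) ai0 => [j -> aj|-> /negP]; first by exists j.
    by rewrite a0 eqxx.
  apply/funext => v; have /(congr1 (fun F => F v)) := ad.
  rewrite big_ord_recl a0 mul0r add0r => dv; rewrite -[RHS]dv.
  by apply: eq_bigr => i _; rewrite /d' liftK.
- move=> u [Xu ug]; split; first exact: XA.
  by rewrite sym// Ag (innerZr BP) ?ug ?mulr0//; exact: XP.
- by move=> u w /XX' Xu /XX' Xw; exact: sym.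
exists m.+1, (fun i => if unlift ord0 i is Some j then e j else g),
  (fun i => if unlift ord0 i is Some j then y j else x); split.
- by move=> i; case: unliftP => // j _; exact: (Xe j).1.
- move=> i j; case: (unliftP ord0 i) => [i' ->|->]; case: (unliftP ord0 j) => [j' ->|->].
  + by rewrite ee (inj_eq lift_inj).
  + by rewrite (Xe i').2 eq_sym (negbTE (neq_lift _ _)).
  + rewrite (inner_conj BP _ Pg) ?(Xe j').2 ?conjc0 ?(negbTE (neq_lift _ _))//.
    by apply: XP; exact: (Xe j').1.
  + by rewrite gg eqxx.
- by move=> i; case: unliftP => // j _; exact: Ae.
move=> u Xu; pose w v := u v - B u g * g v.
have Xw : X w by apply: subspaceB => //; exact: subspaceZ.
have X'w : X' w.
  split=> //; rewrite (innerBl BP (XP _ Xu) (XP _ (subspaceZ (B u g) sX Xg)) Pg).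
  by rewrite (innerZl BP _ Pg Pg) gg mulr1 subrr.
have wE := eX _ X'w.
apply/funext => v; rewrite big_ord_recl unlift_none.
under eq_bigr do rewrite liftK.
have -> : u v = B u g * g v + w v by rewrite /w addrCA subrr addr0.
congr (_ + _); rewrite {1}wE; apply: eq_bigr => i _; congr (_ * _).
have Pe := XP _ (Xe i).1.
rewrite (innerBl BP (XP _ Xu) (XP _ (subspaceZ (B u g) sX Xg)) Pe).
by rewrite (innerZl BP _ Pg Pe) (inner_conj BP Pe Pg) (Xe i).2 conjc0 mulr0 subr0.
Qed.

End Eigenbasis.
End Inner.

(** * A compactly supported measure is determined by its moments *)

Section AbsApproximation.
Variable R : realType.

(** The classical iteration that increases to the absolute value on [-1, 1]. *)
Fixpoint abs_poly (n : nat) : {poly R} :=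
  if n is m.+1 then abs_poly m + 2^-1 *: ('X^2 - abs_poly m ^+ 2) else 0.

Lemma abs_poly_bounds n (t : R) : `|t| <= 1 ->
  0 <= (abs_poly n).[t] /\ 0 <= `|t| - (abs_poly n).[t] <= `|t| * (1 - `|t| / 2) ^+ n.
Proof.
move=> t1; have t0 := normr_ge0 t.
elim: n => [|n [p0 /andP[pt IH]]].
  by rewrite horner0 subr0 expr0 mulr1 !lexx t0.
rewrite /= hornerD hornerZ hornerD hornerN hornerXn horner_exp.
set p := (abs_poly n).[t] in p0 pt IH *.
have tt : t ^+ 2 = `|t| ^+ 2 by rewrite -normrX ger0_norm// sqr_ge0.
(* Each step multiplies the error by 1 - (|t| + p) / 2, which is at most 1 - |t| / 2. *)
rewrite tt; have H : `|t| - (p + 2^-1 * (`|t| ^+ 2 - p ^+ 2)) =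
  (`|t| - p) * (1 - (`|t| + p) / 2) by field.
rewrite H; split; first by nra.
apply/andP; split; first by nra.
rewrite exprSr mulrA; apply: ler_pM => //; nra.
Qed.

Lemma abs_poly_cvg (t : R) : `|t| <= 1 -> (abs_poly n).[t] @[n --> \oo] --> `|t|.
Proof.
move=> t1; have b n := abs_poly_bounds n t1.
have g0 : `|t| * (1 - `|t| / 2) ^+ n @[n --> \oo] --> (0 : R).
  have [->|t0] := eqVneq t 0.
    by rewrite normr0; under eq_fun do rewrite mul0r; exact: cvg_cst.
  rewrite -[X in _ --> X](mulr0 `|t|); apply: cvgMr; apply: cvg_expr.
  have tp : 0 < `|t| by rewrite normr_gt0.
  by rewrite ger0_norm; lra.
have : `|t| - (abs_poly n).[t] @[n --> \oo] --> (0 : R).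
  apply: squeeze_cvgr (cvg_cst 0) g0.
  by apply: nearW => n; case: (b n).
move=> h.
rewrite -[X in _ --> X]subr0.
rewrite (_ : (fun n => _) = (fun n => `|t| - (`|t| - (abs_poly n).[t]))); last first.
  by apply/funext => n; rewrite opprB addrC subrK.
by apply: cvgB => //; exact: cvg_cst.
Qed.
End AbsApproximation.

Section CompactSupport.
Variables (R : realType) (mu : {finite_measure set R -> \bar R}) (M : R).
Hypothesis muM : mu (~` `[- M, M]) = 0%E.

Lemma ae_compact_support (Q : R -> Prop) : (forall x, - M <= x <= M -> Q x) ->
  {ae mu, forall x, Q x}.
Proof.
move=> MQ; exists (~` `[- M, M]%classic); split => //.
  by apply: measurableC.
by move=> x /= nQ Mx; apply: nQ; apply: MQ; move: Mx; rewrite /= in_itv.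
Qed.

Lemma integrable_compact_support (f : R -> R) (c : R) : measurable_fun setT f ->
  (forall x, - M <= x <= M -> `|f x| <= c) -> mu.-integrable setT (EFin \o f).
Proof.
move=> mf fc.
have mMM : measurable (`[- M, M]%classic : set R) by exact: measurable_itv.
have mf' : measurable_fun setT (EFin \o f) by exact/measurable_EFinP.
apply/(negligible_integrable _ measurableT mf' muM); first exact: measurableC.
rewrite setDE setCK setTI; apply: measurable_bounded_integrable => //.
- by rewrite -ge0_fin_numE// fin_num_measure.
- exact: measurable_funTS.
exists c; split; first by rewrite num_real.
move=> d cd x /=; rewrite in_itv /= => /fc fcx.
exact: le_trans fcx (ltW cd).
Qed.

Lemma integrable_poly (p : {poly R}) : mu.-integrable setT (EFin \o horner p).
Proof.
have cp : continuous (horner p) by exact: continuous_horner.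
have [c pc] : exists c, forall x, - M <= x <= M -> `|p.[x]| <= c.
  have [MM|MM] := leP (- M) M; last by exists 0 => x /andP[a b]; exfalso; lra.
  have [|c _ cP] := @EVT_max R (fun x => `|p.[x]|) _ _ MM.
    apply: continuous_subspaceT => x; apply: continuous_comp; first exact: cp.
    exact: norm_continuous.
  by exists `|p.[c]| => x xM; apply: cP; rewrite in_itv.
apply: integrable_compact_support pc.
exact: continuous_measurable_fun.
Qed.

Lemma Rintegral_poly (p : {poly R}) :
  \int[mu]_x p.[x] = \sum_(i < size p) p`_i * \int[mu]_x (x ^+ i).
Proof.
have H (n : nat) (a : nat -> R) : \int[mu]_x (\sum_(i < n) a i * x ^+ i) =
    \sum_(i < n) a i * \int[mu]_x (x ^+ i).
  have ix m (k : R) : mu.-integrable setT (EFin \o (fun x => k * x ^+ m)).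
    have := integrable_poly (k *: 'X^m); apply: eq_integrable => // x _ /=.
    by rewrite hornerZ hornerXn.
  elim: n => [|n IH].
    by rewrite big_ord0; under eq_Rintegral do rewrite big_ord0; rewrite Rintegral_cst// mul0r.
  under eq_Rintegral do rewrite big_ord_recr /=.
  rewrite RintegralD//; last first.
    have := integrable_poly (\poly_(i < n) a i); apply: eq_integrable => // x _ /=.
    rewrite horner_poly; congr _%:E.
  rewrite IH big_ord_recr /=; congr (_ + _).
  have := ix n 1; under eq_fun do rewrite mul1r.
  by move=> ixn; rewrite RintegralZl.
by under eq_Rintegral do rewrite horner_coef; exact: H.
Qed.

Lemma cvg_Rintegral_compact_support (f_ : nat -> R -> R) (f : R -> R) (c : R) :
  (forall n, measurable_fun setT (f_ n)) -> measurable_fun setT f ->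
  (forall x, - M <= x <= M -> f_ n x @[n --> \oo] --> f x) ->
  (forall n x, - M <= x <= M -> `|f_ n x| <= c) ->
  \int[mu]_x f_ n x @[n --> \oo] --> \int[mu]_x f x.
Proof.
move=> mf_ mf ff fc.
have [|||||fi _ h] := @dominated_convergence _ _ _ mu setT measurableT
    (fun n => EFin \o f_ n) (EFin \o f) (cst c%:E).
- by move=> n; exact/measurable_EFinP.
- exact/measurable_EFinP.
- by apply: ae_compact_support => x xM _; apply: cvg_EFin; [exact: nearW|exact: ff].
- by apply: (@integrable_compact_support (cst c) `|c|).
- by apply: ae_compact_support => x xM n _; rewrite lee_fin; exact: fc.
apply: fine_cvg; rewrite fineK; first exact: h.
exact: integrable_fin_num.
Qed.

End CompactSupport.

(** * Equal moments give equal measures *)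

Section MomentUniqueness.
Variables (R : realType) (mu nu : {finite_measure set R -> \bar R}) (M : R).
Hypotheses (muM : mu (~` `[- M, M]) = 0%E) (nuM : nu (~` `[- M, M]) = 0%E).
Hypothesis munu : forall n, \int[mu]_x (x ^+ n) = \int[nu]_x (x ^+ n).

Let munu_poly (p : {poly R}) : \int[mu]_x p.[x] = \int[nu]_x p.[x].
Proof.
by rewrite (Rintegral_poly muM) (Rintegral_poly nuM); apply: eq_bigr => i _; rewrite munu.
Qed.

Let mabs (a : R) : measurable_fun setT (fun x : R => `|x - a|).
Proof.
apply: measurableT_comp => //; apply: measurable_funB => //; exact: measurable_cst.
Qed.

Let munu_abs (a : R) : \int[mu]_x `|x - a| = \int[nu]_x `|x - a|.
Proof.
(* Bounds |x - a| for x in [-M, M], so that [(x - a) / c] stays in the range of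
   [abs_poly_bounds]. *)
pose c := `|M| + `|a| + 1.
have c0 : 0 < c by rewrite ltr_wpDl// addr_ge0.
pose p n := c *: (abs_poly R n \Po (c^-1 *: ('X - a%:P))).
have pE n x : (p n).[x] = c * (abs_poly R n).[(x - a) / c].
  by rewrite hornerZ horner_comp hornerZ !hornerE mulrC [c^-1 * _]mulrC mulrC.
have xc x : - M <= x <= M -> `|(x - a) / c| <= 1.
  move=> xM; rewrite normrM normfV (ger0_norm (ltW c0)) ler_pdivrMr// mul1r.
  apply: le_trans (ler_normB _ _) _; rewrite /c.
  have : `|x| <= `|M| by rewrite ler_norml; have := ler_norm M; lra.
  by lra.
have cv (rho : {finite_measure set R -> \bar R}) : rho (~` `[- M, M]) = 0%E ->
    \int[rho]_x (p n).[x] @[n --> \oo] --> \int[rho]_x `|x - a|.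
  move=> rM; apply: (cvg_Rintegral_compact_support rM (c := c)) => //.
  - by move=> n; apply: continuous_measurable_fun; exact: continuous_horner.
  - move=> x xM; have -> : `|x - a| = c * `|(x - a) / c|.
      by rewrite normrM normfV (ger0_norm (ltW c0)) mulrCA divff ?mulr1// gt_eqF.
    under eq_fun do rewrite pE; apply: cvgMr.
    by apply: abs_poly_cvg; exact: xc.
  - move=> n x xM; rewrite pE normrM (ger0_norm (ltW c0)) ler_piMr ?(ltW c0)//.
    have [h0 /andP[h1 _]] := abs_poly_bounds n (xc _ xM).
    by rewrite ger0_norm//; have := xc _ xM; lra.
apply: cvg_unique (cv _ nuM) => //.
have := cv _ muM; rewrite (_ : (fun n => _) = fun n => \int[nu]_x (p n).[x]) //.
by apply/funext => n; exact: munu_poly.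
Qed.

(** For positive [k], the continuous function that is 0 up to [a - k^-1], 1 from [a] on and affine
    between. It is written with two absolute values so that [munu_abs] gives its integral. *)
Let ramp (a k x : R) := 2^-1 + (k / 2 * `|x - (a - k^-1)| - k / 2 * `|x - a|).

Let rampE a k x : 0 < k -> ramp a k x =
  if a <= x then 1 else if x <= a - k^-1 then 0 else 1 - k * (a - x).
Proof.
move=> k0; have k10 : 0 < k^-1 by rewrite invr_gt0.
rewrite /ramp; have kk : k * k^-1 = 1 by rewrite divff// gt_eqF.
case: (leP a x) => ax.
  rewrite !ger0_norm; [|lra|lra]; field; exact: lt0r_neq0.
case: (leP x (a - k^-1)) => xa.
  rewrite !ler0_norm; [|lra|lra]; field; exact: lt0r_neq0.
rewrite ger0_norm ?ler0_norm; [|lra|lra]; field; exact: lt0r_neq0.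
Qed.

Let munu_ramp a k : 0 < k -> \int[mu]_x ramp a k x = \int[nu]_x ramp a k x.
Proof.
move=> k0.
suff E (rho : {finite_measure set R -> \bar R}) : rho (~` `[- M, M]) = 0%E ->
   \int[rho]_x ramp a k x = 2^-1 * \int[rho]_x (x ^+ 0) +
     (k / 2 * \int[rho]_x `|x - (a - k^-1)| - k / 2 * \int[rho]_x `|x - a|).
  by rewrite !E// !munu_abs munu.
move=> rM.
have ia b : rho.-integrable setT (EFin \o (fun x : R => `|x - b|)).
  apply: (integrable_compact_support rM (c := `|M| + `|b|)) => // x xM.
  rewrite normr_id; apply: le_trans (ler_normB _ _) _; rewrite lerD2r.
  by rewrite ler_norml; have := ler_norm M; lra.
have iZ b (d : R) : rho.-integrable setT (EFin \o (fun x : R => d * `|x - b|)).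
  by have := integrableZl measurableT d (ia b); apply: eq_integrable.
have ic : rho.-integrable setT (EFin \o (fun x : R => 2^-1 : R)).
  by apply: (integrable_compact_support rM (c := 2^-1)) => // x _; rewrite ger0_norm.
rewrite /ramp RintegralD//; last first.
  by have := integrableB measurableT (iZ (a - k^-1) (k / 2)) (iZ a (k / 2)); apply: eq_integrable.
rewrite RintegralB// !RintegralZl//; congr (_ + _).
under [in RHS]eq_Rintegral do rewrite expr0.
by rewrite !Rintegral_cst// mul1r.
Qed.

(** As [k] grows, the ramps decrease to the indicator of the half-line from [a] on, and these
    half-lines form a generating class stable under intersection. *)
Lemma moments_unique (B : set R) : measurable B -> mu B = nu B.
Proof.
have ray (a : R) : mu `[a, +oo[%classic = nu `[a, +oo[%classic.
  have mra : measurable (`[a, +oo[%classic : set R) by exact: measurable_itv.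
  have k0 n : (0 : R) < n.+1%:R by rewrite ltr0n.
  have cv (rho : {finite_measure set R -> \bar R}) : rho (~` `[- M, M]) = 0%E ->
      \int[rho]_x ramp a n.+1%:R x @[n --> \oo] --> \int[rho]_x \1_(`[a, +oo[%classic) x.
    move=> rM; apply: (cvg_Rintegral_compact_support rM (c := 1)) => //.
    - move=> n; rewrite /ramp; apply: measurable_funD; first exact: measurable_cst.
      by apply: measurable_funB; apply: measurable_funM; try exact: measurable_cst; exact: mabs.
    - move=> x _; rewrite indicE; have [ax|ax] := leP a x.
        rewrite mem_set /=; last by rewrite in_itv /= ax.
        by under eq_fun do rewrite rampE// ax; exact: cvg_cst.
      rewrite memNset /=; last by rewrite in_itv /= leNgt ax.
      (* To the left of [a] the ramp vanishes once [k] exceeds [(a - x)^-1]. *)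
      apply: cvg_near_cst; near=> n; rewrite rampE// leNgt ax /= ifT//.
      have : (a - x)^-1 < n.+1%:R.
        apply: (lt_trans (_ : _ < n%:R)); last by rewrite ltr_nat.
        near: n; exact: nbhs_infty_gtr.
      have ax0 : 0 < a - x by rewrite subr_gt0.
      by rewrite -invf_plt ?posrE// => h; rewrite -(lerD2r n.+1%:R^-1) subrK -lerBrDl ltW.
    - move=> n x _; rewrite rampE//; case: ifPn => ax; first by rewrite normr1.
      case: ifPn => xa; first by rewrite normr0.
      rewrite -!ltNge in ax xa; have := k0 n => kn.
      have kk : n.+1%:R * n.+1%:R^-1 = 1 :> R by rewrite divff// gt_eqF.
      move: kn kk xa; move: (n.+1%:R : R) => k; move: k^-1 => ki kn kk xa.
      have h1 : k * (a - x) <= k * ki by rewrite ler_pM2l//; lra.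
      have h2 : 0 <= k * (a - x) by rewrite mulr_ge0 ?ltW// subr_gt0.
      by rewrite kk in h1; rewrite ler_norml; lra.
  have e : \int[mu]_x \1_(`[a, +oo[%classic) x = \int[nu]_x (\1_(`[a, +oo[%classic) x : R).
    apply: cvg_unique (cv _ nuM) => //.
    have := cv _ muM; rewrite (_ : (fun n => _) = fun n => \int[nu]_x ramp a n.+1%:R x) //.
    by apply/funext => n; exact: munu_ramp.
  move: e; rewrite /Rintegral !integral_indic// !setIT => e.
  by rewrite -[LHS]fineK ?fin_num_measure// -[RHS]fineK ?fin_num_measure// e.
move=> mB; apply: (measure_unique (@RGenCInfty.G R) (fun n => `[- n%:R, +oo[%classic)) => //.
- exact: RGenCInfty.measurableE.
- move=> _ _ [a ->] [b ->]; exists (Num.max a b).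
  apply/seteqP; split => x /=; rewrite !in_itv /= !andbT ge_max.
    by move=> [-> ->].
  by move=> /andP[-> ->].
- by move=> n; exists (- n%:R).
- apply/seteqP; split => // x _; exists (Num.truncn `|x|).+1 => //=.
  rewrite in_itv /= andbT lerNl; apply: le_trans (ler_norm _) _.
  by rewrite normrN ltW// truncnS_gt.
- by move=> _ [a ->]; exact: ray.
- move=> n; rewrite -ge0_fin_numE// fin_num_measure//; exact: measurable_itv.
Unshelve. all: by end_near. Qed.

End MomentUniqueness.

(** * Square-integrable functions on a set of finite measure *)

Section ComplexIntegral.
Variables (R : realType) (D : set R).
Local Notation C := R[i].
Local Notation Re := complex.Re.
Local Notation Im := complex.Im.
Local Notation mu := (@lebesgue_measure R).
Hypotheses (mD : measurable (D : set (measurableTypeR R))) (fD : (mu D < +oo)%E).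
Implicit Types (f g h : R -> C).

Lemma eq_cmeasurable f g : (forall x, D x -> f x = g x) -> cmeasurable D f -> cmeasurable D g.
Proof.
move=> fg [rf if_]; split; [apply: eq_measurable_fun rf|apply: eq_measurable_fun if_];
  by move=> x /set_mem Dx; rewrite fg.
Qed.

Lemma cmeasurableD f g : cmeasurable D f -> cmeasurable D g ->
  cmeasurable D (fun x => f x + g x).
Proof.
move=> [rf if_] [rg ig]; split.
  rewrite (_ : (fun x => _) = fun x => Re (f x) + Re (g x)).
    exact: measurable_funD.
  by apply/funext => x; case: (f x); case: (g x).
rewrite (_ : (fun x => _) = fun x => Im (f x) + Im (g x)).
  exact: measurable_funD.
by apply/funext => x; case: (f x); case: (g x).
Qed.

Lemma cmeasurableM f g : cmeasurable D f -> cmeasurable D g ->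
  cmeasurable D (fun x => f x * g x).
Proof.
move=> [rf if_] [rg ig]; split.
  rewrite (_ : (fun x => _) = fun x => Re (f x) * Re (g x) - Im (f x) * Im (g x)).
    by apply: measurable_funB; exact: measurable_funM.
  by apply/funext => x; case: (f x) => a b; case: (g x) => c d.
rewrite (_ : (fun x => _) = fun x => Re (f x) * Im (g x) + Im (f x) * Re (g x)).
  by apply: measurable_funD; exact: measurable_funM.
by apply/funext => x; case: (f x) => a b; case: (g x) => c d.
Qed.

Lemma cmeasurable_conj f : cmeasurable D f -> cmeasurable D (fun x => conjc (f x)).
Proof.
move=> [rf if_]; split.
  by apply: eq_measurable_fun rf => x _; case: (f x).
apply: (eq_measurable_fun (fun x => - Im (f x))).
  by move=> x _; case: (f x).
exact: measurableT_comp.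
Qed.

Lemma cmeasurable_real (u : R -> R) : measurable_fun D u -> cmeasurable D (fun x => (u x)%:C%C).
Proof. by move=> mu_; split => //=; exact: measurable_cst. Qed.

Lemma cmeasurable_cst (c : C) : cmeasurable D (fun=> c).
Proof. by split; exact: measurable_cst. Qed.

Lemma cmeasurableX f n : cmeasurable D f -> cmeasurable D (fun x => f x ^+ n).
Proof.
move=> mf; elim: n => [|n IH].
  by apply: eq_cmeasurable (cmeasurable_cst 1) => x _; rewrite expr0.
by apply: eq_cmeasurable (cmeasurableM mf IH) => x _; rewrite exprS.
Qed.

Lemma cmeasurable_sum (I : Type) (s : seq I) (P : pred I) (F : I -> R -> C) :
  (forall i, cmeasurable D (F i)) -> cmeasurable D (fun x => \sum_(i <- s | P i) F i x).
Proof.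
move=> mF; elim: s => [|i s IH].
  by apply: eq_cmeasurable (cmeasurable_cst 0) => x _; rewrite big_nil.
case Pi: (P i).
  by apply: eq_cmeasurable (cmeasurableD (mF i) IH) => x _; rewrite big_cons Pi.
by apply: eq_cmeasurable IH => x _; rewrite big_cons Pi.
Qed.

Lemma measurable_nsq f : cmeasurable D f -> measurable_fun D (fun x => nsq (f x)).
Proof. by move=> [rf if_]; apply: measurable_funD; exact: measurable_funX. Qed.

Definition sqint f : \bar R := (\int[mu]_(x in D) (nsq (f x))%:E)%E.
(** Functions, not classes modulo null sets; [L2D0_ae] and [ae_L2D0] translate norm zero into
    vanishing almost everywhere. *)
Definition L2D f := cmeasurable D f /\ (sqint f < +oo)%E.

Lemma integrable_nsq f : L2D f -> mu.-integrable D (EFin \o (fun x => nsq (f x))).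
Proof.
move=> [mf foo]; apply/integrableP; split.
  by apply/measurable_EFinP; exact: measurable_nsq.
apply: le_lt_trans foo; rewrite /sqint le_eqVlt; apply/orP; left; apply/eqP.
by apply: eq_integral => x _; rewrite /= ger0_norm// nsq_ge0.
Qed.

Lemma L2D_le f g : cmeasurable D f -> L2D g ->
  (forall x, D x -> nsq (f x) <= nsq (g x)) -> L2D f.
Proof.
move=> mf [mg goo] fg; split=> //; apply: le_lt_trans goo.
apply: ge0_le_integral => //.
- by move=> x _; rewrite lee_fin nsq_ge0.
- by apply/measurable_EFinP; exact: measurable_nsq.
- by apply/measurable_EFinP; exact: measurable_nsq.
Qed.

Lemma L2D_bounded f (c : R) : cmeasurable D f -> (forall x, D x -> nsq (f x) <= c) -> L2D f.
Proof.
move=> mf fc; split => //.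
apply: (@le_lt_trans _ _ (\int[mu]_(x in D) (cst c%:E x))%E).
  apply: ge0_le_integral => //.
  - by move=> x _; rewrite lee_fin nsq_ge0.
  - by apply/measurable_EFinP; exact: measurable_nsq.
rewrite integral_cst//.
have [c0|c0] := leP 0 c; last first.
  have [->|/set0P[x Dx]] := eqVneq D set0; first by rewrite measure0 mule0.
  by have := le_lt_trans (le_trans (nsq_ge0 _) (fc x Dx)) c0; rewrite ltxx.
by rewrite lte_mul_pinfty// ?lee_fin// ge0_fin_numE.
Qed.

Lemma integrable_le (u v : R -> R) : measurable_fun D u ->
  (forall x, D x -> `|u x| <= v x) -> mu.-integrable D (EFin \o v) ->
  mu.-integrable D (EFin \o u).
Proof.
move=> mu_ uv iv; apply: le_integrable iv => //; first exact/measurable_EFinP.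
by move=> x Dx /=; rewrite lee_fin (le_trans (uv x Dx))// ler_norm.
Qed.

Lemma integrable_scale (k : R) (u : R -> R) : mu.-integrable D (EFin \o u) ->
  mu.-integrable D (EFin \o (fun x => k * u x)).
Proof. by move=> iu; have := integrableZl mD k iu; apply: eq_integrable. Qed.

Lemma integrable_add (u v : R -> R) : mu.-integrable D (EFin \o u) ->
  mu.-integrable D (EFin \o v) -> mu.-integrable D (EFin \o (fun x => u x + v x)).
Proof. by move=> iu iv; have := integrableD mD iu iv; apply: eq_integrable. Qed.

Lemma L2D_subspace : is_subspace L2D.
Proof.
split.
  by apply: (@L2D_bounded _ 0); [exact: cmeasurable_cst|move=> x _; rewrite nsq0].
move=> a f g Lf Lg.
have mafg : cmeasurable D (fun x => a * f x + g x).
  by apply: cmeasurableD Lg.1; apply: cmeasurableM Lf.1; exact: cmeasurable_cst.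
split=> //; have iq : mu.-integrable D (EFin \o (fun x => 2 * nsq a * nsq (f x) + 2 * nsq (g x))).
  by apply: integrable_add; apply: integrable_scale; exact: integrable_nsq.
have [] := integrableP _ _ _ (@integrable_le (fun x => nsq (a * f x + g x)) _ _ _ iq).
- exact: measurable_nsq.
- move=> x _; rewrite ger0_norm ?nsq_ge0//; apply: le_trans (nsqD_le _ _) _.
  by rewrite nsqM mulrA.
move=> _; apply: le_lt_trans; rewrite /sqint le_eqVlt; apply/orP; left; apply/eqP.
by apply: eq_integral => x _; rewrite /= ger0_norm// nsq_ge0.
Qed.

Lemma cintegrable_mul f g : L2D f -> L2D g -> cintegrable D (fun x => f x * conjc (g x)).
Proof.
move=> Lf Lg; have iq := integrable_add (integrable_nsq Lf) (integrable_nsq Lg).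
have [rm im] : cmeasurable D (fun x => f x * conjc (g x)).
  by apply: cmeasurableM; [exact: Lf.1|apply: cmeasurable_conj; exact: Lg.1].
split.
  apply: (integrable_le rm _ (v := fun x => nsq (f x) + nsq (g x))) => // x _.
  case: (f x) => a b; case: (g x) => c d; rewrite /nsq /=.
  have h1 := sqr_ge0 (a + c); have h2 := sqr_ge0 (a - c).
  have h3 := sqr_ge0 (b + d); have h4 := sqr_ge0 (b - d).
  by rewrite ler_norml; apply/andP; split; lra.
apply: (integrable_le im _ (v := fun x => nsq (f x) + nsq (g x))) => // x _.
case: (f x) => a b; case: (g x) => c d; rewrite /nsq /=.
have h1 := sqr_ge0 (a + d); have h2 := sqr_ge0 (a - d).
have h3 := sqr_ge0 (b + c); have h4 := sqr_ge0 (b - c).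
by rewrite ler_norml; apply/andP; split; lra.
Qed.

Lemma cintegral_lin (a : C) f g : cintegrable D f -> cintegrable D g ->
  cintegrable D (fun x => a * f x + g x) /\
  cintegral D (fun x => a * f x + g x) = a * cintegral D f + cintegral D g.
Proof.
move=> [rf if_] [rg ig]; case: a => a b.
have e1 : (fun x => Re ((a +i* b)%C * f x + g x)) =
    (fun x => a * Re (f x) + - b * Im (f x) + Re (g x)).
  by apply/funext => x; case: (f x) => c d; case: (g x) => c' d' /=; ring.
have e2 : (fun x => Im ((a +i* b)%C * f x + g x)) =
    (fun x => a * Im (f x) + b * Re (f x) + Im (g x)).
  by apply/funext => x; case: (f x) => c d; case: (g x) => c' d' /=; ring.
have Z := integrable_scale; have A := integrable_add.
split.
  rewrite /cintegrable; split.
    rewrite (_ : (fun x => _) = EFin \o (fun x => Re ((a +i* b)%C * f x + g x)))// e1.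
    by do 2?apply: (A) => //; exact: Z.
  rewrite (_ : (fun x => _) = EFin \o (fun x => Im ((a +i* b)%C * f x + g x)))// e2.
  by do 2?apply: (A) => //; exact: Z.
rewrite /cintegral e1 e2.
rewrite (RintegralD mD (A _ _ (Z a _ rf) (Z (- b) _ if_)) rg).
rewrite (RintegralD mD (Z a _ rf) (Z (- b) _ if_)).
rewrite (RintegralD mD (A _ _ (Z a _ if_) (Z b _ rf)) ig).
rewrite (RintegralD mD (Z a _ if_) (Z b _ rf)).
rewrite !(RintegralZl _ mD rf) !(RintegralZl _ mD if_).
by apply/eqP; rewrite eq_complex /=; apply/andP; split; apply/eqP; ring.
Qed.

Lemma eq_Rint (u v : R -> R) : (forall x, D x -> u x = v x) ->
  \int[mu]_(x in D) u x = \int[mu]_(x in D) v x.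
Proof. by move=> uv; apply: eq_Rintegral => x /set_mem; exact: uv. Qed.

Lemma cintegral_conj f : cintegrable D f ->
  cintegral D (fun x => conjc (f x)) = conjc (cintegral D f).
Proof.
move=> [rf if_]; rewrite /cintegral /=.
have -> : \int[mu]_(x in D) Re (conjc (f x)) = \int[mu]_(x in D) Re (f x).
  by apply: eq_Rint => x _; case: (f x).
have -> // : \int[mu]_(x in D) Im (conjc (f x)) = - \int[mu]_(x in D) Im (f x).
rewrite -mulN1r -(RintegralZl _ mD if_); apply: eq_Rint => x _.
by rewrite mulN1r; case: (f x).
Qed.

Lemma eq_cintegral f g : (forall x, D x -> f x = g x) -> cintegral D f = cintegral D g.
Proof.
by move=> fg; rewrite /cintegral; congr Complex; apply: eq_Rintegral => x /set_mem Dx; rewrite fg.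
Qed.

Lemma cintegrable_eq f g : (forall x, D x -> f x = g x) -> cintegrable D f -> cintegrable D g.
Proof.
by move=> fg [rf if_]; split; [apply: eq_integrable rf|apply: eq_integrable if_] => // x /set_mem Dx;
  rewrite fg.
Qed.

Definition ip f g : C := cintegral D (fun x => f x * conjc (g x)).

Lemma ipff f : L2D f -> ip f f = (fine (sqint f))%:C%C.
Proof.
move=> Lf; rewrite /ip /cintegral.
have -> : \int[mu]_(x in D) Re (f x * conjc (f x)) = \int[mu]_(x in D) nsq (f x).
  by apply: eq_Rint => x _; rewrite -nsqE.
have -> // : \int[mu]_(x in D) Im (f x * conjc (f x)) = 0.
rewrite (@eq_Rint _ (fun x : R => 0 : R)); last by move=> x _; rewrite -nsqE.
by rewrite Rintegral_cst// mul0r.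
Qed.

Lemma ip_inner : is_inner L2D ip.
Proof.
split.
- exact: L2D_subspace.
- move=> a f g h Lf Lg Lh.
  have [_ <-] := cintegral_lin a (cintegrable_mul Lf Lh) (cintegrable_mul Lg Lh).
  by apply: eq_cintegral => x _; ring.
- move=> f g Lf Lg; rewrite /ip -cintegral_conj; last exact: cintegrable_mul.
  apply: eq_cintegral => x _.
  case: (f x) => a b; case: (g x) => c d; apply/eqP; rewrite eq_complex /=.
  by apply/andP; split; apply/eqP; ring.
- move=> f Lf; rewrite ipff// ler0c fine_ge0// integral_ge0// => x _.
  by rewrite lee_fin nsq_ge0.
Qed.

Lemma sqint_inorm f : L2D f -> sqint f = (inorm ip f)%:E.
Proof.
move=> Lf; rewrite /inorm ipff//= fineK// ge0_fin_numE; first exact: Lf.2.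
by apply: integral_ge0 => x _; rewrite lee_fin nsq_ge0.
Qed.

Lemma L2D0_ae f : L2D f -> inorm ip f = 0 -> {ae mu, forall x, D x -> f x = 0}.
Proof.
move=> Lf f0.
have mf : measurable_fun D (EFin \o (fun x => nsq (f x))).
  by apply/measurable_EFinP; apply: measurable_nsq; exact: Lf.1.
have /(ae_eq_integral_abs mu mD mf) : (\int[mu]_(x in D) `|(EFin \o (fun x => nsq (f x))) x| = 0)%E.
  transitivity (sqint f); last by rewrite sqint_inorm// f0.
  by apply: eq_integral => x _; rewrite /= ger0_norm// nsq_ge0.
apply: filterS => x H Dx; have /= [] := H Dx; exact: nsq_eq0.
Qed.

Lemma ae_L2D0 f : L2D f -> {ae mu, forall x, D x -> f x = 0} -> inorm ip f = 0.
Proof.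
move=> Lf H; have : (inorm ip f)%:E = 0%E; last by move=> [].
rewrite -sqint_inorm// /sqint (ae_eq_integral (cst 0%E))//.
- by rewrite integral0.
- by apply/measurable_EFinP; apply: measurable_nsq; exact: Lf.1.
- have [N [mN N0 sN]] := H; exists N; split => // x /= nx; apply: sN => /= fx.
  by apply: nx => Dx; rewrite fx// nsq0.
Qed.

End ComplexIntegral.

(** * Completeness of L^2 along fast sequences *)

Section RieszFischer.
Variables (R : realType) (D : set R).
Local Notation C := R[i].
Local Notation Re := complex.Re.
Local Notation Im := complex.Im.
Local Notation mu := (@lebesgue_measure R).
Hypotheses (mD : measurable (D : set (measurableTypeR R))) (fD : (mu D < +oo)%E).
Local Notation L2D := (L2D D).
Local Notation nrm := (inorm (ip D)).

(** The increments are at most a multiple of [2^-1 ^+ n], hence summable. *)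
Lemma geometric_cvg (u : nat -> R) (K : R) :
  (forall n, (4 ^+ n * (u n.+1 - u n) ^+ 2 <= K)) -> cvgn u.
Proof.
move=> uK; have K0 : 0 <= K by apply: le_trans (uK 0%N); rewrite expr0 mul1r sqr_ge0.
pose d n := u n.+1 - u n.
(* [K + 1] serves as an upper bound for the square root of [K]. *)
have dn n : `|d n| <= (K + 1) * (2^-1) ^+ n.
  have h := uK n; have p2 : (0 : R) < 2 ^+ n by rewrite exprn_gt0.
  rewrite exprVn ler_pdivlMr// -(ler_pXn2r (isT : (0 < 2)%N)) ?nnegrE; last 2 first.
  - by rewrite mulr_ge0// ltW.
  - by rewrite addr_ge0.
  rewrite exprMn -normrX ger0_norm ?sqr_ge0// mulrC -exprM mulnC exprM.
  rewrite (_ : 2 ^+ 2 = 4 :> R); last by ring.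
  by apply: le_trans h _; nra.
have cs : cvgn (series d).
  apply: normed_cvg; apply: (@series_le_cvg _ _ (geometric (K + 1) 2^-1)) => //.
  - by move=> n; exact: normr_ge0.
  - by move=> n; rewrite /geometric /= mulr_ge0 ?exprn_ge0// addr_ge0.
  - by apply: is_cvg_geometric_series; rewrite ger0_norm; lra.
have -> : u = (fun n => u 0%N + series d n).
  by apply/funext => n; rewrite /series /= /d telescope_sumr// addrC subrK.
by apply: is_cvgD => //; exact: is_cvg_cst.
Qed.

Variable g : nat -> R -> C.
Hypothesis Lg : forall n, L2D (g n).
Hypothesis g_fast : forall n, nrm (fun x => g n.+1 x - g n x) <= 16^-1 ^+ n.

(** The constant 4 absorbs the factors 2 of [inormD]: [2 * (4 / 16) + 2 <= 4]. *)
Lemma fast_cauchy n m : nrm (fun x => g (n + m)%N x - g n x) <= 4 * 16^-1 ^+ n.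
Proof.
have sL := L2D_subspace mD fD.
elim: m n => [|m IH] n.
  rewrite addn0 (_ : (fun x => _) = fun=> 0); last by apply/funext => x; rewrite subrr.
  rewrite /inorm (inner0l (ip_inner mD fD) sL.1) /=.
  by apply: mulr_ge0 => //; exact: exprn_ge0.
rewrite (_ : (fun x => _) = fun x =>
  (g (n.+1 + m)%N x - g n.+1 x) + (g n.+1 x - g n x)); last first.
  by apply/funext => x; rewrite addnS -addSn addrA subrK.
apply: le_trans (inormD (ip_inner mD fD) _ _) _; do ?exact: subspaceB.
have := IH n.+1; have := g_fast n; rewrite exprS.
have : (0 : R) <= 16^-1 ^+ n by rewrite exprn_ge0.
by move: (16^-1 ^+ n : R) => k; lra.
Qed.

(** [p] stands for the real or the imaginary part. The squared increments of [p (g n x)] times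
    [4 ^+ n] have integral at most [4^-1 ^+ n], because the squared distances decay like
    [16^-1 ^+ n]. Their sum is therefore finite almost everywhere, and there [geometric_cvg]
    applies. *)
Lemma fast_ae_cvg (p : C -> R) : (forall z w, p (z - w) = p z - p w) ->
  (forall z, p z ^+ 2 <= nsq z) ->
  (forall f, cmeasurable D f -> measurable_fun D (fun x => p (f x))) ->
  {ae mu, forall x, D x -> cvgn (fun n => p (g n x))}.
Proof.
move=> pB pn mp.
pose s n x : \bar R := (4 ^+ n * (p (g n.+1 x) - p (g n x)) ^+ 2)%:E.
have s0 n x : (0 <= s n x)%E by rewrite lee_fin mulr_ge0 ?sqr_ge0// exprn_ge0.
have ms n : measurable_fun D (s n).
  apply/measurable_EFinP; apply: measurable_funM; first exact: measurable_cst.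
  apply: measurable_funX; apply: measurable_funB; apply: mp; exact: (Lg _).1.
have sL := L2D_subspace mD fD.
have is_ n : (\int[mu]_(x in D) s n x <= (4^-1 ^+ n)%:E)%E.
  have Ld : L2D (fun x => g n.+1 x - g n x) by exact: subspaceB.
  apply: (@le_trans _ _ ((4 ^+ n)%:E * sqint D (fun x => (g n.+1 x - g n x)%R))%E).
    rewrite /sqint -ge0_integralZl//; try (by move=> x _; rewrite lee_fin nsq_ge0);
      try (by rewrite lee_fin exprn_ge0);
      try (by apply/measurable_EFinP; apply: measurable_nsq; exact: Ld.1).
    apply: ge0_le_integral => //.
    - exact: ms.
    - under eq_fun do rewrite -EFinM.
      apply/measurable_EFinP; apply: measurable_funM; first exact: measurable_cst.
      by apply: measurable_nsq; exact: Ld.1.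
    - by move=> x _; rewrite -EFinM lee_fin ler_wpM2l ?exprn_ge0// -pB.
  rewrite sqint_inorm// -EFinM lee_fin; apply: le_trans (ler_wpM2l _ (g_fast n)) _.
    by rewrite exprn_ge0.
  by rewrite -exprMn (_ : 4 * 16^-1 = 4^-1)//; field.
have Soo : (\int[mu]_(x in D) (\sum_(n <oo) s n x) < +oo)%E.
  rewrite integral_nneseries//.
  apply: (@le_lt_trans _ _ (\sum_(n <oo) (4^-1 ^+ n)%:E)%E).
    apply: lee_nneseries => n _; last exact: is_.
    by move=> _; apply: integral_ge0.
  have c : cvgn (series (geometric (1 : R) 4^-1)).
    by apply: is_cvg_geometric_series; rewrite ger0_norm; lra.
  rewrite (_ : (fun n => _) = EFin \o series (geometric (1 : R) 4^-1)); last first.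
    by apply/funext => n; rewrite /series /= sumEFin; congr _%:E; apply: eq_bigr => i _; rewrite mul1r.
  by rewrite EFin_lim// ltry.
have iS : mu.-integrable D (fun x => \sum_(n <oo) s n x)%E.
  apply/integrableP; split.
    apply: (@ge0_emeasurable_sum _ _ _ _ _ xpredT) => [n x Dx _|n _]; [exact: s0|exact: ms].
  apply: le_lt_trans Soo; rewrite le_eqVlt; apply/orP; left; apply/eqP.
  by apply: eq_integral => x _; rewrite gee0_abs//; apply: nneseries_ge0 => n _ _.
have [N [mN N0 sN]] := integrable_ae mD iS.
exists N; split => // x /= nx; apply: sN => /= fx; apply: nx => Dx.
have /fineK Sx := fx Dx.
apply: (@geometric_cvg _ (fine (\sum_(n <oo) s n x)%E)) => n.
rewrite -lee_fin Sx -/(s n x); apply: le_trans (nneseries_lim_ge n.+1 (fun k _ _ => s0 k x)).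
by rewrite big_mkord big_ord_recr /= leeDr// sume_ge0.
Qed.

(** The sequence converges almost everywhere, and Fatou's lemma bounds the distance to the limit. *)
Theorem riesz_fischer : exists2 h, L2D h &
  forall n, nrm (fun x => g n x - h x) <= 4 * 16^-1 ^+ n.
Proof.
have sL := L2D_subspace mD fD.
(* The upper limit is defined and measurable on all of [D], and it is the limit where this
   exists. *)
pose lim_ (p : C -> R) x := fine (limn_esup (fun n => (p (g n x))%:E)).
pose h x : C := Complex (lim_ (@Re R) x) (lim_ (@Im R) x).
have mlim (p : C -> R) : (forall f, cmeasurable D f -> measurable_fun D (fun x => p (f x))) ->
    measurable_fun D (lim_ p).
  move=> mp; apply: (@measurableT_comp _ _ _ _ _ _ fine); first exact: fine_measurable.
  apply: measurable_fun_limn_esup => n; apply/measurable_EFinP; apply: mp; exact: (Lg n).1.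
have mh : cmeasurable D h by split; apply: mlim => f [].
have aeR : {ae mu, forall x, D x -> cvgn (fun n => Re (g n x))}.
  apply: fast_ae_cvg => //; first by move=> z w; rewrite raddfB.
    by move=> z; rewrite lerDl sqr_ge0.
  by move=> f [].
have aeI : {ae mu, forall x, D x -> cvgn (fun n => Im (g n x))}.
  apply: fast_ae_cvg => //; first by move=> z w; rewrite raddfB.
    by move=> z; rewrite lerDr sqr_ge0.
  by move=> f [].
have limE (p : C -> R) x : cvgn (fun n => p (g n x)) -> p (g n x) @[n --> \oo] --> lim_ p x.
  move=> c; rewrite /lim_; have /cvg_ex[l cl] := c.
  have /cvg_limn_einf_sup[_ ->] : (p (g n x))%:E @[n --> \oo] --> l%:E by apply: cvg_EFin => //; exact: nearW.
  exact: cl.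
have H n : (sqint D (fun x => (g n x - h x)%R) <= (4 * 16^-1 ^+ n)%:E)%E.
  have md m : cmeasurable D (fun x => g m x - g n x).
    by have [] := subspaceB sL (Lg m) (Lg n).
  apply: (@le_trans _ _ (\int[mu]_(x in D) limn_einf (fun m => (nsq (g m x - g n x))%:E))%E).
    rewrite le_eqVlt; apply/orP; left; apply/eqP; apply: ae_eq_integral => //.
    - apply/measurable_EFinP; apply: measurable_nsq.
      have [] := (@cmeasurableD _ _ _ (fun x => (-1) * h x) (Lg n).1 _); last first.
        by move=> a b; split; [apply: eq_measurable_fun a|apply: eq_measurable_fun b] => x _; rewrite mulN1r.
      by apply: cmeasurableM => //; exact: cmeasurable_cst.
    - rewrite /limn_einf; apply: measurableT_comp => //.
      apply: measurable_fun_limn_esup => m; apply: measurableT_comp => //.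
      by apply/measurable_EFinP; exact: measurable_nsq.
    have [N [mN N0 sN]] := aeR; have [N' [mN' N'0 sN']] := aeI.
    exists (N `|` N'); split; [exact: measurableU|by rewrite null_set_setU|].
    move=> x /= nx; apply: contrapT => /not_orP[nN nN']; apply: nx => Dx.
    have cR : cvgn (fun m => Re (g m x)) by apply: contrapT => nc; apply: nN; apply: sN => /(_ Dx).
    have cI : cvgn (fun m => Im (g m x)) by apply: contrapT => nc; apply: nN'; apply: sN' => /(_ Dx).
    apply/esym; have /cvg_limn_einf_sup[-> _] // : (nsq (g m x - g n x))%:E @[m --> \oo] --> (nsq (g n x - h x))%:E.
    apply: cvg_EFin; first exact: nearW.
    rewrite -opprB nsqN /nsq !raddfB /=.
    under eq_fun do rewrite !raddfB /=.
    have hc (u : nat -> R) (l c : R) : u m @[m --> \oo] --> l -> (u m - c) ^+ 2 @[m --> \oo] --> (l - c) ^+ 2.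
      move=> ul; rewrite expr2; under eq_fun do rewrite expr2.
      by apply: cvgM; apply: cvgB => //; exact: cvg_cst.
    by apply: cvgD; apply: hc; exact: limE.
  have mF m : measurable_fun D (fun x => (nsq (g m x - g n x))%:E).
    by apply/measurable_EFinP; exact: measurable_nsq.
  have F0 m x : D x -> (0 <= (nsq (g m x - g n x))%:E)%E by rewrite lee_fin nsq_ge0.
  apply: (le_trans (@fatou _ _ _ mu D mD _ mF F0)).
  rewrite limn_einf_lim; apply: lime_le; first exact: is_cvg_einfs.
  apply: nearW => m; apply: (@le_trans _ _ (sqint D (fun x => (g (n + m)%N x - g n x)%R))).
    by apply: ereal_inf_lbound; exists (n + m)%N => //=; rewrite leq_addl.
  rewrite sqint_inorm//; first by rewrite lee_fin fast_cauchy.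
  exact: subspaceB.
have Ld n : L2D (fun x => g n x - h x).
  split; last by apply: le_lt_trans (H n) _; rewrite ltry.
  have := cmeasurableD (Lg n).1 (cmeasurableM (cmeasurable_cst D (-1)) mh).
  by apply: eq_cmeasurable => x _; rewrite mulN1r.
exists h; last by move=> n; rewrite -lee_fin -sqint_inorm.
have := subspaceB sL (Lg 0%N) (Ld 0%N); congr (L2D _).
by apply/funext => x; rewrite opprB addrC subrK.
Qed.

End RieszFischer.

(** * Weighted square-summable functions *)

Section Sums.
Variables (R : realType) (V : choiceType).
Implicit Types (u w : V -> R).

Definition nnsum u : \bar R := (\esum_(v in setT) (u v)%:E)%E.

Lemma nnsum_le u (c : R) : (forall s, uniq s -> \sum_(v <- s) u v <= c) ->
  (nnsum u <= c%:E)%E.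
Proof.
move=> uc; apply: ge_ereal_sup => _ [F [fF _] <-].
by rewrite fsbig_finite//= sumEFin lee_fin; apply: uc.
Qed.

Lemma nnsum_ge u (s : seq V) : uniq s -> ((\sum_(v <- s) u v)%:E <= nnsum u)%E.
Proof.
move=> us; apply: esum_ge; exists [set` s].
  by split => //; exact: finite_seq.
by rewrite -fsbig_seq//= sumEFin.
Qed.

Lemma nnsum_ge0 u : (forall v, 0 <= u v) -> (0 <= nnsum u)%E.
Proof. by move=> u0; apply: esum_ge0 => v _; rewrite lee_fin. Qed.

Lemma nnsum_mono u w : (forall v, u v <= w v) -> (nnsum u <= nnsum w)%E.
Proof. by move=> uw; apply: le_esum => v _; rewrite lee_fin. Qed.

Lemma nnsumD u w : (forall v, 0 <= u v) -> (forall v, 0 <= w v) ->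
  nnsum (fun v => u v + w v) = (nnsum u + nnsum w)%E.
Proof.
by move=> u0 w0; rewrite -esumD // => v _; rewrite lee_fin.
Qed.

Lemma nnsum_fin u : (forall v, 0 <= u v) -> (nnsum u < +oo)%E ->
  nnsum u = (fine (nnsum u))%:E.
Proof. by move=> u0 uoo; rewrite fineK// ge0_fin_numE// nnsum_ge0. Qed.

(** One inequality comes from finite sums; applying it to [a^-1] gives the other. *)
Lemma nnsumZ (a : R) u : 0 <= a -> (forall v, 0 <= u v) -> (nnsum u < +oo)%E ->
  nnsum (fun v => a * u v) = (a%:E * nnsum u)%E.
Proof.
have le b w : 0 <= b -> (forall v, 0 <= w v) -> (nnsum w < +oo)%E ->
    (nnsum (fun v => b * w v)%R <= b%:E * nnsum w)%E.
  move=> b0 w0 woo; rewrite (nnsum_fin w0 woo) -EFinM; apply: nnsum_le => s us.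
  rewrite -mulr_sumr ler_wpM2l// -lee_fin -nnsum_fin//; exact: nnsum_ge.
move=> a0 u0 uoo; apply/eqP; rewrite eq_le le//=.
have [->|an0] := eqVneq a 0.
  by rewrite mul0e nnsum_ge0// => v; rewrite mul0r.
have ap : 0 < a by rewrite lt_def an0.
have auoo : (nnsum (fun v => a * u v)%R < +oo)%E.
  by apply: le_lt_trans (le _ _ a0 u0 uoo) _; rewrite (nnsum_fin u0 uoo) -EFinM ltry.
have au0 v : 0 <= a * u v by rewrite mulr_ge0.
have := le a^-1 _ (ltW _) au0 auoo; rewrite invr_gt0 => /(_ ap).
rewrite (_ : (fun v => _) = u); last first.
  by apply/funext => v; rewrite mulrA mulVf// mul1r.
rewrite (nnsum_fin u0 uoo) (nnsum_fin au0 auoo) -!EFinM !lee_fin.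
by rewrite -ler_pdivlMl.
Qed.

Definition asummable u := (nnsum (fun v => `|u v|%R) < +oo)%E.

Lemma asummable_le u w : (forall v, `|u v| <= w v) -> (nnsum w < +oo)%E -> asummable u.
Proof. by move=> uw; apply: le_lt_trans; exact: nnsum_mono. Qed.

(** [rsum] is defined by the positive and negative parts. Here every decomposition into summable
    nonnegative families is seen to give the same value, from which additivity follows. *)
Lemma rsum_diff (p n : V -> R) : (forall v, 0 <= p v) -> (forall v, 0 <= n v) ->
  (nnsum p < +oo)%E -> (nnsum n < +oo)%E ->
  rsum (fun v => p v - n v) = fine (nnsum p) - fine (nnsum n).
Proof.
move=> p0 n0 poo noo; rewrite /rsum -/(nnsum _) -/(nnsum _).
set up := fun v => Num.max (p v - n v) 0; set un := fun v => Num.max (- (p v - n v)) 0.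
have up0 v : 0 <= up v by rewrite le_max lexx orbT.
have un0 v : 0 <= un v by rewrite le_max lexx orbT.
have upoo : (nnsum up < +oo)%E.
  apply: le_lt_trans poo; apply: nnsum_mono => v; rewrite /up ge_max p0 andbT.
  by rewrite lerBlDr lerDl.
have unoo : (nnsum un < +oo)%E.
  apply: le_lt_trans noo; apply: nnsum_mono => v; rewrite /un ge_max n0 andbT opprB.
  by rewrite lerBlDr lerDl.
have : nnsum (fun v => up v + n v) = nnsum (fun v => un v + p v).
  congr nnsum; apply/funext => v; rewrite /up /un opprB !maxEle.
  by have [] := leP (p v - n v) 0; have [] := leP (n v - p v) 0; lra.
rewrite !nnsumD// (nnsum_fin up0 upoo) (nnsum_fin un0 unoo) (nnsum_fin p0 poo)
  (nnsum_fin n0 noo) -!EFinD /= => -[]; lra.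
Qed.

Lemma rsum_pos u : (forall v, 0 <= u v) -> (nnsum u < +oo)%E -> rsum u = fine (nnsum u).
Proof.
move=> u0 uoo; have z : nnsum (fun v : V => 0) = 0%E.
  by apply: esum1.
rewrite -[RHS]subr0; have := rsum_diff u0 (fun v : V => lexx (0 : R)) uoo.
rewrite z /= => <- //; by congr rsum; apply/funext => v; rewrite subr0.
Qed.

Definition pos u v : R := Num.max (u v) 0.
Definition neg u v : R := Num.max (- u v) 0.

Lemma pos_ge0 u v : 0 <= pos u v. Proof. by rewrite le_max lexx orbT. Qed.
Lemma neg_ge0 u v : 0 <= neg u v. Proof. by rewrite le_max lexx orbT. Qed.
Lemma pos_neg u v : u v = pos u v - neg u v.
Proof. by rewrite /pos /neg !maxEle; do 2?case: ifPn; rewrite -?ltNge; lra. Qed.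
Lemma pos_fin u : asummable u -> (nnsum (pos u) < +oo)%E.
Proof.
apply: le_lt_trans; apply: nnsum_mono => v.
by rewrite ge_max normr_ge0 ler_norm.
Qed.
Lemma neg_fin u : asummable u -> (nnsum (neg u) < +oo)%E.
Proof.
apply: le_lt_trans; apply: nnsum_mono => v.
by rewrite ge_max normr_ge0 -normrN ler_norm.
Qed.

Lemma rsumE u : rsum u = fine (nnsum (pos u)) - fine (nnsum (neg u)).
Proof. by []. Qed.

Lemma asummableD u w : asummable u -> asummable w -> asummable (fun v => u v + w v).
Proof.
move=> au aw; apply: (@asummable_le _ (fun v => `|u v| + `|w v|)).
  by move=> v; exact: ler_normD.
by rewrite nnsumD// lte_add_pinfty.
Qed.

Lemma asummableZ (a : R) u : asummable u -> asummable (fun v => a * u v).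
Proof.
move=> au; apply: (@asummable_le _ (fun v => `|a| * `|u v|)).
  by move=> v; rewrite normrM.
rewrite nnsumZ// (nnsum_fin _ au)//; first by rewrite -EFinM ltry.
Qed.

Lemma rsumD u w : asummable u -> asummable w ->
  rsum (fun v => u v + w v) = rsum u + rsum w.
Proof.
move=> au aw.
have -> : (fun v => u v + w v) = fun v => (pos u v + pos w v) - (neg u v + neg w v).
  by apply/funext => v; rewrite {1}(pos_neg u v) {1}(pos_neg w v); ring.
have p := pos_fin; have n := neg_fin; have p0 := pos_ge0; have n0 := neg_ge0.
have D0 (a b : V -> R) : (forall v, 0 <= a v) -> (forall v, 0 <= b v) -> forall v, 0 <= a v + b v.
  by move=> a0 b0 v; exact: addr_ge0.
rewrite rsum_diff; [|exact: D0|exact: D0|by rewrite nnsumD// lte_add_pinfty ?p|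
  by rewrite nnsumD// lte_add_pinfty ?n].
rewrite !nnsumD//.
rewrite !fineD ?ge0_fin_numE ?nnsum_ge0 ?(p _ au) ?(p _ aw) ?(n _ au) ?(n _ aw)//.
by rewrite !rsumE; ring.
Qed.

Lemma rsumN u : rsum (fun v => - u v) = - rsum u.
Proof.
rewrite /rsum opprB; congr (fine _ - fine _).
by congr esum; apply/funext => v; rewrite opprK.
Qed.

Lemma rsumZ (a : R) u : asummable u -> rsum (fun v => a * u v) = a * rsum u.
Proof.
wlog a0 : a / 0 <= a => [H au|au].
  have [a0|a0] := leP 0 a; first exact: H.
  have := H (- a); rewrite oppr_ge0 => /(_ (ltW a0)).
  rewrite (_ : (fun v => - a * u v) = fun v => - (a * u v)); last first.
    by apply/funext => v; rewrite mulNr.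
  by rewrite rsumN mulNr => /(_ au)/oppr_inj.
have -> : (fun v => a * u v) = fun v => a * pos u v - a * neg u v.
  by apply/funext => v; rewrite -mulrBr -pos_neg.
have p := pos_fin au; have n := neg_fin au; have p0 := pos_ge0 u; have n0 := neg_ge0 u.
have pE := nnsum_fin p0 p; have nE := nnsum_fin n0 n.
rewrite rsum_diff; do ?by move=> v; rewrite mulr_ge0.
- by rewrite rsumE !nnsumZ// pE nE /= mulrBr.
- by rewrite nnsumZ// pE -EFinM ltry.
- by rewrite nnsumZ// nE -EFinM ltry.
Qed.

Lemma nnsum_seq u (s : seq V) : (forall v, 0 <= u v) -> uniq s ->
  (forall v, v \notin s -> u v = 0) -> nnsum u = (\sum_(v <- s) u v)%:E.
Proof.
move=> u0 us us0.
transitivity (\esum_(v in [set` s]) (u v)%:E)%E.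
  rewrite /nnsum [RHS]esum_mkcond; apply: eq_esum => v _; rewrite mem_setE.
  by case: ifPn => // /us0 ->.
rewrite esum_fset; first by rewrite -fsbig_seq//= sumEFin.
- exact: finite_seq.
- by move=> v _; rewrite lee_fin.
Qed.

Lemma rsum_seq u (s : seq V) : uniq s -> (forall v, v \notin s -> u v = 0) ->
  asummable u /\ rsum u = \sum_(v <- s) u v.
Proof.
move=> us us0; split.
  by rewrite /asummable (nnsum_seq _ us) ?ltry// => v /us0 ->; rewrite normr0.
rewrite rsumE (nnsum_seq (pos_ge0 u) us); last by move=> v /us0 uv; rewrite /pos uv maxxx.
rewrite (nnsum_seq (neg_ge0 u) us); last by move=> v /us0 uv; rewrite /neg uv oppr0 maxxx.
by rewrite /= -sumrB; apply: eq_bigr => v _; rewrite -pos_neg.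
Qed.

End Sums.

Section CSum.
Variables (R : realType) (V : choiceType).
Local Notation C := R[i].
Local Notation Re := complex.Re.
Local Notation Im := complex.Im.
Implicit Types (u w : V -> C).

Definition casummable u := asummable (fun v => Re (u v)) /\ asummable (fun v => Im (u v)).

Lemma csum_lin (a : C) u w : casummable u -> casummable w ->
  casummable (fun v => a * u v + w v) /\
  csum (fun v => a * u v + w v) = a * csum u + csum w.
Proof.
move=> [ru iu] [rw iw]; case: a => a b.
have e1 : (fun v => Re ((a +i* b)%C * u v + w v)) =
    (fun v => a * Re (u v) + - b * Im (u v) + Re (w v)).
  by apply/funext => v; case: (u v) => x y; case: (w v) => x' y' /=; ring.
have e2 : (fun v => Im ((a +i* b)%C * u v + w v)) =
    (fun v => a * Im (u v) + b * Re (u v) + Im (w v)).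
  by apply/funext => v; case: (u v) => x y; case: (w v) => x' y' /=; ring.
have s1 c := asummableZ c ru; have s2 c := asummableZ c iu.
have s3 := asummableD (s1 a) (s2 (- b)); have s4 := asummableD (s2 a) (s1 b).
split; first by rewrite /casummable e1 e2; split; [exact: asummableD s3 rw|exact: asummableD s4 iw].
rewrite /csum e1 e2 (rsumD s3 rw) (rsumD s4 iw) (rsumD (s1 a) (s2 (- b))) (rsumD (s2 a) (s1 b)).
rewrite !(rsumZ _ ru) !(rsumZ _ iu).
apply/eqP; rewrite eq_complex /=; apply/andP; split; apply/eqP; ring.
Qed.

Lemma csum_conj u : csum (fun v => conjc (u v)) = conjc (csum u).
Proof.
rewrite /csum /= -rsumN.
rewrite (_ : (fun v => Re _) = fun v => Re (u v)); last by apply/funext => v; case: (u v).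
rewrite (_ : (fun v => Im (conjc _)) = fun v => - Im (u v)) //.
by apply/funext => v; case: (u v).
Qed.

Lemma csum_seq u (s : seq V) : uniq s -> (forall v, v \notin s -> u v = 0) ->
  csum u = \sum_(v <- s) u v.
Proof.
move=> us us0; rewrite /csum.
have r0 v : v \notin s -> Re (u v) = 0 by move/us0 ->.
have i0 v : v \notin s -> Im (u v) = 0 by move/us0 ->.
rewrite (rsum_seq us r0).2 (rsum_seq us i0).2.
by apply/eqP; rewrite eq_complex /= !raddf_sum /= !eqxx.
Qed.

End CSum.

(** * The Hilbert space of weighted square-summable functions *)

Section Dot.
Variables (R : realType) (V : choiceType) (lam : V -> R).
Hypothesis lam_gt0 : forall v, 0 < lam v.
Local Notation C := R[i].
Local Notation L2 := (L2 lam).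
Local Notation dot := (dot lam).
Implicit Types (f g h : V -> C).

Definition sqw f v : R := nsq (f v) * lam v.

Lemma sqw_ge0 f v : 0 <= sqw f v.
Proof. by rewrite mulr_ge0 ?nsq_ge0// ltW. Qed.

Lemma l2norm2E f : l2norm2 lam f = nnsum (sqw f).
Proof. by rewrite /l2norm2; congr esum; apply/funext => v; rewrite normc_sqr. Qed.

Lemma L2P f : L2 f <-> (nnsum (sqw f) < +oo)%E.
Proof. by rewrite /L2 /mkset l2norm2E. Qed.

Lemma L2_subspace : is_subspace L2.
Proof.
split.
  apply/L2P; rewrite (_ : sqw _ = fun=> 0); last by apply/funext => v; rewrite /sqw nsq0 mul0r.
  by rewrite /nnsum esum1.
move=> a f g /L2P Lf /L2P Lg; apply/L2P.
apply: (@le_lt_trans _ _ (nnsum (fun v => 2 * nsq a * sqw f v + 2 * sqw g v))).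
  apply: nnsum_mono => v; rewrite /sqw.
  have := nsqD_le (a * f v) (g v); rewrite nsqM.
  by move/(ler_wpM2r (ltW (lam_gt0 v))); congr (_ <= _); ring.
have a0 := nsq_ge0 a; have f0 := sqw_ge0 f; have g0 := sqw_ge0 g.
have a20 : 0 <= 2 * nsq a by lra.
rewrite nnsumD; [|by move=> v; rewrite mulr_ge0|by move=> v; rewrite mulr_ge0].
by rewrite !nnsumZ// (nnsum_fin f0 Lf) (nnsum_fin g0 Lg) -!EFinM -EFinD ltry.
Qed.

Lemma dot_casummable f g : L2 f -> L2 g ->
  casummable (fun v => f v * conjc (g v) * (lam v)%:C%C).
Proof.
move=> /L2P Lf /L2P Lg; have f0 := sqw_ge0 f; have g0 := sqw_ge0 g.
have oo : (nnsum (fun v => (sqw f v + sqw g v)%R) < +oo)%E.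
  by rewrite nnsumD// lte_add_pinfty.
split; apply: (asummable_le _ oo) => v; rewrite /sqw /nsq; have := lam_gt0 v;
  case: (f v) => a b; case: (g v) => c d /=; move=> l0; have l0' := ltW l0.
- rewrite mulr0 subr0 normrM (ger0_norm l0') -mulrDl ler_wpM2r//.
  have h1 := sqr_ge0 (a + c); have h2 := sqr_ge0 (a - c).
  have h3 := sqr_ge0 (b + d); have h4 := sqr_ge0 (b - d).
  by rewrite ler_norml; apply/andP; split; lra.
- rewrite mulr0 add0r normrM (ger0_norm l0') -mulrDl ler_wpM2r//.
  have h1 := sqr_ge0 (a + d); have h2 := sqr_ge0 (a - d).
  have h3 := sqr_ge0 (b + c); have h4 := sqr_ge0 (b - c).
  by rewrite ler_norml; apply/andP; split; lra.
Qed.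

Lemma dot_seq f g (s : seq V) : uniq s ->
  (forall v, v \notin s -> f v = 0 \/ g v = 0) ->
  dot f g = \sum_(v <- s) f v * conjc (g v) * (lam v)%:C%C.
Proof.
move=> us s0; rewrite /dot; apply: csum_seq => // v /s0 [|] ->.
  by rewrite !mul0r.
by rewrite conjc0 mulr0 mul0r.
Qed.

Lemma dot_norm f : L2 f -> dot f f = (fine (l2norm2 lam f))%:C%C.
Proof.
move=> /L2P Lf; rewrite l2norm2E -rsum_pos//; last exact: sqw_ge0.
apply/eqP; rewrite eq_complex /=; apply/andP; split; apply/eqP.
  by congr rsum; apply/funext => v; rewrite /sqw /nsq; case: (f v) => a b /=; ring.
have := @rsum_seq R V (fun=> 0) [::] isT (fun _ _ => erefl).
by rewrite big_nil => -[_ <-]; congr rsum; apply/funext => v; case: (f v) => a b /=; ring.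
Qed.

Lemma dot_inner : is_inner L2 dot.
Proof.
split.
- exact: L2_subspace.
- move=> a f g h Lf Lg Lh; rewrite /dot.
  have [_ <-] := csum_lin a (dot_casummable Lf Lh) (dot_casummable Lg Lh).
  by congr csum; apply/funext => v; ring.
- move=> f g Lf Lg; rewrite /dot -csum_conj; congr csum; apply/funext => v.
  case: (f v) => a b; case: (g v) => c d; apply/eqP; rewrite eq_complex /=.
  by apply/andP; split; apply/eqP; ring.
- move=> f Lf; rewrite dot_norm// ler0c fine_ge0// l2norm2E.
  by apply: nnsum_ge0; exact: sqw_ge0.
Qed.

Lemma l2norm2_inorm f : L2 f -> l2norm2 lam f = (inorm dot f)%:E.
Proof.
move=> Lf; rewrite /inorm dot_norm//= fineK// ge0_fin_numE//.
by rewrite l2norm2E nnsum_ge0//; exact: sqw_ge0.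
Qed.

Lemma sum_le_inorm f (s : seq V) : L2 f -> uniq s ->
  \sum_(v <- s) nsq (f v) * lam v <= inorm dot f.
Proof.
move=> Lf us; rewrite -lee_fin -l2norm2_inorm// l2norm2E.
exact: nnsum_ge.
Qed.

(** A bound on finite partial sums is the form in which square-summability is obtained for [nbop]
    and [synthesis]. *)
Lemma L2_bound f (c : R) :
  (forall s, uniq s -> \sum_(v <- s) nsq (f v) * lam v <= c) ->
  L2 f /\ inorm dot f <= c.
Proof.
move=> fc; have H : (l2norm2 lam f <= c%:E)%E by rewrite l2norm2E; exact: nnsum_le.
have Lf : L2 f by apply: le_lt_trans H _; rewrite ltry.
by split => //; rewrite -lee_fin -l2norm2_inorm.
Qed.

Lemma dot_definite f : L2 f -> dot f f = 0 -> f = fun=> 0.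
Proof.
move=> Lf f0; apply/funext => v; apply: nsq_eq0; apply: le_anti; rewrite nsq_ge0 andbT.
have := @sum_le_inorm f [:: v] Lf isT.
by rewrite big_seq1 /inorm f0 /= pmulr_lle0.
Qed.

Definition restrict_to (s : seq V) f v : C := if v \in s then f v else 0.

Lemma finitely_supportedP f : finitely_supported f <->
  exists2 s, uniq s & forall v, v \notin s -> f v = 0.
Proof.
split=> [/finite_seqP[s fs]|[s us s0]].
  exists (undup s); first exact: undup_uniq.
  move=> v; rewrite mem_undup => vs; apply: contrapT => fv.
  have : [set v | f v <> 0] v by [].
  by rewrite fs /= (negbTE vs).
apply: (@sub_finite_set _ _ [set` s]); last exact: finite_seq.
by move=> v /= fv; apply: contrapT => /negP /s0.
Qed.

Lemma restrict_finite s f : finitely_supported (restrict_to s f).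
Proof.
apply/finitely_supportedP; exists (undup s); first exact: undup_uniq.
by move=> v; rewrite mem_undup /restrict_to => /negbTE ->.
Qed.

Lemma finite_L2 f : finitely_supported f -> L2 f.
Proof.
move=> /finitely_supportedP[s us s0]; apply/L2P; rewrite (nnsum_seq _ us) ?ltry//.
  exact: sqw_ge0.
by move=> v /s0 fv; rewrite /sqw fv nsq0 mul0r.
Qed.

Lemma finite_subspace : is_subspace (@finitely_supported R V).
Proof.
split.
  by apply/finitely_supportedP; exists [::].
move=> a f g /finitely_supportedP[s us s0] /finitely_supportedP[t ut t0].
apply/finitely_supportedP; exists (undup (s ++ t)); first exact: undup_uniq.
move=> v; rewrite mem_undup mem_cat negb_or => /andP[/s0 -> /t0 ->].
by rewrite mulr0 addr0.
Qed.

Lemma inorm_seq f (s : seq V) : uniq s -> (forall v, v \notin s -> f v = 0) ->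
  inorm dot f = \sum_(v <- s) nsq (f v) * lam v.
Proof.
move=> us s0; rewrite /inorm (dot_seq us); last by move=> v /s0; left.
by rewrite raddf_sum; apply: eq_bigr => v _; rewrite -nsqE /=; ring.
Qed.

(** A finite set carries all but [e] of the squared norm. Truncation is an orthogonal projection, so
    the error is the difference of the two squared norms. *)
Lemma restrict_approx f (e : R) : L2 f -> 0 < e -> exists s, uniq s /\
  forall t, uniq t -> {subset s <= t} ->
    inorm dot (fun v => f v - restrict_to t f v) <= e.
Proof.
move=> Lf e0.
(* Otherwise [inorm f - e] would bound every finite sum, hence [inorm f] itself. *)
have [s [us sE]] : exists s, uniq s /\ inorm dot f - e <= \sum_(v <- s) nsq (f v) * lam v.
  apply: contrapT => /forallNP H.
  have [_] : L2 f /\ inorm dot f <= inorm dot f - e; last by lra.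
  apply: L2_bound => s us; have /not_andP[//|/negP] := H s.
  by rewrite -ltNge => /ltW.
exists s; split => // t ut st.
have Lr : L2 (restrict_to t f) by exact/finite_L2/restrict_finite.
have rE : inorm dot (restrict_to t f) = \sum_(v <- t) nsq (f v) * lam v.
  rewrite (inorm_seq ut); last by move=> v; rewrite /restrict_to => /negbTE ->.
  by rewrite !big_seq; apply: eq_bigr => v vt; rewrite /restrict_to vt.
have dE : dot f (restrict_to t f) = (inorm dot (restrict_to t f))%:C%C.
  rewrite rE (dot_seq ut); last by move=> v; rewrite /restrict_to => /negbTE ->; right.
  rewrite raddf_sum !big_seq; apply: eq_bigr => v vt; rewrite /restrict_to vt.
  by rewrite -nsqE /=; apply/eqP; rewrite eq_complex /=; apply/andP; split; apply/eqP; ring.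
have : inorm dot (fun v => f v - restrict_to t f v) =
    inorm dot f - inorm dot (restrict_to t f).
  rewrite (_ : (fun v => _) = fun v => (-1) * restrict_to t f v + f v); last first.
    by apply/funext => v; rewrite mulN1r addrC.
  rewrite (inorm_sub dot_inner) // (inner_conj dot_inner Lf Lr) dE conjc_real.
  by rewrite nsqN (_ : nsq 1 = 1) /= ?oppr0 /nsq/=; ring.
move=> ->; rewrite rE.
suff : \sum_(v <- s) nsq (f v) * lam v <= \sum_(v <- t) nsq (f v) * lam v by lra.
rewrite -rE; apply: le_trans (sum_le_inorm Lr us); rewrite !big_seq.
by apply: ler_sum => v /st vt; rewrite /restrict_to vt.
Qed.

End Dot.

(** * The quotient of the tree as a weighted graph *)

Section SeqPartition.
Variables (T U : eqType) (h : T -> U).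

Lemma sum_fiber (M : nmodType) (F : T -> M) (s : seq T) (r : seq U) : uniq r ->
  (forall x, x \in s -> h x \in r) ->
  \sum_(x <- s) F x = \sum_(y <- r) \sum_(x <- s | h x == y) F x.
Proof.
move=> ur sr; rewrite (exchange_big_dep predT)//= !big_seq.
apply: eq_bigr => x xs; under eq_bigl do rewrite eq_sym.
by rewrite -big_filter filter_pred1_uniq ?big_seq1// sr.
Qed.

End SeqPartition.

(** * Lattices, vertices and the action of PGL_2 *)

Section Lattices.
Local Open Scope quotient_scope.
Variables (K : fieldType) (w : K -> int).
Hypothesis wP : is_discrete_valuation w.
Hypothesis residues : exists s : seq K, forall x, val_ge w 0 x ->
  exists2 c, c \in s & val_ge w 1 (x - c).

Local Notation lattice := (lattice w).
Local Notation vertex := (vertex w).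

Lemma uniformizer : exists2 p, p != 0 & w p = 1.
Proof.
have [p wp] := valuation_onto wP; exists p => //.
by apply/eqP => p0; move: wp; rewrite p0 (valuation0 wP).
Qed.

Lemma valuationX p n : p != 0 -> w (p ^+ n) = w p *+ n.
Proof.
move=> p0; elim: n => [|n IH]; first by rewrite expr0 (valuation1 wP).
by rewrite exprS (valuationM wP) ?expf_neq0// IH mulrS.
Qed.

Lemma val_geMl (c : K) (n m : int) x : c != 0 -> w c = n -> val_ge w m x ->
  val_ge w (n + m) (c * x).
Proof.
move=> c0 wc; have [->|x0] := eqVneq x 0; first by rewrite mulr0; left.
by move=> [/eqP|mx]; [rewrite (negbTE x0)|right; rewrite (valuationM wP)// wc lerD2l].
Qed.

(** Truncated expansions in a uniformizer: [c] accumulates [m] digits and [p ^+ m * d] appends the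
    next. *)
Lemma residues_mod m : exists s : seq K, forall x, val_ge w 0 x ->
  exists2 c, c \in s & val_ge w m%:Z (x - c).
Proof.
have [p p0 wp] := uniformizer; have [t tP] := residues.
elim: m => [|m [s sP]].
  by exists [:: 0] => x x0; exists 0; rewrite ?mem_head// subr0.
exists [seq c + p ^+ m * d | c <- s, d <- t] => x x0.
have [c cs xc] := sP x x0.
have pm0 : p ^+ m != 0 by rewrite expf_neq0.
have wpm : w (p ^+ m) = m%:Z by rewrite valuationX// wp natz.
have [d dt yd] : exists2 d, d \in t & val_ge w 1 ((x - c) / p ^+ m - d).
  apply: tP; rewrite mulrC -(addNr (m%:Z)); apply: val_geMl => //.
    by rewrite invr_eq0.
  by rewrite (valuationV wP)// wpm.
exists (c + p ^+ m * d); first by apply/allpairsP; exists (c, d).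
have := val_geMl pm0 wpm yd.
by rewrite mulrBr mulrCA divff// mulr1 opprD addrA -PoszD addn1.
Qed.

Lemma integral_mxD (x y : 'cV[K]_2) : Defs.integral w x -> Defs.integral w y -> Defs.integral w (x + y).
Proof. by move=> ix iy i j; rewrite mxE; apply: (val_geD wP). Qed.

Lemma integral_mxZ c (x : 'cV[K]_2) : val_ge w 0 c -> Defs.integral w x -> Defs.integral w (c *: x).
Proof. by move=> c0 ix i j; rewrite mxE; apply: (val_geM wP). Qed.

Lemma integral_mxM (g : 'M[K]_2) (x : 'cV[K]_2) : Defs.integral w g -> Defs.integral w x ->
  Defs.integral w (g *m x).
Proof.
move=> ig ix i j; rewrite mxE; apply: (val_ge_sum wP) => l.
by apply: (val_geM wP); [exact: ig|exact: ix].
Qed.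

Lemma integral_reps m : exists s : seq 'cV[K]_2, forall x : 'cV[K]_2, Defs.integral w x ->
  exists2 c, c \in s & forall i j, val_ge w m%:Z ((x - c) i j).
Proof.
have [s sP] := residues_mod m.
exists [seq (\col_(i < 2) if i == 0 then a else b) | a <- s, b <- s] => x ix.
have [a as_ xa] := sP _ (ix 0 0); have [b bs xb] := sP _ (ix 1 0).
exists (\col_(i < 2) if i == 0 then a else b); first by apply/allpairsP; exists (a, b).
move=> i j; rewrite (ord1 j) !mxE; have [->//|i0] := eqVneq i 0.
by have -> : i = 1 by apply: val_inj; case: i i0 => [[|[|]]].
Qed.

Lemma latticeP (L : lattice) : exists g : GL2 K, val L = lattice_of w (val g).
Proof. exact: set_mem (valP L). Qed.

Lemma latticeD (L : lattice) x y : val L x -> val L y -> val L (x + y).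
Proof.
have [g ->] := latticeP L => -[u iu <-] [v iv <-]; exists (u + v).
  exact: integral_mxD.
by rewrite mulmxDr.
Qed.

Lemma latticeZ (L : lattice) c x : val_ge w 0 c -> val L x -> val L (c *: x).
Proof.
have [g ->] := latticeP L => c0 [u iu <-]; exists (c *: u).
  exact: integral_mxZ.
by rewrite scalemxAr.
Qed.

Lemma latticeN (L : lattice) x : val L x -> val L (- x).
Proof.
by rewrite -scaleN1r; apply: latticeZ; right; rewrite (valuationN1 wP).
Qed.

Definition sublattices_between (c : K) (L : lattice) : set lattice :=
  [set M | ( *:%R c) @` val L `<=` val M /\ val M `<=` val L].

(** A lattice between [c L] and [L] is a union of classes modulo [c L], of which there are finitely
    many. *)
Lemma finite_sublattices c (L : lattice) : c != 0 -> 0 <= w c ->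
  finite_set (sublattices_between c L).
Proof.
move=> c0 wc; have [h Lh] := latticeP L.
have [n wn] : exists n : nat, w c = n%:Z by case: (w c) wc => // n _; exists n.
have [s sP] := integral_reps n.
(* Records which of the finitely many representatives of [L] modulo [c L] lie in [M]. *)
pose code (M : lattice) : (size s).-tuple bool :=
  map_tuple (fun x => `[< (val M : set 'cV[K]_2) (val h *m x) >]) (in_tuple s).
have inj : {in sublattices_between c L &, injective code}.
  suff H (M N : lattice) : sublattices_between c L M -> sublattices_between c L N ->
      code M = code N -> val M `<=` val N.
    move=> M N /set_mem LM /set_mem LN e; apply: val_inj; apply/seteqP; split.
      exact: H.
    by apply: H.
  move=> [cM ML] [cN NL] e y My.
  have := ML _ My; rewrite Lh => -[x ix xy].
  have [d ds xd] := sP _ ix.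
  pose z := c^-1 *: (x - d).
  have iz : Defs.integral w z.
    move=> i j; rewrite mxE -(addNr n%:Z); apply: val_geMl (xd i j).
      by rewrite invr_eq0.
    by rewrite (valuationV wP)// wn.
  have hz : val h *m (x - d) = c *: (val h *m z).
    by rewrite scalemxAr scalerA divff// scale1r.
  have Lz : val L (val h *m z) by rewrite Lh; exists z.
  have Md : val M (val h *m d).
    have -> : val h *m d = y + - (val h *m (x - d)).
      by rewrite mulmxBr opprB xy addrC subrK.
    by apply: latticeD => //; apply: latticeN; rewrite hz; apply: cM; exists (val h *m z).
  have Nd : val N (val h *m d).
    have /(congr1 val) /= /eq_in_map /(_ d ds) := e.
    by rewrite (asboolT Md) => /esym/asboolP.
  have -> : y = val h *m d + val h *m (x - d) by rewrite -mulmxDr addrCA subrr addr0 xy.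
  by apply: latticeD => //; rewrite hz; apply: cN; exists (val h *m z).
rewrite -(eq_finite_set (inj_card_eq inj)).
exact: (sub_finite_set (@subsetT _ _)).
Qed.

Definition lattice_scale_subproof (c : K) (L : lattice) :
  c != 0 -> ( *:%R c) @` val L \in is_lattice w.
Proof.
move=> c0; apply/mem_set; have [g Lg] := latticeP L.
have u : c *: val g \in unitmx by rewrite unitmxZ ?unitfE// (valP g).
exists (Sub (c *: val g) u); rewrite Lg /lattice_of /=; apply/seteqP; split.
  by move=> _ [_ [x ix <-] <-]; exists x => //; rewrite scalemxAl.
by move=> _ [x ix <-]; exists (val g *m x); [exists x|rewrite scalemxAl].
Qed.

Definition lattice_scale c (c0 : c != 0) (L : lattice) : lattice :=
  exist (fun M => M \in is_lattice w) _ (lattice_scale_subproof L c0).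

Lemma vertex_ofP (L M : lattice) : vertex_of L = vertex_of M <->
  exists2 c : K, c != 0 & val L = ( *:%R c) @` val M.
Proof.
rewrite /vertex_of; split=> [/eqP|e].
  by rewrite -[_ == _]/(_ == _ %[mod Defs.vertex w])%qT eqmodE => /asboolP.
by apply/eqP; rewrite -[_ == _]/(_ == _ %[mod Defs.vertex w])%qT eqmodE; apply/asboolP.
Qed.

Lemma vertex_ofK (x : vertex) : vertex_of (repr x) = x.
Proof. exact: reprK. Qed.

Lemma vertex_scale c (c0 : c != 0) (L : lattice) : vertex_of (lattice_scale c0 L) = vertex_of L.
Proof. by apply/vertex_ofP; exists c. Qed.

Lemma entries_bounded (X : 'M[K]_2) : exists n : nat, forall i j, val_ge w (- n%:Z) (X i j).
Proof.
exists (\sum_(ij : 'I_2 * 'I_2) absz (w (X ij.1 ij.2)))%N => i j; right.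
rewrite lerNl (bigD1 (i, j)) //= PoszD.
set k := w (X i j); set t := Posz (\sum_(_ | _) _).
have t0 : (0 : int) <= t by [].
by lia.
Qed.

(** The exponents [a] and [b] bound the denominators of the two base changes between [L] and [M], so
    [p ^+ a] times [M] lies in [L] and [p ^+ b] times [L] lies in [M]. *)
Lemma homothetic_between (L M : lattice) : exists (c : K) (N : lattice),
  [/\ c != 0, 0 <= w c, vertex_of N = vertex_of M & sublattices_between c L N].
Proof.
have [p p0 wp] := uniformizer.
have [h Lh] := latticeP L; have [g Mg] := latticeP M.
have [a aP] := entries_bounded (invmx (val h) *m val g).
have [b bP] := entries_bounded (invmx (val g) *m val h).
have pa0 : p ^+ a != 0 by rewrite expf_neq0.
have wX n : w (p ^+ n) = n%:Z by rewrite valuationX// wp natz.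
exists (p ^+ (a + b)), (lattice_scale pa0 M); split.
- by rewrite expf_neq0.
- by rewrite wX.
- exact: vertex_scale.
split.
  move=> _ [y Ly <-] /=; exists (p ^+ b *: y); last by rewrite scalerA -exprD.
  move: Ly; rewrite Lh Mg => -[x ix <-]; exists (p ^+ b *: (invmx (val g) *m val h) *m x).
    apply: integral_mxM => // i j; rewrite mxE -(subrr b%:Z).
    by apply: val_geMl (bP i j); rewrite ?expf_neq0.
  by rewrite -scalemxAl scalemxAr !mulmxA mulmxV ?mul1mx ?scalemxAr// (valP g).
move=> _ [y My <-] /=; move: My; rewrite Lh Mg => -[x ix <-].
exists (p ^+ a *: (invmx (val h) *m val g) *m x).
  apply: integral_mxM => // i j; rewrite mxE -(subrr a%:Z).
  by apply: val_geMl (aP i j); rewrite ?expf_neq0.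
by rewrite -scalemxAl scalemxAr !mulmxA mulmxV ?mul1mx ?scalemxAr// (valP h).
Qed.

(** Frees the action from the representatives hidden in [act]. *)
Lemma actE (g : GL2 K) (L : lattice) :
  act (PGL2_class g) (vertex_of L) = vertex_of (lattice_image g L).
Proof.
rewrite /act; have [c c0 gE] := repr_PGL2_class g.
have /vertex_ofP[d d0 LE] : vertex_of (repr (vertex_of L)) = vertex_of L by exact: vertex_ofK.
apply/vertex_ofP; exists (c * d); first by rewrite mulf_neq0.
rewrite /= gE LE; apply/seteqP; split.
  move=> _ [_ [x Lx <-] <-]; exists (val g *m x); first by exists x.
  by rewrite -scalemxAr -scalemxAl scalerA mulrC.
move=> _ [_ [x Lx <-] <-]; exists (d *: x); first by exists x.
by rewrite -scalemxAr -scalemxAl scalerA mulrC.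
Qed.

Lemma actM (g h : PGL2 K) (x : vertex) : act (g * h)%g x = act g (act h x).
Proof.
rewrite -(PGL2_reprK g) -(PGL2_reprK h) -(vertex_ofK x).
rewrite -[(_ * _)%g]/(PGL2_mul _ _) PGL2_mulE !actE; congr vertex_of.
apply: val_inj => /=; rewrite image_comp; congr image; apply/funext => v.
by rewrite /= mulmxA.
Qed.

Lemma act1 (x : vertex) : act (1%g : PGL2 K) x = x.
Proof.
rewrite -[1%g]/(PGL2_class (GL2_one K)) -(vertex_ofK x) actE; congr vertex_of.
apply: val_inj => /=; rewrite -[RHS]image_id; congr image; apply/funext => v.
by rewrite mul1mx.
Qed.

Lemma actK (g : PGL2 K) (x : vertex) : act g^-1%g (act g x) = x.
Proof. by rewrite -actM mulVg act1. Qed.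

Lemma adjacent_act (g : PGL2 K) (x y : vertex) :
  Defs.adjacent x y -> Defs.adjacent (act g x) (act g y).
Proof.
rewrite -(PGL2_reprK g); set G := repr g => -[L [M [<- <- [p [wp [pM nM] [ML nL]]]]]].
exists (lattice_image G L), (lattice_image G M); rewrite !actE; split => //.
have inj (u v : 'cV[K]_2) : val G *m u = val G *m v -> u = v.
  by move/(congr1 (mulmx (invmx (val G)))); rewrite !mulmxA mulVmx ?mul1mx// (valP G).
exists p; split => //; split => /=.
- move=> _ [_ [z Lz <-] <-]; exists (p *: z); last by rewrite scalemxAr.
  by apply: pM; exists z.
- move=> H; apply: nM => z Mz; have [|_ [u Lu <-] e] := H (val G *m z); first by exists z.
  by exists u => //; apply: inj; rewrite -e scalemxAr.
- by move=> _ [z Mz <-]; exists z => //; exact: ML.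
- move=> H; apply: nL => z Lz; have [|u Mu e] := H (val G *m z); first by exists z.
  by rewrite -(inj _ _ e).
Qed.

(** The chain [p L < M < L] continues to [p M < p L < M], and [p L] represents the same vertex as
    [L]. *)
Lemma adjacent_sym (x y : vertex) : Defs.adjacent x y -> Defs.adjacent y x.
Proof.
move=> [L [M [<- <- [p [wp [pM nM] [ML nL]]]]]].
have p0 : p != 0 by apply/eqP => p0; move: wp; rewrite p0 (valuation0 wP).
exists M, (lattice_scale p0 L); split => //; first exact: vertex_scale.
exists p; split => //; split => //=.
  by move=> _ [z Mz <-]; exists z => //; exact: ML.
move=> H; apply: nL => z Lz; have [|u Mu e] := H (p *: z); first by exists z.
by rewrite -(scalerI p0 e).
Qed.

(** Every neighbor of [x] is represented by a lattice between [p L] and [L], for one fixed lattice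
    [L] of the class [x] and one fixed uniformizer [p]. *)
Lemma finite_neighbors (x : vertex) : finite_set [set y | Defs.adjacent x y].
Proof.
have [p p0 wp] := uniformizer.
have fin : finite_set (sublattices_between p (repr x)).
  by apply: finite_sublattices => //; rewrite wp.
apply: sub_finite_set (finite_image (@vertex_of _ w) fin).
move=> y [L [M [Lx <- [p' [wp' [pM nM] [ML nL]]]]]].
have /vertex_ofP[c c0 LE] : vertex_of L = vertex_of (repr x) by rewrite Lx vertex_ofK.
have p'0 : p' != 0 by apply/eqP => p'0; move: wp'; rewrite p'0 (valuation0 wP).
have ci0 : c^-1 != 0 by rewrite invr_eq0.
exists (lattice_scale ci0 M); last exact: vertex_scale.
split.
  (* [p / p'] is a unit, since both have valuation 1. *)
  move=> _ [z Lz <-]; exists (p' *: (c *: ((p / p') *: z))).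
    apply: pM; exists (c *: ((p / p') *: z)) => //; rewrite LE.
    exists ((p / p') *: z) => //; apply: latticeZ => //; right.
    by rewrite (valuationM wP) ?invr_eq0// (valuationV wP)// wp wp' subrr.
  by rewrite !scalerA; congr (_ *: _); field; rewrite c0 p'0.
move=> _ [z Mz <-]; have := ML _ Mz; rewrite LE => -[u Lu <-].
by rewrite scalerA mulVf// scale1r.
Qed.

End Lattices.

(** * Stabilizers, edge orbits and weights in the quotient *)

Section QuotientGraph.
Local Open Scope quotient_scope.
Variables (K : fieldType) (w : K -> int) (Gamma : set (PGL2 K)).
Hypothesis wP : is_discrete_valuation w.
Hypothesis residues : exists s : seq K, forall x, val_ge w 0 x ->
  exists2 c, c \in s & val_ge w 1 (x - c).
Hypothesis Gamma1 : Gamma 1%g.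
Hypothesis GammaM : forall g h, Gamma g -> Gamma h -> Gamma (g * h)%g.
Hypothesis GammaV : forall g, Gamma g -> Gamma g^-1%g.

Local Notation vertex := (vertex w).
Local Notation qv := (quotient_vertex w Gamma).
Local Notation stab := (@stab K w Gamma).
Local Notation proj := (@Defs.proj K w Gamma).
Local Notation lift := (@Defs.lift K w Gamma).
Local Notation adj := (@Defs.adjacent K w).

Lemma proj_eq (x y : vertex) : proj x = proj y <-> exists2 g, Gamma g & act g x = y.
Proof.
split=> [/(congr1 val) /= e|[g Gg <-]].
  have : Defs.orbit Gamma y y by exists 1%g => //; exact: act1.
  by rewrite -e => -[g Gg <-]; exists g.
apply: val_inj => /=; apply/seteqP; split=> [_ [h Gh <-]|_ [h Gh <-]].
  exists (h * g^-1)%g; first by apply: GammaM => //; exact: GammaV.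
  by rewrite actM actK.
by exists (h * g)%g; [exact: GammaM|rewrite actM].
Qed.

Lemma proj_lift (v : qv) : proj (lift v) = v.
Proof.
apply: val_inj => /=; rewrite /Defs.lift; case: cid2 => x /= _ ->.
by [].
Qed.

Lemma stab1 x : stab x 1%g. Proof. by split => //; exact: act1. Qed.
Lemma stabM x g h : stab x g -> stab x h -> stab x (g * h)%g.
Proof.
by move=> [Gg gx] [Gh hx]; split; [exact: GammaM|rewrite actM hx gx].
Qed.
Lemma stabV x g : stab x g -> stab x g^-1%g.
Proof.
by move=> [Gg gx]; split; [exact: GammaV|rewrite -{1}gx actK].
Qed.

(** Rescaled to preserve a lattice [L] of the class [x], an element of [stab x] permutes the
    finitely many lattices between [c L] and [L], one of which represents [y]. So [y] has a finite
    orbit under [stab x], and the elements that send [y] to a given vertex lie in one translate of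
    [stab y]. *)
Lemma stab_finite_transfer (x y : vertex) : finite_set (stab y) -> finite_set (stab x).
Proof.
move=> fy.
have [c [N [c0 wc Ny [cN NL]]]] := homothetic_between wP (repr x) (repr y).
have fS := finite_sublattices wP residues (repr x) c0 wc.
pose Z := [set act g y | g in stab x].
have fZ : finite_set Z.
  apply: sub_finite_set (finite_image (@vertex_of _ w) fS) => _ [g [Gg gx] <-].
  move: gx; rewrite -(PGL2_reprK g) -{1 2}(vertex_ofK x) actE.
  move=> /vertex_ofP[d d0 gL].
  have di0 : d^-1 != 0 by rewrite invr_eq0.
  exists (lattice_scale di0 (lattice_image (repr g) N)); last first.
    by rewrite vertex_scale -actE Ny vertex_ofK.
  split.
    move=> _ [u Lu <-].
    have : (( *:%R d) @` val (repr x)) (d *: u) by exists u.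
    rewrite -gL /= => -[v Lv gv].
    exists (val (repr g) *m (c *: v)); first by exists (c *: v) => //; apply: cN; exists v.
    by rewrite -scalemxAr gv !scalerA mulrAC mulVf// mul1r.
  move=> _ [_ [u Nu <-] <-].
  have : ((fun v => val (repr g) *m v) @` val (repr x)) (val (repr g) *m u).
    by exists u => //; exact: NL.
  have -> : (fun v => val (repr g) *m v) @` val (repr x) = ( *:%R d) @` val (repr x).
    exact: gL.
  by move=> [v Lv <-]; rewrite scalerA mulVf// scale1r.
pose k z := xget 1%g [set g | stab x g /\ act g y = z].
apply: (@sub_finite_set _ _ (\bigcup_(z in Z) [set (k z * h)%g | h in stab y])).
  move=> g sg; exists (act g y); first by exists g.
  have [[Gk kx] ky] : stab x (k (act g y)) /\ act (k (act g y)) y = act g y.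
    by apply: (@xgetPex _ 1%g [set g' | stab x g' /\ act g' y = act g y]); exists g.
  exists ((k (act g y))^-1 * g)%g; last by rewrite mulgA mulgV mul1g.
  split; first by apply: GammaM; [exact: GammaV|exact: sg.1].
  by rewrite actM -[X in act _ X = _]ky actK.
by apply: bigcup_finite => // z _; exact: finite_image.
Qed.

Definition neighbors (x : vertex) : seq vertex := fset_set [set y | adj x y].

Lemma neighborsP x y : (y \in neighbors x) = `[< adj x y >].
Proof.
rewrite in_fset_set; last exact: finite_neighbors.
by apply/idP/asboolP => [/set_mem|/mem_set].
Qed.

Lemma neighbors_uniq x : uniq (neighbors x).
Proof. exact: fset_uniq. Qed.

Hypothesis stab_finite : forall x, finite_set (stab x).

(* The transporter from [x] to [y] is a coset of the stabilizer of [x]. *)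
Lemma transporter_card (s : seq (PGL2 K)) (x y : vertex) : uniq s ->
  (forall g, (g \in s) = `[< Gamma g /\ act g x = y >]) -> s != [::] ->
  size s = #|` fset_set (stab x)|.
Proof.
move=> us sP; case: s us sP => // g0 s us sP _.
have [Gg0 g0x] : Gamma g0 /\ act g0 x = y by apply/asboolP; rewrite -sP mem_head.
have /perm_size <- : perm_eq (map (fun h => g0 * h)%g (fset_set (stab x))) (g0 :: s).
  apply: uniq_perm => //.
    by rewrite map_inj_uniq; [exact: fset_uniq|exact: mulgI].
  move=> g; rewrite sP; apply/mapP/asboolP => [[h]|[Gg gx]].
    rewrite in_fset_set// => /set_mem[Gh hx] ->.
    by split; [exact: GammaM|rewrite actM hx].
  exists (g0^-1 * g)%g; last by rewrite mulgA mulgV mul1g.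
  rewrite in_fset_set//; apply/mem_set; split; first by apply: GammaM => //; exact: GammaV.
  by rewrite actM gx -g0x actK.
by rewrite size_map.
Qed.

(** A list with repetitions: the multiplicity of [u] counts the tree edges from [lift v] into the
    orbit [u]. *)
Definition qneighbors (v : qv) : seq qv := [seq proj y | y <- neighbors (lift v)].

Definition edge_orbit (x y : vertex) : set (edge w) := [set act_edge g (x, y) | g in stab x].

Lemma edge_orbitP x y y' : edge_orbit x y = edge_orbit x y' <->
  exists2 g, stab x g & act g y = y'.
Proof.
split=> [e|[h sh <-]].
  have : edge_orbit x y' (x, y') by exists 1%g; [exact: stab1|rewrite /act_edge !act1].
  by rewrite -e => -[g sg [_ gy]]; exists g.
apply/seteqP; split=> [_ [g sg <-]|_ [g sg <-]].
  exists (g * h^-1)%g; first by apply: stabM => //; exact: stabV.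
  by rewrite /act_edge /= !actM actK (stabV sh).2.
by exists (g * h)%g; [exact: stabM|rewrite /act_edge /= !actM sh.2].
Qed.

(** Orbit-stabilizer: the coset of [h] corresponds to the neighbor [act h y], so the index is the
    number of tree edges in the orbit of the given one. *)
Lemma group_index_orbit x y : adj x y ->
  group_index (stab x) (edge_stab Gamma (x, y)) =
  count (fun y' => edge_orbit x y' == edge_orbit x y) (neighbors x).
Proof.
move=> xy; rewrite -size_filter; set s := seq.filter _ _.
have us : uniq s by rewrite filter_uniq// neighbors_uniq.
pose coset z : set (PGL2 K) := [set g | stab x g /\ act g y = z].
have sP z : z \in s <-> exists2 g, stab x g & act g y = z.
  rewrite mem_filter neighborsP; split=> [/andP[/eqP/esym/edge_orbitP[g sg gy] _]|[g sg gy]].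
    by exists g.
  apply/andP; split; first by apply/eqP/esym/edge_orbitP; exists g.
  by apply/asboolP; rewrite -gy -{1}sg.2; exact: adjacent_act.
pose S := [fset z in s]%fset.
have SP z : z \in S <-> exists2 g, stab x g & act g y = z.
  by rewrite -sP /S inE.
rewrite /group_index (_ : [set _ | h in _] = [set coset z | z in [set` S]]).
  have inj : {in S &, injective coset}.
    move=> z z' /SP[g sg gy] _ e.
    have : coset z g by split.
    by rewrite e => -[_ <-].
  rewrite fset_set_image ?set_fsetK; last exact: finite_fset.
  by rewrite card_in_imfset//= card_fseq undup_id.
apply/seteqP; split=> [_ [h sh <-]|_ [z /SP[h sh <-] <-]].
  exists (act h y); first by apply/SP; exists h.
  apply/seteqP; split=> [g [sg gy]|_ [k [sk [_ ky]] <-]].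
    exists (h^-1 * g)%g; last by rewrite mulgA mulgV mul1g.
    have shg : stab x (h^-1 * g)%g by apply: stabM => //; exact: stabV.
    split=> //; rewrite /act_edge /= shg.2 actM gy actK//.
  by split; [exact: stabM|rewrite actM ky].
exists h => //; apply/seteqP; split=> [_ [k [sk [_ ky]] <-]|g [sg gy]].
  by split; [exact: stabM|rewrite actM ky].
exists (h^-1 * g)%g; last by rewrite mulgA mulgV mul1g.
have shg : stab x (h^-1 * g)%g by apply: stabM => //; exact: stabV.
by split=> //; rewrite /act_edge /= shg.2 actM gy actK.
Qed.

(** The index attached to an edge orbit is the number of edges in it, and [f] takes the same value
    at all their ends. The weighted sum over orbits becomes a sum over all tree neighbors. *)
Lemma adjacencyE (R : realType) (f : qv -> R[i]) (v : qv) :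
  adjacency f v = \sum_(u <- qneighbors v) f u.
Proof.
rewrite /adjacency /qneighbors big_map; set x := lift v.
pose r := undup [seq edge_orbit x y | y <- neighbors x].
have -> : edge_orbits Gamma x = [set` r].
  apply/seteqP; split=> [_ [[x' y] [/= -> xy] <-]|O].
    by rewrite /= mem_undup; apply/mapP; exists y => //; rewrite neighborsP; exact/asboolP.
  rewrite /= mem_undup => /mapP[y]; rewrite neighborsP => /asboolP xy ->.
  by exists (x, y).
rewrite -fsbig_seq ?undup_uniq//= (@sum_fiber _ _ (edge_orbit x) _ _ _ r (undup_uniq _)); last first.
  by move=> y yx; rewrite mem_undup map_f.
rewrite !big_seq; apply: eq_bigr => O; rewrite mem_undup => /mapP[y yx ->].
(* The representative chosen by [xget] is some edge of the orbit, and it starts at [x] because the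
   orbit is taken under [stab x]. *)
have [y' e xy'] : exists2 y', edge_repr x (edge_orbit x y) = (x, y') &
    edge_orbit x y' = edge_orbit x y.
  have : edge_orbit x y (edge_repr x (edge_orbit x y)).
    apply: xgetPex; exists (x, y); exists 1%g; first exact: stab1.
    by rewrite /act_edge !act1.
  move=> [g sg <-]; exists (act g y); first by rewrite /act_edge /= sg.2.
  by apply/esym/edge_orbitP; exists g.
rewrite e group_index_orbit; last first.
  have [g sg <-] := (edge_orbitP x y y').1 (esym xy').
  by rewrite -{1}sg.2; apply: adjacent_act; move: yx; rewrite neighborsP => /asboolP.
rewrite xy' -sum1_count natr_sum mulr_suml big_seq_cond [RHS]big_seq_cond.
apply: eq_bigr => z /andP[_ /eqP]; rewrite mul1r -xy' => /edge_orbitP[g sg <-].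
by congr f; apply/esym/proj_eq; exists g => //; exact: sg.1.
Qed.

Lemma weight_gt0 (R : realType) (v : qv) : 0 < weight R v.
Proof.
rewrite invr_gt0 ltr0n cardfs_gt0; apply/fset0Pn; exists 1%g.
by rewrite in_fset_set//; apply/mem_set; exact: stab1.
Qed.

(** Detailed balance, by counting the [g] in [Gamma] for which [act g y] is adjacent to [x]. Sorting
    them by [act g y] gives a multiple of the order of [stab y]; inversion exchanges the roles of
    [x] and [y]. *)
Lemma weight_sym (R : realType) (v u : qv) :
  weight R v * (count_mem u (qneighbors v))%:R =
  weight R u * (count_mem v (qneighbors u))%:R.
Proof.
set x := lift v; set y := lift u.
pose G := [set g | Gamma g /\ adj x (act g y)].
have tr z : finite_set [set g | Gamma g /\ act g y = z].
  have [[g0 [Gg0 g0y]]|n] := pselect (exists g, Gamma g /\ act g y = z); last first.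
    rewrite (_ : [set _ | _] = set0)//; apply/seteqP; split => // g Gg.
    by case: n; exists g.
  apply: sub_finite_set (finite_image (fun h => g0 * h)%g (stab_finite y)) => g [Gg gy].
  exists (g0^-1 * g)%g; last by rewrite mulgA mulgV mul1g.
  by split; [apply: GammaM => //; exact: GammaV|rewrite actM gy -g0y actK].
have fG : finite_set G.
  apply: (@sub_finite_set _ _ (\bigcup_(z in [set` neighbors x]) [set g | Gamma g /\ act g y = z])).
    by move=> g [Gg xg]; exists (act g y) => //=; rewrite neighborsP; exact/asboolP.
  by apply: bigcup_finite => //; exact: finite_seq.
(* The [g] that send [lift b] to a given neighbor [z] form a coset of [stab (lift b)], or the empty
   set if [z] is outside the orbit [b]. *)
have main (a b : qv) (s : seq (PGL2 K)) : uniq s ->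
    (forall g, (g \in s) = `[< Gamma g /\ adj (lift a) (act g (lift b)) >]) ->
    size s = (count_mem b (qneighbors a) * #|` fset_set (stab (lift b))|)%N.
  move=> us sP; rewrite -sum1_size.
  rewrite (@sum_fiber _ _ (fun g => act g (lift b)) _ _ _ _ (neighbors_uniq (lift a))); last first.
    by move=> g; rewrite sP neighborsP => /asboolP[_ ?]; exact/asboolP.
  rewrite /qneighbors count_map -sum1_count big_distrl /= [RHS]big_mkcond /= !big_seq.
  apply: eq_bigr => z; rewrite neighborsP => /asboolP az.
  rewrite mul1n sum1_count -size_filter; case: ifPn => [/eqP zb|zb].
    have /esym := zb; rewrite -{1}(proj_lift b) => /proj_eq[g Gg gz].
    apply: (transporter_card (x := lift b) (y := z)).
    - exact: filter_uniq.
    - move=> h; rewrite mem_filter sP; apply/andP/asboolP => [[/eqP hz /asboolP[Gh _]]//|[Gh hz]].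
      by split; [exact/eqP|apply/asboolP; split => //; rewrite hz].
    - have : g \in [seq i <- s | act i (lift b) == z].
        by rewrite mem_filter gz eqxx sP; apply/asboolP; rewrite gz.
      by case: (seq.filter _ _).
  apply/eqP; rewrite size_filter -leqn0 leqNgt -has_count; apply/hasPn => g.
  rewrite sP => /asboolP[Gg _]; apply/eqP => gz; move/eqP: zb; apply.
  by rewrite -[RHS]proj_lift; apply/esym/proj_eq; exists g.
have s1 := main v u (fset_set G) (fset_uniq _) _.
have s2 := main u v [seq g^-1%g | g <- fset_set G] _ _.
have cst a : (#|` fset_set (stab (lift a))|%:R : R) != 0.
  by have := weight_gt0 R a; rewrite invr_gt0 => /lt0r_neq0.
rewrite /weight -/x -/y.
have e : (count_mem u (qneighbors v) * #|` fset_set (stab y)| =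
          count_mem v (qneighbors u) * #|` fset_set (stab x)|)%N.
  rewrite -s1; last by move=> g; rewrite in_fset_set//; apply/idP/asboolP => [/set_mem|/mem_set].
  have u2 : uniq [seq g^-1%g | g <- fset_set G].
    by rewrite map_inj_uniq ?fset_uniq//; exact: invg_inj.
  rewrite -(s2 u2) ?size_map// => g; apply/mapP/asboolP => [[h]|[Gg yx]].
    rewrite in_fset_set// => /set_mem[Gh xh] ->; split; first exact: GammaV.
    by rewrite -[X in adj X _](actK h); apply: adjacent_act; exact: adjacent_sym.
  exists g^-1%g; last by rewrite invgK.
  rewrite in_fset_set//; apply/mem_set; split; first exact: GammaV.
  by rewrite -[X in adj X _](actK g); apply: adjacent_act; exact: adjacent_sym.
have := congr1 (fun n => n%:R : R) e; rewrite !natrM => {}e.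
rewrite mulrC -[LHS]/(_ / _) [RHS]mulrC -[RHS]/(_ / _).
by apply/eqP; rewrite eqr_div ?cst//; apply/eqP.
Qed.

Lemma qneighborsP (v u : qv) : u \in qneighbors v ->
  exists2 y, adj (lift v) y & proj y = u.
Proof.
by move=> /mapP[y]; rewrite neighborsP => /asboolP vy ->; exists y.
Qed.

End QuotientGraph.

(** * The arithmetic group and its quotient *)

Section Arithmetic.
Local Open Scope quotient_scope.
Variables (K L : fieldType) (f : {rmorphism K -> L}).

Lemma PGL2_map_class (g : GL2 K) : PGL2_map f (PGL2_class g) = PGL2_class (GL2_map f g).
Proof.
rewrite /PGL2_map; have [c c0 e] := repr_PGL2_class g.
apply/PGL2_classP; exists (f c); first by rewrite fmorph_eq0.
by rewrite /= e map_mxZ.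
Qed.

Lemma PGL2_mapM (x y : PGL2 K) : PGL2_map f (x * y)%g = (PGL2_map f x * PGL2_map f y)%g.
Proof.
rewrite -(PGL2_reprK x) -(PGL2_reprK y) -[(_ * _)%g]/(PGL2_mul _ _) PGL2_mulE.
rewrite !PGL2_map_class -[RHS]/(PGL2_mul _ _) PGL2_mulE; congr PGL2_class.
by apply: val_inj; rewrite /= map_mxM.
Qed.

Lemma PGL2_map1 : PGL2_map f 1%g = 1%g.
Proof. by apply: (mulgI (PGL2_map f 1%g)); rewrite -PGL2_mapM !mulg1. Qed.

Lemma PGL2_mapV (x : PGL2 K) : PGL2_map f x^-1%g = (PGL2_map f x)^-1%g.
Proof. by apply: (mulgI (PGL2_map f x)); rewrite -PGL2_mapM !mulgV PGL2_map1. Qed.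

End Arithmetic.

Section ArithmeticQuotient.
Local Open Scope quotient_scope.
Variables (F : finFieldType) (k : fieldExtType {fraction {poly F}}) (infty : place k).
Variable (kc : forall v : place k, completion v).
Variables (Kf : set (adelic_PGL2 infty kc)) (g0 : adelic_PGL2 infty kc).
Hypothesis infty_degree : degree_one infty.
Hypothesis Kf_compact_open : compact_open_subgroup Kf.

Let Gamma := arithmetic_group Kf g0.

Lemma arithmetic_group1 : Gamma 1%g.
Proof.
have [[/set_mem Kf1 _] _ _] := Kf_compact_open.
exists 1%g; last exact: PGL2_map1.
by exists 1%g => // v; rewrite PGL2_map1 mulg1 mulgV.
Qed.

Let Kf_div x y : Kf x -> Kf y -> Kf (x * y^-1)%g.
Proof.
by have [[_ Kfd] _ _] := Kf_compact_open => Kx Ky; apply/set_mem/Kfd; exact/mem_set.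
Qed.

Lemma arithmetic_groupV g : Gamma g -> Gamma g^-1%g.
Proof.
have [[/set_mem Kf1 _] _ _] := Kf_compact_open.
move=> [gamma [kappa Kk e] <-]; exists gamma^-1%g; last exact: PGL2_mapV.
exists kappa^-1%g; first by rewrite -[kappa^-1%g]mul1g; exact: Kf_div.
by move=> v; rewrite PGL2_mapV e /= !invgM invgK mulgA.
Qed.

Lemma arithmetic_groupM g h : Gamma g -> Gamma h -> Gamma (g * h)%g.
Proof.
have [[/set_mem Kf1 _] _ _] := Kf_compact_open.
move=> [gamma [kappa Kk e] <-] [gamma' [kappa' Kk' e'] <-].
exists (gamma * gamma')%g; last exact: PGL2_mapM.
exists (kappa * kappa')%g.
  rewrite -[kappa']invgK; apply: Kf_div => //; rewrite -[kappa'^-1%g]mul1g.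
  exact: Kf_div.
move=> v; rewrite PGL2_mapM e e' /= -!mulgA; congr (_ * (_ * _))%g.
by rewrite [((g0 v)^-1 * _)%g]mulgA mulVg mul1g.
Qed.

(** Density approximates an integral element by one of [k] modulo the maximal ideal, and degree one
    approximates that by a constant; so the constants provide the residues. *)
Lemma completion_residues : exists s : seq (kc infty), forall x,
  val_ge (@completion_val _ _ _ (kc infty)) 0 x ->
  exists2 c, c \in s & val_ge (@completion_val _ _ _ (kc infty)) 1 (x - c).
Proof.
set w := @completion_val _ _ _ (kc infty).
have wP : is_discrete_valuation w by exact: completion_valP.
pose emb := completion_emb (kc infty).
have emb_ge n y : val_ge w n (emb y) <-> val_ge infty n y.
  rewrite /val_ge /= /w completion_val_emb; split=> -[h|h]; [left|by right|left|by right].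
    by apply/eqP; rewrite -(fmorph_eq0 emb) h.
  by rewrite h rmorph0.
exists [seq emb (Defs.constant k c) | c <- enum F] => x x0.
have [y xy] := completion_dense x 1.
have wN n z : val_ge w n z -> val_ge w n (- z).
  move=> h; rewrite -mulN1r; apply: (val_geM wP) => //.
  by right; rewrite (valuationN1 wP).
have [c yc] : exists c, val_ge infty 1 (y - Defs.constant k c).
  apply: infty_degree; apply/emb_ge.
  have -> : emb y = x + - (x - emb y) by rewrite opprB addrC subrK.
  by apply: (val_geD wP) => //; apply: wN; apply: val_ge_le xy.
exists (emb (Defs.constant k c)); first by apply/mapP; exists c => //; rewrite mem_enum.
have -> : x - emb (Defs.constant k c) = (x - emb y) + emb (y - Defs.constant k c).
  by rewrite rmorphB /= addrA subrK.
by apply: (val_geD wP) => //; apply/emb_ge.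
Qed.

Variables (R : realType) (r : nat) (ray : 'I_r -> nat -> arithmetic_quotient Kf g0).
Variable (width : 'I_r -> R).
Hypothesis r_gt0 : (0 < r)%N.
Hypothesis cusps : is_cusp_decomposition #|F| ray width.

(** An infinite stabilizer has [weight] zero, because [fset_set] of an infinite set is empty and the
    inverse of 0 is 0. The weights on rays are positive, so one stabilizer is finite, and by
    [stab_finite_transfer] all are. *)
Lemma arithmetic_stab_finite x : finite_set (@stab _ (@completion_val _ _ _ (kc infty)) Gamma x).
Proof.
have wP := completion_valP (kc infty).
have F0 : (0 < #|F|)%N by apply/card_gt0P; exists 0.
apply: (@stab_finite_transfer _ _ _ wP completion_residues arithmetic_groupM arithmetic_groupV
  _ (Defs.lift (ray (Ordinal r_gt0) 1))).
apply: contrapT => inf.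
have := ray_weight cusps (Ordinal r_gt0) (isT : (0 < 1)%N).
rewrite /weight /fset_set; case: pselect => // _.
rewrite cardfs0 invr0 => /esym/eqP; apply/negP.
have q0 : (#|F|%:R : R) != 0 by rewrite pnatr_eq0 -lt0n.
have q1 : (#|F|%:R + 1 : R) != 0 by rewrite gt_eqF// ltr_wpDl.
by rewrite !mulf_neq0 ?invr_eq0 ?expf_neq0 ?(gt_eqF (width_gt0 cusps _)).
Qed.

(** Together with the cusp decomposition, this is what the analysis uses of the tree and the
    group. *)
Lemma arithmetic_quotient_graph : exists nb : arithmetic_quotient Kf g0 ->
    seq (arithmetic_quotient Kf g0),
  [/\ forall (f : arithmetic_quotient Kf g0 -> R[i]) v,
        adjacency f v = \sum_(u <- nb v) f u,
      forall v : arithmetic_quotient Kf g0, 0 < weight R v,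
      forall v u, weight R v * (count_mem u (nb v))%:R =
        weight R u * (count_mem v (nb u))%:R &
      forall c u, u \in nb (ray c 1) -> core ray u \/ u = ray c 2].
Proof.
have wP := completion_valP (kc infty).
pose res := completion_residues; pose sf := arithmetic_stab_finite.
exists (@qneighbors _ _ Gamma); split.
- by move=> f v; apply: adjacencyE => //; [exact: arithmetic_group1|
    exact: arithmetic_groupM|exact: arithmetic_groupV].
- by move=> v; apply: weight_gt0 => //; exact: arithmetic_group1.
- by move=> v u; apply: weight_sym => //; [exact: arithmetic_group1|
    exact: arithmetic_groupM|exact: arithmetic_groupV].
- move=> c u /(qneighborsP wP res)[y cy <-].
  exact: (ray_first cusps).
Qed.

End ArithmeticQuotient.

(** * Graphs with cusps *)

Section NeighborOperator.
Variables (R : realType) (V : choiceType) (nb : V -> seq V).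
Local Notation C := R[i].
Implicit Types (f g h : V -> C).

Definition nbop f v : C := \sum_(u <- nb v) f u.
Definition nbw v u : R := (count_mem u (nb v))%:R.

Lemma nbop_lin (a : C) f g : nbop (fun v => a * f v + g v) = (fun v => a * nbop f v + nbop g v).
Proof. by apply/funext => v; rewrite /nbop big_split /= mulr_sumr. Qed.

Lemma nbop_seq f v (s : seq V) : uniq s -> (forall u, u \in nb v -> u \notin s -> f u = 0) ->
  nbop f v = \sum_(u <- s) (nbw v u)%:C%C * f u.
Proof.
move=> us s0; rewrite /nbop (bigID (mem s)) /= [X in _ + X]big1_seq ?addr0; last first.
  by move=> u /andP[us' uv]; exact: s0.
rewrite -big_filter (@sum_fiber _ _ id _ _ _ s us); last first.
  by move=> u; rewrite mem_filter => /andP[].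
rewrite !big_seq; apply: eq_bigr => u us'; rewrite big_filter_cond /=.
rewrite (eq_bigl (fun x => x == u)); last first.
  by move=> x; case: (eqVneq x u) => [->|]; rewrite ?us' ?andbF.
rewrite (eq_bigr (fun=> f u)); last by move=> x /eqP ->.
rewrite big_const_seq iter_addr_0 /nbw rmorph_nat mulr_natl.
by congr (_ *+ _).
Qed.

Lemma nbw0 v u : u \notin nb v -> nbw v u = 0.
Proof. by move=> uv; rewrite /nbw (count_memPn uv). Qed.

Lemma nbw_eq0 v u : nbw v u = 0 -> u \notin nb v.
Proof. by move=> /eqP; rewrite pnatr_eq0 => /eqP /count_memPn. Qed.

Definition delta v : V -> C := fun u => (u == v)%:R.

Lemma nbop_delta u v : nbop (delta u) v = (nbw v u)%:C%C.
Proof.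
rewrite (@nbop_seq _ _ [:: u])//; last first.
  by move=> x _; rewrite inE /delta => /negbTE ->.
by rewrite big_seq1 /delta eqxx mulr1.
Qed.

End NeighborOperator.

(** A weighted graph with detailed balance, [cg_sym], and homogeneous cusps. The spectral analysis
    takes place at this level of generality. *)
Record cusp_graph (R : realType) (V : choiceType) (lam : V -> R) (nb : V -> seq V)
    (q r : nat) (ray : 'I_r -> nat -> V) (width : 'I_r -> R) : Prop := CuspGraph {
  cg_lam : forall v, 0 < lam v;
  cg_sym : forall v u, lam v * nbw R nb v u = lam u * nbw R nb u v;
  cg_q : (1 < q)%N;
  cg_inj : forall c c' n n', (0 < n)%N -> (0 < n')%N ->
    ray c n = ray c' n' -> c = c' /\ n = n';
  cg_core : finite_set [set v | forall c n, (0 < n)%N -> v <> ray c n];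
  cg_ray : forall (f : V -> R[i]) c n, (1 < n)%N ->
    nbop nb f (ray c n) = q%:R * f (ray c n.-1) + f (ray c n.+1);
  cg_first : forall c u, u \in nb (ray c 1) ->
    (forall c' n, (0 < n)%N -> u <> ray c' n) \/ u = ray c 2;
  cg_weight : forall c n, (0 < n)%N -> lam (ray c n) = width c * (q%:R + 1) * q%:R ^- n;
  cg_width : forall c, 0 < width c }.

(** * Green's identity and the Wronskian *)

Section Graph.
Variables (R : realType) (V : choiceType) (lam : V -> R) (nb : V -> seq V)
  (q r : nat) (ray : 'I_r -> nat -> V) (width : 'I_r -> R).
Hypothesis G : cusp_graph lam nb q ray width.
Local Notation C := R[i].
Local Notation A := (@nbop R V nb).
Local Notation w := (nbw R nb).
Local Notation dot := (dot lam).
Local Notation delta := (@delta R V).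
Implicit Types (f g h : V -> C).

Definition core_set : set V := [set v | forall c n, (0 < n)%N -> v <> ray c n].
Definition core_seq : seq V := fset_set core_set.

Lemma core_seqP v : reflect (core_set v) (v \in core_seq).
Proof.
rewrite /core_seq in_fset_set; last exact: cg_core G.
by apply: (iffP idP) => [/set_mem|/mem_set].
Qed.

Lemma core_uniq : uniq core_seq. Proof. exact: fset_uniq. Qed.

Lemma core_or_ray v : v \in core_seq \/ exists c n, (0 < n)%N /\ v = ray c n.
Proof.
have [vc|] := pselect (core_set v); first by left; exact/core_seqP.
by move=> /existsNP[c /existsNP[n /not_implyP[n0 /contrapT vn]]]; right; exists c, n.
Qed.

Lemma ray_eq c c' n n' : ray c n.+1 = ray c' n'.+1 -> c = c' /\ n = n'.
Proof. by move=> /(cg_inj G (ltn0Sn n) (ltn0Sn n'))[-> []]. Qed.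

Lemma ray_notin_core c n : (0 < n)%N -> ray c n \notin core_seq.
Proof. by move=> n0; apply/negP => /core_seqP/(_ c n n0). Qed.

Lemma q_gt0 : 0 < q%:R :> R. Proof. by rewrite ltr0n; have := cg_q G; lia. Qed.
Let lam0 := cg_lam G.

Lemma nb_sym v u : u \in nb v -> v \in nb u.
Proof.
move=> uv; apply: contraT => /nbw0 vu.
have := cg_sym G v u; rewrite (vu R) mulr0 => /eqP; rewrite mulf_eq0 gt_eqF//= => /eqP.
by move=> /nbw_eq0; rewrite uv.
Qed.

(** Applying [cg_ray] to point masses reads the neighbors off the operator. *)
Lemma nb_ray c n u : (1 < n)%N -> u \in nb (ray c n) -> u = ray c n.-1 \/ u = ray c n.+1.
Proof.
move=> n1; apply: contraPP => /not_orP[u1 u2]; apply/negP; apply: (@nbw_eq0 R).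
apply: (@complexI R); rewrite -nbop_delta (cg_ray G)//.
have d0 v : u <> v -> delta u v = 0 by move=> uv; rewrite /delta; case: eqP => // e; case: uv.
by rewrite (d0 _ u1) (d0 _ u2) mulr0 addr0.
Qed.

Lemma nbw_21 c : w (ray c 2) (ray c 1) = q%:R.
Proof.
apply: (@complexI R); rewrite -nbop_delta (cg_ray G)// /delta eqxx mulr1.
have /negbTE -> : ray c 3 != ray c 1 by apply/eqP => /(@ray_eq c c 2 0)[_].
by rewrite addr0 rmorph_nat.
Qed.

(** Detailed balance with [nbw_21]: the weight drops by the factor [q] from height 1 to height 2. *)
Lemma nbw_12 c : w (ray c 1) (ray c 2) = 1.
Proof.
have := cg_sym G (ray c 1) (ray c 2); rewrite nbw_21 !(cg_weight G)//.
have q0 := q_gt0; have w0 := cg_width G c.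
move=> e; have : (q%:R : R) * (width c * (q%:R + 1) * q%:R ^- 1 * w (ray c 1) (ray c 2)) =
  q%:R * (width c * (q%:R + 1) * q%:R ^- 2 * q%:R) by rewrite e.
have -> : (q%:R : R) * (width c * (q%:R + 1) * q%:R ^- 1 * w (ray c 1) (ray c 2)) =
  (width c * (q%:R + 1)) * w (ray c 1) (ray c 2) by field; rewrite gt_eqF.
have -> : (q%:R : R) * (width c * (q%:R + 1) * q%:R ^- 2 * q%:R) =
  (width c * (q%:R + 1)) * 1 by field; rewrite gt_eqF.
by apply: mulfI; rewrite mulf_neq0 ?gt_eqF// addr_gt0.
Qed.

(** A vertex at height 2 or more has its neighbors on the ray, so by symmetry it is not a neighbor
    of the core. *)
Lemma nb_core v u : v \in core_seq -> u \in nb v -> u \in core_seq \/ exists c, u = ray c 1.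
Proof.
move=> /core_seqP vc uv; have [|[c [n [n0 un]]]] := core_or_ray u; first by left.
right; exists c; case: n n0 un => [//|[//|n]] _ un.
have := nb_sym uv; rewrite un => /(nb_ray (isT : (1 < n.+2)%N)) [] vn;
  by have := vc c _ _ vn; move/(_ isT).
Qed.

Lemma nb_first c u : u \in nb (ray c 1) -> u \in core_seq \/ u = ray c 2.
Proof. by move=> /(cg_first G)[h|h]; [left; exact/core_seqP|right]. Qed.

Lemma ray_seq_uniq n : (0 < n)%N -> uniq [seq ray c n | c <- enum 'I_r].
Proof.
move=> n0; rewrite map_inj_uniq ?enum_uniq// => c c' e.
by have [] := cg_inj G n0 n0 e.
Qed.

Lemma nbop_core f v : v \in core_seq -> A f v =
  \sum_(u <- core_seq) (w v u)%:C%C * f u +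
  \sum_c (w v (ray c 1))%:C%C * f (ray c 1).
Proof.
move=> vc; rewrite (@nbop_seq _ _ _ _ _ (core_seq ++ [seq ray c 1 | c <- enum 'I_r])).
- by rewrite big_cat /= big_map big_enum.
- rewrite cat_uniq core_uniq ray_seq_uniq// andbT /=; apply/hasPn => _ /mapP[c _ ->].
  exact: ray_notin_core.
move=> u /(nb_core vc)[uc|[c ->]]; rewrite mem_cat; first by rewrite uc.
by rewrite map_f ?orbT// mem_enum.
Qed.

Definition core_trace f c : C := \sum_(u <- core_seq) (w (ray c 1) u)%:C%C * f u.

Lemma nbop_first f c : A f (ray c 1) = core_trace f c + f (ray c 2).
Proof.
rewrite (@nbop_seq _ _ _ _ _ (rcons core_seq (ray c 2))).
- by rewrite -cats1 big_cat /= big_seq1 nbw_12 mul1r.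
- by rewrite rcons_uniq core_uniq ray_notin_core.
by move=> u /nb_first[uc|->]; rewrite mem_rcons inE ?uc ?eqxx ?orbT.
Qed.

Lemma nbop_finite f : finitely_supported f -> finitely_supported (A f).
Proof.
move=> /finitely_supportedP[s us s0]; apply/finitely_supportedP.
exists (undup (flatten [seq nb u | u <- s])); first exact: undup_uniq.
move=> v; rewrite mem_undup => vs; rewrite /nbop big1_seq// => u /andP[_ uv].
apply: s0; apply: contra vs => us'; apply/flattenP; exists (nb u); last exact: nb_sym.
exact: map_f.
Qed.

(** Summation by parts on a finite set containing the support of [f] and its neighbors; [h] is
    arbitrary, so generalized eigenfunctions are allowed. *)
Lemma dot_nbop f h : finitely_supported f -> dot (A f) h = dot f (A h).
Proof.
move=> /finitely_supportedP[s us s0].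
set t := undup (s ++ flatten [seq nb u | u <- s]).
have ut : uniq t by exact: undup_uniq.
have st u : u \in s -> u \in t by rewrite mem_undup mem_cat => ->.
have ft u : u \notin t -> f u = 0 by move=> ut'; apply: s0; apply: contra ut'; exact: st.
have Af u : u \notin t -> A f u = 0.
  move=> u't; rewrite /nbop big1_seq// => x /andP[_ xu]; apply: s0.
  apply: contra u't => xs; rewrite mem_undup mem_cat; apply/orP; right.
  by apply/flattenP; exists (nb x); [exact: map_f|exact: nb_sym].
rewrite (dot_seq lam ut); last by move=> v /Af; left.
rewrite (dot_seq lam ut); last by move=> v /ft; left.
transitivity (\sum_(v <- t) \sum_(u <- t) (w v u)%:C%C * f u * conjc (h v) * (lam v)%:C%C).
  apply: eq_bigr => v _; rewrite (@nbop_seq _ _ _ _ _ t)//; last by move=> u _; exact: ft.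
  by rewrite !mulr_suml.
rewrite exchange_big /= !big_seq; apply: eq_bigr => u ut'.
have [us'|/s0 fu0] := boolP (u \in s); last first.
  by rewrite fu0 !mul0r big1// => v _; rewrite mulr0 !mul0r.
rewrite (@nbop_seq _ _ _ _ _ t)//; last first.
  move=> v vu; rewrite mem_undup mem_cat negb_or => /andP[_ /negP]; case.
  by apply/flattenP; exists (nb u) => //; exact: map_f.
rewrite rmorph_sum mulr_sumr mulr_suml; apply: eq_bigr => v _.
rewrite rmorphM /= oppr0 -[Complex _ 0]/((w u v)%:C%C).
have := congr1 (fun x => x%:C%C) (cg_sym G v u); rewrite !rmorphM /= => e.
transitivity ((lam v)%:C%C * (w v u)%:C%C * (f u * conjc (h v))); first by ring.
by rewrite e; ring.
Qed.

(** Green's identity for the core: sum [A f * g - A g * f] over it against [lam]. The edges inside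
    cancel by detailed balance, and only those to the first ray vertices remain. *)
Lemma green (x : C) f g : A f = (fun v => x * f v) -> A g = (fun v => x * g v) ->
  \sum_c (lam (ray c 1))%:C%C * (f (ray c 1) * core_trace g c - g (ray c 1) * core_trace f c) = 0.
Proof.
move=> Af Ag.
pose S h k := \sum_(v <- core_seq) \sum_(u <- core_seq) (lam v * w v u)%:C%C * h u * k v.
have symS h k : S h k = S k h.
  rewrite /S exchange_big /=; apply: eq_bigr => v _; apply: eq_bigr => u _.
  by rewrite (cg_sym G); ring.
have PE h k : \sum_(v <- core_seq) (lam v)%:C%C * A h v * k v =
    S h k + \sum_c (lam (ray c 1))%:C%C * (h (ray c 1) * core_trace k c).
  transitivity (\sum_(v <- core_seq) ((\sum_(u <- core_seq) (lam v * w v u)%:C%C * h u * k v)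
      + \sum_c (lam v * w v (ray c 1))%:C%C * h (ray c 1) * k v)).
    rewrite !big_seq; apply: eq_bigr => v vc; rewrite nbop_core// mulrDr mulrDl.
    congr (_ + _); rewrite mulr_sumr mulr_suml; apply: eq_bigr => u _; rewrite rmorphM /=; ring.
  rewrite big_split /=; congr (_ + _); rewrite exchange_big /=; apply: eq_bigr => c _.
  rewrite /core_trace !mulr_sumr; apply: eq_bigr => v _.
  by rewrite (cg_sym G) rmorphM /=; ring.
have e1 := PE f g; have e2 := PE g f.
have : \sum_(v <- core_seq) (lam v)%:C%C * A f v * g v = \sum_(v <- core_seq) (lam v)%:C%C * A g v * f v.
  by apply: eq_bigr => v _; rewrite Af Ag; ring.
rewrite e1 e2 symS => /addrI e; under eq_bigr do rewrite mulrBr.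
by rewrite sumrB e subrr.
Qed.

Local Notation k := (Num.sqrt (q%:R : R)).

Lemma k_gt0 : 0 < k. Proof. by rewrite sqrtr_gt0 q_gt0. Qed.
Lemma kk : k ^+ 2 = q%:R. Proof. by rewrite sqr_sqrtr// ltW// q_gt0. Qed.

Lemma qk : (q%:R : C) = k%:C%C ^+ 2.
Proof. by rewrite -[RHS](rmorphXn (real_complex R)) kk rmorph_nat. Qed.

Definition ray_expansion (z : C) f (b a : 'I_r -> C) := forall c n, (0 < n)%N ->
  f (ray c n) = k%:C%C ^+ n * (z ^+ n * b c + z^-1 ^+ n * a c).

Definition joukowski (z : C) : C := k%:C%C * (z + z^-1).

(** The core contributes to [A f] at height 1 what [q] times the value of the expansion at height 0
    would. *)
Lemma core_trace_expansion z f b a c : z != 0 -> ray_expansion z f b a ->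
  A f = (fun v => joukowski z * f v) -> core_trace f c = q%:R * (b c + a c).
Proof.
move=> z0 fE Af; have := congr1 (fun F => F (ray c 1)) Af.
rewrite nbop_first => /eqP; rewrite -subr_eq0 -addrA addr_eq0 => /eqP ->.
rewrite !fE// /joukowski !expr1 opprB qk.
by field.
Qed.

(** Inserting [core_trace_expansion] in [green] turns the contribution of each cusp into its
    weighted amplitude determinant times [(q + 1) * k * (z - z^-1)], a nonzero constant. *)
Lemma wronskian z f g b a b' a' : z != 0 -> z ^+ 2 != 1 ->
  ray_expansion z f b a -> A f = (fun v => joukowski z * f v) ->
  ray_expansion z g b' a' -> A g = (fun v => joukowski z * g v) ->
  \sum_c (width c)%:C%C * (b c * a' c - a c * b' c) = 0.
Proof.
move=> z0 z1 fE Af gE Ag; have := green Af Ag.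
have q0 : (q%:R : C) != 0 by rewrite pnatr_eq0; have := cg_q G; lia.
have k0 : k%:C%C != 0 by apply/eqP => /complexI/eqP; rewrite gt_eqF// k_gt0.
have E c : (lam (ray c 1))%:C%C * (f (ray c 1) * core_trace g c - g (ray c 1) * core_trace f c) =
    (q%:R + 1) * k%:C%C * (z - z^-1) * ((width c)%:C%C * (b c * a' c - a c * b' c)).
  rewrite (core_trace_expansion c z0 fE Af) (core_trace_expansion c z0 gE Ag) fE// gE// (cg_weight G)//.
  rewrite !(rmorphM (real_complex R)) (rmorphD (real_complex R)) (fmorphV (real_complex R)).
  rewrite (rmorphXn (real_complex R)) (rmorph_nat (real_complex R)) (rmorph1 (real_complex R)) /=.
  move: k%:C%C (width c)%:C%C => K W; field; by rewrite q0 z0.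
rewrite (eq_bigr _ (fun c _ => E c)).
rewrite -mulr_sumr => /eqP; rewrite !mulf_eq0 (negbTE k0) orbF => /orP[/orP[q1|zz]|/eqP//].
  by move: q1; rewrite natr1 pnatr_eq0.
move: zz; rewrite subr_eq0 => /eqP zz; move: z1; rewrite expr2 {2}zz divff// eqxx.
by [].
Qed.

End Graph.

(** * Rationality and boundedness of the Eisenstein eigenfunctions *)

Section Circle.
Variable R : realType.
Local Notation C := R[i].

Definition cis (t : R) : C := Complex (cos t) (sin t).

Lemma cis_conj t : cis t * conjc (cis t) = 1.
Proof.
apply/eqP; rewrite eq_complex /=; apply/andP; split; apply/eqP.
  by rewrite mulrN opprK -!expr2 cos2Dsin2.
by ring.
Qed.

Lemma cis_neq0 t : cis t != 0.
Proof.
apply/eqP => z0; have := cis_conj t; rewrite z0 mul0r => /esym/eqP.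
by rewrite oner_eq0.
Qed.

Lemma cis_inv t : (cis t)^-1 = conjc (cis t).
Proof. by apply: (mulfI (cis_neq0 t)); rewrite cis_conj divff ?cis_neq0. Qed.

Lemma cis_joukowski t : cis t + (cis t)^-1 = (2 * cos t)%:C%C.
Proof. by rewrite cis_inv; apply/eqP; rewrite eq_complex /=; apply/andP; split; apply/eqP; ring. Qed.

Lemma cis_sqr_neq1 t : sin t != 0 -> cis t ^+ 2 != 1.
Proof.
move=> s0; apply/eqP => z2; move/eqP: s0; apply.
have : cis t = (cis t)^-1.
  by apply: (mulfI (cis_neq0 t)); rewrite -expr2 z2 divff// cis_neq0.
rewrite cis_inv /cis /= => -[] h; lra.
Qed.

(** Packed as a ring morphism so that evaluation passes through determinants and adjugates. *)
Definition pev (y : C) : {rmorphism {poly R} -> C} :=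
  GRing.RMorphism.clone _ _ (horner_eval y \o map_poly (real_complex R)) _.

Lemma pevE y p : pev y p = \sum_(i < size p) (p`_i)%:C%C * y ^+ i.
Proof.
rewrite /= /horner_eval horner_coef size_map_poly.
by apply: eq_bigr => i _; rewrite coef_map.
Qed.

Lemma pev_const y (c : R) : pev y c%:P = c%:C%C.
Proof. by rewrite /= /horner_eval map_polyC hornerC. Qed.

Lemma pevX y : pev y 'X = y.
Proof. by rewrite /= /horner_eval map_polyX hornerX. Qed.

(** A zero at [conjc (cis t)] has real part [cos t], so the [acos] of the real parts of the roots
    list the exceptional parameters. *)
Lemma pev_roots (p : {poly R}) : p != 0 -> exists s : seq R,
  forall t, 0 <= t <= pi -> t \notin s -> pev (conjc (cis t)) p != 0.
Proof.
move=> p0; have pC0 : map_poly (real_complex R) p != 0 by rewrite map_poly_eq0.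
have [rs prs] := closed_field_poly_normal (map_poly (real_complex R) p).
exists [seq acos (complex.Re z) | z <- rs] => t t0 ts; apply: contra ts.
rewrite /= /horner_eval prs hornerZ mulf_eq0 lead_coef_eq0 (negbTE pC0) /=.
rewrite horner_prod prodf_seq_eq0 => /hasP[z zrs /=].
rewrite hornerXsubC subr_eq0 => /eqP tz; apply/mapP; exists z => //.
by rewrite -tz /= cosK// in_itv.
Qed.

End Circle.

(** * Cramer's rule on the core *)

Section Rational.
Variables (R : realType) (V : choiceType) (lam : V -> R) (nb : V -> seq V)
  (q r : nat) (ray : 'I_r -> nat -> V) (width : 'I_r -> R).
Hypothesis G : cusp_graph lam nb q ray width.
Local Notation C := R[i].
Local Notation A := (@nbop R V nb).
Local Notation w := (nbw R nb).
Local Notation cs := (core_seq ray).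
Local Notation k := (Num.sqrt (q%:R : R)).
Local Notation N := (size cs).

Let cv (i : 'I_N) : V := tnth (in_tuple cs) i.

Definition core_mx : 'M[R]_N := \matrix_(i, j) w (cv i) (cv j).
Definition out_mx : 'M[R]_(r, N) := \matrix_(c, j) w (ray c 1) (cv j).
Definition in_mx : 'M[R]_(N, r) := \matrix_(i, c) w (cv i) (ray c 1).

(* In terms of y = z^-1, the eigenvalue equation on the core reads
   system_mx(y) u = k (1 - y^2) in_mx b. *)
Definition system_mx : 'M[{poly R}]_N :=
  (k%:P * (1 + 'X^2))%:M - 'X *: map_mx polyC core_mx
  - (k^-1%:P * 'X^2) *: map_mx polyC (in_mx *m out_mx).
Definition denominator : {poly R} := \det system_mx.
(** Cramer's rule: the adjugate instead of the inverse keeps all entries polynomial, with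
    [denominator] as common denominator. *)
Definition core_numerator : 'M[{poly R}]_(N, r) :=
  (k%:P * (1 - 'X^2)) *: (\adj system_mx *m map_mx polyC in_mx).
Definition scattering_numerator : 'M[{poly R}]_r :=
  (q%:R^-1)%:P *: (map_mx polyC out_mx *m core_numerator) - denominator%:M.

(** At [y = 0] the matrix of the system is the scalar [k]. *)
Lemma denominator_neq0 : denominator != 0.
Proof.
apply/eqP => d0; have := congr1 (horner_eval (0 : R)) d0.
rewrite /denominator -det_map_mx [RHS]/horner_eval horner0.
have -> : map_mx (horner_eval (0 : R)) system_mx = k%:M.
  apply/matrixP => i j; rewrite !mxE /horner_eval !hornerE hornerMn !hornerE /=.
  by rewrite expr2 !(mul0r, mulr0) !subr0 addr0 mulr1.
rewrite det_scalar => /eqP; rewrite expf_eq0 => /andP[_].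
by rewrite gt_eqF// (k_gt0 G).
Qed.

Let sum_core (F : V -> C) : \sum_(u <- cs) F u = \sum_i F (cv i).
Proof. by rewrite big_tnth. Qed.

Section AtPoint.
Variables (z : C) (f : V -> C) (b a : 'I_r -> C).
Hypotheses (z0 : z != 0) (fE : ray_expansion q ray z f b a)
  (Af : A f = (fun v => joukowski q z * f v)).
Let y := z^-1.
Let u : 'cV[C]_N := \col_i f (cv i).
Let bv : 'cV[C]_r := \col_c b c.
Let av : 'cV[C]_r := \col_c a c.
Let K : C := k%:C%C.
Local Notation toC := (map_mx (real_complex R)).

Let K0 : K != 0.
Proof. by apply/eqP => /complexI/eqP; rewrite gt_eqF// (k_gt0 G). Qed.

Let out_u : toC out_mx *m u = K ^+ 2 *: (bv + av).
Proof.
apply/colP => c; rewrite !mxE -(qk R q) -(core_trace_expansion G c z0 fE Af).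
rewrite /core_trace sum_core; apply: eq_bigr => i _; by rewrite !mxE.
Qed.

Let core_eq : toC core_mx *m u + K *: (toC in_mx *m (z *: bv + y *: av)) = (K * (z + y)) *: u.
Proof.
apply/colP => i; rewrite !mxE.
have cvi : cv i \in cs by rewrite mem_tnth.
have := congr1 (fun F => F (cv i)) Af; rewrite /joukowski -/y => <-.
rewrite (nbop_core G)// sum_core; congr (_ + _).
  by apply: eq_bigr => j _; rewrite !mxE.
rewrite mulr_sumr; apply: eq_bigr => c _; rewrite !mxE fE// !expr1 -/K -/y; ring.
Qed.

Let aE : av = (K ^- 2) *: (toC out_mx *m u) - bv.
Proof. by rewrite out_u scalerA mulVf ?expf_neq0// scale1r addrC addKr. Qed.

Let phi_exists : exists phi : {rmorphism {poly R} -> C},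
  [/\ phi = pev y, forall c : R, phi c%:P = c%:C%C & phi 'X = y].
Proof. by exists (pev y); split => // [c|]; rewrite ?pev_const ?pevX. Qed.

(** [out_u] expresses the amplitudes [av] by the core values; substituting this in [core_eq] and
    multiplying by [y] leaves a linear system for [u] alone. *)
Let system_solution (phi : {rmorphism {poly R} -> C}) :
  (forall c : R, phi c%:P = c%:C%C) -> phi 'X = y ->
  phi denominator *: u = map_mx phi core_numerator *m bv.
Proof.
move=> phiC phiX.
have polyCK m n (X : 'M[R]_(m, n)) : map_mx phi (map_mx polyC X) = toC X.
  by apply/matrixP => i j; rewrite !mxE phiC.
have yz : y * z = 1 by rewrite mulVf.
have sys : map_mx phi system_mx *m u = (K * (1 - y ^+ 2)) *: (toC in_mx *m bv).
  have -> : map_mx phi system_mx = (K * (1 + y ^+ 2))%:M - y *: toC core_mx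
      - (K^-1 * y ^+ 2) *: (toC in_mx *m toC out_mx).
    rewrite /system_mx !map_mxB map_scalar_mx !map_mxZ !polyCK map_mxM.
    rewrite !rmorphM rmorphD rmorph1 !rmorphXn /= !phiC phiX.
    by rewrite (fmorphV (real_complex R)).
  rewrite !mulmxBl mul_scalar_mx -!scalemxAl -mulmxA.
  have -> : toC out_mx *m u = K ^+ 2 *: (bv + av) by exact: out_u.
  have ce := core_eq.
  have -> : toC core_mx *m u = (K * (z + y)) *: u - K *: (toC in_mx *m (z *: bv + y *: av)).
    by rewrite -ce addrK.
  rewrite !scalerBr !scalerA !mulmxDr -!scalemxAr !scalerDr !scalerA mulmxDr scalerDr.
  have -> : y * (K * (z + y)) = K * (1 + y ^+ 2).
    by transitivity (K * (y * z + y ^+ 2)); [ring|rewrite yz].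
  have -> : y * K * z = K by transitivity (K * (y * z)); [ring|rewrite yz mulr1].
  have -> : y * K * y = K * y ^+ 2 by ring.
  have -> : K^-1 * y ^+ 2 * K ^+ 2 = K * y ^+ 2 by field.
  by rewrite subKr mulrBr mulr1 scalerBl opprD addrACA subrr addr0.
have := congr1 (mulmx (map_mx phi (\adj system_mx))) sys.
rewrite mulmxA -map_mxM mul_adj_mx map_scalar_mx mul_scalar_mx => ->.
rewrite /core_numerator map_mxZ map_mxM polyCK -!scalemxAl -scalemxAr mulmxA.
by rewrite !rmorphM rmorphB rmorph1 rmorphXn /= phiC phiX.
Qed.

Lemma core_solution i :
  pev y denominator * f (cv i) = \sum_c pev y (core_numerator i c) * b c.
Proof.
have [phi [phiE phiC phiX]] := phi_exists; rewrite -phiE.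
have /colP/(_ i) := system_solution phiC phiX; rewrite !mxE => ->.
by apply: eq_bigr => c _; rewrite !mxE.
Qed.

Lemma scattering_solution c :
  pev y denominator * a c = \sum_c' pev y (scattering_numerator c c') * b c'.
Proof.
have [phi [phiE phiC phiX]] := phi_exists; rewrite -phiE.
have e : phi denominator *: av = map_mx phi scattering_numerator *m bv.
  rewrite aE scalerBr scalerA mulrC -scalerA scalemxAr (system_solution phiC phiX).
  have -> : map_mx phi scattering_numerator =
      K ^- 2 *: (toC out_mx *m map_mx phi core_numerator) - (phi denominator)%:M.
    rewrite /scattering_numerator map_mxB map_scalar_mx map_mxZ phiC; congr (_ *: _ - _).
      by rewrite (fmorphV (real_complex R)) /= (rmorph_nat (real_complex R)) (qk R q).
    rewrite (map_mxM phi (map_mx polyC out_mx) core_numerator); congr (_ *m _).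
    by apply/matrixP => i j; rewrite !mxE phiC.
  by rewrite mulmxBl mul_scalar_mx -scalemxAl mulmxA.
have /colP/(_ c) := e; rewrite !mxE => ->.
by apply: eq_bigr => c' _; rewrite !mxE.
Qed.

End AtPoint.
End Rational.

Section Conj.
Variable R : realType.
Implicit Types x y : R[i].
Lemma conjcM x y : conjc (x * y) = conjc x * conjc y. Proof. exact: (rmorphM conjc). Qed.
Lemma conjcD x y : conjc (x + y) = conjc x + conjc y. Proof. exact: (rmorphD conjc). Qed.
Lemma conjcX x n : conjc (x ^+ n) = conjc x ^+ n. Proof. exact: (rmorphXn conjc). Qed.
End Conj.

Section FiniteDot.
Variables (R : realType) (V : choiceType) (lam : V -> R).
Local Notation C := R[i].
Local Notation dot := (dot lam).
Implicit Types (f g h : V -> C).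

(** Finite support is asked of [f] and [g] alone: the generalized eigenfunctions that appear as [h]
    need not be square-summable. *)
Lemma dot_finite_lin (a : C) f g h : finitely_supported f -> finitely_supported g ->
  dot (fun v => a * f v + g v) h = a * dot f h + dot g h.
Proof.
move=> /finitely_supportedP[s us s0] /finitely_supportedP[t ut t0].
have ust : uniq (undup (s ++ t)) by exact: undup_uniq.
have fst v : v \notin undup (s ++ t) -> f v = 0 /\ g v = 0.
  by rewrite mem_undup mem_cat negb_or => /andP[/s0 -> /t0 ->].
rewrite (dot_seq lam ust); last by move=> v /fst[-> ->]; left; rewrite mulr0 addr0.
rewrite (dot_seq lam ust); last by move=> v /fst[-> _]; left.
rewrite (dot_seq lam ust); last by move=> v /fst[_ ->]; left.
by rewrite mulr_sumr -big_split /=; apply: eq_bigr => v _; ring.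
Qed.

Lemma dotZ_finite (a : C) f h : finitely_supported f ->
  dot (fun v => a * f v) h = a * dot f h.
Proof.
move=> /finitely_supportedP[s us s0].
rewrite (dot_seq lam us); last by move=> v /s0 ->; left; rewrite mulr0.
rewrite (dot_seq lam us); last by move=> v /s0 ->; left.
by rewrite mulr_sumr; apply: eq_bigr => v _; ring.
Qed.

Lemma delta_finite v : finitely_supported (@delta R V v).
Proof.
by apply/finitely_supportedP; exists [:: v] => // u; rewrite inE /delta => /negbTE ->.
Qed.

Lemma dot_delta v h : dot (@delta R V v) h = conjc (h v) * (lam v)%:C%C.
Proof.
rewrite (@dot_seq _ _ lam _ _ [:: v])//; last first.
  by move=> u; rewrite inE /delta => /negbTE ->; left.
by rewrite big_seq1 /delta eqxx mul1r.
Qed.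

Lemma finite_sum_delta f (s : seq V) : uniq s -> (forall v, v \notin s -> f v = 0) ->
  f = fun u => \sum_(v <- s) f v * delta R v u.
Proof.
move=> us s0; apply/funext => u; have [us'|us'] := boolP (u \in s).
  rewrite (bigD1_seq u)//= /delta eqxx mulr1 big1 ?addr0// => v vu.
  by rewrite eq_sym (negbTE vu) mulr0.
rewrite s0// big1_seq// => v /andP[_ vs]; rewrite /delta; case: eqP => [uv|]; last by rewrite mulr0.
by rewrite uv vs in us'.
Qed.

End FiniteDot.

(** * Scattering relations and uniform bounds for the eigenfunctions *)

Section EisensteinData.
Variables (R : realType) (V : choiceType) (lam : V -> R) (nb : V -> seq V)
  (q r : nat) (ray : 'I_r -> nat -> V) (width : 'I_r -> R).
Hypothesis G : cusp_graph lam nb q ray width.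
Local Notation C := R[i].
Local Notation A := (@nbop R V nb).
Local Notation cs := (core_seq ray).
Local Notation k := (Num.sqrt (q%:R : R)).
Local Notation dot := (dot lam).
Local Notation L2 := (L2 lam).
Local Notation delta := (@delta R V).
Let lam0 := cg_lam G.
Let dotP := dot_inner lam0.

Definition spec (t : R) : R := 2 * k * cos t.

Lemma joukowski_cis t : joukowski q (cis t) = (spec t)%:C%C.
Proof.
rewrite /joukowski cis_joukowski -(rmorphM (real_complex R)) /spec.
by congr (_%:C)%C; ring.
Qed.

Variables (e : R -> 'I_r -> V -> C) (S : R -> 'I_r -> 'I_r -> C) (bad : seq R).
Hypothesis eP : forall t : R, 0 <= t <= pi -> t \notin bad -> sin t != 0 /\ forall c,
  ray_expansion q ray (cis t) (e t c) (fun c' => (c' == c)%:R) (fun c' => S t c' c) /\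
  A (e t c) = (fun v => (spec t)%:C%C * e t c v).

Lemma dot_nbop_eigen f g (x : R) : finitely_supported f ->
  A g = (fun v => x%:C%C * g v) -> dot (A f) g = x%:C%C * dot f g.
Proof.
move=> ff gA; have -> : dot (A f) g = dot f (A g) by exact: (dot_nbop G).
rewrite gA; have /finitely_supportedP[l ul l0] := ff.
rewrite (dot_seq lam ul); last by move=> v /l0; left.
rewrite (dot_seq lam ul); last by move=> v /l0; left.
by rewrite mulr_sumr; apply: eq_bigr => v _; rewrite conjcM conjc_real; ring.
Qed.

Section AtGood.
Variable t : R.
Hypotheses (t0 : 0 <= t <= pi) (tb : t \notin bad).
Let z0 := cis_neq0 t.

Let z1 : cis t ^+ 2 != 1.
Proof. by apply: cis_sqr_neq1; case: (eP t0 tb). Qed.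

Let eA c : A (e t c) = (fun v => joukowski q (cis t) * e t c v).
Proof. by rewrite joukowski_cis; case: (eP t0 tb) => _ /(_ c)[]. Qed.

Let eR c := ((eP t0 tb).2 c).1.

(** The Wronskian of the eigenfunctions attached to [c] and [c']. *)
Lemma scattering_sym c c' :
  (width c)%:C%C * S t c c' = (width c')%:C%C * S t c' c.
Proof.
have := wronskian G z0 z1 (eR c) (eA c) (eR c') (eA c').
under eq_bigr do rewrite mulrBr; rewrite sumrB => /eqP; rewrite subr_eq0 => /eqP.
rewrite (bigD1 c)//= eqxx mul1r big1 ?addr0; last first.
  by move=> i /negbTE ->; rewrite mul0r mulr0.
move=> ->; rewrite (bigD1 c')//= eqxx mulr1 big1 ?addr0// => i /negbTE ->.
by rewrite !mulr0.
Qed.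

(** The Wronskian with a conjugate eigenfunction: it has the same real eigenvalue, and conjugation
    exchanges [z] with [z^-1], hence the two amplitudes. *)
Lemma scattering_unitary c c' :
  \sum_i (width i)%:C%C * (S t i c * conjc (S t i c')) = (width c)%:C%C * (c == c')%:R.
Proof.
have gA : A (fun v => conjc (e t c' v)) =
    (fun v => joukowski q (cis t) * conjc (e t c' v)).
  apply/funext => v; transitivity (conjc (A (e t c') v)).
    by rewrite /nbop (rmorph_sum conjc).
  by rewrite eA conjcM joukowski_cis conjc_real.
have gE : ray_expansion q ray (cis t) (fun v => conjc (e t c' v))
    (fun i => conjc (S t i c')) (fun i => (i == c')%:R).
  move=> i n n0; rewrite (eR c')// !(conjcM, conjcD, conjcX).
  by rewrite conjc_real cis_inv conjcK conjc_nat addrC.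
have := wronskian G z0 z1 (eR c) (eA c) gE gA.
under eq_bigr do rewrite mulrBr; rewrite sumrB => /eqP; rewrite subr_eq0 => /eqP <-.
rewrite (bigD1 c)//= eqxx mul1r big1 ?addr0// => i /negbTE ->.
by rewrite mul0r mulr0.
Qed.

(** A single term of the diagonal case of unitarity. *)
Lemma scattering_bounded c' c : nsq (S t c' c) <= width c / width c'.
Proof.
rewrite ler_pdivlMr ?(cg_width G)//.
have h := scattering_unitary c c; rewrite eqxx mulr1 in h.
have : \sum_i width i * nsq (S t i c) = width c.
  apply: (@complexI R); rewrite -h rmorph_sum; apply: eq_bigr => i _.
  by rewrite -nsqE -(rmorphM (real_complex R)).
move=> <-; rewrite (bigD1 c')//= mulrC lerDl; apply: sumr_ge0 => i _.
by rewrite mulr_ge0 ?nsq_ge0// ltW// (cg_width G).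
Qed.

End AtGood.

(** The exceptional list [s] may depend on [f], but [K] is uniform in the parameter. For a point
    mass of the core, membership says that the eigenfunctions stay bounded at that vertex, also near
    the zeros of [denominator]. *)
Definition good_bounded (f : V -> C) := finitely_supported f /\ exists (K : R) (s : seq R),
  forall t : R, 0 <= t <= pi -> t \notin s -> t \notin bad -> forall c, nsq (dot f (e t c)) <= K.

Lemma good_bounded_subspace : is_subspace good_bounded.
Proof.
split.
  split; first exact: (finite_subspace R V).1.
  exists 0, [::] => t _ _ _ c; rewrite (@dot_seq _ _ lam _ _ [::])//; last by left.
  by rewrite big_nil nsq0.
move=> a f g [ff [Kf [sf bf]]] [fg [Kg [sg bg]]].
split; first exact: (finite_subspace R V).2.
exists (2 * (nsq a * Kf) + 2 * Kg), (sf ++ sg) => t t0; rewrite mem_cat negb_or.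
move=> /andP[tf tg] tb c; rewrite dot_finite_lin//; apply: le_trans (nsqD_le _ _) _.
rewrite nsqM lerD// ler_pM2l//; last exact: bg.
by rewrite ler_wpM2l ?nsq_ge0//; exact: bf.
Qed.

Lemma good_bounded_nbop f : good_bounded f -> good_bounded (A f).
Proof.
move=> [ff [K [s b]]]; split; first exact: (nbop_finite G).
exists ((2 * k) ^+ 2 * K), s => t t0 ts tb c.
have [_ /(_ c)[_ eA]] := eP t0 tb.
have -> : dot (A f) (e t c) = (spec t)%:C%C * dot f (e t c). by exact: dot_nbop_eigen.
rewrite nsqM nsqR; have h := b t t0 ts tb c; apply: ler_pM => //; rewrite ?sqr_ge0 ?nsq_ge0//.
rewrite /spec exprMn ler_piMr ?sqr_ge0//; have h1 := cos_le1 t; have h2 := cos_geN1 t; nra.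
Qed.

(** Direct from the expansion: [z] has modulus 1 and the scattering entries are bounded. *)
Lemma ray_dot_bounded c n : (0 < n)%N -> exists K : R, forall t : R, 0 <= t <= pi ->
  t \notin bad -> forall c', nsq (dot (delta (ray c n)) (e t c')) <= K.
Proof.
move=> n0.
pose K c' := lam (ray c n) ^+ 2 * (k ^+ n) ^+ 2 * (2 + 2 * (width c' / width c)).
exists (\sum_c' K c') => t t0 tb c'.
have [_ /(_ c')[eR _]] := eP t0 tb.
have K0 i : 0 <= K i.
  rewrite !mulr_ge0 ?exprn_ge0 ?sqr_ge0 ?sqrtr_ge0 ?(ltW (lam0 _))// addr_ge0// mulr_ge0//.
  by rewrite divr_ge0// ltW// (cg_width G).
apply: (@le_trans _ _ (K c')); last first.
  by rewrite (bigD1 c')//= lerDl; apply: sumr_ge0 => i _.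
rewrite dot_delta nsqM nsq_conj nsqR eR// nsqM mulrC -mulrA.
have -> : nsq (k%:C%C ^+ n) = (k ^+ n) ^+ 2 by rewrite -(rmorphXn (real_complex R)) nsqR.
rewrite mulrA -expr2 mulrA /K; apply: ler_wpM2l; first by rewrite mulr_ge0 ?sqr_ge0.
have nz m : nsq (cis t ^+ m) = 1 /\ nsq ((cis t)^-1 ^+ m) = 1.
  have n1 : nsq (cis t) = 1 by rewrite /nsq /= cos2Dsin2.
  elim: m => [|m [IH IH']]; first by rewrite !expr0 /nsq /=; split; ring.
  by rewrite !exprS !nsqM IH IH' cis_inv nsq_conj n1 mulr1.
apply: le_trans (nsqD_le _ _) _; rewrite !nsqM !(nz n).1 !(nz n).2 !mul1r.
apply: lerD; last by rewrite ler_pM2l//; exact: scattering_bounded.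
by rewrite -[X in _ <= X]mulr1 ler_pM2l// /nsq; case: (c == c') => /=; lra.
Qed.

Lemma good_bounded_ray c n : (0 < n)%N -> good_bounded (delta (ray c n)).
Proof.
move=> /(ray_dot_bounded c)[K KP]; split; first exact: delta_finite.
by exists K, [::] => t t0 _; exact: KP.
Qed.

Definition core_supported (f : V -> C) := forall v, v \notin cs -> f v = 0.

Lemma core_supported_finite f : core_supported f -> finitely_supported f.
Proof. by move=> cf; apply/finitely_supportedP; exists cs => //; exact: core_uniq. Qed.

Lemma core_supported_subspace : is_subspace core_supported.
Proof. by split=> // a f g cf cg v vc; rewrite cf// cg// mulr0 addr0. Qed.

Lemma core_dim f : core_supported f -> exists a : 'I_(size cs) -> C,
  f = fun u => \sum_i a i * delta (tnth (in_tuple cs) i) u.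
Proof.
move=> cf; exists (fun i => f (tnth (in_tuple cs) i)).
rewrite {1}(finite_sum_delta (core_uniq _) cf); apply/funext => u.
by rewrite [LHS]big_tnth.
Qed.

(* Such functions form an A-invariant space whose eigenvectors are themselves
   good, hence zero. *)
Lemma core_orthogonal f : core_supported f ->
  (forall g, good_bounded g -> dot f g = 0) -> f = fun=> 0.
Proof.
move=> cf f0.
pose X := [set f | core_supported f /\ forall g, good_bounded g -> dot f g = 0].
have Xfin h : X h -> finitely_supported h by move=> [ch _]; exact: core_supported_finite.
have XL2 : X `<=` L2 by move=> h /Xfin; exact: finite_L2.
have sX : is_subspace X.
  split.
    split=> // g gg; rewrite (inner0l dotP)//; apply: finite_L2 => //; exact: gg.1.
  move=> a h h' Xh Xh'; split; first by apply: core_supported_subspace.2; [exact: Xh.1|exact: Xh'.1].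
  by move=> g gg; rewrite dot_finite_lin ?(Xh.2 _ gg) ?(Xh'.2 _ gg) ?mulr0 ?addr0//; exact: Xfin.
have sym h h' : X h -> X h' -> dot (A h) h' = dot h (A h').
  by move=> Xh _; apply: (dot_nbop G); exact: Xfin.
have XA h : X h -> X (A h).
  move=> Xh; split.
    move=> v vc; have [|[c [n [n0 ->]]]] := core_or_ray G v; first by rewrite (negbTE vc).
    (* Point masses on cusps and their images under [A] are good, so orthogonality to the latter
       makes [A h] vanish on the cusps. *)
    have := Xh.2 _ (good_bounded_nbop (good_bounded_ray c n0)).
    rewrite -(dot_nbop G); last exact: Xfin.
    rewrite (inner_conj dotP) ?dot_delta; last 2 first.
    - exact/finite_L2/delta_finite.
    - by apply: finite_L2 => //; apply: (nbop_finite G); exact: Xfin.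
    rewrite conjcM conjcK conjc_real => /eqP; rewrite mulf_eq0 => /orP[/eqP //|/eqP/complexI/eqP].
    by rewrite gt_eqF.
  by move=> g gg; rewrite (dot_nbop G); [exact: Xh.2 (good_bounded_nbop gg)|exact: Xfin].
have dX : dim_le (size cs) X.
  by apply: span_dim_le => h [ch _]; exact: core_dim.
have [m [b [x [Xb bb Ab bX]]]] := orthonormal_eigenbasis dotP (dot_definite lam0)
  (@nbop_lin R V nb) sX XL2 dX XA sym.
have Xf : X f by [].
rewrite (bX _ Xf); apply/funext => v; case: m b x Xb bb Ab bX => [|m] b x Xb bb Ab bX.
  by rewrite big_ord0.
have gb : good_bounded (b ord0).
  split; first exact: Xfin.
  (* The only parameter where the eigenvalue of [b ord0] can equal [spec t]; elsewhere symmetry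
     forces the pairing to vanish. *)
  exists 0, [:: acos (x ord0 / (2 * k))] => t t0; rewrite inE => ts tb c.
  suff -> : dot (b ord0) (e t c) = 0 by rewrite nsq0.
  have [_ /(_ c)[_ eA]] := eP t0 tb.
  have h1 : dot (A (b ord0)) (e t c) = (x ord0)%:C%C * dot (b ord0) (e t c).
    by rewrite Ab dotZ_finite//; exact: Xfin.
  have h2 : dot (A (b ord0)) (e t c) = (spec t)%:C%C * dot (b ord0) (e t c).
    by apply: dot_nbop_eigen => //; exact: Xfin.
  apply/eqP; apply: contraNT ts => d0; apply/eqP.
  have := h1; rewrite h2 => /(mulIf d0)/complexI <-.
  have k0 := k_gt0 G; rewrite /spec mulrC mulKf ?cosK ?in_itv//.
  by rewrite mulf_neq0// gt_eqF.
have := bb ord0 ord0; rewrite (Xb ord0).2// eqxx => /eqP.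
by rewrite eq_sym oner_eq0.
Qed.

(** The part of [f] orthogonal to the good functions supported on the core is orthogonal to all good
    functions, because cutting a good function down to the core only removes point masses of cusps,
    which are good. By [core_orthogonal] this part is zero. *)
Lemma good_bounded_core f : core_supported f -> good_bounded f.
Proof.
move=> cf.
pose Y := [set f | core_supported f /\ good_bounded f].
have YL2 : Y `<=` L2 by move=> h [_ [fh _]]; exact: finite_L2.
have sY : is_subspace Y.
  split; first by split; [exact: core_supported_subspace.1|exact: good_bounded_subspace.1].
  by move=> a h h' [ch gh] [ch' gh']; split;
    [exact: core_supported_subspace.2|exact: good_bounded_subspace.2].
have dY : dim_le (size cs) Y by apply: span_dim_le => h [ch _]; exact: core_dim.
have [m [b [x [Yb bb _ bY]]]] := @orthonormal_eigenbasis _ _ _ _ dotP (dot_definite lam0)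
  id (fun a f g => erefl) _ Y sY YL2 dY (fun f Yf => Yf) (fun f g _ _ => erefl).
pose p v := \sum_i dot f (b i) * b i v.
have Yp : Y p by exact: subspace_sum.
have Lf : L2 f by apply: finite_L2 => //; exact: core_supported_finite.
have Lp := YL2 _ Yp.
suff e0 : (fun v => f v - p v) = fun=> 0.
  have -> : f = p by apply/funext => v; have /(congr1 (fun F => F v)) /subr0_eq := e0.
  exact: Yp.2.
have fpb i : dot (fun v => f v - p v) (b i) = 0.
  rewrite (innerBl dotP)//; last by apply: YL2; exact: Yb.
  rewrite /p (inner_suml dotP) => [|j _|]; try (by apply: YL2; exact: Yb).
  rewrite (bigD1 i)//= bb eqxx mulr1 big1 ?addr0 ?subrr// => j ji.
  by rewrite bb (negbTE ji) mulr0.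
apply: core_orthogonal; first by apply: (subspaceB core_supported_subspace cf Yp.1).
move=> g gg; pose gc v := if v \in cs then g v else 0.
have Lg : L2 g by apply: finite_L2 => //; exact: gg.1.
have cgc : core_supported gc by move=> v vc; rewrite /gc (negbTE vc).
have Ygc : Y gc.
  split=> //; have /finitely_supportedP[l ul l0] := gg.1.
  pose l' := [seq v <- l | v \notin cs].
  have gr : good_bounded (fun u => \sum_(v <- l' | v \notin cs) g v * delta v u).
    apply: subspace_sum => [|v vc]; first exact: good_bounded_subspace.
    have [|[c [n [n0 ->]]]] := core_or_ray G v; first by rewrite (negbTE vc).
    exact: good_bounded_ray.
  have := subspaceB good_bounded_subspace gg gr; congr good_bounded; apply/funext => u.
  rewrite {1}(finite_sum_delta ul l0) (bigID (mem cs)) /= /l' big_filter_cond /=.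
  under [X in _ - X]eq_bigl do rewrite andbb.
  rewrite addrK /gc; case: ifPn => uc.
    rewrite [in RHS](finite_sum_delta ul l0) [RHS](bigID (mem cs)) /= [X in _ = _ + X]big1 ?addr0//.
    by move=> v vc; rewrite /delta; case: eqP => [uv|]; rewrite ?mulr0//; rewrite uv (negbTE vc) in uc.
  apply: big1 => v vc; rewrite /delta; case: eqP => [uv|]; rewrite ?mulr0//.
  by rewrite uv vc in uc.
have -> : dot (fun v => f v - p v) g = dot (fun v => f v - p v) gc.
  have z v : v \notin cs -> f v - p v = 0 by move=> vc; rewrite cf// Yp.1// subrr.
  rewrite (dot_seq lam (core_uniq ray)); last by move=> v /z; left.
  rewrite (dot_seq lam (core_uniq ray)); last by move=> v /z; left.
  by rewrite !big_seq; apply: eq_bigr => v vc; rewrite /gc vc.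
have Lfp : L2 (fun v => f v - p v) by apply: (subspaceB (L2_subspace lam0)).
rewrite (inner_conj dotP _ Lfp); last exact: YL2.
rewrite (bY _ Ygc) (inner_suml dotP)//; last by move=> i _; apply: YL2; exact: Yb.
rewrite big1 ?conjc0// => i _; rewrite (inner_conj dotP Lfp); last by apply: YL2; exact: Yb.
by rewrite fpb conjc0 mulr0.
Qed.

End EisensteinData.

Section ComplexInverse.
Variables (R : realType) (D : set R).
Local Notation C := R[i].

Lemma nsqV (z : C) : nsq z^-1 = (nsq z)^-1.
Proof.
have [->|z0] := eqVneq z 0; first by rewrite invr0 nsq0 invr0.
have n1 : nsq z * nsq z^-1 = 1 by rewrite -nsqM mulfV// nsqR expr1n.
have n0 : nsq z != 0 by apply: contra z0 => /eqP/nsq_eq0 ->.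
by apply: (mulfI n0); rewrite n1 mulfV.
Qed.

Lemma invc_conj (z : C) : z^-1 = conjc z * ((nsq z)^-1)%:C%C.
Proof.
have [->|z0] := eqVneq z 0; first by rewrite invr0 conjc0 mul0r.
have -> : ((nsq z)^-1)%:C%C = (z * conjc z)^-1 by rewrite -nsqE; exact: (fmorphV (real_complex R)).
by rewrite invfM mulrCA mulfV ?mulr1// (fmorph_eq0 conjc).
Qed.

Lemma cmeasurable_inv (f : R -> C) : cmeasurable D f -> cmeasurable D (fun t => (f t)^-1).
Proof.
move=> mf; have -> : (fun t => (f t)^-1) = fun t => conjc (f t) * (nsq (f t) `^ (-1))%:C%C.
  by apply/funext => t; rewrite invc_conj powR_inv1// nsq_ge0.
apply: cmeasurableM; first exact: cmeasurable_conj.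
apply: cmeasurable_real.
exact: (measurableT_comp (@measurable_powR R (-1)) (measurable_nsq mf)).
Qed.

End ComplexInverse.

Section Measurability.
Variables (R : realType) (D : set R).
Hypothesis mD : measurable (D : set (measurableTypeR R)).
Local Notation C := R[i].

Lemma cmeasurable_cis : cmeasurable D (@cis R).
Proof.
split; apply: measurable_funTS; apply: continuous_measurable_fun.
  exact: continuous_cos.
exact: continuous_sin.
Qed.

Lemma cmeasurable_pev (p : {poly R}) : cmeasurable D (fun t => pev (conjc (cis t)) p).
Proof.
apply: (@eq_cmeasurable _ _ (fun t => \sum_(i < size p) (p`_i)%:C%C * conjc (cis t) ^+ i)).
  by move=> t _; rewrite pevE.
apply: cmeasurable_sum => i; apply: cmeasurableM; first exact: cmeasurable_cst.
by apply: cmeasurableX; apply: cmeasurable_conj; exact: cmeasurable_cis.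
Qed.

Lemma cmeasurable_notin (s : seq R) : cmeasurable D (fun t => (t \notin s)%:R).
Proof.
have ms : measurable ([set` s] : set (measurableTypeR R)).
  by apply: countable_measurable => //; apply: finite_set_countable; exact: finite_seq.
apply: (@eq_cmeasurable _ _ (fun t => (\1_(~` [set` s]) t)%:C%C)).
  move=> t _; rewrite indicE; have -> : (t \in ~` [set` s]) = (t \notin s).
    by apply/idP/idP => [/set_mem/negP|h]; [|apply/mem_set/negP].
  by rewrite (rmorph_nat (real_complex R)).
apply: cmeasurable_real; apply: measurable_funTS; apply: measurable_indic.
exact: measurableC.
Qed.

End Measurability.

(** The form in which the Eisenstein functions enter from here on. They are set to 0 at the finitely
    many bad parameters, so that the eigenvalue equation and the bound hold without exception; [d]
    is a common denominator of the scattering matrix, in the variable [conjc (cis t)]. *)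
Record spectral_family (R : realType) (V : choiceType) (nb : V -> seq V)
    (q r : nat) (ray : 'I_r -> nat -> V) (width : 'I_r -> R)
    (E : R -> 'I_r -> V -> R[i]) (S : R -> 'I_r -> 'I_r -> R[i]) (bad : seq R)
    (d : {poly R}) (P : 'I_r -> 'I_r -> {poly R}) : Prop := SpectralFamily {
  sf_eigen : forall t c, nbop nb (E t c) = (fun v => (spec q t)%:C%C * E t c v);
  sf_meas : forall c v, cmeasurable `[0, pi] (fun t => E t c v);
  sf_bound : forall v, exists K : R, forall t c, nsq (E t c v) <= K;
  sf_sin : forall t, 0 <= t <= pi -> t \notin bad -> sin t != 0;
  sf_ray : forall t c, 0 <= t <= pi -> t \notin bad ->
    ray_expansion q ray (cis t) (E t c) (fun c' => (c' == c)%:R) (fun c' => S t c' c);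
  sf_sym : forall t c c', 0 <= t <= pi -> t \notin bad ->
    (width c)%:C%C * S t c c' = (width c')%:C%C * S t c' c;
  sf_unitary : forall t c c', 0 <= t <= pi -> t \notin bad ->
    \sum_i (width i)%:C%C * (S t i c * conjc (S t i c')) = (width c)%:C%C * (c == c')%:R;
  sf_pev : forall t c c', 0 <= t <= pi -> t \notin bad ->
    pev (conjc (cis t)) d * S t c c' = pev (conjc (cis t)) (P c c');
  sf_d : d != 0;
  sf_zero : forall t c v, t \in bad -> E t c v = 0 }.

(** * Assembly of the spectral family *)

Section Existence.
Variables (R : realType) (V : choiceType) (lam : V -> R) (nb : V -> seq V)
  (q r : nat) (ray : 'I_r -> nat -> V) (width : 'I_r -> R).
Hypothesis G : cusp_graph lam nb q ray width.
Local Notation C := R[i].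
Local Notation cs := (core_seq ray).
Local Notation I := (`[0, pi]%classic : set R).
Variables (e : R -> 'I_r -> V -> C) (S : R -> 'I_r -> 'I_r -> C) (bad : seq R).
Hypothesis eP : forall t : R, 0 <= t <= pi -> t \notin bad -> sin t != 0 /\ forall c,
  ray_expansion q ray (cis t) (e t c) (fun c' => (c' == c)%:R) (fun c' => S t c' c) /\
  nbop nb (e t c) = (fun v => (spec q t)%:C%C * e t c v).

Definition cutoff_family (bad' : seq R) t c v : C :=
  if (0 <= t <= pi) && (t \notin bad') then e t c v else 0.

(** The new bad parameters are the given ones, the zeros of the denominator, and for each core
    vertex the exceptions of [good_bounded_core]. Measurability on the core comes from the rational
    formulas, boundedness from the estimates above. *)
Lemma spectral_family_exists : exists bad' d P,
  spectral_family nb q ray width (cutoff_family bad') S bad' d P /\ {subset bad <= bad'}.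
Proof.
have lam0 := cg_lam G.
have inI t : I t -> 0 <= t <= pi by rewrite /= in_itv.
have mI : measurable (I : set (measurableTypeR R)) by exact: measurable_itv.
have [sd sdP] := pev_roots (denominator_neq0 G).
have coreb v : v \in cs -> exists s : seq R, exists K : R, forall t : R,
    0 <= t <= pi -> t \notin s -> t \notin bad -> forall c, nsq (e t c v) <= K.
  move=> vcs; have [|_ [K [s sP]]] := good_bounded_core G eP (f := delta R v).
    by move=> u ucs; rewrite /delta; case: eqP => // uv; rewrite uv vcs in ucs.
  exists s, (K / lam v ^+ 2) => t t0 ts tb c; have := sP t t0 ts tb c.
  by rewrite dot_delta nsqM nsq_conj nsqR ler_pdivlMr// exprn_gt0.
pose sv v : seq R := if pselect (v \in cs) is left h then projT1 (cid (coreb v h)) else [::].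
pose bad' := bad ++ sd ++ flatten [seq sv v | v <- cs].
have sub : {subset bad <= bad'} by move=> t; rewrite mem_cat => ->.
have goodE t : t \notin bad' -> t \notin bad by apply: contra => /sub.
have cutE t c : 0 <= t <= pi -> t \notin bad' -> cutoff_family bad' t c = e t c.
  by move=> t0 tb; apply/funext => v; rewrite /cutoff_family t0 tb.
have dn0 t : 0 <= t <= pi -> t \notin bad' -> pev (conjc (cis t)) (denominator R nb q ray) != 0.
  by move=> t0; rewrite !mem_cat !negb_or => /and3P[_ tsd _]; exact: sdP.
have ev t c : 0 <= t <= pi -> t \notin bad' ->
    nbop nb (e t c) = (fun v => joukowski q (cis t) * e t c v).
  by move=> t0 tb; rewrite joukowski_cis; case: (eP t0 (goodE _ tb)) => _ /(_ c)[].
have er t c : 0 <= t <= pi -> t \notin bad' ->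
    ray_expansion q ray (cis t) (e t c) (fun c' => (c' == c)%:R) (fun c' => S t c' c).
  by move=> t0 tb; case: (eP t0 (goodE _ tb)) => _ /(_ c)[].
have pevS t c c' : 0 <= t <= pi -> t \notin bad' ->
    pev (conjc (cis t)) (denominator R nb q ray) * S t c c' =
    pev (conjc (cis t)) (scattering_numerator R nb q ray c c').
  move=> t0 tb; rewrite -cis_inv (scattering_solution G (cis_neq0 t) (er t c' t0 tb) (ev t c' t0 tb)).
  by rewrite (bigD1 c')//= eqxx mulr1 big1 ?addr0// => i /negbTE ->; rewrite mulr0.
have mS c c' : cmeasurable I (fun t => (t \notin bad')%:R * S t c c').
  apply: (@eq_cmeasurable _ _ (fun t => (t \notin bad')%:R *
     (pev (conjc (cis t)) (scattering_numerator R nb q ray c c') / pev (conjc (cis t)) (denominator R nb q ray)))).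
    move=> t /inI t0; case: (boolP (t \in bad')) => tb; rewrite ?mul0r// !mul1r.
    by rewrite -(pevS _ _ _ t0 tb) mulrC mulKf// dn0.
  apply: cmeasurableM; first exact: cmeasurable_notin.
  by apply: cmeasurableM; [exact: cmeasurable_pev|apply: cmeasurable_inv => //; exact: cmeasurable_pev].
exists bad', (denominator R nb q ray), (fun c c' => scattering_numerator R nb q ray c c'); split => //.
split.
- move=> t c; case: (boolP ((0 <= t <= pi) && (t \notin bad'))) => [/andP[t0 tb]|tb].
    by rewrite cutE//; case: (eP t0 (goodE _ tb)) => _ /(_ c)[].
  have -> : cutoff_family bad' t c = fun=> 0.
    by apply/funext => v; rewrite /cutoff_family (negbTE tb).
  by rewrite (linop0 (@nbop_lin R V nb)); apply/funext => v; rewrite mulr0.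
- move=> c v; have [vcs|[c' [n [n0 ->]]]] := core_or_ray G v.
    pose i := index v cs; have icS : (i < size cs)%N by rewrite index_mem.
    have vi : v = tnth (in_tuple cs) (Ordinal icS) by rewrite (tnth_nth v) /= nth_index.
    apply: (@eq_cmeasurable _ _ (fun t => (t \notin bad')%:R *
     (pev (conjc (cis t)) (core_numerator R nb q ray (Ordinal icS) c) / pev (conjc (cis t)) (denominator R nb q ray)))).
      move=> t /inI t0; rewrite /cutoff_family t0 andTb.
      case: (boolP (t \in bad')) => tb; rewrite ?mul0r// mul1r.
      apply: (mulfI (dn0 _ t0 tb)); rewrite mulrCA divff ?mulr1 ?dn0//.
      have := core_solution G (cis_neq0 t) (er t c t0 tb) (ev t c t0 tb) (Ordinal icS).
      rewrite -vi cis_inv => ->.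
      by rewrite (bigD1 c)//= eqxx mulr1 big1 ?addr0// => j /negbTE ->; rewrite mulr0.
    apply: cmeasurableM; first exact: cmeasurable_notin.
    by apply: cmeasurableM; [exact: cmeasurable_pev|apply: cmeasurable_inv => //; exact: cmeasurable_pev].
  apply: (@eq_cmeasurable _ _ (fun t => (Num.sqrt q%:R)%:C%C ^+ n *
     (cis t ^+ n * (c' == c)%:R * (t \notin bad')%:R + conjc (cis t) ^+ n * ((t \notin bad')%:R * S t c' c)))).
    move=> t /inI t0; rewrite /cutoff_family t0 andTb.
    case: (boolP (t \in bad')) => tb; first by rewrite !(mul0r, mulr0) addr0 mulr0.
    by rewrite (er t c t0 tb)// !mul1r mulr1 cis_inv.
  apply: cmeasurableM; first exact: cmeasurable_cst.
  apply: cmeasurableD; apply: cmeasurableM => //.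
  + by apply: cmeasurableM; [apply: cmeasurableX; exact: cmeasurable_cis|exact: cmeasurable_cst].
  + exact: cmeasurable_notin.
  + by apply: cmeasurableX; apply: cmeasurable_conj; exact: cmeasurable_cis.
- move=> v.
  suff [K KP] : exists K : R, forall t c, 0 <= t <= pi -> t \notin bad' -> nsq (e t c v) <= K.
    exists (`|K|) => t c; rewrite /cutoff_family; case: ifP => [/andP[t0 tb]|_]; last by rewrite nsq0.
    exact: le_trans (KP _ _ t0 tb) (ler_norm _).
  have [vcs|[c' [n [n0 ->]]]] := core_or_ray G v.
    have [K KP] : exists K : R, forall t : R, 0 <= t <= pi -> t \notin sv v -> t \notin bad ->
        forall c, nsq (e t c v) <= K.
      by rewrite /sv; case: pselect => // h; case: (cid _).
    exists K => t c t0 tb; apply: KP => //; last exact: goodE.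
    move: tb; rewrite !mem_cat !negb_or => /and3P[_ _]; apply: contra => tv.
    by apply/flattenP; exists (sv v) => //; apply: map_f.
  have [K KP] := ray_dot_bounded G eP c' n0.
  exists (K / lam (ray c' n) ^+ 2) => t c t0 tb; have := KP t t0 (goodE _ tb) c.
  by rewrite dot_delta nsqM nsq_conj nsqR ler_pdivlMr// exprn_gt0.
- by move=> t t0 tb; case: (eP t0 (goodE _ tb)).
- by move=> t c t0 tb; rewrite cutE//; exact: er.
- by move=> t c c' t0 tb; exact: (scattering_sym G eP t0 (goodE _ tb)).
- by move=> t c c' t0 tb; exact: (scattering_unitary G eP t0 (goodE _ tb)).
- by move=> t c c' t0 tb; rewrite pevS.
- exact: denominator_neq0 G.
- by move=> t c v tb; rewrite /cutoff_family tb andbF.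
Qed.

End Existence.

(** * The substitution x = a cos t *)

Section PushDensity.
Variable R : realType.
Local Notation mu := (@lebesgue_measure R).
Local Notation mR := (measurableTypeR R).
Variables (phi h : R -> R).
Hypotheses (mphi : measurable_fun [set: mR] phi) (h0 : forall t, 0 <= h t)
  (ih : mu.-integrable setT (EFin \o h)).

Let nu0 (A : set R) : \bar R := (\int[mu]_(t in phi @^-1` A) (h t)%:E)%E.

Let mh : measurable_fun [set: mR] h.
Proof. exact/measurable_EFinP/measurable_int/ih. Qed.

Let mpre (A : set R) : measurable (A : set mR) -> measurable (phi @^-1` A : set mR).
Proof. by move=> mA; rewrite -[_ @^-1` _]setTI; exact: mphi. Qed.

Let nu0_0 : nu0 set0 = 0%E.
Proof. by rewrite /nu0 preimage_set0 integral_set0. Qed.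

Let nu0_ge0 A : (0 <= nu0 A)%E.
Proof. by apply: integral_ge0 => t _; rewrite lee_fin. Qed.

Let nu0_sigma : semi_sigma_additive (nu0 : set R -> \bar R).
Proof.
move=> F mF tF mUF; rewrite /nu0 preimage_bigcup integral_bigcup//=.
- apply: is_cvg_ereal_nneg_natsum_cond => n _ _; exact: nu0_ge0.
- apply/trivIsetP => i j _ _ ij; rewrite -preimage_setI.
  by move/trivIsetP : tF => /(_ i j Logic.I Logic.I ij) ->; rewrite preimage_set0.
- by move=> n; exact: (mpre (mF n)).
- apply: (integrableS measurableT) => //; by apply: bigcup_measurable => n _; exact: (mpre (mF n)).
Qed.

Import HBNNSimple.

(** The push-forward under [phi] of the measure with density [h]; the integration formula holds for
    simple functions and passes to monotone limits. *)
Lemma push_density : exists nu : {finite_measure set R -> \bar R},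
  (forall A, measurable A -> nu A = (\int[mu]_(t in phi @^-1` A) (h t)%:E)%E) /\
  (forall f : R -> R, measurable_fun setT f -> (forall x, 0 <= f x) ->
    (\int[nu]_x (f x)%:E = \int[mu]_t (f (phi t) * h t)%:E)%E).
Proof.
have [nu nuE] : exists nu : {finite_measure set R -> \bar R}, forall A, nu A = nu0 A.
  pose m : {measure set R -> \bar R} :=
    HB.pack nu0 (isMeasure.Build _ R R nu0 nu0_0 nu0_ge0 nu0_sigma).
  have fm : fin_num_fun m.
    move=> A mA; rewrite ge0_fin_numE; last exact: nu0_ge0.
    have [_] := integrableP _ _ _ (integrableS measurableT (mpre mA) (@subsetT _ _) ih).
    by under eq_integral do rewrite /= ger0_norm//.
  pose nu : {finite_measure set R -> \bar R} :=
    HB.pack nu0 (isMeasure.Build _ R R nu0 nu0_0 nu0_ge0 nu0_sigma)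
      (@Measure_isFinite.Build _ R R m fm).
  by exists nu.
exists nu; split=> [A _|f mf f0]; first exact: nuE.
have mEf : measurable_fun [set: R] (EFin \o f) by exact/measurable_EFinP.
pose f_ := nnsfun_approx (@measurableT _ R) mEf.
have mf_ n : measurable_fun [set: mR] (f_ n : R -> R) 
  by have : measurable_fun [set: R] (f_ n) by exact: measurable_funP.
have fcvg x : (f_ n x)%:E @[n --> \oo] --> (f x)%:E.
  by apply: (cvg_nnsfun_approx (@measurableT _ R) mEf) => // y _; rewrite lee_fin.
have fnd x : {homo f_^~ x : n p / (n <= p)%N >-> n <= p}.
  by move=> n p np; exact/lefP/nd_nnsfun_approx.
have mfn n : measurable_fun [set: mR] (fun t => f_ n (phi t)).
  by apply: (@measurableT_comp _ _ _ _ _ _ (f_ n) setT phi) => //; exact: mf_.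
have mfk n k : measurable (phi @^-1` (f_ n @^-1` [set k]) : set mR).
  by have := mfn n measurableT [set k] (measurable_set1 k); rewrite setTI.
transitivity (limn (fun n => \int[nu]_x (f_ n x)%:E))%E.
  rewrite -monotone_convergence//.
  - by apply: eq_integral => x _; apply/esym/cvg_lim => //; exact: fcvg.
  - by move=> n; exact/measurable_EFinP/measurable_funP.
  - by move=> n x _; rewrite lee_fin.
  - by move=> x _ n p np; rewrite lee_fin fnd.
transitivity (limn (fun n => \int[mu]_t (f_ n (phi t) * h t)%:E))%E; last first.
  rewrite -monotone_convergence//.
  - apply: eq_integral => t _; apply/cvg_lim => //.
    rewrite EFinM; under eq_fun do rewrite EFinM.
    by apply: cvgeZr => //; exact: fcvg.
  - by move=> n; apply/measurable_EFinP; apply: measurable_funM.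
  - by move=> n t _; rewrite lee_fin mulr_ge0.
  - by move=> t _ n p np; rewrite lee_fin ler_wpM2r// fnd.
congr (limn _); apply/funext => n.
rewrite integralT_nnsfun sintegralE.
transitivity (\sum_(k \in range (f_ n)) \int[mu]_t (k * \1_(phi @^-1` (f_ n @^-1` [set k])) t * h t)%:E)%E; last first.
  rewrite -ge0_integral_fsum//.
  - apply: eq_integral => t _; rewrite [in RHS](fimfunE (f_ n) (phi t)).
    rewrite (fsbig_finite _ _ (fimfunP (f_ n))) [X in (X * _)%:E](fsbig_finite _ _ (fimfunP (f_ n))).
    by rewrite mulr_suml sumEFin.
  - move=> k; apply/measurable_EFinP; apply: measurable_funM => //.
    apply: measurable_funM => //; apply: measurable_indic; exact: mfk.
  - move=> k t _; rewrite lee_fin indicE; case: (boolP (t \in _)) => [/set_mem /= <-|_].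
      by rewrite mulr1 mulr_ge0.
    by rewrite mulr0 mul0r.
apply: eq_fsbigr => k /set_mem[x _ kx].
have k0 : 0 <= k by rewrite -kx.
transitivity (k%:E * nu0 (f_ n @^-1` [set k]))%E; first by congr (_ * _)%E; exact: nuE.
rewrite /nu0 integral_mkcond -ge0_integralZl//.
- apply: eq_integral => t _; rewrite patchE indicE; case: ifP => _ /=.
    by rewrite -EFinM mulr1.
  by rewrite mule0 mulr0 mul0r.
- apply: (measurable_restrictT _ _).1; [exact: mfk|].
  by apply/measurable_EFinP; exact: measurable_funTS.
- by move=> t _; rewrite patchE; case: ifP => _ //; rewrite lee_fin.
Qed.

Lemma push_density_moments (nu : {finite_measure set R -> \bar R}) :
  (forall f : R -> R, measurable_fun setT f -> (forall x, 0 <= f x) ->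
    (\int[nu]_x (f x)%:E = \int[mu]_t (f (phi t) * h t)%:E)%E) ->
  forall f : R -> R, measurable_fun setT f ->
    \int[nu]_x f x = \int[mu]_t (f (phi t) * h t).
Proof.
move=> nuE f mf; rewrite /Rintegral integralE [in RHS]integralE.
have mpos : measurable_fun [set: mR] (fun x => Num.max (f x) 0).
  by apply: measurable_maxr.
have mneg : measurable_fun [set: mR] (fun x => Num.max (- f x) 0).
  by apply: measurable_maxr => //; exact: measurableT_comp.
congr (fine (_ - _))%E.
  transitivity (\int[nu]_x (Num.max (f x) 0)%:E)%E.
    by apply: eq_integral => x _; rewrite funeposE EFin_max.
  rewrite nuE//; last by move=> x; rewrite le_max lexx orbT.
  by apply: eq_integral => t _; rewrite funeposE -EFin_max maxr_pMl// mul0r.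
transitivity (\int[nu]_x (Num.max (- f x) 0)%:E)%E.
  by apply: eq_integral => x _; rewrite funenegE EFin_max.
rewrite nuE//; last by move=> x; rewrite le_max lexx orbT.
by apply: eq_integral => t _; rewrite funenegE -EFinN -EFin_max maxr_pMl// mul0r mulNr.
Qed.

End PushDensity.

(** * Trigonometric integrals and the change of variables *)

Section Trig.
Variable R : realType.
Local Notation mu := (@lebesgue_measure R).
Local Notation mR := (measurableTypeR R).

Lemma FTC_everywhere (f F : R -> R) (a b : R) : a < b -> continuous f ->
  (forall x : R, is_derive x 1 F (f x)) ->
  (\int[mu]_(x in `[a, b]) (f x)%:E = (F b - F a)%:E)%E.
Proof.
move=> ab cf dF; rewrite (continuous_FTC2 ab (F := F)) ?EFinB//.
- exact: continuous_subspaceT.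
- have cF x : {for x, continuous F} by apply: differentiable_continuous; apply/derivable1_diffP; case: (dF x).
  split; first by move=> x _; case: (dF x).
    by apply: cvg_at_right_filter; exact: cF.
  by apply: cvg_at_left_filter; exact: cF.
- by move=> x _; rewrite derive1E; case: (dF x).
Qed.

Lemma is_derive_pow (g : R -> R) (t dg : R) (n : nat) : is_derive t 1 g dg ->
  is_derive t 1 (fun u => g u ^+ n.+1) (n.+1%:R * g t ^+ n * dg).
Proof.
move=> dg_; elim: n => [|n IH].
  by rewrite expr0 mulr1 mul1r; have -> : (fun u => g u ^+ 1) = g by apply/funext => u; rewrite expr1.
have -> : (fun u => g u ^+ n.+2) = g * (fun u => g u ^+ n.+1).
  by apply/funext => u; rewrite exprS.
apply: is_derive_eq; rewrite /GRing.scale /= -[n.+2%:R]natr1 exprS; ring.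
Qed.

Lemma negligible_seq (s : seq R) : mu.-negligible [set` s].
Proof.
apply/negligibleP.
  by apply: countable_measurable => //; apply: finite_set_countable; exact: finite_seq.
by apply: countable_lebesgue_measure0; apply: finite_set_countable; exact: finite_seq.
Qed.

Lemma sin_nat_pi n : sin (n%:R * pi) = 0 :> R.
Proof.
elim: n => [|n IH]; first by rewrite mul0r sin0.
by rewrite -natr1 mulrDl mul1r sinDpi IH oppr0.
Qed.

Lemma integral_cos (n : nat) : (\int[mu]_(t in `[0%R, (pi : R)]) (cos (n.+1%:R * t))%:E = 0)%E.
Proof.
have n0 : n.+1%:R != 0 :> R by rewrite pnatr_eq0.
have dF (t : R) : is_derive t 1 (fun t : R => n.+1%:R^-1 * sin (n.+1%:R * t)) (cos (n.+1%:R * t)).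
  by apply: is_derive_eq; rewrite /GRing.scale /=; field.
rewrite (FTC_everywhere _ _ dF) ?pi_gt0//.
  by rewrite mulr0 sin0 sin_nat_pi mulr0 subrr.
move=> t; apply: continuous_comp; last exact: continuous_cos.
by apply: cvgMr; exact: cvg_id.
Qed.

Variable a : R.
Hypothesis a0 : 0 < a.

(** The substitution for monomials: both sides follow from the antiderivative of [x ^+ n]. *)
Lemma integral_chebyshev (n : nat) :
  (\int[mu]_(t in `[0%R, (pi : R)]) ((a * cos t) ^+ n * (a * sin t))%:E =
   \int[mu]_(x in `[(- a)%R, a]) (x ^+ n)%:E)%E.
Proof.
have n0 : n.+1%:R != 0 :> R by rewrite pnatr_eq0.
have dx (t : R) : is_derive t 1 (fun t : R => n.+1%:R^-1 * t ^+ n.+1) (t ^+ n).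
  have := is_derive_pow n (is_derive_id t (1 : R)) => dp.
  by apply: is_derive_eq; rewrite /GRing.scale /=; field.
have dc (t : R) : is_derive t 1 (fun t : R => a * cos t) (- (a * sin t)).
  by apply: is_derive_eq; rewrite /GRing.scale /=; ring.
have dF (t : R) : is_derive t 1 (fun t : R => (- n.+1%:R^-1) * (a * cos t) ^+ n.+1)
    ((a * cos t) ^+ n * (a * sin t)).
  have := is_derive_pow n (dc t) => dp.
  by apply: is_derive_eq; rewrite /GRing.scale /=; field.
rewrite (FTC_everywhere _ _ dF) ?pi_gt0// ?(FTC_everywhere _ _ dx) ?gtrN//.
- by rewrite cospi cos0 mulr1 mulrN1; congr (_%:E); rewrite !mulNr; ring.
- by move=> t; exact: exprn_continuous.
- move=> t; apply: cvgM; last first.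
    by apply: cvgMr; exact: continuous_sin.
  apply: (@continuous_comp _ _ _ (fun t : R => a * cos t) (fun u : R => u ^+ n)).
    by apply: cvgMr; exact: continuous_cos.
  exact: exprn_continuous.
Qed.

Lemma scaled_cos_bound (t : R) : - a <= a * cos t <= a.
Proof.
apply/andP; split; first by rewrite -[- a]mulrN1 ler_pM2l// cos_geN1.
by rewrite -[leRHS]mulr1 ler_pM2l// cos_le1.
Qed.

Lemma measurable_scaled_cos : measurable_fun [set: mR] (fun t => a * cos t).
Proof.
apply: continuous_measurable_fun => t; apply: cvgMr; exact: continuous_cos.
Qed.

Let sin_ge0 (t : R) : `[0, pi]%classic t -> 0 <= sin t.
Proof. by rewrite /= in_itv /= => t0; exact: sin_ge0_pi. Qed.

(** Both sides integrate [f] against a finite measure on [-a, a]. The measures have the same moments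
    by [integral_chebyshev], so [moments_unique] identifies them. *)
Lemma change_of_variables (f : R -> R) : measurable_fun setT f -> (forall x, 0 <= f x) ->
  (\int[mu]_(x in `[(- a)%R, a]) (f x)%:E =
   \int[mu]_(t in `[0%R, (pi : R)]) (f (a * cos t) * (a * sin t))%:E)%E.
Proof.
move=> mf f0.
have mI : measurable (`[0, pi] : set mR) by exact: measurable_itv.
have mJ : measurable (`[- a, a] : set mR) by exact: measurable_itv.
pose h t : R := a * sin t * \1_(`[0, pi]%classic : set R) t.
pose g x : R := \1_(`[- a, a]%classic : set R) x.
have h0 t : 0 <= h t.
  rewrite /h indicE; case: (boolP (t \in _)) => [/set_mem/sin_ge0 s0|_]; last by rewrite mulr0.
  by rewrite mulr1 mulr_ge0// ltW.
have g0 x : 0 <= g x by rewrite /g indicE.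
have indI (u : R -> R) (D : set R) : (\int[mu]_t (u t * \1_D t)%:E = \int[mu]_(t in D) (u t)%:E)%E.
  rewrite [RHS]integral_mkcond; apply: eq_integral => t _; rewrite patchE indicE.
  by case: ifP => _; rewrite ?mulr1// mulr0.
have fJ : (mu (`[(- a)%R, a]%classic : set R) < +oo)%E by rewrite lebesgue_measure_itv /=; case: ifP => _; rewrite ltry.
have ih : mu.-integrable setT (EFin \o h).
  apply/integrableP; split.
    apply/measurable_EFinP; apply: measurable_funM.
      by apply: continuous_measurable_fun => t; apply: cvgMr; exact: continuous_sin.
    exact: measurable_indic.
  under eq_integral do rewrite /= ger0_norm//.
  rewrite indI -[X in (\int[_]_(t in _) X t < _)%E]/(fun t => (a * sin t)%:E).
  have := integral_chebyshev 0; under eq_integral do rewrite expr0 mul1r.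
  move=> ->; under eq_integral do rewrite expr0.
  by rewrite integral_cst// mul1e.
have ig : mu.-integrable setT (EFin \o g).
  apply/integrableP; split; first by apply/measurable_EFinP; exact: measurable_indic.
  under eq_integral do rewrite /= ger0_norm//.
  by rewrite /g integral_indic// setIT.
have [nu [nuA nuE]] := push_density measurable_scaled_cos h0 ih.
have [rho [rhoA rhoE]] := push_density (@measurable_id _ _ setT) g0 ig.
have far (P : set R) : (forall t, P t -> ~ - a <= t <= a) -> forall u : R -> R,
    (\int[mu]_(t in P) (u t * g t)%:E = 0)%E.
  move=> Pa u; apply: integral0_eq => t /Pa ta; rewrite /g indicE memNset ?mulr0//.
have nuM : nu (~` `[- a, a]) = 0%E.
  rewrite nuA; last exact: measurableC.
  apply: integral0_eq => t /= ta; rewrite /h indicE; case: (boolP (t \in _)) => [_|]; last by rewrite mulr0.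
  exfalso; apply: ta; rewrite in_itv /=.
  exact: scaled_cos_bound.
have rhoM : rho (~` `[- a, a]) = 0%E.
  rewrite rhoA; last exact: measurableC.
  rewrite -(far (~` `[- a, a]) _ (fun=> 1)); last by move=> t /=; rewrite in_itv.
  by apply: eq_integral => t _; rewrite mul1r.
have mom n : \int[nu]_x (x ^+ n) = \int[rho]_x (x ^+ n).
  rewrite (push_density_moments h0 nuE)// (push_density_moments g0 rhoE)//.
  rewrite /Rintegral; congr fine.
  transitivity (\int[mu]_(t in `[0%R, (pi : R)]) ((a * cos t) ^+ n * (a * sin t))%:E)%E.
    rewrite -(indI (fun t => (a * cos t) ^+ n * (a * sin t))).
    by apply: eq_integral => t _; rewrite /h mulrA.
  by rewrite integral_chebyshev -(indI (fun x => x ^+ n)).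
have nurho (A : set R) : measurable A -> nu A = rho A.
  exact: (@moments_unique R nu rho a nuM rhoM mom).
rewrite -(indI f); transitivity (\int[rho]_x (f x)%:E)%E; first by rewrite rhoE.
transitivity (\int[nu]_x (f x)%:E)%E.
  by apply: eq_measure_integral => A mA _; exact/esym/nurho.
rewrite nuE// -(indI (fun t => f (a * cos t) * (a * sin t))).
by apply: eq_integral => t _; rewrite /h mulrA.
Qed.

(** The substitution applied to the indicator of [B]; the factor [sin t] vanishes only at the ends
    of the interval. *)
Lemma spectral_null (B : set R) : measurable (B : set mR) -> mu B = 0%E ->
  mu (`[0, pi] `&` (fun t => a * cos t) @^-1` B) = 0%E.
Proof.
move=> mB B0.
have mI : measurable (`[0, pi] : set mR) by exact: measurable_itv.
have mP : measurable ((fun t => a * cos t) @^-1` B : set mR).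
  by rewrite -[_ @^-1` _]setTI; exact: measurable_scaled_cos.
have mb : measurable_fun [set: mR] (\1_B : R -> R) by exact: measurable_indic.
have := change_of_variables mb (fun x => _); rewrite integral_indic; last 2 first.
- exact: measurable_itv.
- exact: mB.
move=> /(_ (fun x => ler0n _ _)).
have mB0 : mu (B `&` `[- a, a]) = 0%E.
  apply/eqP; rewrite eq_le measure_ge0 andbT -B0; apply: le_measure; rewrite ?inE//.
  by apply: measurableI => //; exact: measurable_itv.
move=> e0; have e := etrans (esym e0) mB0.
have := @ae_eq_integral_abs _ _ R mu `[0, pi] mI
  (fun t => (\1_B (a * cos t) * (a * sin t))%:E).
case=> [|h _].
  apply/measurable_EFinP; apply: measurable_funTS; apply: measurable_funM.
    by apply: measurableT_comp mb _; exact: measurable_scaled_cos.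
  by apply: continuous_measurable_fun => t; apply: cvgMr; exact: continuous_sin.
have {}h : ae_eq mu (`[0, pi]%classic : set R) (fun t => (\1_B (a * cos t) * (a * sin t))%:E) (cst 0%E).
  apply: h; rewrite -[RHS]e; apply: eq_integral => t /set_mem tI.
  by rewrite gee0_abs// lee_fin mulr_ge0// mulr_ge0 ?(ltW a0) ?sin_ge0.
suff : mu.-negligible (`[0, pi] `&` (fun t => a * cos t) @^-1` B).
  by move/negligibleP; apply; exact: measurableI.
apply: (@negligibleS _ _ _ mu ([set t | ~ (`[0, pi]%classic t ->
    (\1_B (a * cos t) * (a * sin t))%:E = 0%E)] `|` [set` [:: 0; pi]])).
  move=> t [tI Bt]; have [->|t0] := eqVneq t 0; first by right; rewrite /= inE eqxx.
  have [->|tp] := eqVneq t pi; first by right; rewrite /= !inE eqxx orbT.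
  left => /= /(_ tI); rewrite indicE mem_set// mul1r => -[] /eqP; rewrite gt_eqF//.
  rewrite mulr_gt0// sin_gt0_pi//; move: tI; rewrite /= in_itv /= => /andP[t0' tp'].
  by rewrite !lt_neqAle eq_sym t0 t0' tp tp'.
apply: negligibleU; first exact: h.
exact: negligible_seq.
Qed.

End Trig.

Section Generic.
Variable R : realType.
Local Notation C := R[i].

Lemma nsq_small_eq0 (z : C) (K : R) : (forall e : R, 0 < e -> nsq z <= K * e) -> z = 0.
Proof.
move=> zK; apply: nsq_eq0; apply/eqP; rewrite eq_le nsq_ge0 andbT; apply/ler_addgt0Pl => e e0.
rewrite addr0; have K1 : 0 < `|K| + 1 by rewrite ltr_wpDl.
apply: le_trans (zK (e / (`|K| + 1)) _) _; first by rewrite divr_gt0.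
rewrite mulrA ler_pdivrMr// mulrC ler_pM2l//.
by apply: le_trans (ler_norm _) _; rewrite lerDl.
Qed.

Lemma nsq_sum_seq_le (T : Type) (s : seq T) (F : T -> C) :
  nsq (\sum_(u <- s) F u) <= (size s)%:R * \sum_(u <- s) nsq (F u).
Proof.
rewrite [X in nsq X]big_tnth [X in _ <= _ * X]big_tnth.
by apply: le_trans (nsq_sum_le _) _; rewrite card_ord.
Qed.

Lemma sum_count_le (T : eqType) (s l : seq T) : uniq s ->
  (\sum_(v <- s) count_mem v l <= size l)%N.
Proof.
move=> us; elim: l => [|x l IH]; first by rewrite big1.
rewrite /= big_split /= -add1n leq_add//.
have -> : (\sum_(v <- s) (x == v) = count_mem x s)%N.
  rewrite -sum1_count [RHS]big_mkcond /=; apply: eq_bigr => v _; rewrite eq_sym; by case: eqP.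
by rewrite count_uniq_mem// leq_b1.
Qed.

Lemma inorm_sum_le (T : choiceType) (P : set (T -> C)) (B : (T -> C) -> (T -> C) -> C)
    (J : Type) (s : seq J) (F : J -> T -> C) : is_inner P B -> (forall j, P (F j)) ->
  inorm B (fun v => \sum_(j <- s) F j v) <= 2 ^+ size s * \sum_(j <- s) inorm B (F j).
Proof.
move=> BP PF; have sP := inner_subspace BP.
elim: s => [|j s IH].
  have -> : (fun v => \sum_(j <- [::]) F j v) = fun=> 0 by apply/funext => v; rewrite big_nil.
  by rewrite big_nil mulr0 /inorm (inner0r BP)//; exact: sP.1.
have -> : (fun v => \sum_(i <- j :: s) F i v) = fun v => F j v + \sum_(i <- s) F i v.
  by apply/funext => v; rewrite big_cons.
have Ps : P (fun v => \sum_(i <- s) F i v).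
  have := @subspace_sum _ _ _ _ s xpredT (fun=> 1) F sP (fun i _ => PF i).
  by congr P; apply/funext => v; apply: eq_bigr => i _; rewrite mul1r.
apply: le_trans (inormD BP (PF j) Ps) _; rewrite big_cons mulrDr /= exprS.
have n0 := inorm_ge0 BP (PF j).
rewrite -mulrDr -!mulrA -[leRHS]mulrDr ler_pM2l// lerD//.
by rewrite ler_peMl// exprn_ege1// ler1n.
Qed.

End Generic.

(** * Boundedness and symmetry of the adjacency operator *)

Section Bounded.
Variables (R : realType) (V : choiceType) (lam : V -> R) (nb : V -> seq V)
  (q r : nat) (ray : 'I_r -> nat -> V) (width : 'I_r -> R).
Hypothesis G : cusp_graph lam nb q ray width.
Local Notation C := R[i].
Local Notation A := (@nbop R V nb).
Local Notation w := (nbw R nb).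
Local Notation dot := (dot lam).
Local Notation L2 := (L2 lam).
Let lam0 := cg_lam G.
Let dotP := dot_inner lam0.

(** From height 2 on, the degree is found by applying [cg_ray] to the constant 1; finitely many
    vertices are left. *)
Lemma degree_bound : exists D : nat, forall v, (size (nb v) <= D)%N.
Proof.
pose D := (q.+1 + \sum_(v <- core_seq ray) size (nb v) + \sum_c size (nb (ray c 1)))%N.
exists D => v; have [vc|[c [n [n0 ->]]]] := core_or_ray G v.
  by rewrite /D (bigD1_seq v)//= ?core_uniq//; lia.
case: n n0 => [//|[|n]] _; first by rewrite /D (bigD1 c)//=; lia.
have := cg_ray G (fun=> 1) c (isT : (1 < n.+2)%N).
rewrite /nbop -(big_map (fun=> tt) xpredT (fun=> 1)) big_const_seq count_predT size_map iter_addr_0.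
rewrite mulr1 => e; have : ((size (nb (ray c n.+2)))%:R = q.+1%:R :> C) by rewrite e -natr1.
by move/eqP; rewrite eqr_nat /D => /eqP ->; lia.
Qed.

(** The Schur test: Cauchy-Schwarz at each vertex costs one factor [D]; detailed balance moves the
    weight to the neighbor, and counting edges there costs the other. *)
Lemma nbop_L2 : exists D : R, 0 <= D /\
  forall f, L2 f -> L2 (A f) /\ inorm dot (A f) <= D * inorm dot f.
Proof.
have [D DP] := degree_bound; exists (D%:R * D%:R); split; first by rewrite mulr_ge0.
move=> f Lf; apply: L2_bound => // s us.
pose t := undup (flatten [seq nb v | v <- s]).
have ut : uniq t by exact: undup_uniq.
have tP v u : v \in s -> u \in nb v -> u \in t.
  by move=> vs uv; rewrite mem_undup; apply/flattenP; exists (nb v) => //; exact: map_f.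
have e v : v \in s -> \sum_(u <- nb v) nsq (f u) = \sum_(u <- t) w v u * nsq (f u).
  move=> vs; apply: (@complexI R); rewrite !(rmorph_sum (real_complex R)) /=.
  have := @nbop_seq R V nb (fun u => (nsq (f u))%:C%C) v t ut.
  rewrite /nbop => -> => [|u /(tP _ _ vs) ->//].
  by apply: eq_bigr => u _; rewrite (rmorphM (real_complex R)).
apply: (@le_trans _ _ (\sum_(v <- s) \sum_(u <- t) D%:R * (lam v * w v u * nsq (f u)))).
  rewrite big_seq [leRHS]big_seq; apply: ler_sum => v vs.
  rewrite -mulr_sumr mulrC.
  have -> : \sum_(u <- t) lam v * w v u * nsq (f u) = lam v * \sum_(u <- nb v) nsq (f u).
    by rewrite e// mulr_sumr; apply: eq_bigr => u _; rewrite mulrA.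
  rewrite mulrCA ler_pM2l// /nbop; apply: le_trans (nsq_sum_seq_le _ _) _.
  by rewrite ler_wpM2r ?ler_nat// sumr_ge0// => u _; exact: nsq_ge0.
rewrite exchange_big /=.
apply: (@le_trans _ _ (\sum_(u <- t) D%:R * D%:R * (nsq (f u) * lam u))).
  apply: ler_sum => u _; rewrite -mulr_sumr -mulrA ler_wpM2l//.
  have -> : \sum_(v <- s) lam v * w v u * nsq (f u) = (\sum_(v <- s) w u v) * (nsq (f u) * lam u).
    by rewrite mulr_suml; apply: eq_bigr => v _; rewrite (cg_sym G v u); ring.
  rewrite ler_wpM2r ?mulr_ge0 ?nsq_ge0 ?(ltW (lam0 _))//.
  by rewrite /nbw -natr_sum ler_nat (leq_trans (sum_count_le _ us)).
rewrite -mulr_sumr ler_wpM2l ?mulr_ge0//; exact: sum_le_inorm.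
Qed.

(** The case of finite support and density, with the bound of [nbop_L2] for the error. *)
Lemma nbop_sym f g : L2 f -> L2 g -> dot (A f) g = dot f (A g).
Proof.
move=> Lf Lg; have [D [D0 DP]] := nbop_L2.
have [LAf _] := DP f Lf; have [LAg _] := DP g Lg.
have sL := L2_subspace lam0.
apply/eqP; rewrite -subr_eq0; apply/eqP.
apply: (@nsq_small_eq0 _ _ (2 * inorm dot (A f) + 2 * (inorm dot f * D))) => e e0.
have [s [us sP]] := restrict_approx lam0 Lg e0.
have {sP} := sP s us (fun _ h => h); set h := restrict_to s g; set d := fun v => _ => de.
have fh : finitely_supported h by exact: restrict_finite.
have Lh : L2 h by exact: finite_L2.
have Ld : L2 d by exact: subspaceB.
have [LAd nAd] := DP d Ld; have [LAh _] := DP h Lh.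
have eh : dot (A f) h = dot f (A h).
  rewrite (inner_conj dotP Lh LAf) -(dot_nbop G f fh).
  by rewrite -(inner_conj dotP LAh Lf).
have -> : dot (A f) g - dot f (A g) = dot (A f) d - dot f (A d).
  have Ad : A d = fun v => A g v - A h v by exact: (linopB (@nbop_lin R V nb)).
  by rewrite Ad !(innerBr dotP)// eh opprB addrA subrK.
have n1 := inner_CS dotP LAf Ld; have n2 := inner_CS dotP Lf LAd.
apply: le_trans (nsqD_le _ _) _; rewrite nsqN [leRHS]mulrDl; apply: lerD; rewrite -mulrA ler_pM2l//.
  by apply: le_trans n1 _; rewrite ler_wpM2l// (inorm_ge0 dotP).
apply: le_trans n2 _; rewrite -mulrA ler_wpM2l ?(inorm_ge0 dotP)//.
by apply: le_trans nAd _; rewrite ler_wpM2l.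
Qed.

End Bounded.

Section IntegralTools.
Variables (R : realType) (D : set R).
Local Notation C := R[i].
Local Notation mu := (@lebesgue_measure R).
Hypotheses (mD : measurable (D : set (measurableTypeR R))) (fD : (mu D < +oo)%E).

Lemma cintegrable_L2D f : L2D D f -> cintegrable D f.
Proof.
move=> Lf; have L1 : L2D D (fun=> 1).
  by apply: (@L2D_bounded _ _ mD fD _ 1) => [|x _]; [exact: cmeasurable_cst|rewrite /nsq /=; lra].
apply: (cintegrable_eq mD _ (cintegrable_mul mD Lf L1)) => x _.
by rewrite conjc1 mulr1.
Qed.

Lemma cintegral_sum (J : Type) (s : seq J) (c : J -> C) (F : J -> R -> C) :
  (forall j, cintegrable D (F j)) ->
  cintegrable D (fun t => \sum_(j <- s) c j * F j t) /\
  cintegral D (fun t => \sum_(j <- s) c j * F j t) = \sum_(j <- s) c j * cintegral D (F j).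
Proof.
move=> iF; elim: s => [|j s [i1 i2]].
  have -> : (fun t => \sum_(j <- [::]) c j * F j t) = fun=> 0 by apply/funext => t; rewrite big_nil.
  have i0 : cintegrable D (fun=> 0 : C).
    by apply: cintegrable_L2D; exact: (L2D_subspace mD fD).1.
  split=> //; rewrite big_nil /cintegral /=.
  by rewrite /Rintegral integral0.
have -> : (fun t => \sum_(i <- j :: s) c i * F i t) =
    fun t => c j * F j t + \sum_(i <- s) c i * F i t by apply/funext => t; rewrite big_cons.
have [h1 h2] := cintegral_lin mD (c j) (iF j) i1.
by split=> //; rewrite h2 i2 big_cons.
Qed.

Lemma Rintegral_off_seq (s : seq R) (u v : R -> R) : measurable_fun D u -> measurable_fun D v ->
  (forall t, D t -> t \notin s -> u t = v t) ->
  \int[mu]_(t in D) u t = \int[mu]_(t in D) v t.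
Proof.
move=> mu_ mv uv; rewrite /Rintegral; congr fine; apply: ae_eq_integral => //.
- exact/measurable_EFinP.
- exact/measurable_EFinP.
apply: (@negligibleS _ _ _ mu [set` s]); last exact: negligible_seq.
move=> t /= h; have [//|ts] := boolP (t \in s); exfalso; apply: h => Dt.
by rewrite (uv t).
Qed.

Lemma cintegral_off_seq (s : seq R) f g : cmeasurable D f -> cmeasurable D g ->
  (forall t, D t -> t \notin s -> f t = g t) -> cintegral D f = cintegral D g.
Proof.
move=> [f1 f2] [g1 g2] fg; rewrite /cintegral; congr Complex.
  by apply: (@Rintegral_off_seq s) => // t Dt ts; rewrite fg.
by apply: (@Rintegral_off_seq s) => // t Dt ts; rewrite fg.
Qed.

Lemma inorm_Rintegral f : inorm (ip D) f = \int[mu]_(t in D) nsq (f t).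
Proof.
rewrite /inorm /ip /cintegral /=; apply: eq_Rint => t _.
by case: (f t) => x y; rewrite /nsq /=; ring.
Qed.

Lemma inorm_le2 f g h (a b : R) : L2D D f -> L2D D g -> L2D D h ->
  (forall t, D t -> nsq (f t) <= a * nsq (g t) + b * nsq (h t)) ->
  inorm (ip D) f <= a * inorm (ip D) g + b * inorm (ip D) h.
Proof.
move=> Lf Lg Lh fgh; rewrite !inorm_Rintegral.
have ig := integrable_nsq Lg; have ih := integrable_nsq Lh.
rewrite -!RintegralZl// -RintegralD//; [|exact: integrable_scale|exact: integrable_scale].
apply: le_Rintegral => //; first exact: integrable_nsq.
by apply: integrable_add => //; exact: integrable_scale.
Qed.

Lemma L2D_mul (u f : R -> C) (c : R) : cmeasurable D u -> (forall t, D t -> nsq (u t) <= c) ->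
  L2D D f -> L2D D (fun t => u t * f t) /\ inorm (ip D) (fun t => u t * f t) <= c * inorm (ip D) f.
Proof.
move=> mu_ uc Lf.
have Lc : L2D D (fun t => (Num.sqrt `|c|)%:C%C * f t).
  exact: (subspaceZ (Num.sqrt `|c|)%:C%C (L2D_subspace mD fD) Lf).
have Lu : L2D D (fun t => u t * f t).
  apply: (L2D_le mD _ Lc); first by apply: cmeasurableM => //; exact: Lf.1.
  move=> t Dt; rewrite !nsqM nsqR sqr_sqrtr// ler_wpM2r ?nsq_ge0//.
  by apply: le_trans (uc t Dt) _; exact: ler_norm.
split=> //; have := inorm_le2 (a := c) (b := 0) Lu Lf Lf; rewrite mul0r addr0; apply.
by move=> t Dt; rewrite mul0r addr0 nsqM ler_wpM2r ?nsq_ge0// uc.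
Qed.

End IntegralTools.

Section AlmostEverywhere.
Variable R : realType.
Local Notation mu := (@lebesgue_measure R).

Lemma ae_mono (P Q : R -> Prop) : {ae mu, forall t, P t} -> (forall t, P t -> Q t) ->
  {ae mu, forall t, Q t}.
Proof. by move=> h PQ; apply: negligibleS h => t /= nQ pP; exact/nQ/PQ. Qed.

Lemma ae_and (P Q : R -> Prop) : {ae mu, forall t, P t} -> {ae mu, forall t, Q t} ->
  {ae mu, forall t, P t /\ Q t}.
Proof.
move=> h1 h2; apply: (negligibleS _ (negligibleU h1 h2)) => t /= /not_andP.
by case; [left|right].
Qed.

Lemma ae_notin (s : seq R) : {ae mu, forall t, t \notin s}.
Proof. by apply: (negligibleS _ (negligible_seq s)) => t /= /negP; rewrite negbK. Qed.

End AlmostEverywhere.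

(** * Parseval's identity on the half circle *)

Section Fourier.
Variable R : realType.
Local Notation C := R[i].
Local Notation Re := complex.Re.
Local Notation mu := (@lebesgue_measure R).
Local Notation I := (`[0, pi]%classic : set R).

Lemma mI : measurable (I : set (measurableTypeR R)).
Proof. exact: measurable_itv. Qed.

Lemma fI : (mu I < +oo)%E.
Proof. by rewrite lebesgue_measure_itv /=; case: ifP => _; rewrite ltry. Qed.

Lemma cisD (a b : R) : cis (a + b) = cis a * cis b.
Proof. by apply/eqP; rewrite eq_complex /= cosD sinD; apply/andP; split; apply/eqP; ring. Qed.

Lemma cisN (a : R) : cis (- a) = conjc (cis a).
Proof. by rewrite /cis cosN sinN. Qed.

Lemma cis_natM (n : nat) (t : R) : cis (n%:R * t) = cis t ^+ n.
Proof.
elim: n => [|n IH]; first by rewrite mul0r /cis cos0 sin0.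
by rewrite -natr1 mulrDl mul1r cisD IH exprSr.
Qed.

Lemma nsq_cis (t : R) : nsq (cis t) = 1.
Proof. by rewrite /nsq /= cos2Dsin2. Qed.

Lemma nsqX (z : C) n : nsq (z ^+ n) = nsq z ^+ n.
Proof. by elim: n => [|n IH]; rewrite ?expr0 ?exprS ?nsqM ?IH// /nsq /=; ring. Qed.

Definition zpow (n : nat) (t : R) : C := cis t ^+ n.
Definition zbpow (n : nat) (t : R) : C := conjc (cis t) ^+ n.

Lemma L2D_zpow n : L2D I (zpow n).
Proof.
apply: (@L2D_bounded _ _ mI fI _ 1); first exact/cmeasurableX/cmeasurable_cis.
by move=> t _; rewrite /zpow nsqX nsq_cis expr1n.
Qed.

Lemma L2D_zbpow n : L2D I (zbpow n).
Proof.
apply: (@L2D_bounded _ _ mI fI _ 1).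
  by apply: cmeasurableX; apply: cmeasurable_conj; exact: cmeasurable_cis.
by move=> t _; rewrite /zbpow nsqX nsq_conj nsq_cis expr1n.
Qed.

Lemma zbpow_conj n t : zbpow n t = conjc (zpow n t).
Proof. by rewrite /zbpow -conjcX. Qed.

Definition fourier_pairing (m n : nat) : C := cintegral I (fun t => zpow m t * zbpow n t).

(** Over half a period the exponentials are not orthogonal, but the real part of the pairing is an
    integral of [cos ((m - n) t)]. *)
Lemma fourier_pairing_Re (m n : nat) : 2 * Re (fourier_pairing m n) = 2 * pi * (m == n)%:R.
Proof.
rewrite /fourier_pairing /cintegral /=.
have e t : Re (zpow m t * zbpow n t) = cos ((m%:R - n%:R) * t).
  by rewrite zbpow_conj /zpow -!cis_natM -cisN -cisD mulrBl.
rewrite (eq_Rint (fun t _ => e t)).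
have off (j : nat) : \int[mu]_(t in I) cos (j.+1%:R * t) = 0.
  by rewrite /Rintegral integral_cos.
have [mn|nm|->] := ltngtP m n.
- rewrite -(subnKC mn) addSn -addnS natrD; under eq_Rintegral do rewrite opprD addNKr mulNr cosN.
  by rewrite off !mulr0.
- rewrite -(subnKC nm) addSn -addnS natrD; under eq_Rintegral do rewrite addrAC subrr add0r.
  by rewrite off !mulr0.
under eq_Rintegral do rewrite subrr mul0r cos0.
have e1 : fine (mu I) = pi by rewrite lebesgue_measure_itv /= lte_fin pi_gt0 /= oppr0 addr0.
rewrite Rintegral_cst; last exact: mI.
by rewrite mul1r e1 mulr1.
Qed.

Lemma fourier_pairing_conj (m n : nat) :
  fourier_pairing m n + conjc (fourier_pairing m n) = (2 * pi * (m == n)%:R)%:C%C.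
Proof.
rewrite -fourier_pairing_Re; case: (fourier_pairing m n) => x y.
by apply/eqP; rewrite eq_complex /=; apply/andP; split; apply/eqP; ring.
Qed.

(** Powers of [z] and of its conjugate, with the same coefficients, have conjugate pairings; adding
    the two norms leaves [fourier_pairing_conj]. *)
Lemma parseval (M : nat) (a : nat -> C) :
  inorm (ip I) (fun t => \sum_(n < M) a n * zpow n t) +
  inorm (ip I) (fun t => \sum_(n < M) a n * zbpow n t) = 2 * pi * \sum_(n < M) nsq (a n).
Proof.
have IP := ip_inner mI fI.
have Lz n := L2D_zpow n; have Lzb n := L2D_zbpow n.
have sL := L2D_subspace mI fI.
have expand (F : nat -> R -> C) : (forall n, L2D I (F n)) ->
    ip I (fun t => \sum_(n < M) a n * F n t) (fun t => \sum_(n < M) a n * F n t) =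
    \sum_(n < M) \sum_(m < M) a n * conjc (a m) * ip I (F n) (F m).
  move=> LF; have LS : L2D I (fun t => \sum_(n < M) a n * F n t) by exact: subspace_sum.
  rewrite (inner_suml IP)//; apply: eq_bigr => n _.
  rewrite (inner_conj IP LS (LF n)) (inner_suml IP)// (rmorph_sum conjc) mulr_sumr.
  apply: eq_bigr => m _; by rewrite [in RHS](inner_conj IP (LF m) (LF n)) (rmorphM conjc) mulrA.
have e1 n m : ip I (zpow n) (zpow m) = fourier_pairing n m.
  by rewrite /ip /fourier_pairing; apply: eq_cintegral => t _; rewrite zbpow_conj.
have e2 n m : ip I (zbpow n) (zbpow m) = conjc (fourier_pairing n m).
  rewrite -e1 -(inner_conj IP (Lz n) (Lz m)) /ip; apply: eq_cintegral => t _.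
  by rewrite !zbpow_conj conjcK mulrC.
rewrite /inorm (expand zpow)// (expand zbpow)//.
have ReD (x y : C) : Re x + Re y = Re (x + y) by case: x y => x1 x2 [].
rewrite ReD -big_split /=.
have -> : \sum_(n < M) (\sum_(m < M) a n * conjc (a m) * ip I (zpow n) (zpow m) +
     \sum_(m < M) a n * conjc (a m) * ip I (zbpow n) (zbpow m)) =
    (2 * pi * \sum_(n < M) nsq (a n))%:C%C.
  rewrite mulr_sumr (rmorph_sum (real_complex R)); apply: eq_bigr => n _.
  rewrite -big_split /= (bigD1 n)//= big1 ?addr0 => [|m mn].
    rewrite e1 e2 -mulrDr fourier_pairing_conj eqxx mulr1 -nsqE -(rmorphM (real_complex R)) mulrC.
    by [].
  rewrite e1 e2 -mulrDr fourier_pairing_conj.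
  have -> : (nat_of_ord n == m) = false by apply/negbTE; apply: contra mn => /eqP e; apply/eqP/val_inj.
  by rewrite mulr0 mulr0.
by [].
Qed.

End Fourier.

(** * The spectral transform and its adjoint *)

Section Transform.
Variables (R : realType) (V : choiceType) (lam : V -> R) (nb : V -> seq V)
  (q r : nat) (ray : 'I_r -> nat -> V) (width : 'I_r -> R).
Hypothesis G : cusp_graph lam nb q ray width.
Local Notation C := R[i].
Local Notation A := (@nbop R V nb).
Local Notation cs := (core_seq ray).
Local Notation k := (Num.sqrt (q%:R : R)).
Local Notation dot := (dot lam).
Local Notation L2 := (L2 lam).
Local Notation I := (`[0, pi]%classic : set R).
Variables (E : R -> 'I_r -> V -> C) (S : R -> 'I_r -> 'I_r -> C) (bad : seq R)
  (d : {poly R}) (P : 'I_r -> 'I_r -> {poly R}).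
Hypothesis SF : spectral_family nb q ray width E S bad d P.
Let lam0 := cg_lam G.
Let dotP := dot_inner lam0.
Let IP := ip_inner (@mI R) (@fI R).
Let sI := L2D_subspace (@mI R) (@fI R).

(** The diagonal of [plancherel_matrix]. Its value is dictated by [2 * pi * kappa c * lam (ray c n)
    * q ^+ n = 1], which the end of [synthesis_null] requires. *)
Definition kappa c : R := (2 * pi * (q%:R + 1) * width c)^-1.

Lemma kappa_gt0 c : 0 < kappa c.
Proof.
by rewrite invr_gt0 mulr_gt0 ?(cg_width G)// mulr_gt0 ?mulr_gt0 ?pi_gt0// ltr_wpDl.
Qed.

(** The sum of [r] copies of L^2 of [0, pi], as functions of a pair so that [is_inner] covers it. *)
Definition KL2 : set (('I_r * R) -> C) := [set F | forall c, L2D I (fun t => F (c, t))].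
Definition ipK (F H : 'I_r * R -> C) : C :=
  \sum_c (kappa c)%:C%C * ip I (fun t => F (c, t)) (fun t => H (c, t)).

Lemma ipK_inner : is_inner KL2 ipK.
Proof.
split.
- split=> [c|a F H KF KH c]; first exact: sI.1.
  exact: (sI.2 a _ _ (KF c) (KH c)).
- move=> a F H X KF KH KX; rewrite /ipK mulr_sumr -big_split /=; apply: eq_bigr => c _.
  by rewrite (inner_lin IP a (KF c) (KH c) (KX c)); ring.
- move=> F H KF KH; rewrite /ipK (rmorph_sum conjc); apply: eq_bigr => c _.
  by rewrite (inner_conj IP (KF c) (KH c)) (rmorphM conjc) /= oppr0.
- move=> F KF; apply: sumr_ge0 => c _; rewrite mulr_ge0 ?ler0c ?(ltW (kappa_gt0 c))//.
  exact: (inner_ge0 IP (KF c)).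
Qed.
Let KP := ipK_inner.
Let sK := inner_subspace KP.

Lemma inorm_ipK F : KL2 F ->
  inorm ipK F = \sum_c kappa c * inorm (ip I) (fun t => F (c, t)).
Proof.
move=> KF; apply: (@complexI R); rewrite -(inormE KP KF) /ipK (rmorph_sum (real_complex R)).
by apply: eq_bigr => c _; rewrite (inormE IP (KF c)) (rmorphM (real_complex R)).
Qed.

(** Conjugated because [ipK] is conjugate-linear on the right: [evaluation v] represents the value
    at [v] of a synthesis. *)
Definition evaluation v : 'I_r * R -> C := fun ct => conjc (E ct.2 ct.1 v).
Definition transform f : 'I_r * R -> C := fun ct => dot f (E ct.2 ct.1).
Definition synthesis F : V -> C := fun v => ipK F (evaluation v).
Definition mult (u : R -> C) (F : 'I_r * R -> C) : 'I_r * R -> C := fun ct => u ct.2 * F ct.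
Definition specC t : C := (spec q t)%:C%C.

Lemma evaluation_K v : KL2 (evaluation v).
Proof.
move=> c; have [K KV] := sf_bound SF v.
apply: (@L2D_bounded _ _ (@mI R) (@fI R) _ K) => [|t _]; last by rewrite nsq_conj.
by apply: cmeasurable_conj; exact: (sf_meas SF).
Qed.

Lemma transform_seq f s : uniq s -> (forall v, v \notin s -> f v = 0) ->
  transform f = fun ct => \sum_(v <- s) f v * (lam v)%:C%C * evaluation v ct.
Proof.
move=> us s0; apply/funext => ct; rewrite /transform (dot_seq lam us); last first.
  by move=> v /s0; left.
by apply: eq_bigr => v _; rewrite mulrAC.
Qed.

Lemma transform_K f : finitely_supported f -> KL2 (transform f).
Proof.
move=> /finitely_supportedP[s us s0]; rewrite (transform_seq us s0).
by apply: subspace_sum => // v _; exact: evaluation_K.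
Qed.

Lemma transform_adj F f : KL2 F -> finitely_supported f ->
  ipK F (transform f) = dot (synthesis F) f.
Proof.
move=> KF ff; have /finitely_supportedP[s us s0] := ff.
rewrite (inner_conj KP (transform_K ff) KF) (transform_seq us s0).
rewrite (inner_suml KP)//; last by move=> v _; exact: evaluation_K.
rewrite (dot_seq lam us); last by move=> v /s0; right.
rewrite (rmorph_sum conjc); apply: eq_bigr => v _.
rewrite (rmorphM conjc) /= -(inner_conj KP (evaluation_K v) KF) conjcM conjc_real.
by rewrite /synthesis; ring.
Qed.

Lemma transform_lin a f g : finitely_supported f -> finitely_supported g ->
  transform (fun v => a * f v + g v) = fun ct => a * transform f ct + transform g ct.
Proof. by move=> ff fg; apply/funext => ct; rewrite /transform dot_finite_lin. Qed.

Lemma synthesis_lin a F H : KL2 F -> KL2 H ->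
  synthesis (fun ct => a * F ct + H ct) = fun v => a * synthesis F v + synthesis H v.
Proof.
by move=> KF KH; apply/funext => v; rewrite /synthesis (inner_lin KP)//; exact: evaluation_K.
Qed.

Lemma mult_K u (b : R) F : cmeasurable I u -> (forall t, I t -> nsq (u t) <= b) -> KL2 F ->
  KL2 (mult u F) /\ inorm ipK (mult u F) <= b * inorm ipK F.
Proof.
move=> mu_ ub KF.
have h c := L2D_mul (@mI R) (@fI R) mu_ ub (KF c).
have KM : KL2 (mult u F) by move=> c; exact: (h c).1.
split=> //; rewrite !inorm_ipK// mulr_sumr; apply: ler_sum => c _.
by rewrite mulrCA ler_pM2l ?kappa_gt0//; exact: (h c).2.
Qed.

Lemma mult_adj u F H : (forall t, conjc (u t) = u t) ->
  ipK (mult u F) H = ipK F (mult u H).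
Proof.
move=> ur; apply: eq_bigr => c _; congr (_ * _); apply: eq_cintegral => t _.
by rewrite /mult /= (rmorphM conjc) /= ur; ring.
Qed.

Lemma cmeasurable_spec : cmeasurable I specC.
Proof.
apply: cmeasurable_real; apply: measurable_funTS.
exact: (@measurable_scaled_cos R (2 * k)).
Qed.

Lemma specC_bound t : nsq (specC t) <= (2 * k) ^+ 2.
Proof.
by rewrite nsqR /spec exprMn ler_piMr ?sqr_ge0//; have h1 := cos_le1 t; have h2 := cos_geN1 t; nra.
Qed.

Lemma specC_real t : conjc (specC t) = specC t. Proof. exact: conjc_real. Qed.

Lemma mult_spec_K F : KL2 F -> KL2 (mult specC F).
Proof. by move=> KF; case: (mult_K cmeasurable_spec (fun t _ => specC_bound t) KF). Qed.

Lemma transform_nbop f : finitely_supported f ->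
  transform (A f) = mult specC (transform f).
Proof.
move=> ff; apply/funext => ct; rewrite /transform /mult.
by rewrite (dot_nbop_eigen G (x := spec q ct.2))//; exact: (sf_eigen SF).
Qed.

(** Multiplication by the real function [specC] moves to [evaluation v], where the eigenvalue
    equation turns it into a sum over neighbors. *)
Lemma synthesis_nbop F : KL2 F -> A (synthesis F) = synthesis (mult specC F).
Proof.
move=> KF; apply/funext => v; rewrite /synthesis (mult_adj _ _ specC_real).
have -> : mult specC (evaluation v) = fun ct => \sum_(u <- nb v) 1 * evaluation u ct.
  apply/funext => ct; under eq_bigr do rewrite mul1r.
  have := congr1 (fun f => conjc (f v)) (sf_eigen SF ct.2 ct.1).
  rewrite /= conjcM conjc_real /mult /evaluation /specC => <-.
  by rewrite /nbop (rmorph_sum conjc).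
have KS : KL2 (fun ct => \sum_(u <- nb v) 1 * evaluation u ct).
  by apply: subspace_sum => // u _; exact: evaluation_K.
rewrite (inner_conj KP KS KF) (inner_suml KP)//; last by move=> u _; exact: evaluation_K.
rewrite (rmorph_sum conjc); apply: eq_bigr => u _.
by rewrite mul1r; exact: (inner_conj KP (evaluation_K u) KF).
Qed.

Lemma S_bound t c c' : 0 <= t <= pi -> t \notin bad -> nsq (S t c' c) <= width c / width c'.
Proof.
move=> t0 tb; have wP := cg_width G.
have h := sf_unitary SF c c t0 tb; rewrite eqxx mulr1 in h.
have e : \sum_i width i * nsq (S t i c) = width c.
  apply: (@complexI R); rewrite -h (rmorph_sum (real_complex R)); apply: eq_bigr => i _.
  by rewrite -nsqE -(rmorphM (real_complex R)).
rewrite ler_pdivlMr// -e (bigD1 c')//= mulrC lerDl; apply: sumr_ge0 => i _.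
by rewrite mulr_ge0 ?nsq_ge0// ltW.
Qed.

Lemma evaluation_ray c n c' t : (0 < n)%N -> 0 <= t <= pi ->
  evaluation (ray c n) (c', t) = (t \notin bad)%:R * (k%:C%C ^+ n *
    (zbpow n t * (c == c')%:R + zpow n t * conjc (S t c c'))).
Proof.
move=> n0 t0; rewrite /evaluation /=; have [tb|tb] := boolP (t \in bad).
  by rewrite (sf_zero SF _ _ tb) conjc0 mul0r.
rewrite mul1r (sf_ray SF c' t0 tb)// conjcM conjcX conjc_real conjcD !conjcM conjc_nat.
by rewrite !conjcX cis_inv conjcK.
Qed.

(** On a cusp the transform combines powers of [z] and of its conjugate with the same coefficients,
    up to bounded scattering factors; [parseval] controls both together. *)
Lemma ray_transform_bound c : exists2 B : R, 0 <= B & forall M (b : nat -> C),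
  inorm ipK (fun ct => \sum_(n < M) b n * evaluation (ray c n.+1) ct) <=
  B * \sum_(n < M) nsq (b n) * (k ^+ n.+1) ^+ 2.
Proof.
have wP := cg_width G.
pose B := \sum_c' kappa c' * ((2 + 2 * (width c' / width c)) * (2 * pi)).
have Ks0 c' : 0 <= width c' / width c by rewrite divr_ge0// ltW.
exists B.
  apply: sumr_ge0 => c' _; rewrite mulr_ge0 ?(ltW (kappa_gt0 _))// mulr_ge0 ?mulr_ge0 ?pi_ge0//.
  by rewrite addr_ge0// mulr_ge0.
(* The exponent is the height: entry [n] belongs to height [n], and entry 0 is empty. *)
move=> M b; pose a n : C := if n is m.+1 then b m * k%:C%C ^+ n else 0.
have aE (z : nat -> R -> C) t :
    \sum_(n < M.+1) a n * z n t = \sum_(n < M) b n * k%:C%C ^+ n.+1 * z n.+1 t.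
  by rewrite big_ord_recl mul0r add0r.
have KF : KL2 (fun ct => \sum_(n < M) b n * evaluation (ray c n.+1) ct).
  by apply: subspace_sum => // n _; exact: evaluation_K.
rewrite inorm_ipK// /B mulr_suml; apply: ler_sum => c' _.
rewrite -!mulrA ler_pM2l ?kappa_gt0//.
have Lp : L2D I (fun t => \sum_(n < M.+1) a n * zpow n t).
  by apply: subspace_sum => // n _; exact: L2D_zpow.
have Lq : L2D I (fun t => \sum_(n < M.+1) a n * zbpow n t).
  by apply: subspace_sum => // n _; exact: L2D_zbpow.
apply: le_trans (inorm_le2 (@mI R) (a := 2 * (width c' / width c)) (b := 2) (KF c') Lp Lq _) _.
  move=> t; rewrite /= in_itv /= => t0.
  under [X in nsq X <= _]eq_bigr do rewrite evaluation_ray//.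
  have [tb|tb] := boolP (t \in bad).
    rewrite [X in nsq X]big1 ?nsq0 => [|i _]; last by rewrite mul0r mulr0.
    by rewrite addr_ge0// mulr_ge0 ?nsq_ge0// mulr_ge0.
  have -> : \sum_(n < M) b n * (1 * (k%:C%C ^+ n.+1 *
        (zbpow n.+1 t * (c == c')%:R + zpow n.+1 t * conjc (S t c c')))) =
      conjc (S t c c') * (\sum_(n < M.+1) a n * zpow n t) +
      (c == c')%:R * (\sum_(n < M.+1) a n * zbpow n t).
    by rewrite !aE !mulr_sumr -big_split /=; apply: eq_bigr => n _; ring.
  apply: le_trans (nsqD_le _ _) _; rewrite !nsqM nsq_conj; apply: lerD.
    rewrite -mulrA ler_pM2l// ler_wpM2r ?nsq_ge0//; exact: S_bound.
  rewrite ler_pM2l//; case: (c == c'); rewrite ?mulr1n ?mulr0n.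
    by rewrite [nsq 1](_ : _ = 1) ?mul1r// /nsq /=; ring.
  by rewrite nsq0 mul0r nsq_ge0.
have nn f : L2D I f -> 0 <= inorm (ip I) f by exact: (inorm_ge0 IP).
have pars := parseval M.+1 a.
have sumE : \sum_(n < M.+1) nsq (a n) = \sum_(n < M) nsq (b n) * (k ^+ n.+1) ^+ 2.
  rewrite big_ord_recl /= nsq0 add0r; apply: eq_bigr => n _.
  by rewrite nsqM -(rmorphXn (real_complex R)) nsqR.
rewrite sumE in pars.
have -> : (2 + 2 * (width c' / width c)) * (2 * (pi * \sum_(n < M) nsq (b n) * (k ^+ n.+1) ^+ 2)) =
   (2 + 2 * (width c' / width c)) * (2 * pi * \sum_(n < M) nsq (b n) * (k ^+ n.+1) ^+ 2) by ring.
rewrite -pars; have aux (w x y : R) : 0 <= x -> 0 <= y -> 0 <= w ->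
    2 * w * x + 2 * y <= (2 + 2 * w) * (x + y).
  move=> x0 y0 w0; rewrite -subr_ge0.
  have -> : (2 + 2 * w) * (x + y) - (2 * w * x + 2 * y) = 2 * x + 2 * (w * y) by ring.
  by rewrite addr_ge0// !mulr_ge0.
by apply: aux; [exact: nn|exact: nn|exact: Ks0].
Qed.

Lemma support_bound (f : V -> C) : finitely_supported f ->
  exists M, forall c n, (M <= n)%N -> f (ray c n.+1) = 0.
Proof.
move=> /finitely_supportedP[s us s0].
pose idx v : nat := if pselect (exists n c, v = ray c n.+1) is left h then projT1 (cid h) else 0.
exists (\max_(v <- s) (idx v).+1) => c n Mn; have [vs|/s0//] := boolP (ray c n.+1 \in s).
have : ((idx (ray c n.+1)).+1 <= \max_(v <- s) (idx v).+1)%N.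
  by apply: (@leq_bigmax_seq _ s xpredT (fun v => (idx v).+1)).
have -> : idx (ray c n.+1) = n.
  rewrite /idx; case: pselect => [h|[]]; last by exists n, c.
  by case: (cid h) => /= m [c' e]; have [_ <-] := ray_eq G e.
by move=> nM; have := leq_trans nM Mn; rewrite ltnn.
Qed.

(** The support is cut into the core, finite and treated crudely, and one stretch per cusp, treated
    by [ray_transform_bound]. Along a cusp [lam * q ^+ n] is constant, which turns the latter bound
    into one by the norm of [f]. *)
Lemma transform_bound : exists2 B : R, 0 <= B & forall f, finitely_supported f ->
  inorm ipK (transform f) <= B * inorm dot f.
Proof.
have wP := cg_width G.
have /boolp.choice[Br /all_and2[Br0 BrP]] : forall c, exists B : R, 0 <= B /\ forall M (b : nat -> C),
    inorm ipK (fun ct => \sum_(n < M) b n * evaluation (ray c n.+1) ct) <=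
    B * \sum_(n < M) nsq (b n) * (k ^+ n.+1) ^+ 2.
  by move=> c; have [B] := ray_transform_bound c; exists B.
have ev0 v : 0 <= inorm ipK (evaluation v) by exact: (inorm_ge0 KP (evaluation_K v)).
pose B1 := 2 ^+ size cs * \sum_(v <- cs) lam v * inorm ipK (evaluation v).
pose B2 := 2 ^+ size (index_enum 'I_r) * \sum_c Br c * (width c * (q%:R + 1)).
have B10 : 0 <= B1.
  by rewrite mulr_ge0 ?exprn_ge0// sumr_ge0// => v _; rewrite mulr_ge0// ltW.
have B20 : 0 <= B2.
  rewrite mulr_ge0 ?exprn_ge0// sumr_ge0// => c _; rewrite mulr_ge0// mulr_ge0 ?(ltW (wP _))// addr_ge0.
exists (2 * B1 + 2 * B2); first by rewrite addr_ge0// mulr_ge0.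
move=> f ff; have Lf : L2 f by exact: finite_L2.
have [M MP] := support_bound ff.
pose rl := [seq ray c n.+1 | c <- index_enum 'I_r, n <- iota 0 M].
have url : uniq rl.
  apply: allpairs_uniq; rewrite ?index_enum_uniq ?iota_uniq// => -[c n] [c' n'] _ _ /=.
  by move=> /(ray_eq G)[-> ->].
have ucr : uniq (cs ++ rl).
  rewrite cat_uniq core_uniq url andbT; apply/hasPn => v /allpairsP[[c n] [_ _ ->]] /=.
  by apply: ray_notin_core => //; exact: G.
have supp v : v \notin cs ++ rl -> f v = 0.
  rewrite mem_cat negb_or => /andP[vc vr]; have [|[c [n [n0 vE]]]] := core_or_ray G v.
    by rewrite (negbTE vc).
  case: n n0 vE => // n _ vE; rewrite vE; apply: MP; rewrite leqNgt; apply: contra vr => nM; rewrite vE.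
  by apply/allpairsP; exists (c, n); rewrite mem_index_enum mem_iota.
pose X ct := \sum_(v <- cs) f v * (lam v)%:C%C * evaluation v ct.
pose Y c ct := \sum_(n < M) f (ray c n.+1) * (lam (ray c n.+1))%:C%C * evaluation (ray c n.+1) ct.
have TE : transform f = fun ct => X ct + \sum_c Y c ct.
  rewrite (transform_seq ucr supp); apply/funext => ct; rewrite big_cat /=; congr (_ + _).
  rewrite big_allpairs_dep; apply: eq_bigr => c _.
  rewrite /Y -(big_mkord xpredT (fun n : nat => f (ray c n.+1) * (lam (ray c n.+1))%:C%C * evaluation (ray c n.+1) ct)).
  by rewrite /index_iota subn0.
have KX : KL2 X by apply: subspace_sum => // v _; exact: evaluation_K.
have KY c : KL2 (Y c) by apply: subspace_sum => // n _; exact: evaluation_K.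
have KYs : KL2 (fun ct => \sum_c Y c ct).
  have := @subspace_sum _ _ _ _ (index_enum 'I_r) xpredT (fun=> 1) Y sK (fun c _ => KY c).
  by congr KL2; apply/funext => v; apply: eq_bigr => i _; rewrite mul1r.
rewrite TE mulrDl; apply: le_trans (inormD KP KX KYs) _.
have n0 := inorm_ge0 dotP Lf.
rewrite -!mulrA; apply: lerD; rewrite ler_pM2l//.
  apply: le_trans (@inorm_sum_le _ _ _ _ _ cs (fun v ct => f v * (lam v)%:C%C * evaluation v ct) KP _) _.
    by move=> v; exact: (subspaceZ (f v * (lam v)%:C%C) sK (evaluation_K v)).
  rewrite ler_wpM2l ?exprn_ge0// mulr_suml; apply: ler_sum => v _.
  rewrite (inormZ KP)//; last exact: evaluation_K.
  rewrite nsqM nsqR mulrAC; have := @sum_le_inorm _ _ _ lam0 f [:: v] Lf isT.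
  rewrite big_seq1; have lv := lam0 v; have ev := ev0 v => h.
  have -> : nsq (f v) * inorm ipK (evaluation v) * lam v ^+ 2 =
    lam v * inorm ipK (evaluation v) * (nsq (f v) * lam v) by ring.
  by rewrite ler_wpM2l// mulr_ge0// ltW.
apply: le_trans (@inorm_sum_le _ _ _ _ _ (index_enum 'I_r) Y KP KY) _.
rewrite ler_wpM2l ?exprn_ge0// mulr_suml; apply: ler_sum => c _.
apply: le_trans (BrP c M (fun n => f (ray c n.+1) * (lam (ray c n.+1))%:C%C)) _.
rewrite -mulrA ler_wpM2l//.
have -> : \sum_(n < M) nsq (f (ray c n.+1) * (lam (ray c n.+1))%:C%C) * (k ^+ n.+1) ^+ 2 =
    width c * (q%:R + 1) * \sum_(n < M) nsq (f (ray c n.+1)) * lam (ray c n.+1).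
  rewrite mulr_sumr; apply: eq_bigr => n _; rewrite nsqM nsqR.
  have -> : (k ^+ n.+1) ^+ 2 = q%:R ^+ n.+1 by rewrite -exprM mulnC exprM (kk R q).
  have e : lam (ray c n.+1) * q%:R ^+ n.+1 = width c * (q%:R + 1).
    rewrite (cg_weight G)// mulfVK// expf_neq0// gt_eqF//; exact: (q_gt0 G).
  by rewrite -e; ring.
rewrite ler_wpM2l ?mulr_ge0 ?addr_ge0 ?(ltW (wP c))//.
have := @sum_le_inorm _ _ _ lam0 f [seq ray c n.+1 | n <- index_iota 0 M] Lf.
rewrite big_map big_mkord; apply; rewrite map_inj_uniq ?iota_uniq//.
by move=> n n' /(ray_eq G)[].
Qed.

(** Duality: pairing the synthesis with its own truncation, of squared norm [x], gives
    [x ^+ 2 <= B * inorm ipK F * x]. *)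
Lemma synthesis_L2 : exists2 B : R, 0 <= B & forall F, KL2 F ->
  L2 (synthesis F) /\ inorm dot (synthesis F) <= B * inorm ipK F.
Proof.
have [B B0 BP] := transform_bound; exists B => // F KF; apply: L2_bound => // s us.
set x := \sum_(v <- s) _.
pose f := restrict_to s (synthesis F).
have ff : finitely_supported f by exact: restrict_finite.
have x0 : 0 <= x by apply: sumr_ge0 => v _; rewrite mulr_ge0 ?nsq_ge0// ltW.
have fE v : v \notin s -> f v = 0 by rewrite /f /restrict_to => /negbTE ->.
have xE : dot (synthesis F) f = x%:C%C.
  rewrite (dot_seq lam us); last by move=> v /fE; right.
  rewrite (rmorph_sum (real_complex R)) /= big_seq [RHS]big_seq; apply: eq_bigr => v vs.
  by rewrite /f /restrict_to vs -nsqE -(rmorphM (real_complex R)).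
have nf : inorm dot f = x.
  rewrite (inorm_seq lam us fE) /x !big_seq; apply: eq_bigr => v vs.
  by rewrite /f /restrict_to vs.
have := inner_CS KP KF (transform_K ff); rewrite (transform_adj KF ff) xE nsqR.
have := BP f ff; rewrite nf => h1 h2; have F0 := inorm_ge0 KP KF.
have : x ^+ 2 <= (B * inorm ipK F) * x.
  apply: le_trans h2 _; rewrite [B * _]mulrC -mulrA; exact: ler_wpM2l.
by have [->|xn0] := eqVneq x 0; [rewrite mulr_ge0|rewrite expr2 ler_pM2r// lt_neqAle eq_sym xn0].
Qed.

End Transform.

(** * The defect has finite rank *)

Section Defect.
Variables (R : realType) (V : choiceType) (lam : V -> R) (nb : V -> seq V)
  (q r : nat) (ray : 'I_r -> nat -> V) (width : 'I_r -> R).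
Hypothesis G : cusp_graph lam nb q ray width.
Local Notation C := R[i].
Local Notation A := (@nbop R V nb).
Local Notation cs := (core_seq ray).
Local Notation k := (Num.sqrt (q%:R : R)).
Local Notation dot := (dot lam).
Local Notation L2 := (L2 lam).
Local Notation I := (`[0, pi]%classic : set R).
Local Notation delta := (@delta R V).
Variables (E : R -> 'I_r -> V -> C) (S : R -> 'I_r -> 'I_r -> C) (bad : seq R)
  (d : {poly R}) (P : 'I_r -> 'I_r -> {poly R}).
Hypothesis SF : spectral_family nb q ray width E S bad d P.
Let lam0 := cg_lam G.
Let dotP := dot_inner lam0.
Let sI := L2D_subspace (@mI R) (@fI R).
Local Notation kappa := (kappa q width).
Local Notation ipK := (ipK q width).
Local Notation evaluation := (evaluation E).
Local Notation transform := (transform lam E).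
Local Notation synthesis := (synthesis q width E).
Lemma dot_finite_sum (J : Type) (s : seq J) (a : J -> C) (F : J -> V -> C) h :
  (forall j, finitely_supported (F j)) ->
  dot (fun v => \sum_(j <- s) a j * F j v) h = \sum_(j <- s) a j * dot (F j) h.
Proof.
move=> fF; elim: s => [|j s IH].
  rewrite big_nil (@dot_seq _ _ lam _ _ [::])//; first by rewrite big_nil.
  by move=> v _; left; rewrite big_nil.
have -> : (fun v => \sum_(i <- j :: s) a i * F i v) =
    fun v => a j * F j v + \sum_(i <- s) a i * F i v.
  by apply/funext => v; rewrite big_cons.
rewrite dot_finite_lin// ?IH ?big_cons//.
by apply: subspace_sum => //; exact: finite_subspace.
Qed.

(** Dividing by [lam] and by the power of [k] compensates the weight in [dot] and the growth along
    the cusp. In the transform the coefficients thus recombine to the value of [d] at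
    [conjc (cis t)], which clears the denominator of the scattering matrix. *)
Definition null_vector c n : V -> C := fun v =>
  \sum_(i < size d) (d`_i / (lam (ray c (n + i)%N) * k ^+ (n + i)))%:C%C * delta (ray c (n + i)%N) v.

Lemma null_vector_finite c n : finitely_supported (null_vector c n).
Proof. by apply: subspace_sum => [|i _]; [exact: finite_subspace|exact: delta_finite]. Qed.

Let pd t : C := pev (conjc (cis t)) d.
Let pP c c' t : C := pev (conjc (cis t)) (P c c').

Let zb_add n m t : zbpow (n + m) t = zbpow n t * zbpow m t :> C.
Proof. exact: exprD. Qed.

Let k0 : k%:C%C != 0 :> C.
Proof. by apply/eqP => /complexI/eqP; rewrite gt_eqF// (k_gt0 G). Qed.

Lemma transform_null c n c' t : (0 < n)%N -> 0 <= t <= pi ->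
  transform (null_vector c n) (c', t) = (t \notin bad)%:R *
    (zbpow n t * pd t * (c == c')%:R + conjc (zbpow n t * pP c c' t)).
Proof.
move=> n0 t0; rewrite /transform dot_finite_sum; last by move=> i; exact: delta_finite.
have [tb|tb] := boolP (t \in bad).
  rewrite mul0r big1// => i _.
  by rewrite dot_delta (sf_zero SF _ _ tb) conjc0 mul0r mulr0.
have -> : pP c c' t = pd t * S t c c' by rewrite (sf_pev SF).
rewrite mul1r {1 2}/pd pevE !mulr_sumr mulr_suml !mulr_suml mulr_sumr (rmorph_sum conjc) -big_split /=.
apply: eq_bigr => i _; rewrite dot_delta.
have ni : (0 < n + i)%N by rewrite addn_gt0 n0.
have := evaluation_ray SF c c' ni t0; rewrite /evaluation /= tb mul1r => ->.
have l0 : (lam (ray c (n + i)%N))%:C%C != 0 :> C.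
  by apply/eqP => /complexI/eqP; rewrite gt_eqF.
rewrite !conjcM conjc_real.
rewrite !(rmorphM (real_complex R)) (fmorphV (real_complex R)) (rmorphM (real_complex R)) (rmorphXn (real_complex R)) /=.
rewrite zb_add.
have -> : zpow (n + i) t = conjc (zbpow n t) * conjc (conjc (cis t) ^+ i).
  by rewrite -conjcM -[_ * _]/(zbpow n t * zbpow i t) -zb_add zbpow_conj conjcK.
rewrite -[conjc (cis t) ^+ i]/(zbpow i t).
by field; rewrite l0 expf_neq0.
Qed.

Lemma kappa_sym t c c' : 0 <= t <= pi -> t \notin bad ->
  (kappa c)%:C%C * S t c' c = (kappa c')%:C%C * S t c c'.
Proof.
move=> t0 tb; have := sf_sym SF c c' t0 tb.
have w0 i : (width i)%:C%C != 0 :> C by apply/eqP => /complexI/eqP; rewrite gt_eqF// (cg_width G).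
have kE i : (kappa i)%:C%C = (2 * pi * (q%:R + 1))^-1%:C%C / (width i)%:C%C :> C.
  by rewrite -(fmorphV (real_complex R)) -(rmorphM (real_complex R)) /= -invfM.
rewrite !kE; move: (w0 c) (w0 c') (_^-1%:C%C).
move: ((width c)%:C%C) ((width c')%:C%C) (S t c' c) (S t c c') => a b x y a0 b0 K0 e.
by apply: (mulfI a0); apply: (mulfI b0); transitivity (K0 * (b * x)); [|rewrite -e]; field.
Qed.

(** [kappa c] is proportional to the inverse width, and [sf_sym] exchanges the indices, so this is
    [sf_unitary] summed over the other index. *)
Lemma kappa_unitary t c c' : 0 <= t <= pi -> t \notin bad ->
  \sum_e (kappa e)%:C%C * (S t c' e * conjc (S t c e)) = (kappa c)%:C%C * (c == c')%:R.
Proof.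
move=> t0 tb.
have w0 i : (width i)%:C%C != 0 :> C by apply/eqP => /complexI/eqP; rewrite gt_eqF// (cg_width G).
have := sf_unitary SF c' c t0 tb; rewrite [c' == c]eq_sym => h.
have kE i : (kappa i)%:C%C = (2 * pi * (q%:R + 1))^-1%:C%C / (width i)%:C%C :> C.
  by rewrite -(fmorphV (real_complex R)) -(rmorphM (real_complex R)) /= -invfM.
transitivity ((kappa c')%:C%C / (width c)%:C%C * \sum_e (width e)%:C%C * (S t e c' * conjc (S t e c))).
  rewrite mulr_sumr; apply: eq_bigr => e _; rewrite mulrA (kappa_sym e c' t0 tb).
  have := congr1 conjc (sf_sym SF c e t0 tb); rewrite !conjcM !conjc_real => e2.
  have -> : conjc (S t c e) = (width e)%:C%C * conjc (S t e c) / (width c)%:C%C.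
    by rewrite -e2 mulrC mulKf.
  ring.
rewrite h !kE; case: eqP => [->|_]; last by rewrite !mulr0.
by rewrite !mulr1 mulfVK.
Qed.

(** By symmetry and unitarity the integrand is [K], made of trigonometric polynomials added to their
    conjugates, of which integration keeps the constant terms. [X] yields the coefficient of [d] at
    index [m - n], if there is one; [Y] has negative exponents only and yields nothing. *)
Lemma synthesis_null c n c' m : (0 < n)%N -> (0 < m)%N ->
  synthesis (transform (null_vector c n)) (ray c' m) = null_vector c n (ray c' m).
Proof.
move=> n0 m0; set F := transform _.
have KF : KL2 F by exact: (transform_K G SF (null_vector_finite c n)).
have KE := evaluation_K SF (ray c' m).
pose X t : C := \sum_(i < size d) (d`_i)%:C%C * (zpow m t * zbpow (n + i) t).
pose Y t : C := \sum_(j < size (P c c')) ((P c c')`_j)%:C%C * (zpow 0 t * zbpow (m + n + j) t).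
have izz a b : cintegrable I (fun t => zpow a t * zbpow b t).
  apply: (cintegrable_eq (@mI R) _ (cintegrable_mul (@mI R) (L2D_zpow R a) (L2D_zpow R b))) => t _.
  by rewrite zbpow_conj.
have [iX eX] := @cintegral_sum R I (@mI R) (@fI R) _ (index_enum 'I_(size d)) (fun i => (d`_i)%:C%C)
  (fun i t => zpow m t * zbpow (n + i) t) (fun i => izz _ _).
have [iY eY] := @cintegral_sum R I (@mI R) (@fI R) _ (index_enum 'I_(size (P c c'))) (fun j => ((P c c')`_j)%:C%C)
  (fun j t => zpow 0 t * zbpow (m + n + j) t) (fun i => izz _ _).
rewrite -/(X : R -> C) in iX eX; rewrite -/(Y : R -> C) in iY eY.
have iconj f : cintegrable I f -> cintegrable I (fun t => conjc (f t)).
  move=> [i1 i2]; split.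
    have -> : (fun t => (complex.Re (conjc (f t)))%:E) = (fun t => (complex.Re (f t))%:E).
      by apply/funext => t; case: (f t).
    exact: i1.
  have -> : (fun t => (complex.Im (conjc (f t)))%:E) = EFin \o (fun t => -1 * complex.Im (f t)).
    by apply/funext => t; rewrite /= mulN1r; case: (f t).
  exact: (integrable_scale (@mI R) (-1) i2).
(* The first summand joins the term free of scattering entries with the one quadratic in them, the
   second joins the two linear terms. *)
pose K t : C := k%:C%C ^+ m * ((kappa c)%:C%C * (c == c')%:R) * (X t + conjc (X t)) +
  k%:C%C ^+ m * (kappa c')%:C%C * (Y t + conjc (Y t)).
have sumC (p : {poly R}) (J : nat -> C) (u : nat -> R) : (forall i, J i + conjc (J i) = (u i)%:C%C) ->
    \sum_(i < size p) (p`_i)%:C%C * J i + conjc (\sum_(i < size p) (p`_i)%:C%C * J i) =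
    \sum_(i < size p) (p`_i)%:C%C * (u i)%:C%C.
  move=> Ju; rewrite (rmorph_sum conjc) -big_split; apply: eq_bigr => i _.
  have e : conjc ((p`_i)%:C%C * J i) = (p`_i)%:C%C * conjc (J i) by rewrite conjcM conjc_real.
  by rewrite -Ju mulrDr -e.
have sumJ (p : {poly R}) a b := sumC p _ _ (fun i => fourier_pairing_conj R a (b + i)).
have one f : cintegrable I f -> cintegrable I (fun t => f t + conjc (f t)) /\
    cintegral I (fun t => f t + conjc (f t)) = cintegral I f + conjc (cintegral I f).
  move=> if_; have [h1 h2] := cintegral_lin (@mI R) 1 if_ (iconj _ if_).
  split; first by apply: (cintegrable_eq (@mI R) _ h1) => t _; rewrite mul1r.
  rewrite -(cintegral_conj (@mI R) if_) -[cintegral I f]mul1r -h2.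
  by apply: eq_cintegral => t _; rewrite mul1r.
have [iXX eXX] := one _ iX; have [iYY eYY] := one _ iY.
have eK : cintegral I K = k%:C%C ^+ m * ((kappa c)%:C%C * (c == c')%:R) *
    \sum_(i < size d) (d`_i)%:C%C * (2 * pi * (m == (n + i)%N)%:R)%:C%C.
  have [iZ eZ] := cintegral_lin (@mI R) (k%:C%C ^+ m * (kappa c')%:C%C) iYY (g := fun=> 0)
    (cintegrable_L2D (@mI R) (@fI R) sI.1).
  have [_ e] := cintegral_lin (@mI R) (k%:C%C ^+ m * ((kappa c)%:C%C * (c == c')%:R)) iXX iZ.
  have -> : cintegral I K = cintegral I (fun t => k%:C%C ^+ m * ((kappa c)%:C%C * (c == c')%:R) *
      (X t + conjc (X t)) + (k%:C%C ^+ m * (kappa c')%:C%C * (Y t + conjc (Y t)) + 0)).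
    by apply: eq_cintegral => t _; rewrite addr0.
  rewrite e eZ eXX eYY eX eY (sumJ d m n) (sumJ (P c c') 0 (m + n)%N).
  (* [m + n] is positive, so no exponent of [Y] is zero. *)
  have -> : \sum_(i < size (P c c')) ((P c c')`_i)%:C%C * (2 * pi * (0 == (m + n + i)%N)%:R)%:C%C = 0.
    apply: big1 => i _; rewrite (_ : (0 == _)%N = false) ?mulr0 ?mulr0//.
    by apply/negbTE; rewrite eq_sym -lt0n !addn_gt0 m0.
  have -> : cintegral I (fun=> 0 : C) = 0.
    by rewrite /cintegral /= /Rintegral integral0.
  by rewrite mulr0 add0r addr0.
transitivity (cintegral I K).
  rewrite /synthesis /ipK /ip.
  have [_ <-] := @cintegral_sum R I (@mI R) (@fI R) _ (index_enum 'I_r) (fun e => (kappa e)%:C%C)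
    (fun e t => F (e, t) * conjc (evaluation (ray c' m) (e, t)))
    (fun e => cintegrable_mul (@mI R) (KF e) (KE e)).
  have mzz a b : cmeasurable I (fun t => zpow a t * zbpow b t).
    by apply: cmeasurableM; [exact: (L2D_zpow R a).1|exact: (L2D_zbpow R b).1].
  have mX : cmeasurable I X by apply: cmeasurable_sum => i; apply: cmeasurableM => //; exact: cmeasurable_cst.
  have mY : cmeasurable I Y by apply: cmeasurable_sum => i; apply: cmeasurableM => //; exact: cmeasurable_cst.
  apply: (@cintegral_off_seq R I (@mI R) bad).
  - apply: cmeasurable_sum => e; apply: cmeasurableM; first exact: cmeasurable_cst.
    by apply: cmeasurableM; [exact: (KF e).1|apply: cmeasurable_conj; exact: (KE e).1].
  - apply: cmeasurableD; apply: cmeasurableM; try exact: cmeasurable_cst.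
      by apply: cmeasurableD => //; exact: cmeasurable_conj.
    by apply: cmeasurableD => //; exact: cmeasurable_conj.
  move=> t; rewrite /= in_itv /= => t0 tb.
  have XE : X t = zpow m t * (zbpow n t * pd t).
    rewrite /X /pd pevE !mulr_sumr; apply: eq_bigr => i _; rewrite zb_add /zbpow; ring.
  have YE : Y t = zbpow m t * (zbpow n t * (pd t * S t c c')).
    rewrite (sf_pev SF c c' t0 tb) /Y pevE !mulr_sumr; apply: eq_bigr => i _.
    by rewrite !zb_add /zpow expr0 /zbpow; ring.
  have FE e : F (e, t) = zbpow n t * pd t * (c == e)%:R + conjc (zbpow n t * (pd t * S t c e)).
    by rewrite /F transform_null// tb mul1r /pP -(sf_pev SF c e t0 tb).
  have EE e : conjc (evaluation (ray c' m) (e, t)) =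
      k%:C%C ^+ m * (zpow m t * (c' == e)%:R + zbpow m t * S t c' e).
    rewrite (evaluation_ray SF)// tb mul1r conjcM conjcX conjc_real conjcD !conjcM conjc_nat conjcK.
    have hz : conjc (zbpow m t) = zpow m t :> C by rewrite zbpow_conj conjcK.
    by rewrite hz -zbpow_conj.
  under eq_bigr do rewrite FE EE.
  pose a := zbpow n t * pd t.
  transitivity (k%:C%C ^+ m * (\sum_e (kappa e)%:C%C * ((c == e)%:R * (c' == e)%:R) * (a * zpow m t) +
     \sum_e (c' == e)%:R * ((kappa e)%:C%C * (conjc (a * S t c e) * zpow m t)) +
     \sum_e (c == e)%:R * ((kappa e)%:C%C * (S t c' e * (a * zbpow m t))) +
     (\sum_e (kappa e)%:C%C * (S t c' e * conjc (S t c e))) * (zbpow m t * conjc a))).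
    rewrite [X in _ + X]mulr_suml -!big_split mulr_sumr /=; apply: eq_bigr => e _.
    rewrite /a mulrA !conjcM; ring.
  rewrite (kappa_unitary c c' t0 tb).
  have pick (i : 'I_r) (H : 'I_r -> C) : \sum_e (i == e)%:R * H e = H i.
    rewrite (bigD1 i)//= eqxx mul1r big1 ?addr0// => e ei.
    by rewrite eq_sym (negbTE ei) mul0r.
  rewrite !pick [X in _ * (_ + _ + X + _)]mulrA (kappa_sym c c' t0 tb).
  have -> : \sum_e (kappa e)%:C%C * ((c == e)%:R * (c' == e)%:R) * (a * zpow m t) =
     (kappa c)%:C%C * (c == c')%:R * (a * zpow m t).
    transitivity (\sum_e (c == e)%:R * ((kappa e)%:C%C * (c' == e)%:R * (a * zpow m t))).
      by apply: eq_bigr => e _; ring.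
    by rewrite pick [c' == c]eq_sym.
  have hz : conjc (zpow m t) = zbpow m t :> C by rewrite zbpow_conj.
  have hb : conjc (zbpow m t) = zpow m t :> C by rewrite zbpow_conj conjcK.
  rewrite /K XE YE /a !conjcM hz hb; ring.
rewrite eK /null_vector mulr_sumr; apply: eq_bigr => i _; rewrite /delta.
have -> : (ray c' m == ray c (n + i)%N) = (c == c') && (m == (n + i)%N).
  apply/eqP/andP => [/(cg_inj G)[]//|[/eqP -> /eqP ->//]]; last by move=> -> ->; rewrite !eqxx.
  by rewrite addn_gt0 n0.
case: eqP => [_|]; last by rewrite !(mulr0, mul0r).
case: eqP => [<-|]; last by rewrite !(mulr0, mul0r).
have -> : (true && true)%:R = 1 :> C by [].
have -> : true%:R = 1 :> R by [].
rewrite !mulr1 -(rmorphXn (real_complex R)) -!(rmorphM (real_complex R)); congr (_%:C)%C.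
(* Since [k ^+ 2 = q], the weight formula makes [2 * pi * kappa c] the inverse of
   [lam (ray c m) * q ^+ m]. *)
have w0 := cg_width G c; have p0 := pi_gt0 R; rewrite (cg_weight G)// /kappa.
move: (k_gt0 G) (kk R q); move: (Num.sqrt (q%:R : R)) => y y0 <-.
have q1 : 0 < y ^+ 2 + 1 by rewrite ltr_wpDl// sqr_ge0.
rewrite -exprM mulnC exprM; move: (y ^+ m) (exprn_gt0 m y0) => l l0.
have aux (w Q x p dd : R) : w != 0 -> Q != 0 -> x != 0 -> p != 0 ->
    x / (2 * p * Q * w) * (dd * (2 * p)) = dd / (w * Q / x ^+ 2 * x).
  by move=> *; field; do ?[apply/andP; split].
by apply: aux; exact: lt0r_neq0.
Qed.

Definition defect f : V -> C := fun v => f v - synthesis (transform f) v.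

Lemma defect_lin (a : C) f g : finitely_supported f -> finitely_supported g ->
  defect (fun v => a * f v + g v) = fun v => a * defect f v + defect g v.
Proof.
move=> ff fg; apply/funext => v; rewrite /defect transform_lin//.
rewrite (synthesis_lin G SF a (transform_K G SF ff) (transform_K G SF fg)).
by rewrite mulrBr opprD addrACA.
Qed.

Lemma defect0 : defect (fun=> 0) = fun=> 0.
Proof.
have f0 := (finite_subspace R V).1.
have := defect_lin (-1) f0 f0.
have -> : (fun v : V => -1 * 0 + 0 : C) = fun=> 0 by apply/funext => v; rewrite mulr0 addr0.
by move=> ->; apply/funext => v; rewrite mulN1r addNr.
Qed.

Lemma defect_sum (J : Type) (s : seq J) (a : J -> C) (F : J -> V -> C) :
  (forall j, finitely_supported (F j)) ->
  defect (fun v => \sum_(j <- s) a j * F j v) = fun v => \sum_(j <- s) a j * defect (F j) v.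
Proof.
move=> fF; elim: s => [|j s IH].
  transitivity (defect (fun=> 0)); first by congr defect; apply/funext => v; rewrite big_nil.
  by rewrite defect0; apply/funext => v; rewrite big_nil.
have -> : (fun v => \sum_(i <- j :: s) a i * F i v) =
    fun v => a j * F j v + \sum_(i <- s) a i * F i v.
  by apply/funext => v; rewrite big_cons.
rewrite defect_lin// ?IH; first by apply/funext => v; rewrite big_cons.
by apply: subspace_sum => //; exact: finite_subspace.
Qed.

Lemma defect_nbop f : finitely_supported f -> defect (A f) = A (defect f).
Proof.
move=> ff; have -> : defect f = fun v => f v - synthesis (transform f) v by [].
rewrite (linopB (@nbop_lin R V nb)) (synthesis_nbop G SF (transform_K G SF ff)).
by rewrite /defect (transform_nbop G SF ff).
Qed.

Lemma defect_L2 f : finitely_supported f -> L2 (defect f).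
Proof.
move=> ff; apply: (subspaceB (L2_subspace lam0)); first exact: finite_L2.
by have [B _ BP] := synthesis_L2 G SF; case: (BP _ (transform_K G SF ff)).
Qed.

(* By induction along the cusp: the null vector based at n expresses the defect
   of the point mass at n + deg d through earlier ones and the core. *)
Lemma defect_finite_rank : exists (J : finType) (e : J -> V -> C),
  forall f, finitely_supported f -> exists a : J -> C, defect f = fun v => \sum_j a j * e j v.
Proof.
pose cv (i : 'I_(size cs)) := tnth (in_tuple cs) i.
pose e (j : 'I_(size cs) + 'I_(size cs) + 'I_r * 'I_(size d)) : V -> C :=
  match j with
  | inl (inl i) => defect (delta (cv i))
  | inl (inr i) => delta (cv i)
  | inr (c, n) => defect (delta (ray c n.+1))
  end.
exists ('I_(size cs) + 'I_(size cs) + 'I_r * 'I_(size d))%type, e.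
pose X : set (V -> C) := [set g | exists a : _ -> C, g = fun v => \sum_j a j * e j v].
have sX : is_subspace X.
  split; first by exists (fun=> 0); apply/funext => v; rewrite big1// => j _; rewrite mul0r.
  move=> z _ _ [a ->] [b ->]; exists (fun j => z * a j + b j); apply/funext => v.
  by rewrite mulr_sumr -big_split /=; apply: eq_bigr => j _; ring.
have Xe j : X (e j).
  exists (fun i => (i == j)%:R); apply/funext => v.
  by rewrite (bigD1 j)//= eqxx mul1r big1 ?addr0// => i /negbTE ->; rewrite mul0r.
have cvP v : v \in cs -> exists i, v = cv i.
  move=> vc; have iv : (index v cs < size cs)%N by rewrite index_mem.
  by exists (Ordinal iv); rewrite /cv (tnth_nth v) /= nth_index.
have Xcore g : (forall v, v \notin cs -> g v = 0) -> X g.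
  move=> g0;
  have -> : g = fun u => \sum_(i < size cs) g (cv i) * delta (cv i) u.
    by rewrite {1}(finite_sum_delta (core_uniq ray) g0); apply/funext => u; rewrite [LHS]big_tnth.
  by apply: subspace_sum => // i _; exact: (Xe (inl (inr i))).
have Xray c n : X (defect (delta (ray c n.+1))).
  elim/ltn_ind: n => n IH; have [nd|dn] := ltnP n (size d).
    exact: (Xe (inr (c, Ordinal nd))).
  (* [D] will be the degree of [d]; the null vector based at [n'] ends exactly at height [n.+1], and
     [n'] is positive because [size d <= n]. *)
  have d0 : (0 < size d)%N by rewrite size_poly_gt0 (sf_d SF).
  pose D := (size d).-1; pose n' := (n.+1 - D)%N.
  have n'0 : (0 < n')%N by rewrite /n' /D subn_gt0; lia.
  (* By [synthesis_null] this defect vanishes on every cusp, so it is spanned by point masses of the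
     core. *)
  have Xnull : X (defect (null_vector c n')).
    apply: Xcore => v vc; have [|[c' [m [m0 ->]]]] := core_or_ray G v; first by rewrite (negbTE vc).
    by rewrite /defect synthesis_null// subrr.
  have nD : (n' + D = n.+1)%N by rewrite /n' subnK// (leq_trans (leq_pred _))// ltnW.
  pose mu_ i : C := (d`_i / (lam (ray c (n' + i)%N) * k ^+ (n' + i)))%:C%C.
  (* Up to a nonzero factor this is the leading coefficient of [d]. *)
  have mu0 : mu_ D != 0.
    apply/eqP => /complexI/eqP; rewrite mulf_eq0 invr_eq0 mulf_eq0 expf_eq0.
    rewrite (gt_eqF (k_gt0 G)) andbF (gt_eqF (lam0 _)) !orbF -[d`_D]/(lead_coef d).
    by rewrite lead_coef_eq0 (negbTE (sf_d SF)).
  have := @defect_sum _ (index_enum 'I_(size d)) (fun i : 'I_(size d) => mu_ i)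
    (fun i : 'I_(size d) => delta (ray c (n' + i)%N)) (fun i => @delta_finite R V _).
  rewrite -/(null_vector c n') => e1.
  have sd : (size d = D.+1)%N by rewrite /D prednK.
  have e2 : defect (delta (ray c n.+1)) = fun v => (mu_ D)^-1 * (defect (null_vector c n') v -
      \sum_(i < D) mu_ i * defect (delta (ray c (n' + i)%N)) v).
    apply/funext => v; rewrite e1.
    have -> : \sum_(i < size d) mu_ i * defect (delta (ray c (n' + i)%N)) v =
      \sum_(i < D) mu_ i * defect (delta (ray c (n' + i)%N)) v + mu_ D * defect (delta (ray c (n' + D)%N)) v.
      by rewrite sd big_ord_recr.
    by rewrite nD [X in _ * (X - _)]addrC addrK mulKf.
  rewrite e2; apply: subspaceZ => //; apply: subspaceB => //.
  apply: (@subspace_sum R V X 'I_D (index_enum 'I_D) xpredT (fun i => mu_ i)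
    (fun i : 'I_D => defect (delta (ray c (n' + i)%N))) sX) => i _.
  have -> : (n' + i = (n' + i).-1.+1)%N by rewrite prednK// addn_gt0 n'0.
  by apply: IH; rewrite -ltnS prednK ?addn_gt0 ?n'0// -nD ltn_add2l ltn_ord.
have Xd v : X (defect (delta v)).
  have [vc|[c [n [n0 ->]]]] := core_or_ray G v; last by case: n n0.
  by have [i ->] := cvP v vc; exact: (Xe (inl (inl i))).
move=> f /finitely_supportedP[s us s0].
rewrite (finite_sum_delta us s0) defect_sum; last by move=> v; exact: delta_finite.
by apply: (subspace_sum (X := X)).
Qed.

(** The range of the defect is finite-dimensional, and invariant because the defect commutes with
    [A]; so the symmetric operator [A] is diagonalizable on it. *)
Lemma defect_eigenbasis : exists m (psi : 'I_m -> V -> C) (x : 'I_m -> R),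
  [/\ forall i, L2 (psi i), forall i j, dot (psi i) (psi j) = (i == j)%:R,
      forall i, A (psi i) = (fun v => (x i)%:C%C * psi i v) &
      forall f, finitely_supported f ->
        defect f = (fun v => \sum_i dot (defect f) (psi i) * psi i v)].
Proof.
have [J [e eP]] := defect_finite_rank.
pose X : set (V -> C) := [set g | exists2 f, finitely_supported f & g = defect f].
have sX : is_subspace X.
  split; first by exists (fun=> 0); [exact: (finite_subspace R V).1|rewrite defect0].
  move=> a _ _ [f ff ->] [g fg ->]; exists (fun v => a * f v + g v).
    exact: (finite_subspace R V).2.
  by rewrite defect_lin.
have XL2 : X `<=` L2 by move=> _ [f ff ->]; exact: defect_L2.
have XA f : X f -> X (A f).
  by move=> [g fg ->]; exists (A g); [exact: (nbop_finite G)|rewrite defect_nbop].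
have dX : dim_le #|J| X.
  apply: (@span_dim_le _ _ _ _ (fun i => e (enum_val i))) => _ [f ff ->].
  have [a ->] := eP f ff; exists (fun i => a (enum_val i)); apply/funext => v.
  by rewrite (reindex (@enum_val J xpredT)) //=; apply: onW_bij; exact: enum_val_bij.
have symX f g : X f -> X g -> dot (A f) g = dot f (A g).
  by move=> /XL2 Lf /XL2 Lg; exact: (nbop_sym G).
have [m [psi [x [Xp pp Ap pX]]]] := orthonormal_eigenbasis dotP (dot_definite lam0)
  (@nbop_lin R V nb) sX XL2 dX XA symX.
exists m, psi, x; split=> // [i|f ff]; first exact: XL2.
by apply: pX; exists f.
Qed.

End Defect.

(** * Injectivity of the synthesis and the spectral decomposition *)

Section MomentsAe.
Variable R : realType.
Local Notation mu := (@lebesgue_measure R).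
Local Notation mR := (measurableTypeR R).
Local Notation I := (`[0, pi]%classic : set R).
Variable a : R.
Hypothesis a0 : 0 < a.

Lemma measurable_scaled_acos : measurable_fun (`]- a, a[%classic : set mR) (fun x => acos (x / a)).
Proof.
apply: open_continuous_measurable_fun; first exact: itv_open.
move=> x /set_mem; rewrite /= in_itv /= => /andP[x1 x2].
apply: (@continuous_comp _ _ _ (fun x : R => x / a) (@acos R)).
  by apply: cvgMl; exact: cvg_id.
apply: continuous_acos; apply/andP; split.
  by rewrite ltr_pdivlMr// mulN1r.
by rewrite ltr_pdivrMr// mul1r.
Qed.

Lemma scaled_cosK (t : R) : 0 <= t <= pi -> acos (a * cos t / a) = t.
Proof. by move=> t0; rewrite mulrC mulKf ?gt_eqF// cosK ?in_itv. Qed.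

Lemma scaled_cos_open (t : R) : 0 < t < pi -> - a < a * cos t < a.
Proof.
move=> /andP[t0 tp]; have s0 : 0 < sin t by rewrite sin_gt0_pi// t0 tp.
have := cos2Dsin2 t; have : 0 < sin t ^+ 2 by rewrite exprn_gt0.
move=> s2 e; have c1 : cos t ^+ 2 < 1 by rewrite -e ltrDl.
have /andP[l u] : - 1 < cos t < 1 by rewrite -ltr_norml -(ltr_pXn2r (n := 2)) ?nnegrE// real_normK ?num_real// expr1n.
by rewrite -[- a]mulrN1 ltr_pM2l// l -[ltRHS]mulr1 ltr_pM2l.
Qed.

Lemma integrable_patch (u : R -> R) : mu.-integrable I (EFin \o u) ->
  mu.-integrable setT (EFin \o (u \_ I)).
Proof.
move=> /(integrable_mkcond _ (@mI R)).
by congr (integrable _ _ _); apply/funext => t; rewrite /= !patchE; case: ifP.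
Qed.

(** The densities |u| and |u| + u have push-forwards under [a * cos t] with the same moments, hence
    equal. Up to the two end points the set [u > 0] is the preimage of a Borel set, the cosine being
    injective, and on it the equality makes the integral of [u] vanish. *)
Lemma moments_positive_null (u : R -> R) : mu.-integrable I (EFin \o u) ->
  (forall n, \int[mu]_(t in I) ((a * cos t) ^+ n * u t) = 0) ->
  {ae mu, forall t, I t -> ~ 0 < u t}.
Proof.
move=> iu mom; pose g := u \_ I.
have ig : mu.-integrable setT (EFin \o g) by exact: integrable_patch.
have iag : mu.-integrable setT (EFin \o (fun t => `|g t|)) by exact: integrable_abse ig.
have mg : measurable_fun [set: mR] g by apply/measurable_EFinP/measurable_int/ig.
have mag : measurable_fun [set: mR] (fun t => `|g t|) by exact: measurableT_comp.
have ih1 : mu.-integrable setT (EFin \o (fun t => `|g t| + g t)) by exact: integrable_add.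
have h10 t : 0 <= `|g t| + g t by rewrite -lerBlDr sub0r ler_normr lexx orbT.
have h20 t : 0 <= `|g t| by [].
have mphi := measurable_scaled_cos a.
have [nu1 [nu1A nu1E]] := push_density mphi h10 ih1.
have [nu2 [nu2A nu2E]] := push_density mphi h20 iag.
have out : (fun t => a * cos t) @^-1` (~` `[- a, a]) = set0.
  apply/seteqP; split=> // t /= h; apply: h; rewrite in_itv /=; exact: scaled_cos_bound.
have nu1M : nu1 (~` `[- a, a]) = 0%E.
  by rewrite nu1A ?out ?integral_set0//; apply: measurableC; exact: measurable_itv.
have nu2M : nu2 (~` `[- a, a]) = 0%E.
  by rewrite nu2A ?out ?integral_set0//; apply: measurableC; exact: measurable_itv.
have ipow (h : R -> R) n : mu.-integrable setT (EFin \o h) ->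
    mu.-integrable setT (EFin \o (fun t => (a * cos t) ^+ n * h t)).
  move=> ih; apply: (@le_integrable _ _ R mu setT measurableT _ (EFin \o (fun t => a ^+ n * h t))).
  - apply/measurable_EFinP; apply: measurable_funM; last exact/measurable_EFinP/measurable_int/ih.
    by apply: measurable_funX; exact: mphi.
  - move=> t _; rewrite /= lee_fin !normrM ler_wpM2r// !normrX; apply: lerXn2r; rewrite ?nnegrE//.
    by rewrite (gtr0_norm a0) ler_norml; exact: scaled_cos_bound.
  - exact: integrable_scale.
have moms n : \int[nu1]_x (x ^+ n) = \int[nu2]_x (x ^+ n).
  rewrite (push_density_moments h10 nu1E); last exact: exprn_measurable.
  rewrite (push_density_moments h20 nu2E); last exact: exprn_measurable.
  have -> : \int[mu]_t ((a * cos t) ^+ n * (`|g t| + g t)) =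
      \int[mu]_t ((a * cos t) ^+ n * `|g t| + (a * cos t) ^+ n * g t).
    by apply: eq_Rintegral => t _; rewrite mulrDr.
  rewrite RintegralD//; [|exact: ipow|exact: ipow].
  have -> : \int[mu]_t ((a * cos t) ^+ n * g t) = \int[mu]_(t in I) ((a * cos t) ^+ n * u t).
    rewrite [RHS]Rintegral_mkcond; apply: eq_Rintegral => t _; rewrite /g !patchE.
    by case: ifP => _ //; rewrite mulr0.
  by rewrite mom addr0.
have nu12 (B : set R) : measurable B -> nu1 B = nu2 B.
  exact: (@moments_unique R nu1 nu2 a nu1M nu2M moms).
(* The image of the set where [u] is positive, described through [acos], which shows that it is
   Borel. *)
pose B : set R := `]- a, a[ `&` (fun x => g (acos (x / a))) @^-1` `]0, +oo[.
have mB : measurable (B : set mR).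
  have mga : measurable_fun (`]- a, a[%classic : set mR) (fun x => g (acos (x / a))).
    by apply: measurableT_comp mg _; exact: measurable_scaled_acos.
  by apply: mga; [exact: measurable_itv|exact: measurable_itv].
pose Q := (fun t => a * cos t) @^-1` B.
have mQ : measurable (Q : set mR) by rewrite -[Q]setTI; exact: mphi.
have Qg t : Q t -> 0 <= g t.
  rewrite /Q /B /=; move=> [_]; rewrite in_itv /= andbT; have [tI|tI] := pselect (I t).
    by rewrite scaled_cosK; [exact: ltW|move: tI; rewrite /= in_itv].
  by rewrite {2}/g patchE memNset.
have e : (\int[mu]_(t in Q) `|(g t)%:E| = 0)%E.
  have := nu12 B mB; rewrite nu1A// nu2A// -/Q => e12.
  have fin : (\int[mu]_(t in Q) (`|g t|)%:E)%E \is a fin_num.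
    by apply: integrable_fin_num => //; exact: (integrableS measurableT mQ (@subsetT _ _) iag).
  have e1 : (\int[mu]_(t in Q) (`|g t| + g t)%:E = \int[mu]_(t in Q) (`|g t|)%:E + \int[mu]_(t in Q) (`|g t|)%:E)%E.
    transitivity (\int[mu]_(t in Q) ((`|g t|)%:E + (`|g t|)%:E))%E.
      by apply: eq_integral => t /set_mem Qt; rewrite -EFinD !(ger0_norm (Qg t Qt)).
    have maQ : measurable_fun (Q : set mR) (fun t => (`|g t|)%:E).
      by apply/measurable_EFinP; exact: measurable_funTS.
    by rewrite ge0_integralD// => t _; rewrite lee_fin.
  move: e12; rewrite e1; under [RHS]eq_integral do rewrite -abse_EFin.
  under [in X in _ -> X]eq_integral do rewrite abse_EFin.
  case: (\int[mu]_(t in Q) (`|g t|)%:E)%E fin => // y _ /= [] /eqP.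
  by rewrite -subr_eq0 addrK => /eqP ->.
have mgQ : measurable_fun (Q : set mR) (EFin \o g) by apply/measurable_EFinP; exact: measurable_funTS.
have [h _] := @ae_eq_integral_abs _ _ R mu Q mQ (EFin \o g) mgQ.
have {}h := h e.
apply: (@negligibleS _ _ _ mu ([set t | ~ (Q t -> (g t)%:E = 0%E)] `|` [set` [:: 0; pi]])).
  move=> t /= /not_implyP[tI /contrapT u0].
  have [->|tn0] := eqVneq t 0; first by right; rewrite inE eqxx.
  have [->|tnp] := eqVneq t pi; first by right; rewrite !inE eqxx orbT.
  left; have t01 : 0 <= t <= pi by move: tI; rewrite in_itv.
  have gt : g t = u t by rewrite /g patchE mem_set//= in_itv.
  have Qt : Q t.
    split; rewrite /= in_itv /=.
      by apply: scaled_cos_open; case/andP: t01 => x y; rewrite !lt_neqAle eq_sym tn0 x tnp y.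
    by rewrite andbT scaled_cosK// gt.
  by move=> /(_ Qt) [] ; rewrite gt => /eqP; rewrite gt_eqF.
by apply: negligibleU; [exact: h|exact: negligible_seq].
Qed.

(** [moments_positive_null] for the real and imaginary parts and their negatives. *)
Lemma moments_ae0 (f : R -> R[i]) : L2D I f ->
  (forall n, cintegral I (fun t => (a * cos t)%:C%C ^+ n * f t) = 0) ->
  {ae mu, forall t, I t -> f t = 0}.
Proof.
move=> Lf mom; have [i1 i2] := cintegrable_L2D (@mI R) (@fI R) Lf.
have e n t : (a * cos t)%:C%C ^+ n * f t =
    Complex ((a * cos t) ^+ n * complex.Re (f t)) ((a * cos t) ^+ n * complex.Im (f t)).
  rewrite -(rmorphXn (real_complex R)); case: (f t) => x y.
  by apply/eqP; rewrite eq_complex /=; apply/andP; split; apply/eqP; ring.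
have m1 n : \int[mu]_(t in I) ((a * cos t) ^+ n * complex.Re (f t)) = 0.
  transitivity (complex.Re (cintegral I (fun t => (a * cos t)%:C%C ^+ n * f t))); last by rewrite mom.
  by rewrite /cintegral /=; apply: eq_Rint => t _; rewrite e.
have m2 n : \int[mu]_(t in I) ((a * cos t) ^+ n * complex.Im (f t)) = 0.
  transitivity (complex.Im (cintegral I (fun t => (a * cos t)%:C%C ^+ n * f t))); last by rewrite mom.
  by rewrite /cintegral /=; apply: eq_Rint => t _; rewrite e.
have neg (u : R -> R) : mu.-integrable I (EFin \o u) -> (forall n, \int[mu]_(t in I) ((a * cos t) ^+ n * u t) = 0) ->
    {ae mu, forall t, I t -> ~ u t < 0}.
  move=> iu mu0; have iu' := integrable_scale (@mI R) (-1) iu.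
  have ipow n : mu.-integrable I (EFin \o (fun t => (a * cos t) ^+ n * u t)).
    apply: (@integrable_le _ _ (@mI R) _ (fun t => a ^+ n * `|u t|)).
    - apply: measurable_funM; last by apply/measurable_EFinP; exact: measurable_int iu.
      by apply: measurable_funTS; apply: measurable_funX; exact: measurable_scaled_cos.
    - move=> t _; rewrite normrM ler_wpM2r// normrX; apply: lerXn2r; rewrite ?nnegrE ?(ltW a0)//.
      by rewrite ler_norml; exact: scaled_cos_bound.
    - by apply: integrable_scale; [exact: mI|exact: integrable_abse iu].
  have := moments_positive_null iu' _ => /(_ _)[].
    move=> n; have -> : \int[mu]_(t in I) ((a * cos t) ^+ n * (-1 * u t)) =
        \int[mu]_(t in I) (-1 * ((a * cos t) ^+ n * u t)) by apply: eq_Rint => t _; ring.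
    by rewrite RintegralZl ?mu0 ?mulr0//; exact: mI.
  move=> N [mN N0 NP]; exists N; split=> // t /= h; apply: NP => /= h'; apply: h => tI.
  by have := h' tI; rewrite mulN1r oppr_gt0.
have p1 := moments_positive_null i1 m1; have n1 := neg _ i1 m1.
have p2 := moments_positive_null i2 m2; have n2 := neg _ i2 m2.
apply: (ae_mono (ae_and (ae_and p1 n1) (ae_and p2 n2))) => t [[a1 a2] [a3 a4]] It.
have z (w : R) : ~ 0 < w -> ~ w < 0 -> w = 0.
  by move=> /negP; rewrite -leNgt => w1 /negP; rewrite -leNgt => w2; apply/eqP; rewrite eq_le w1.
have := z _ (a1 It) (a2 It); have := z _ (a3 It) (a4 It).
by case: (f t) => x y /= -> ->.
Qed.

End MomentsAe.

(** * The expansion of square-summable functions *)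

Section SpectralDecomposition.
Variables (R : realType) (V : choiceType) (lam : V -> R) (nb : V -> seq V)
  (q r : nat) (ray : 'I_r -> nat -> V) (width : 'I_r -> R).
Hypothesis G : cusp_graph lam nb q ray width.
Local Notation C := R[i].
Local Notation A := (@nbop R V nb).
Local Notation k := (Num.sqrt (q%:R : R)).
Local Notation dot := (dot lam).
Local Notation L2 := (L2 lam).
Local Notation I := (`[0, pi]%classic : set R).
Local Notation mu := (@lebesgue_measure R).
Variables (E : R -> 'I_r -> V -> C) (S : R -> 'I_r -> 'I_r -> C) (bad : seq R)
  (d : {poly R}) (P : 'I_r -> 'I_r -> {poly R}).
Hypothesis SF : spectral_family nb q ray width E S bad d P.
Let lam0 := cg_lam G.
Let dotP := dot_inner lam0.
Let sL := L2_subspace lam0.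
Let IP := ip_inner (@mI R) (@fI R).
Local Notation kappa := (kappa q width).
Local Notation ipK := (ipK q width).
Local Notation evaluation := (evaluation E).
Local Notation transform := (transform lam E).
Local Notation synthesis := (synthesis q width E).
Local Notation specC := (@specC R q).
Local Notation KL2 := (@KL2 R r).
Let KP := ipK_inner G.
Let sK := inner_subspace KP.

Definition aeK (F H : 'I_r * R -> C) := forall c, {ae mu, forall t, I t -> F (c, t) = H (c, t)}.

Lemma aeK_inorm0 F : KL2 F -> inorm ipK F = 0 -> aeK F (fun=> 0).
Proof.
move=> KF; rewrite (inorm_ipK G KF) => /eqP; rewrite psumr_eq0 => [/allP h c|c _]; last first.
  by rewrite mulr_ge0 ?(ltW (kappa_gt0 G _))// (inorm_ge0 IP (KF c)).
have := h c (mem_index_enum c); rewrite mulf_eq0 gt_eqF ?(kappa_gt0 G)//= => /eqP e.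
exact: (L2D0_ae (@mI R) (KF c) e).
Qed.

Lemma inorm0_aeK F : KL2 F -> aeK F (fun=> 0) -> inorm ipK F = 0.
Proof.
move=> KF F0; rewrite (inorm_ipK G KF) big1// => c _.
by rewrite (ae_L2D0 (@mI R) (KF c) (F0 c)) mulr0.
Qed.

Lemma aeK_sub F H : aeK (fun ct => F ct - H ct) (fun=> 0) -> aeK F H.
Proof. by move=> FH c; apply: (ae_mono (FH c)) => t h It; apply/eqP; rewrite -subr_eq0 h. Qed.

Lemma sub_aeK F H : aeK F H -> aeK (fun ct => F ct - H ct) (fun=> 0).
Proof. by move=> FH c; apply: (ae_mono (FH c)) => t h It; rewrite h// subrr. Qed.

Lemma aeK_trans F H X : aeK F H -> aeK H X -> aeK F X.
Proof.
by move=> FH HX c; apply: (ae_mono (ae_and (FH c) (HX c))) => t [h1 h2] It; rewrite h1// h2.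
Qed.

Lemma ipK_nondegenerate F H : KL2 F -> KL2 H -> (forall X, KL2 X -> ipK F X = ipK H X) -> aeK F H.
Proof.
move=> KF KH e; have KD := subspaceB sK KF KH.
apply: aeK_sub; apply: aeK_inorm0 => //.
by rewrite /inorm (innerBl KP KF KH KD) e// subrr.
Qed.

Lemma ipK_aeK F H X : KL2 F -> KL2 H -> KL2 X -> aeK F H -> ipK F X = ipK H X.
Proof.
move=> KF KH KX FH; have KD := subspaceB sK KF KH.
apply/eqP; rewrite -subr_eq0 -(innerBl KP KF KH KX); apply/eqP.
by apply: (inorm0_orth KP) => //; apply: inorm0_aeK => //; exact: sub_aeK.
Qed.

Lemma synthesis_aeK F H : KL2 F -> KL2 H -> aeK F H -> synthesis F = synthesis H.
Proof.
by move=> KF KH FH; apply/funext => v; apply: ipK_aeK => //; exact: (evaluation_K SF).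
Qed.

Lemma synthesis_inj F : KL2 F -> synthesis F = (fun=> 0) -> aeK F (fun=> 0).
Proof.
move=> KF F0.
(* The integrand of the synthesis at [v], summed over the cusps. Multiplying [F] by powers of
   [specC] keeps the synthesis zero, so all moments of [Phi v] vanish. *)
pose Phi v t : C := \sum_e (kappa e)%:C%C * (F (e, t) * conjc (evaluation v (e, t))).
have LE e v : L2D I (fun t => F (e, t) * conjc (evaluation v (e, t))).
  have [K KV] := sf_bound SF v.
  have m1 : cmeasurable I (fun t => E t e v) by exact: (sf_meas SF).
  have [h _] := L2D_mul (@mI R) (@fI R) m1 (fun t _ => KV t e) (KF e).
  have -> // : (fun t => F (e, t) * conjc (evaluation v (e, t))) = fun t => E t e v * F (e, t).
  by apply/funext => t; rewrite /evaluation conjcK mulrC.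
have LPhi v : L2D I (Phi v) by apply: subspace_sum => //; exact: (L2D_subspace (@mI R) (@fI R)).
have KM n : KL2 (iter n (mult specC) F) /\ synthesis (iter n (mult specC) F) = fun=> 0.
  elim: n => [//|n [IH1 IH2]]; split; first exact: (mult_spec_K G).
  by rewrite -(synthesis_nbop G SF IH1) IH2 (linop0 (@nbop_lin R V nb)).
have iterE n e t : iter n (mult specC) F (e, t) = (2 * k * cos t)%:C%C ^+ n * F (e, t).
  elim: n => [|n IH]; first by rewrite mul1r.
  by rewrite iterS /mult /= IH exprS mulrA.
have Phi0 v : {ae mu, forall t, I t -> Phi v t = 0}.
  apply: (@moments_ae0 R (2 * k)) => //; first by rewrite mulr_gt0// (k_gt0 G).
  move=> n; have [Kn sn] := KM n.
  have := congr1 (fun f => f v) sn; rewrite /synthesis /ipK /ip => <-.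
  have [_ <-] := @cintegral_sum R I (@mI R) (@fI R) _ (index_enum 'I_r) (fun e => (kappa e)%:C%C)
    (fun e t => iter n (mult specC) F (e, t) * conjc (evaluation v (e, t)))
    (fun e => cintegrable_mul (@mI R) (Kn e) (evaluation_K SF v e)).
  apply: eq_cintegral => t _; rewrite mulr_sumr; apply: eq_bigr => e _.
  by rewrite iterE; ring.
move=> c; have h := ae_and (Phi0 (ray c 1)) (Phi0 (ray c 2)).
apply: (ae_mono (ae_and h (ae_notin bad))) => t [[h1 h2] tb] It.
have t0 : 0 <= t <= pi by move: It; rewrite /= in_itv.
(* [a] and [b] are the amplitudes of [z ^+ n] and [z^-1 ^+ n] in the values of [Phi] along the cusp
   [c]. *)
pose a := (kappa c)%:C%C * F (c, t).
pose b := \sum_e (kappa e)%:C%C * (F (e, t) * S t c e).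
have PhiE n : (0 < n)%N -> Phi (ray c n) t = k%:C%C ^+ n * (cis t ^+ n * a + (cis t)^-1 ^+ n * b).
  move=> n0; rewrite /Phi.
  under eq_bigr do rewrite /evaluation conjcK (sf_ray SF _ t0 tb)//=.
  transitivity (\sum_e ((c == e)%:R * (k%:C%C ^+ n * cis t ^+ n * ((kappa e)%:C%C * F (e, t))) +
      k%:C%C ^+ n * (cis t)^-1 ^+ n * ((kappa e)%:C%C * (F (e, t) * S t c e)))).
    by apply: eq_bigr => e _; ring.
  rewrite big_split /= (bigD1 c)//= eqxx mul1r big1 ?addr0 => [|e ei]; last first.
    by rewrite eq_sym (negbTE ei) mul0r.
  rewrite -mulr_sumr -/b -/a; ring.
have k0 : k%:C%C != 0 :> C by apply/eqP => /complexI/eqP; rewrite gt_eqF// (k_gt0 G).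
have z0 := cis_neq0 t; have z1 := cis_sqr_neq1 (sf_sin SF t0 tb).
have e1 : cis t ^+ 1 * a + (cis t)^-1 ^+ 1 * b = 0.
  by apply: (mulfI (expf_neq0 1 k0)); rewrite mulr0 -PhiE// h1.
have e2 : cis t ^+ 2 * a + (cis t)^-1 ^+ 2 * b = 0.
  by apply: (mulfI (expf_neq0 2 k0)); rewrite mulr0 -PhiE// h2.
(* Eliminating [a] between heights 1 and 2 leaves the factor [z ^+ 2 - 1], nonzero off the bad
   parameters. *)
have b0 : b = 0.
  have : (cis t ^+ 2 - 1) * b = 0.
    transitivity (cis t ^+ 2 * (cis t * (cis t ^+ 1 * a + (cis t)^-1 ^+ 1 * b)
      - (cis t ^+ 2 * a + (cis t)^-1 ^+ 2 * b))); first by field.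
    by rewrite e1 e2 mulr0 subrr mulr0.
  by move=> /eqP; rewrite mulf_eq0 subr_eq0 (negbTE z1) => /eqP.
move: e1; rewrite b0 mulr0 addr0 => /eqP; rewrite mulf_eq0 expf_eq0 (negbTE z0) andbF /= => /eqP.
move=> /eqP; rewrite mulf_eq0 => /orP[/eqP/complexI/eqP|/eqP//].
by rewrite gt_eqF// (kappa_gt0 G).
Qed.

(** The transform of a general [f] is the limit of the transforms of truncations, whose errors are
    chosen so small that [riesz_fischer] applies on each cusp. *)
Lemma dual_transform_exists f : L2 f -> exists2 F, KL2 F &
  forall H, KL2 H -> ipK F H = dot f (synthesis H).
Proof.
move=> Lf; have [B B0 BP] := transform_bound G SF.
have kB0 c : true -> 0 <= (kappa c)^-1 * (4 * B).
  by move=> _; apply: mulr_ge0; [rewrite invr_ge0 ltW// (kappa_gt0 G)|exact: mulr_ge0].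
(* Dividing by [M] turns the constant [4 * B / kappa c] of each cusp into one at most 1; the summand
   1 keeps [M] positive. *)
pose M := \sum_c (kappa c)^-1 * (4 * B) + 1.
have M0 : 0 < M.
  by rewrite ltr_wpDl// sumr_ge0.
pose eps n : R := 16^-1 ^+ n / M.
have eps0 n : 0 < eps n by rewrite divr_gt0 ?exprn_gt0 ?invr_gt0.
have /boolp.choice[fn fnP] : forall n, exists g, finitely_supported g /\
    inorm dot (fun v => g v - f v) <= eps n.
  move=> n; have [s [us sP]] := restrict_approx lam0 Lf (eps0 n).
  exists (restrict_to s f); split; first exact: restrict_finite.
  have Lr : L2 (restrict_to s f) by apply: finite_L2 => //; exact: restrict_finite.
  have -> : (fun v => restrict_to s f v - f v) = fun v => -1 * (f v - restrict_to s f v).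
    by apply/funext => v; rewrite mulN1r opprB.
  rewrite (inormZ dotP); last exact: subspaceB.
  by rewrite nsqN [nsq 1](_ : _ = 1) ?mul1r; [exact: sP|rewrite /nsq /=; ring].
have ff n := (fnP n).1; have Lfn n : L2 (fn n) by exact: finite_L2.
have KT n : KL2 (transform (fn n)) by exact: (transform_K G SF).
have LD n : L2 (fun v => fn n v - f v) by exact: subspaceB.
have Tsub g h : finitely_supported g -> finitely_supported h ->
    transform (fun v => g v - h v) = fun ct => transform g ct - transform h ct.
  move=> fg fh; have := transform_lin lam E (-1) fh fg.
  have -> : (fun v => -1 * h v + g v) = fun v => g v - h v by apply/funext => v; ring.
  by move=> ->; apply/funext => ct; ring.
have fast c n : inorm (ip I) (fun t => transform (fn n.+1) (c, t) - transform (fn n) (c, t)) <= 16^-1 ^+ n.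
  have fd : finitely_supported (fun v => fn n.+1 v - fn n v).
    by apply: subspaceB => //; exact: finite_subspace.
  have KD := transform_K G SF fd.
  have h1 : kappa c * inorm (ip I) (fun t => transform (fn n.+1) (c, t) - transform (fn n) (c, t)) <=
      inorm ipK (transform (fun v => fn n.+1 v - fn n v)).
    rewrite (inorm_ipK G KD) (bigD1 c)//= Tsub// lerDl; apply: sumr_ge0 => e _.
    apply: mulr_ge0; first exact/ltW/(kappa_gt0 G).
    by have := inorm_ge0 IP (KD e); rewrite Tsub.
  have h2 : inorm dot (fun v => fn n.+1 v - fn n v) <= 4 * eps n.
    have -> : (fun v => fn n.+1 v - fn n v) = fun v => (fn n.+1 v - f v) - (fn n v - f v).
      by apply/funext => v; ring.
    apply: le_trans (inormB dotP (LD _) (LD _)) _.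
    have -> : 4 * eps n = 2 * eps n + 2 * eps n by ring.
    rewrite lerD ?ler_pM2l//; last exact: (fnP n).2.
    apply: le_trans (fnP n.+1).2 _; rewrite /eps ler_pM2r ?invr_gt0// exprS ger_pMl ?exprn_gt0 ?invr_gt0//.
    by rewrite invf_le1// ler1n.
  have k0 := kappa_gt0 G c; rewrite -(ler_pM2l k0); apply: le_trans h1 _.
  apply: le_trans (BP _ fd) _; apply: le_trans (ler_wpM2l B0 h2) _.
  have -> : B * (4 * eps n) = kappa c * (16^-1 ^+ n * (((kappa c)^-1 * (4 * B)) / M)).
    transitivity ((kappa c * (kappa c)^-1) * (16^-1 ^+ n * (4 * B) / M)); last by ring.
    by rewrite divff ?lt0r_neq0// mul1r /eps; ring.
  rewrite ler_pM2l// ger_pMr ?exprn_gt0 ?invr_gt0// ler_pdivrMr// mul1r /M.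
  rewrite (bigD1 c)//= -addrA lerDl addr_ge0// sumr_ge0// => e _.
  exact: kB0.
have /boolp.choice[h hP] : forall c, exists h, L2D I h /\ forall n,
    inorm (ip I) (fun t => transform (fn n) (c, t) - h t) <= 4 * 16^-1 ^+ n.
  move=> c; have [h] := riesz_fischer (@mI R) (@fI R) (fun n => KT n c) (fast c).
  by exists h.
pose F (ct : 'I_r * R) : C := h ct.1 ct.2.
have KF : KL2 F by move=> c; exact: (hP c).1.
exists F => // H KH.
apply/eqP; rewrite -subr_eq0; apply/eqP.
have [B' B'0 B'P] := synthesis_L2 G SF; have [LS _] := B'P H KH.
pose W := \sum_c kappa c * 4.
have W0 : 0 <= W by apply: sumr_ge0 => c _; rewrite mulr_ge0// ltW// (kappa_gt0 G).
apply: (@nsq_small_eq0 R _ (2 * (W * inorm ipK H) + 2 * (M^-1 * inorm dot (synthesis H)))) => e e0.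
have [n ne] : exists n, 16^-1 ^+ n <= e.
  have := @cvg_expr R 16^-1; rewrite ger0_norm ?invr_ge0// invf_lt1// ltr1n => /(_ isT).
  move=> /cvgrPdist_le /(_ e e0) [n _ /(_ n (leqnn n))] /=; rewrite sub0r normrN => hn.
  by exists n; apply: le_trans hn; exact: ler_norm.
have KD : KL2 (fun ct => transform (fn n) ct - F ct) by exact: (subspaceB sK (KT n) KF).
have -> : ipK F H - dot f (synthesis H) =
    dot (fun v => fn n v - f v) (synthesis H) - ipK (fun ct => transform (fn n) ct - F ct) H.
  rewrite (innerBl dotP)// (innerBl KP)//.
  have -> : ipK (transform (fn n)) H = dot (fn n) (synthesis H).
    rewrite (inner_conj KP KH (KT n)) (transform_adj G SF KH (ff n)).
    by rewrite -(inner_conj dotP LS (Lfn n)).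
  ring.
apply: le_trans (nsqD_le _ _) _; rewrite nsqN [leRHS]mulrDl addrC; apply: lerD.
  rewrite -mulrA ler_pM2l//; apply: le_trans (inner_CS KP KD KH) _.
  rewrite mulrAC; apply: ler_wpM2r; first exact: (inorm_ge0 KP KH).
  rewrite (inorm_ipK G KD) /W mulr_suml; apply: ler_sum => c _.
  rewrite -mulrA ler_pM2l ?(kappa_gt0 G)//; apply: le_trans ((hP c).2 n) _.
  by rewrite ler_pM2l.
rewrite -mulrA ler_pM2l//; apply: le_trans (inner_CS dotP (LD n) LS) _.
rewrite mulrAC; apply: ler_wpM2r; first exact: (inorm_ge0 dotP LS).
by apply: le_trans (fnP n).2 _; rewrite /eps mulrC ler_pM2l ?invr_gt0.
Qed.

(** [sd_dual] determines [T f] only up to null sets; its linearity and the relation with [A] are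
    therefore proved in the sense of [aeK]. *)
Record spectral_decomposition (m : nat) (psi : 'I_m -> V -> C) (x : 'I_m -> R)
    (T : (V -> C) -> 'I_r * R -> C) : Prop := SpectralDecomposition {
  sd_L2 : forall i, L2 (psi i);
  sd_ortho : forall i j, dot (psi i) (psi j) = (i == j)%:R;
  sd_eigen : forall i, A (psi i) = (fun v => (x i)%:C%C * psi i v);
  sd_K : forall f, L2 f -> KL2 (T f);
  sd_dual : forall f F, L2 f -> KL2 F -> ipK (T f) F = dot f (synthesis F);
  sd_psi : forall i F, KL2 F -> dot (psi i) (synthesis F) = 0;
  sd_expand : forall f, L2 f ->
    f = (fun v => synthesis (T f) v + \sum_i dot f (psi i) * psi i v) }.

Theorem spectral_decomposition_exists : exists m (psi : 'I_m -> V -> C) (x : 'I_m -> R) T,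
  spectral_decomposition psi x T.
Proof.
have [m [psi [x [Lp pp Ap pQ]]]] := defect_eigenbasis G SF.
pose T f : 'I_r * R -> C := if pselect (L2 f) is left h then projT1 (cid2 (dual_transform_exists h)) else fun=> 0.
have TP f : L2 f -> KL2 (T f) /\ forall H, KL2 H -> ipK (T f) H = dot f (synthesis H).
  by move=> Lf; rewrite /T; case: pselect => // h; case: (cid2 _).
have [B B0 BP] := synthesis_L2 G SF.
have orth i F : KL2 F -> dot (psi i) (synthesis F) = 0.
  move=> KF; have [KT TE] := TP _ (Lp i).
  have T0 : aeK (T (psi i)) (fun=> 0).
    (* Symmetry of [A] makes multiplication by [specC] and by the constant [x i] agree on
       [T (psi i)], while the two factors coincide for at most one parameter. *)
    have e : aeK (mult specC (T (psi i))) (fun ct => (x i)%:C%C * T (psi i) ct).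
      apply: ipK_nondegenerate.
      - exact: (mult_spec_K G).
      - exact: (subspaceZ (x i)%:C%C sK KT).
      move=> X KX; rewrite (mult_adj _ _ _ _ (@specC_real R q)) (innerZl KP)// !TE//; last exact: (mult_spec_K G).
      have [LX _] := BP X KX.
      by rewrite -(synthesis_nbop G SF KX) -(nbop_sym G (Lp i) LX) Ap (innerZl dotP).
    move=> c; have nx := ae_notin [:: acos (x i / (2 * k))].
    apply: (ae_mono (ae_and (e c) nx)) => t [/= ht tn] It; move: (ht It).
    rewrite /mult /= => /eqP; rewrite -subr_eq0 -mulrBl mulf_eq0 => /orP[/eqP h|/eqP//].
    exfalso; move/negP: tn; apply; rewrite inE; move: h; rewrite /specC -(rmorphB (real_complex R)).
    move=> /complexI/eqP; rewrite subr_eq0 => /eqP <-.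
    by rewrite /spec (scaled_cosK (mulr_gt0 (ltr0Sn R 1) (k_gt0 G)))//; move: It; rewrite /= in_itv.
  by rewrite -TE// (ipK_aeK KT sK.1 KF T0) (inner0l KP).
(* On finite supports this is the expansion of the defect, whose coefficients are those of [f] by
   the orthogonality just shown. *)
have expand_fin f : finitely_supported f ->
    f = fun v => synthesis (transform f) v + \sum_i dot f (psi i) * psi i v.
  move=> ff; have Lf : L2 f by exact: finite_L2.
  have [LS _] := BP _ (transform_K G SF ff).
  have e := pQ f ff; apply/funext => v; have := congr1 (fun g => g v) e.
  rewrite /defect => /eqP; rewrite subr_eq addrC => /eqP {1}->; congr (_ + _).
  apply: eq_bigr => i _; congr (_ * _); rewrite (innerBl dotP)//.
  by rewrite (inner_conj dotP (Lp i) LS) orth ?conjc0 ?subr0//; exact: (transform_K G SF).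
exists m, psi, x, T; split=> //.
- by move=> f Lf; exact: (TP f Lf).1.
- by move=> f F Lf KF; exact: (TP f Lf).2.
move=> f Lf; have [KT TE] := TP f Lf; have [LS _] := BP _ KT.
have Lsum : L2 (fun v => \sum_i dot f (psi i) * psi i v) by exact: subspace_sum.
have LSs := subspaceD sL LS Lsum.
have Lz := subspaceB sL Lf LSs.
(* The error of the expansion is orthogonal to all finitely supported functions, in particular to
   point masses. *)
have z0 g : finitely_supported g -> dot (fun v => f v - (synthesis (T f) v + \sum_i dot f (psi i) * psi i v)) g = 0.
  move=> fg; have Lg : L2 g by exact: finite_L2.
  rewrite (innerBl dotP)// (innerDl dotP)// (inner_suml dotP)//.
  rewrite -(transform_adj G SF KT fg) TE; last exact: (transform_K G SF).
  have [LSg _] := BP _ (transform_K G SF fg).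
  rewrite {1}[g in X in X - _](expand_fin g fg).
  have Lsg : L2 (fun v => \sum_i dot g (psi i) * psi i v) by exact: subspace_sum.
  rewrite (innerDr dotP)// opprD addrACA subrr add0r.
  apply/eqP; rewrite subr_eq0; apply/eqP.
  rewrite (inner_conj dotP Lsg Lf) (inner_suml dotP)// (rmorph_sum conjc); apply: eq_bigr => i _.
  by rewrite [dot f _](inner_conj dotP (Lp i) Lf) [dot (psi i) g](inner_conj dotP Lg (Lp i)) (rmorphM conjc) mulrC.
apply/funext => v; have := z0 (@delta R V v) (@delta_finite R V v).
rewrite (inner_conj dotP _ Lz); last exact/finite_L2/delta_finite.
rewrite dot_delta conjcM conjcK conjc_real => /eqP; rewrite mulf_eq0 subr_eq0 => /orP[/eqP //|/eqP/complexI/eqP].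
by rewrite gt_eqF.
Qed.

End SpectralDecomposition.

(** * Spectral measures *)

Section FiniteMeasures.
Variable R : realType.
Local Notation mu := (@lebesgue_measure R).
Local Notation mR := (measurableTypeR R).
Local Notation I := (`[0, pi]%classic : set R).

Lemma Rintegral_zero (D : set R) : \int[mu]_(x in D) (0 : R) = 0.
Proof. by rewrite /Rintegral integral0. Qed.

Lemma Rintegral_scale (a : R) (u : R -> R) : a != 0 ->
  mu.-integrable I (EFin \o (fun t => a * u t)) ->
  \int[mu]_(t in I) (a * u t) = a * \int[mu]_(t in I) u t.
Proof.
move=> a0 iu; have i2 : mu.-integrable I (EFin \o u).
  have := integrable_scale (@mI R) a^-1 iu; apply: eq_integrable; first exact: mI.
  by move=> t _ /=; rewrite mulKf.
by apply: RintegralZl => //; exact: mI.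
Qed.

Lemma finite_measure_add (m1 m2 : {finite_measure set R -> \bar R}) (M : R) :
  m1 (~` `[- M, M]) = 0%E -> m2 (~` `[- M, M]) = 0%E ->
  exists m : {finite_measure set R -> \bar R}, (forall A, m A = (m1 A + m2 A)%E) /\
    forall n, \int[m]_x (x ^+ n) = \int[m1]_x (x ^+ n) + \int[m2]_x (x ^+ n).
Proof.
move=> m1M m2M; pose ma : {measure set R -> \bar R} := [the measure _ _ of measure_add m1 m2].
have maE B : ma B = (m1 B + m2 B)%E by exact: measure_addE.
have fm : fin_num_fun ma.
  move=> A mA; rewrite maE fin_numD.
  by apply/andP; split; exact: fin_num_measure.
pose m : {finite_measure set R -> \bar R} :=
  HB.pack (ma : set R -> \bar R) ma (@Measure_isFinite.Build _ R R ma fm).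
exists m; split=> [B|n]; first exact: maE.
have mX : measurable_fun [set: R] (fun x : R => x ^+ n) by exact: exprn_measurable.
have i (m0 : {finite_measure set R -> \bar R}) : m0 (~` `[- M, M]) = 0%E ->
    m0.-integrable setT (EFin \o (fun x : R => x ^+ n)).
  move=> m0M; apply: (integrable_compact_support m0M (c := M ^+ n)) => // x xM.
  by rewrite normrX; apply: lerXn2r; rewrite ?nnegrE ?ler_norml//; case/andP: xM; lra.
rewrite /Rintegral -fineD; [|exact/integrable_fin_num/i|exact/integrable_fin_num/i] => //.
congr fine; apply: integral_measure_add => //; exact: i.
Qed.

(** A point mass as the push-forward of the density [c / pi] on [0, pi] under a constant map, so
    that [push_density] gives its moments. *)
Lemma atomic_measure (c x : R) : 0 <= c -> exists m : {finite_measure set R -> \bar R},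
  (forall A, measurable A -> m A = (c * (x \in A)%:R)%:E) /\
  forall n, \int[m]_y (y ^+ n) = c * x ^+ n.
Proof.
move=> c0; pose h t : R := c / pi * \1_I t.
have h0 t : 0 <= h t by rewrite mulr_ge0 ?divr_ge0 ?pi_ge0// indicE.
have i1 : mu.-integrable setT (EFin \o (\1_I : R -> R)).
  apply/integrableP; split; first by apply/measurable_EFinP; apply: measurable_indic; exact: mI.
  under eq_integral do rewrite /= ger0_norm//.
  by rewrite integral_indic ?setIT ?fI//; exact: mI.
have ih : mu.-integrable setT (EFin \o h) by exact: integrable_scale.
have mc : measurable_fun [set: mR] (fun _ : R => x) by exact: measurable_cst.
have fIpi : fine (mu I) = pi by rewrite lebesgue_measure_itv /= lte_fin pi_gt0 /= oppr0 addr0.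
have inth : \int[mu]_t h t = c.
  rewrite /h RintegralZl// /Rintegral integral_indic; [|exact: measurableT|exact: mI].
  by rewrite setIT fIpi mulfVK// gt_eqF// pi_gt0.
have [m [mA mE]] := push_density mc h0 ih.
exists m; split=> [A mA'|n].
  rewrite mA//; have [xA|xA] := boolP (x \in A).
    have -> : (fun _ : R => x) @^-1` A = setT by apply/seteqP; split=> // t _; apply/set_mem.
    rewrite mulr1 -inth /Rintegral fineK//.
    exact: (integrable_fin_num measurableT ih).
  have -> : (fun _ : R => x) @^-1` A = set0.
    by apply/seteqP; split=> // t /= At; move/negP: xA; apply; exact: mem_set.
  by rewrite integral_set0 mulr0.
rewrite (push_density_moments h0 mE); last exact: exprn_measurable.
by rewrite RintegralZl// inth mulrC.
Qed.

Lemma add_atoms (m : nat) (c x : 'I_m -> R) (nu : {finite_measure set R -> \bar R}) (M : R) :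
  (forall i, 0 <= c i) -> (forall i, - M <= x i <= M) -> nu (~` `[- M, M]) = 0%E ->
  exists rho : {finite_measure set R -> \bar R}, [/\ rho (~` `[- M, M]) = 0%E,
    forall A, measurable A -> rho A = (nu A + (\sum_i c i * (x i \in A)%:R)%:E)%E &
    forall n, \int[rho]_y (y ^+ n) = \int[nu]_y (y ^+ n) + \sum_i c i * x i ^+ n].
Proof.
elim: m c x => [|m IH] c x c0 xM nuM.
  by exists nu; split=> // [A _|n]; rewrite big_ord0 ?adde0 ?addr0.
have [rho [rM rA rI]] := IH (fun i => c (widen_ord (leqnSn m) i)) (fun i => x (widen_ord (leqnSn m) i))
  (fun i => c0 _) (fun i => xM _) nuM.
have [a [aA aI]] := atomic_measure (x ord_max) (c0 ord_max).
have mJ : measurable (~` `[- M, M] : set R) by apply: measurableC; exact: measurable_itv.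
have aM : a (~` `[- M, M]) = 0%E.
  rewrite aA// memNset ?mulr0// => /=; rewrite in_itv /= => h; apply: h; exact: xM.
have [s [sA sI]] := finite_measure_add rM aM.
exists s; split=> [|A mA|n]; first by rewrite sA rM aM adde0.
  by rewrite sA rA// aA// -addeA -EFinD big_ord_recr.
by rewrite sI rI aI -addrA big_ord_recr.
Qed.

End FiniteMeasures.

(** * Spectral measures and the three spectral subspaces *)

Section SpectralMeasure.
Variables (R : realType) (V : choiceType) (lam : V -> R) (nb : V -> seq V)
  (q r : nat) (ray : 'I_r -> nat -> V) (width : 'I_r -> R).
Hypothesis G : cusp_graph lam nb q ray width.
Local Notation C := R[i].
Local Notation A := (@nbop R V nb).
Local Notation k := (Num.sqrt (q%:R : R)).
Local Notation dot := (dot lam).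
Local Notation L2 := (L2 lam).
Local Notation I := (`[0, pi]%classic : set R).
Local Notation mu := (@lebesgue_measure R).
Local Notation mR := (measurableTypeR R).
Variables (E : R -> 'I_r -> V -> C) (S : R -> 'I_r -> 'I_r -> C) (bad : seq R)
  (d : {poly R}) (P : 'I_r -> 'I_r -> {poly R}).
Hypothesis SF : spectral_family nb q ray width E S bad d P.
Variables (m : nat) (psi : 'I_m -> V -> C) (x : 'I_m -> R) (T : (V -> C) -> 'I_r * R -> C).
Hypothesis SD : spectral_decomposition lam nb q width E psi x T.
Let lam0 := cg_lam G.
Let dotP := dot_inner lam0.
Let sL := L2_subspace lam0.
Local Notation kappa := (kappa q width).
Local Notation ipK := (ipK q width).
Local Notation transform := (transform lam E).
Local Notation synthesis := (synthesis q width E).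
Local Notation specC := (@specC R q).
Local Notation KL2 := (@KL2 R r).
Let KP := ipK_inner G.
Let sK := inner_subspace KP.
Let k2 : 0 < 2 * k. Proof. by rewrite mulr_gt0// (k_gt0 G). Qed.

Lemma synthesis_in_L2 F : KL2 F -> L2 (synthesis F).
Proof. by move=> KF; have [B _ BP] := synthesis_L2 G SF; case: (BP F KF). Qed.

Lemma dot_synthesis f F : L2 f -> KL2 F -> dot (synthesis F) f = ipK F (T f).
Proof.
move=> Lf KF; have LS := synthesis_in_L2 KF; have KT := sd_K SD Lf.
by rewrite (inner_conj dotP Lf LS) -(sd_dual SD Lf KF) -(inner_conj KP KT KF).
Qed.

Lemma plancherel f g : L2 f -> L2 g ->
  dot f g = ipK (T f) (T g) + \sum_i dot f (psi i) * conjc (dot g (psi i)).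
Proof.
move=> Lf Lg; have KT := sd_K SD Lf; have LS := synthesis_in_L2 KT.
have Ls : L2 (fun v => \sum_i dot f (psi i) * psi i v).
  by apply: subspace_sum => // i _; exact: (sd_L2 SD).
rewrite {1}(sd_expand SD Lf) (innerDl dotP)// dot_synthesis//; congr (_ + _).
rewrite (inner_suml dotP)//; last by move=> i _; exact: (sd_L2 SD).
by apply: eq_bigr => i _; rewrite -(inner_conj dotP Lg (sd_L2 SD i)).
Qed.

Lemma T_le f : L2 f -> inorm ipK (T f) <= inorm dot f.
Proof.
move=> Lf; have KT := sd_K SD Lf.
have -> : inorm dot f = inorm ipK (T f) + \sum_i nsq (dot f (psi i)).
  apply: (@complexI R); rewrite -(inormE dotP Lf) plancherel// (inormE KP KT).
  rewrite (rmorphD (real_complex R)) (rmorph_sum (real_complex R)) /=; congr (_ + _).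
  by apply: eq_bigr => i _; rewrite nsqE.
by rewrite lerDl sumr_ge0// => i _; exact: nsq_ge0.
Qed.

Lemma T_lin (a : C) f g : L2 f -> L2 g ->
  aeK (T (fun v => a * f v + g v)) (fun ct => a * T f ct + T g ct).
Proof.
move=> Lf Lg; have Lh := sL.2 a f g Lf Lg; have Kf := sd_K SD Lf; have Kg := sd_K SD Lg.
apply: (ipK_nondegenerate G) => [||X KX]; first exact: (sd_K SD).
  exact: sK.2.
have LS := synthesis_in_L2 KX.
by rewrite (sd_dual SD)// (inner_lin dotP)// (inner_lin KP)// !(sd_dual SD).
Qed.

Lemma T_nbop f : L2 f -> aeK (T (A f)) (mult specC (T f)).
Proof.
move=> Lf; have [D [_ DP]] := nbop_L2 G; have [LA _] := DP f Lf; have Kf := sd_K SD Lf.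
apply: (ipK_nondegenerate G) => [||X KX]; first exact: (sd_K SD).
  exact: (mult_spec_K G).
have LS := synthesis_in_L2 KX; have KM := mult_spec_K G KX.
rewrite (sd_dual SD)// (nbop_sym G)// (synthesis_nbop G SF)//.
by rewrite (mult_adj _ _ _ _ (@specC_real R q)) (sd_dual SD).
Qed.

(** The coefficients of a synthesis along [psi] vanish, so by its expansion [T (synthesis F) - F]
    has synthesis zero; [synthesis_inj] concludes. *)
Lemma T_synthesis F : KL2 F -> aeK (T (synthesis F)) F.
Proof.
move=> KF; have LS := synthesis_in_L2 KF; have KT := sd_K SD LS.
apply: aeK_sub; apply: (synthesis_inj G SF); first exact: (subspaceB sK KT KF).
have := synthesis_lin G SF (-1) KF KT.
have -> : (fun ct => -1 * F ct + T (synthesis F) ct) = fun ct => T (synthesis F) ct - F ct.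
  by apply/funext => ct; ring.
move=> ->; apply/funext => v; have := congr1 (fun f => f v) (sd_expand SD LS) => /= e.
rewrite {1}e big1 => [|i _]; first by rewrite addr0 mulN1r addNr.
by rewrite (inner_conj dotP (sd_L2 SD i) LS) (sd_psi SD)// conjc0 mul0r.
Qed.

Lemma T_transform f : finitely_supported f -> aeK (T f) (transform f).
Proof.
move=> ff; have Lf : L2 f by exact: finite_L2.
apply: (ipK_nondegenerate G) => [||X KX]; [exact: (sd_K SD)|exact: (transform_K G SF)|].
have LS := synthesis_in_L2 KX; have KT := transform_K G SF ff.
rewrite (sd_dual SD)// (inner_conj KP KX KT) (transform_adj G SF KX ff).
by rewrite -(inner_conj dotP LS Lf).
Qed.

Lemma iter_nbop n f : L2 f -> [/\ L2 (iter n A f),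
  aeK (T (iter n A f)) (mult (fun t => specC t ^+ n) (T f)) &
  forall i, dot (iter n A f) (psi i) = (x i)%:C%C ^+ n * dot f (psi i)].
Proof.
move=> Lf; have [D [_ DP]] := nbop_L2 G; elim: n => [|n [IH1 IH2 IH3]].
  split=> // [c|i]; last by rewrite mul1r.
  by apply: aeW => t _; rewrite /mult expr0 mul1r.
have LA := (DP _ IH1).1; split=> // [|i].
  apply: (aeK_trans (T_nbop IH1)) => c; apply: (ae_mono (IH2 c)) => t h It.
  by rewrite /mult /= in h *; rewrite h// mulrA -exprS.
rewrite iterS (nbop_sym G)//; last exact: (sd_L2 SD).
have -> : A (psi i) = fun v => (x i)%:C%C * psi i v by exact: (sd_eigen SD).
by rewrite (innerZr dotP)// ?IH3 ?conjc_real ?exprS ?mulrA//; exact: (sd_L2 SD).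
Qed.

(** The density in the parameter; its push-forward under [2 * k * cos t] is the absolutely
    continuous part of the spectral measure. *)
Definition spectral_density f t : R := \sum_c kappa c * nsq (T f (c, t)).

Lemma spectral_density_ge0 f t : 0 <= spectral_density f t.
Proof. by apply: sumr_ge0 => c _; rewrite mulr_ge0 ?nsq_ge0// ltW// (kappa_gt0 G). Qed.

Lemma integrable_density f : L2 f -> mu.-integrable I (EFin \o spectral_density f).
Proof.
move=> Lf; have KT := sd_K SD Lf.
rewrite /spectral_density; elim: (index_enum 'I_r) => [|c s IH].
  have -> : EFin \o (fun t => \sum_(c <- [::]) kappa c * nsq (T f (c, t))) = cst 0%E.
    by apply/funext => t; rewrite /= big_nil.
  exact: integrable0.
have -> : (fun t => \sum_(i <- c :: s) kappa i * nsq (T f (i, t))) =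
    fun t => kappa c * nsq (T f (c, t)) + \sum_(i <- s) kappa i * nsq (T f (i, t)).
  by apply/funext => t; rewrite big_cons.
apply: (integrable_add (@mI R)) => //.
by apply: (integrable_scale (@mI R)); exact: (integrable_nsq (KT c)).
Qed.

Lemma mult_pow_ipK n f : L2 f ->
  ipK (mult (fun t => specC t ^+ n) (T f)) (T f) =
  (\int[mu]_(t in I) ((2 * k * cos t) ^+ n * spectral_density f t))%:C%C.
Proof.
move=> Lf; have KT := sd_K SD Lf.
have i1 c : mu.-integrable I (EFin \o (fun t => kappa c * ((2 * k * cos t) ^+ n * nsq (T f (c, t))))).
  apply: (integrable_scale (@mI R)).
  apply: (@integrable_le _ _ (@mI R) _ (fun t => (2 * k) ^+ n * nsq (T f (c, t)))).
  - apply: measurable_funM; last by apply: measurable_nsq; exact: (KT c).1.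
    by apply: measurable_funTS; apply: measurable_funX; exact: measurable_scaled_cos.
  - move=> t _; rewrite normrM (ger0_norm (nsq_ge0 _)) ler_wpM2r ?nsq_ge0// normrX.
    by apply: lerXn2r; rewrite ?nnegrE ?(ltW k2)// ler_norml; exact: scaled_cos_bound.
  - by apply: (integrable_scale (@mI R)); exact: (integrable_nsq (KT c)).
have e1 c : ip I (fun t => mult (fun t => specC t ^+ n) (T f) (c, t)) (fun t => T f (c, t)) =
    (\int[mu]_(t in I) ((2 * k * cos t) ^+ n * nsq (T f (c, t))))%:C%C.
  have e t : mult (fun t => specC t ^+ n) (T f) (c, t) * conjc (T f (c, t)) =
      ((2 * k * cos t) ^+ n * nsq (T f (c, t)))%:C%C.
    rewrite /mult /= -mulrA -nsqE (rmorphM (real_complex R)) (rmorphXn (real_complex R)).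
    by [].
  rewrite /ip /cintegral; congr Complex.
    by apply: eq_Rint => t _; rewrite e.
  rewrite -[RHS](Rintegral_zero I); apply: eq_Rint => t _; by rewrite e.
rewrite /ipK; under eq_bigr do rewrite e1 -(rmorphM (real_complex R)).
rewrite -(rmorph_sum (real_complex R)); congr (_%:C)%C.
have sumI (s : seq 'I_r) : mu.-integrable I (EFin \o (fun t => \sum_(c <- s) kappa c * ((2 * k * cos t) ^+ n * nsq (T f (c, t))))) /\
   \int[mu]_(t in I) (\sum_(c <- s) kappa c * ((2 * k * cos t) ^+ n * nsq (T f (c, t)))) =
   \sum_(c <- s) kappa c * \int[mu]_(t in I) ((2 * k * cos t) ^+ n * nsq (T f (c, t))).
  elim: s => [|c s [IH1 IH2]].
    have -> : (fun t => \sum_(c <- [::]) kappa c * ((2 * k * cos t) ^+ n * nsq (T f (c, t)))) = fun=> 0.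
      by apply/funext => t; rewrite big_nil.
    split; first exact: integrable0.
    by rewrite big_nil Rintegral_zero.
  have -> : (fun t => \sum_(i <- c :: s) kappa i * ((2 * k * cos t) ^+ n * nsq (T f (i, t)))) =
      fun t => kappa c * ((2 * k * cos t) ^+ n * nsq (T f (c, t))) +
        \sum_(i <- s) kappa i * ((2 * k * cos t) ^+ n * nsq (T f (i, t))).
    by apply/funext => t; rewrite big_cons.
  split; first exact: (integrable_add (@mI R)).
  rewrite (RintegralD (@mI R))// big_cons IH2; congr (_ + _).
  by rewrite Rintegral_scale// gt_eqF// (kappa_gt0 G).
rewrite -(sumI (index_enum 'I_r)).2; apply: eq_Rint => t _.
by rewrite /spectral_density mulr_sumr; apply: eq_bigr => c _; rewrite mulrCA.
Qed.

(** To the push-forward of the density come atoms of mass [nsq (dot f (psi i))] at the eigenvalues;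
    [plancherel] for the iterates of [A] gives the moments. *)
Lemma spectral_measure_exists f : L2 f -> exists nu, is_spectral_measure lam A f nu /\
  forall B, measurable B -> nu B =
    (\int[mu]_(t in (fun t => (2 * k * cos t)%R) @^-1` B) ((spectral_density f \_ I) t)%:E +
     (\sum_i nsq (dot f (psi i)) * (x i \in B)%:R)%:E)%E.
Proof.
move=> Lf; pose h := spectral_density f \_ I.
have ih : mu.-integrable setT (EFin \o h) by apply: integrable_patch; exact: integrable_density.
have h0 t : 0 <= h t by rewrite /h patchE; case: ifP => _ //; exact: spectral_density_ge0.
have [nu [nuA nuE]] := push_density (measurable_scaled_cos (2 * k)) h0 ih.
(* Large enough for the band and for all eigenvalues. *)
pose M := 2 * k + \sum_i `|x i|.
have mJ : measurable (~` `[- M, M] : set R) by apply: measurableC; exact: measurable_itv.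
have sx0 : 0 <= \sum_i `|x i| by apply: sumr_ge0.
have nuM : nu (~` `[- M, M]) = 0%E.
  rewrite nuA//; have -> : (fun t => 2 * k * cos t) @^-1` (~` `[- M, M]) = set0.
    apply/seteqP; split=> // t /= hh; apply: hh; rewrite in_itv /=.
    by have /andP[] := scaled_cos_bound k2 t; rewrite /M; lra.
  by rewrite integral_set0.
have xM i : - M <= x i <= M.
  rewrite -ler_norml /M (bigD1 i)//= addrCA lerDl addr_ge0 ?(ltW k2)//.
  exact: sumr_ge0.
have [rho [rM rA rI]] := add_atoms (fun i => nsq_ge0 (dot f (psi i))) xM nuM.
exists rho; split=> [|B mB]; last by rewrite rA// nuA.
split; first by exists M.
move=> n; have [Ln an cn] := iter_nbop n Lf; have KT := sd_K SD Lf.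
have mp : cmeasurable I (fun t => specC t ^+ n) by apply: cmeasurableX; exact: cmeasurable_spec.
have pb t : I t -> nsq (specC t ^+ n) <= ((2 * k) ^+ 2) ^+ n.
  by move=> _; rewrite nsqX; apply: lerXn2r; rewrite ?nnegrE ?nsq_ge0 ?sqr_ge0//; exact: specC_bound.
have [KM _] := mult_K G mp pb KT.
rewrite plancherel// (ipK_aeK G (sd_K SD Ln) KM KT an) mult_pow_ipK// rI.
rewrite (push_density_moments h0 nuE); last exact: exprn_measurable.
rewrite (rmorphD (real_complex R)) (rmorph_sum (real_complex R)) /=; congr (_ + _).
  congr (_%:C)%C; rewrite [LHS]Rintegral_mkcond; apply: eq_Rintegral => t _.
  by rewrite /h !patchE; case: ifP => _ //; rewrite mulr0.
apply: eq_bigr => i _; rewrite cn -mulrA -nsqE (rmorphM (real_complex R)) (rmorphXn (real_complex R)).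
by rewrite mulrC.
Qed.

(** Any spectral measure and the one constructed live on a common interval, where [moments_unique]
    identifies them. *)
Lemma spectral_measure_unique f nu : L2 f -> is_spectral_measure lam A f nu ->
  forall B, measurable B -> nu B =
    (\int[mu]_(t in (fun t => (2 * k * cos t)%R) @^-1` B) ((spectral_density f \_ I) t)%:E +
     (\sum_i nsq (dot f (psi i)) * (x i \in B)%:R)%:E)%E.
Proof.
move=> Lf [[M1 nuM1] nuI] B mB; have [rho [[[M2 rM2] rI] rA]] := spectral_measure_exists Lf.
rewrite -rA//; pose M := `|M1| + `|M2|.
have mJ (N : R) : measurable (~` `[- N, N] : set R) by apply: measurableC; exact: measurable_itv.
have small (n : {finite_measure set R -> \bar R}) N : N <= M -> n (~` `[- N, N]) = 0%E -> n (~` `[- M, M]) = 0%E.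
  move=> NM n0; apply/eqP; rewrite eq_le measure_ge0 andbT -n0; apply: le_measure; rewrite ?inE//.
  by apply: subsetC => t /=; rewrite !in_itv /= => /andP[]; lra.
apply: (@moments_unique R nu rho M) => //.
- by apply: small nuM1; rewrite /M; have := ler_norm M1; have := normr_ge0 M2; lra.
- by apply: small rM2; rewrite /M; have := ler_norm M2; have := normr_ge0 M1; lra.
- by move=> n; apply: (@complexI R); rewrite -nuI -rI.
Qed.

Lemma density_integral_null f B : L2 f -> measurable (B : set R) ->
  (\int[mu]_(t in (fun t => (2 * k * cos t)%R) @^-1` B) ((spectral_density f \_ I) t)%:E = 0)%E ->
  forall c, {ae mu, forall t, I t -> B (2 * k * cos t) -> T f (c, t) = 0}.
Proof.
move=> Lf mB h0 c; pose Q := (fun t => 2 * k * cos t) @^-1` B.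
have mQ : measurable (Q : set mR).
  by rewrite -[Q]setTI; exact: (measurable_scaled_cos (2 * k) measurableT mB).
have ih := integrable_patch (integrable_density Lf).
have mh : measurable_fun (Q : set mR) (EFin \o (spectral_density f \_ I)).
  by apply: measurable_funTS; exact: measurable_int ih.
have [h _] := @ae_eq_integral_abs _ _ R mu Q mQ _ mh.
have {}h : ae_eq mu Q (EFin \o (spectral_density f \_ I)) (cst 0%E).
  apply: h; rewrite -[RHS]h0; apply: eq_integral => t _ /=.
  by rewrite ger0_norm// patchE; case: ifP => _ //; exact: spectral_density_ge0.
apply: (ae_mono h) => t ht It Bt; have := ht Bt; rewrite /= patchE mem_set//= => -[].
move/eqP; rewrite psumr_eq0 => [/allP /(_ c (mem_index_enum c))|i _]; last first.
  by rewrite mulr_ge0 ?nsq_ge0// ltW// (kappa_gt0 G).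
by rewrite /= mulf_eq0 gt_eqF ?(kappa_gt0 G)//= => /eqP/nsq_eq0.
Qed.

Lemma spectral_preimage_null (B : set R) : measurable B -> mu B = 0%E ->
  {ae mu, forall t, I t -> ~ B (2 * k * cos t)}.
Proof.
move=> mB B0; have h := spectral_null k2 mB B0.
have mQ : measurable (I `&` (fun t => 2 * k * cos t) @^-1` B : set mR).
  apply: measurableI; first exact: mI.
  by rewrite -[_ @^-1` _]setTI; exact: (measurable_scaled_cos (2 * k) measurableT mB).
apply: (negligibleS _ ((negligibleP mu mQ).2 h)) => t /= /not_implyP[It /contrapT Bt].
by split.
Qed.

Lemma T_eq0 f : L2 f -> aeK (T f) (fun=> 0) -> f = fun v => \sum_i dot f (psi i) * psi i v.
Proof.
move=> Lf T0; rewrite {1}(sd_expand SD Lf); apply/funext => v.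
rewrite (synthesis_aeK G SF (sd_K SD Lf) sK.1 T0).
by rewrite /synthesis (inner0l KP) ?add0r//; exact: (evaluation_K SF).
Qed.

Let mC (B : set R) : measurable B -> measurable (~` B). Proof. exact: measurableC. Qed.

(** If [T f] vanishes, the measure sits on the eigenvalues. Conversely, if it is carried by a
    countable set [B], the density vanishes off the preimage of [B], which is a null set, so [T f]
    vanishes almost everywhere. *)
Lemma pp_subspaceE : pp_subspace lam A = [set f | L2 f /\ aeK (T f) (fun=> 0)].
Proof.
apply/seteqP; split=> f [Lf]; last first.
  move=> T0; split=> //; have [nu [nuS nuA]] := spectral_measure_exists Lf.
  exists nu => //; exists [set` [seq x i | i <- enum 'I_m]].
    by apply: finite_set_countable; exact: finite_seq.
  rewrite nuA; last first.
    by apply: mC; apply: countable_measurable => //; apply: finite_set_countable; exact: finite_seq.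
  rewrite big1 => [|i _]; last first.
    by rewrite memNset ?mulr0// => /= h; apply: h; apply: map_f; rewrite mem_enum.
  rewrite adde0; set Q := _ @^-1` _.
  have mQ : measurable (Q : set mR).
    rewrite -[Q]setTI; apply: (measurable_scaled_cos (2 * k) measurableT).
    by apply: mC; apply: countable_measurable => //; apply: finite_set_countable; exact: finite_seq.
  have ih := integrable_patch (integrable_density Lf).
  have mh : measurable_fun (Q : set mR) (EFin \o (spectral_density f \_ I)).
    by apply: measurable_funTS; exact: measurable_int ih.
  rewrite -(integral0 mu Q); apply: ae_eq_integral => //.
  have all0 : {ae mu, forall t, forall c, I t -> T f (c, t) = 0}.
    have : forall s : seq 'I_r, {ae mu, forall t, forall c, c \in s -> I t -> T f (c, t) = 0}.
      elim=> [|c s IH]; first by apply: aeW.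
      apply: (ae_mono (ae_and (T0 c) IH)) => t [h1 h2] c'; rewrite inE => /orP[/eqP -> //|]; exact: h2.
    by move=> /(_ (enum 'I_r)) hs; apply: (ae_mono hs) => t ht c It; apply: ht; rewrite ?mem_enum.
  apply: (ae_mono all0) => t ht _; rewrite patchE; case: ifP => // /set_mem It.
  by rewrite /spectral_density big1// => c _; rewrite ht// nsq0 mulr0.
move=> [nu nuS [B cB nuB]]; split=> //.
have mB : measurable (B : set R) by apply: countable_measurable => //.
have := spectral_measure_unique Lf nuS (mC mB); rewrite nuB => /esym/eqP.
rewrite padde_eq0; last 2 first.
- by apply: integral_ge0 => t _; rewrite lee_fin patchE; case: ifP => _ //; exact: spectral_density_ge0.
- by rewrite lee_fin; apply: sumr_ge0 => i _; rewrite mulr_ge0 ?nsq_ge0.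
move=> /andP[/eqP h _] c.
have B0 : mu B = 0%E by exact: countable_lebesgue_measure0.
have h1 := density_integral_null Lf (mC mB) h c.
have h2 := spectral_preimage_null mB B0.
apply: (ae_mono (ae_and h1 h2)) => t [a1 a2] It; apply: a1 => //; exact: a2.
Qed.

(** An absolutely continuous measure has no atom at [x i]. Conversely, if the coefficients along
    [psi] vanish, the measure is a push-forward under a multiple of the cosine, along which null
    sets have null preimages. *)
Lemma ac_subspaceE : ac_subspace lam A = [set f | L2 f /\ forall i, dot f (psi i) = 0].
Proof.
apply/seteqP; split=> f [Lf].
  move=> [nu nuS numu]; split=> // i; apply: nsq_eq0; apply/eqP.
  have m1 : measurable ([set x i] : set R) by exact: measurable_set1.
  have nu0 : nu [set x i] = 0%E.
    by apply: (numu _ _ _ m1 (fun _ h => h)) => D mD Dx; apply: (subset_measure0 mD m1 Dx); exact: lebesgue_measure_set1.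
  have := spectral_measure_unique Lf nuS m1; rewrite nu0 => /esym/eqP.
  rewrite padde_eq0; last 2 first.
  - by apply: integral_ge0 => t _; rewrite lee_fin patchE; case: ifP => _ //; exact: spectral_density_ge0.
  - by rewrite lee_fin; apply: sumr_ge0 => j _; rewrite mulr_ge0 ?nsq_ge0.
  move=> /andP[_ /eqP[]] /eqP; rewrite psumr_eq0 => [/allP /(_ i (mem_index_enum i))|j _]; last first.
    by rewrite mulr_ge0 ?nsq_ge0.
  by rewrite /= mem_set// mulr1.
move=> f0; split=> //; have [nu [nuS nuA]] := spectral_measure_exists Lf.
exists nu => // N N0 B mB BN; have B0 := N0 B mB BN.
rewrite nuA// big1 => [|i _]; last by rewrite f0 nsq0 mul0r.
rewrite adde0; set Q := _ @^-1` _.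
have mQ : measurable (Q : set mR).
  by rewrite -[Q]setTI; exact: (measurable_scaled_cos (2 * k) measurableT mB).
have ih := integrable_patch (integrable_density Lf).
have mh : measurable_fun (Q : set mR) (EFin \o (spectral_density f \_ I)).
  by apply: measurable_funTS; exact: measurable_int ih.
rewrite -(integral0 mu Q); apply: ae_eq_integral => //.
apply: (ae_mono (spectral_preimage_null mB B0)) => t ht Qt; rewrite patchE; case: ifP => // /set_mem It.
by exfalso; exact: ht.
Qed.

(** Absence of atoms kills the coefficients along [psi], and a null carrier kills [T f]. The zero
    function does belong: its measure is zero, as the moment of order 0 shows. *)
Lemma sc_subspaceE : sc_subspace lam A = [set fun=> 0].
Proof.
apply/seteqP; split=> f.
  move=> [Lf [nu nuS [nu1 [B [mB B0 nuB]]]]].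
  have f0 i : dot f (psi i) = 0.
    apply: nsq_eq0; apply/eqP; have m1 : measurable ([set x i] : set R) by exact: measurable_set1.
    have := spectral_measure_unique Lf nuS m1; rewrite nu1 => /esym/eqP.
    rewrite padde_eq0; last 2 first.
    - by apply: integral_ge0 => t _; rewrite lee_fin patchE; case: ifP => _ //; exact: spectral_density_ge0.
    - by rewrite lee_fin; apply: sumr_ge0 => j _; rewrite mulr_ge0 ?nsq_ge0.
    move=> /andP[_ /eqP[]] /eqP; rewrite psumr_eq0 => [/allP /(_ i (mem_index_enum i))|j _]; last first.
      by rewrite mulr_ge0 ?nsq_ge0.
    by rewrite /= mem_set// mulr1.
  have := spectral_measure_unique Lf nuS (mC mB); rewrite nuB => /esym/eqP.
  rewrite padde_eq0; last 2 first.
  - by apply: integral_ge0 => t _; rewrite lee_fin patchE; case: ifP => _ //; exact: spectral_density_ge0.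
  - by rewrite lee_fin; apply: sumr_ge0 => i _; rewrite mulr_ge0 ?nsq_ge0.
  move=> /andP[/eqP h _].
  have T0 : aeK (T f) (fun=> 0).
    move=> c; have h1 := density_integral_null Lf (mC mB) h c.
    have h2 := spectral_preimage_null mB B0.
    by apply: (ae_mono (ae_and h1 h2)) => t [a1 a2] It; apply: a1 => //; exact: a2.
  rewrite /= (T_eq0 Lf T0); apply/funext => v; rewrite big1// => i _; by rewrite f0 mul0r.
move=> -> /=; split; first exact: sL.1.
have := spectral_measure_exists sL.1 => -[nu [nuS nuA]].
have L0 := sL.1.
have T0 : aeK (T (fun=> 0)) (fun=> 0).
  apply: (ipK_nondegenerate G) => [||X KX]; [exact: (sd_K SD)|exact: sK.1|].
  by rewrite (sd_dual SD)// (inner0l dotP) ?(inner0l KP)//; exact: synthesis_in_L2.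
have pp0 : pp_subspace lam A (fun=> 0) by rewrite pp_subspaceE.
have zero B : measurable B -> nu B = 0%E.
  have n0 : nu setT = 0%E.
    have [_ e] := nuS; have := e 0%N; rewrite /= (inner0l dotP)// => /esym.
    under eq_Rintegral do rewrite expr0.
    rewrite Rintegral_cst// mul1r => /complexI; move/eqP; rewrite fine_eq0; first by move/eqP.
    exact: fin_num_measure.
  move=> mB; apply/eqP; rewrite eq_le measure_ge0 andbT -n0; apply: le_measure; rewrite ?inE//.
exists nu => //; split=> [y|]; first by apply: zero; exact: measurable_set1.
exists set0; split=> //; apply: zero; exact: mC.
Qed.

End SpectralMeasure.

Lemma inorm_ae (R : realType) (f g : R -> R[i]) : L2D `[0, pi] f -> L2D `[0, pi] g ->
  {ae lebesgue_measure, forall t, (`[0, pi]%classic : set R) t -> f t = g t} ->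
  inorm (ip `[0, pi]) f = inorm (ip `[0, pi]) g.
Proof.
move=> Lf Lg fg; rewrite !inorm_Rintegral /Rintegral; congr fine.
apply: ae_eq_integral; first exact: mI.
- by apply/measurable_EFinP; exact: measurable_nsq Lf.1.
- by apply/measurable_EFinP; exact: measurable_nsq Lg.1.
- by apply: (ae_mono fg) => t h It; rewrite h.
Qed.

(** * The essential spectrum *)

Section Spectrum.
Variables (R : realType) (V : choiceType) (lam : V -> R) (nb : V -> seq V)
  (q r : nat) (ray : 'I_r -> nat -> V) (width : 'I_r -> R).
Hypothesis G : cusp_graph lam nb q ray width.
Local Notation C := R[i].
Local Notation A := (@nbop R V nb).
Local Notation k := (Num.sqrt (q%:R : R)).
Local Notation dot := (dot lam).
Local Notation L2 := (L2 lam).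
Local Notation I := (`[0, pi]%classic : set R).
Local Notation mu := (@lebesgue_measure R).
Local Notation mR := (measurableTypeR R).
Variables (E : R -> 'I_r -> V -> C) (S : R -> 'I_r -> 'I_r -> C) (bad : seq R)
  (d : {poly R}) (P : 'I_r -> 'I_r -> {poly R}).
Hypothesis SF : spectral_family nb q ray width E S bad d P.
Variables (m : nat) (psi : 'I_m -> V -> C) (x : 'I_m -> R) (T : (V -> C) -> 'I_r * R -> C).
Hypothesis SD : spectral_decomposition lam nb q width E psi x T.
Let lam0 := cg_lam G.
Let dotP := dot_inner lam0.
Let sL := L2_subspace lam0.
Local Notation ipK := (ipK q width).
Local Notation synthesis := (synthesis q width E).
Local Notation specC := (@specC R q).
Local Notation KL2 := (@KL2 R r).
Let KP := ipK_inner G.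
Let sK := inner_subspace KP.
Let k2 : 0 < 2 * k. Proof. by rewrite mulr_gt0// (k_gt0 G). Qed.
Let Alin := @nbop_lin R V nb.

Definition band : set C := [set y%:C%C | y in `[- (2 * k), 2 * k]].

Lemma band_separation z : ~ band z -> exists2 e, 0 < e & forall t, e <= nsq (specC t - z).
Proof.
case: z => u v zb; have [v0|v0] := eqVneq v 0; last first.
  exists (v ^+ 2) => [|t]; first by rewrite exprn_even_gt0.
  by rewrite /nsq /= sub0r sqrrN lerDr sqr_ge0.
have bd t := scaled_cos_bound k2 t.
have out : u < - (2 * k) \/ 2 * k < u.
  have [|h1] := ltP u (- (2 * k)); first by left.
  have [|h2] := ltP (2 * k) u; first by right.
  by exfalso; apply: zb; rewrite v0; exists u => //; rewrite /= in_itv /= h1.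
case: out => h.
  exists ((- (2 * k) - u) ^+ 2) => [|t]; first by rewrite exprn_gt0// subr_gt0.
  rewrite /nsq /=; apply: ler_wpDr; first exact: sqr_ge0.
  by have /andP[b1 _] := bd t; rewrite lerXn2r ?nnegrE ?subr_ge0// /spec; lra.
exists ((u - 2 * k) ^+ 2) => [|t]; first by rewrite exprn_gt0// subr_gt0.
rewrite /nsq /=; apply: ler_wpDr; first exact: sqr_ge0.
by have /andP[_ b1] := bd t; rewrite -(sqrrN (spec q t - u)) opprB lerXn2r ?nnegrE ?subr_ge0// /spec; lra.
Qed.

Lemma T_shift z f : L2 f ->
  aeK (T (fun v => A f v - z * f v)) (mult (fun t => specC t - z) (T f)).
Proof.
move=> Lf; have [D [_ DP]] := nbop_L2 G; have [LA _] := DP f Lf.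
have -> : (fun v => A f v - z * f v) = fun v => (- z) * f v + A f v.
  by apply/funext => v; ring.
apply: (aeK_trans (T_lin G SF SD (- z) Lf LA)) => c.
apply: (ae_mono (T_nbop G SF SD Lf c)) => t h It; rewrite h// /mult /=; ring.
Qed.

Let nsq_psi i : inorm dot (psi i) = 1.
Proof.
by apply: (@complexI R); rewrite -(inormE dotP (sd_L2 SD i)) (sd_ortho SD) eqxx.
Qed.

Lemma resolvent_set z (e : R) : 0 < e -> (forall t, e <= nsq (specC t - z)) ->
  (forall i, (x i)%:C%C != z) -> ~ spectrum lam A z.
(* The resolvent is explicit: division by [specC t - z] on the continuous part and by [x i - z]
   along [psi i]. The separation [e] bounds the first of these. *)
Proof.
move=> e0 ez xz; apply.
pose rho t := (specC t - z)^-1.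
have s0 t : specC t - z != 0.
  by apply/eqP => h; have := ez t; rewrite h nsq0 leNgt e0.
have mrho : cmeasurable I rho.
  apply: cmeasurable_inv; apply: cmeasurableD; first exact: cmeasurable_spec.
  exact: cmeasurable_cst.
have brho t : I t -> nsq (rho t) <= e^-1.
  move=> _; rewrite nsqV lef_pV2// ?posrE//.
  exact: lt_le_trans (ez t).
pose gam i := ((x i)%:C%C - z)^-1.
have g0 i : (x i)%:C%C - z != 0 by rewrite subr_eq0.
have [B B0 BP] := synthesis_L2 G SF.
have KM f : L2 f -> KL2 (mult rho (T f)) /\ inorm ipK (mult rho (T f)) <= e^-1 * inorm ipK (T f).
  by move=> Lf; apply: (mult_K G mrho brho); exact: (sd_K SD).
have Lsum (c : 'I_m -> C) : L2 (fun v => \sum_i c i * psi i v).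
  by apply: subspace_sum => // i _; exact: (sd_L2 SD).
exists (fun f v => synthesis (mult rho (T f)) v + \sum_i (gam i * dot f (psi i)) * psi i v).
have Lres f : L2 f -> L2 (fun v => synthesis (mult rho (T f)) v + \sum_i (gam i * dot f (psi i)) * psi i v).
  by move=> Lf; apply: (subspaceD sL) => //; exact: (synthesis_in_L2 G SF (KM f Lf).1).
split=> [//||f Lf|f Lf].
- exists (2 * (B * e^-1) + 2 * (2 ^+ m * \sum_i nsq (gam i))) => f Lf.
  have LR := Lres f Lf.
  rewrite !(l2norm2_inorm lam0)// -EFinM lee_fin.
  have [KMf KMb] := KM f Lf; have [LS SB] := BP _ KMf.
  apply: le_trans (inormD dotP LS (Lsum _)) _; rewrite [leRHS]mulrDl; apply: lerD.
    rewrite -mulrA ler_pM2l//; apply: le_trans SB _; rewrite -mulrA ler_wpM2l//.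
    apply: le_trans KMb _; rewrite ler_wpM2l ?invr_ge0 ?(ltW e0)//.
    exact: (T_le G SF SD).
  rewrite -mulrA ler_pM2l//.
  apply: le_trans (inorm_sum_le _ dotP _) _.
    by move=> i; apply: subspaceZ => //; exact: (sd_L2 SD).
  have -> : size (index_enum 'I_m) = m by rewrite -[RHS](card_ord m) cardT enumT [index_enum _]unlock.
  rewrite -[leRHS]mulrA ler_pM2l ?exprn_gt0//.
  rewrite mulr_suml; apply: ler_sum => i _.
  rewrite (inormZ dotP)//; last exact: (sd_L2 SD).
  rewrite nsq_psi mulr1 nsqM ler_wpM2l ?nsq_ge0//.
  by apply: le_trans (inner_CS dotP Lf (sd_L2 SD i)) _; rewrite nsq_psi mulr1.
- have [KMf _] := KM f Lf; have KTf := sd_K SD Lf.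
  have e1 : A (synthesis (mult rho (T f))) = synthesis (mult specC (mult rho (T f))).
    exact: (synthesis_nbop G SF).
  have KS := mult_spec_K G KMf.
  have e2 : synthesis (T f) = fun v => (- z) * synthesis (mult rho (T f)) v + A (synthesis (mult rho (T f))) v.
    rewrite e1 -(synthesis_lin G SF (- z) KMf KS); congr (synthesis _); apply/funext => ct.
    rewrite /mult /rho; have := s0 ct.2; set s := _ - z => sn.
    have -> : specC ct.2 = s + z by rewrite /s subrK.
    by field.
  rewrite [RHS](sd_expand SD Lf) e2.
  have := Alin 1 (synthesis (mult rho (T f))) (fun v => \sum_i (gam i * dot f (psi i)) * psi i v).
  under [X in nbop nb X = _]funext do rewrite mul1r.
  move=> ->; rewrite (linop_sum Alin _ xpredT (fun i => gam i * dot f (psi i)) psi); apply/funext => v /=.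
  have -> : \sum_i (gam i * dot f (psi i)) * A (psi i) v =
      z * (\sum_i (gam i * dot f (psi i)) * psi i v) + \sum_i dot f (psi i) * psi i v.
    rewrite mulr_sumr -big_split /=; apply: eq_bigr => i _; rewrite (sd_eigen SD) /gam.
    by have := g0 i; set s := _ - z => sn; have -> : (x i)%:C%C = s + z by [rewrite /s subrK]; field.
  ring.
- have [D [_ DP]] := nbop_L2 G; have [LA _] := DP f Lf.
  have Lh : L2 (fun v => A f v - z * f v).
    by apply: (subspaceB sL) => //; exact: subspaceZ.
  rewrite [RHS](sd_expand SD Lf).
  have -> : synthesis (mult rho (T (fun v => A f v - z * f v))) = synthesis (T f).
    apply: (synthesis_aeK G SF (KM _ Lh).1 (sd_K SD Lf)) => c.
    apply: (ae_mono (T_shift z Lf c)) => t h It.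
    by rewrite /mult /= in h *; rewrite h// mulrA mulVf// mul1r.
  apply/funext => v; congr (_ + _); apply: eq_bigr => i _; congr (_ * _).
  rewrite (innerBl dotP LA (subspaceZ z sL Lf) (sd_L2 SD i)) (innerZl dotP)//; last exact: (sd_L2 SD).
  rewrite (nbop_sym G)//; last exact: (sd_L2 SD).
  rewrite (sd_eigen SD) (innerZr dotP)//; last exact: (sd_L2 SD).
  by rewrite conjc_real -mulrBl mulrA /gam mulVf// mul1r.
Qed.

(** A parameter [t0] with [2 * k * cos t0 = y] has a one-sided neighborhood inside [0, pi] on which
    the value stays within [e] of [y]. *)
Lemma spectral_window (y e : R) : - (2 * k) <= y <= 2 * k -> 0 < e ->
  (0 < mu (I `&` [set t | (- e < 2 * k * cos t - y < e)%R]))%E.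
Proof.
move=> yb e0; pose t0 := acos (y / (2 * k)).
have yk : -1 <= y / (2 * k) <= 1.
  by rewrite ler_pdivlMr// ler_pdivrMr// mulN1r mul1r.
have c0 : 2 * k * cos t0 = y by rewrite acosK ?in_itv//= mulrC divfK// gt_eqF.
have t0b : 0 <= t0 <= pi by rewrite acos_ge0// acos_lepi.
have cc : {for t0, continuous (fun t => 2 * k * cos t)}.
  by apply: cvgM; [exact: cvg_cst|exact: continuous_cos].
have [dl /= dl0 dlP] : exists2 dl, 0 < dl & forall t, `|t0 - t| < dl -> - e < 2 * k * cos t - y < e.
  have /cvgrPdist_lt /(_ e e0) /nbhs_ballP[dl /= dl0 dlP] := cc.
  exists dl => // t td; have := dlP t td; rewrite c0 -ltr_norml distrC; exact.
(* At most half of [pi], so that there is room on the side of [t0] away from the nearer end. *)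
pose h := Num.min (dl / 2) (pi / 2).
have p0 := pi_gt0 R.
have h0 : 0 < h by rewrite lt_min; apply/andP; split; lra.
have h1 : h <= dl / 2 by rewrite ge_min lexx.
have h2 : h <= pi / 2 by rewrite ge_min lexx orbT.
have mS : measurable (I `&` [set t | (- e < 2 * k * cos t - y < e)%R] : set mR).
  apply: measurableI; first exact: mI.
  have := measurable_scaled_cos (2 * k) measurableT (measurable_itv `]y - e, y + e[).
  rewrite setTI; congr measurable; apply/seteqP; split=> t /=; rewrite in_itv /=;
    by move=> /andP[]; lra.
have sub a : `]a, (a + h)[%classic `<=` I `&` [set t | (- e < 2 * k * cos t - y < e)%R] ->
    (0 < mu (I `&` [set t | (- e < 2 * k * cos t - y < e)%R]))%E.
  have mh : (0 < mu (`]a, (a + h)%R[%classic : set R))%E.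
    by rewrite lebesgue_measure_itv /= lte_fin ltrDl h0 -EFinD lte_fin addrAC subrr add0r.
  by move=> s; apply: lt_le_trans mh (le_measure mu _ _ s); rewrite ?inE//; exact: measurable_itv.
have [tl|tl] := leP t0 (pi / 2).
  apply: (sub t0) => t /=; rewrite in_itv /= => /andP[a1 a2]; split.
    by rewrite /= in_itv /=; apply/andP; split; lra.
  by apply: dlP; rewrite distrC ger0_norm; lra.
apply: (sub (t0 - h)) => t /=; rewrite in_itv /= => /andP[a1 a2]; split.
  by rewrite /= in_itv /=; apply/andP; split; lra.
by apply: dlP; rewrite ger0_norm; lra.
Qed.

(** Synthesizing the indicator of a parameter window around [y] on one cusp gives approximate
    eigenvectors, which contradict a bounded inverse. *)
Lemma band_in_spectrum : (0 < r)%N -> band `<=` spectrum lam A.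
Proof.
move=> r0 _ [y /= yb <-] [B [LB [M BM] _ BI]].
rewrite in_itv /= in yb.
pose c0 := Ordinal r0.
(* Chosen so that [M] times [e ^+ 2] is less than 1 in absolute value. *)
pose e : R := (1 + `|M|)^-1.
have M1 : 0 < 1 + `|M| by rewrite ltr_wpDr.
have e0 : 0 < e by rewrite invr_gt0.
have e1 : e <= 1 by rewrite invf_le1// lerDl.
pose W := I `&` [set t | (- e < 2 * k * cos t - y < e)%R].
have W0 : (0 < mu W)%E by exact: spectral_window.
have mW : measurable (W : set mR).
  apply: measurableI; first exact: mI.
  have := measurable_scaled_cos (2 * k) measurableT (measurable_itv `]y - e, y + e[).
  rewrite setTI; congr measurable; apply/seteqP; split=> t /=; rewrite in_itv /=;
    by move=> /andP[]; lra.
pose F (ct : 'I_r * R) : C := ((ct.1 == c0)%:R * \1_W ct.2)%:C%C.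
have KF : KL2 F.
  move=> c; apply: (@L2D_bounded _ _ (@mI R) (@fI R) _ 1) => [|t _].
    apply: cmeasurable_real; apply: measurable_funTS; apply: measurable_funM => //.
    exact: measurable_indic.
  rewrite /F /= nsqR indicE; case: (_ == _); case: (_ \in _); rewrite ?mulr0 ?mul0r ?mulr1 ?expr0n ?expr1n//=.
pose f := synthesis F; have Lf : L2 f by exact: (synthesis_in_L2 G SF).
have TF : aeK (T f) F by exact: (T_synthesis G SF SD).
have f0 i : dot f (psi i) = 0.
  by rewrite (inner_conj dotP (sd_L2 SD i) Lf) (sd_psi SD)// conjc0.
have KT := sd_K SD Lf.
have nf : inorm dot f = inorm ipK (T f).
  apply: (@complexI R); rewrite -(inormE dotP Lf) -(inormE KP KT) (plancherel G SF SD)//.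
  by rewrite big1 ?addr0// => i _; rewrite f0 mul0r.
have nF : inorm ipK (T f) = inorm ipK F.
  apply: (@complexI R); rewrite -(inormE KP KT) -(inormE KP KF) (ipK_aeK G KT KF KT TF).
  by rewrite (inner_conj KP KT KF) (ipK_aeK G KT KF KF TF) -(inner_conj KP KF KF).
have f_gt0 : 0 < inorm dot f.
  rewrite nf nF lt_neqAle (inorm_ge0 KP KF) andbT eq_sym; apply/eqP => F0.
  have /(_ c0) h := aeK_inorm0 G KF F0.
  have [N [mN N0 sN]] := h.
  move: W0; rewrite lt_neqAle => /andP[/eqP + _]; apply; apply/esym/eqP.
  rewrite eq_le measure_ge0 andbT -N0; apply: le_measure; rewrite ?inE// => t Wt.
  apply: sN => /= ht; have := ht Wt.1; have -> : F (c0, t) = 1.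
    by rewrite /F /= indicE mem_set// ?eqxx mulr1.
  by move/eqP; rewrite oner_eq0.
pose g v := A f v - y%:C%C * f v.
have [D [_ DP]] := nbop_L2 G; have [LA _] := DP f Lf.
have Lg : L2 g by apply: (subspaceB sL) => //; exact: subspaceZ.
have g0 i : dot g (psi i) = 0.
  rewrite (innerBl dotP LA (subspaceZ _ sL Lf) (sd_L2 SD i)) (innerZl dotP)//; last exact: (sd_L2 SD).
  rewrite (nbop_sym G)//; last exact: (sd_L2 SD).
  rewrite (sd_eigen SD) (innerZr dotP)//; last exact: (sd_L2 SD).
  by rewrite f0 !mulr0 subrr.
have KTg := sd_K SD Lg.
have ng : inorm dot g <= e ^+ 2 * inorm dot f.
  have -> : inorm dot g = inorm ipK (T g).
    apply: (@complexI R); rewrite -(inormE dotP Lg) -(inormE KP KTg) (plancherel G SF SD)//.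
    by rewrite big1 ?addr0// => i _; rewrite g0 mul0r.
  rewrite nf nF !(inorm_ipK G)// mulr_sumr; apply: ler_sum => c _.
  rewrite mulrCA ler_pM2l ?(kappa_gt0 G)//.
  pose H t := (specC t - y%:C%C) * F (c, t).
  have mu1 : cmeasurable I (fun t => (specC t - y%:C%C) * (\1_W t)%:C%C).
    apply: cmeasurableM; first by apply: cmeasurableD; [exact: cmeasurable_spec|exact: cmeasurable_cst].
    by apply: cmeasurable_real; apply: measurable_funTS; exact: measurable_indic.
  have bd t : I t -> nsq ((specC t - y%:C%C) * (\1_W t)%:C%C) <= e ^+ 2.
    move=> It; rewrite nsqM indicE; have [/set_mem[_ /= /andP[w1 w2]]|_] := boolP (t \in W).
      rewrite !nsqR expr1n mulr1 /specC -(rmorphB (real_complex R)) nsqR /spec.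
      by rewrite -real_normK ?num_real// lerXn2r ?nnegrE ?(ltW e0)// ltW// ltr_norml; lra.
    by rewrite nsqR expr0n mulr0 sqr_ge0.
  have [L1 L2'] := L2D_mul (@mI R) (@fI R) mu1 bd (KF c).
  apply: le_trans L2'; rewrite le_eqVlt; apply/orP; left; apply/eqP.
  have agg : {ae mu, forall t, I t -> T g (c, t) = (specC t - y%:C%C) * (\1_W t)%:C%C * F (c, t)}.
    apply: (ae_mono (ae_and (T_shift y%:C%C Lf c) (TF c))) => t [h1 h2] It.
    rewrite h1// /mult /= h2// /F /= indicE; case: (_ \in _); rewrite ?mulr1// !mulr0 ?mulr0//.
  exact: inorm_ae.
have := BM g Lg; rewrite BI// !(l2norm2_inorm lam0)// -EFinM lee_fin => fM.
have h1 : M * inorm dot g <= `|M| * (e ^+ 2 * inorm dot f).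
  apply: le_trans (ler_wpM2r (inorm_ge0 dotP Lg) (ler_norm M)) _.
  by rewrite ler_wpM2l.
have h2 : `|M| * e ^+ 2 < 1.
  rewrite expr2 mulrA; have h3 : `|M| * e < 1 by rewrite ltr_pdivrMr// mul1r ltrDr.
  have h4 : 0 <= `|M| * e by rewrite mulr_ge0 ?(ltW e0).
  by apply: le_lt_trans h3; rewrite ler_piMr.
have := le_trans fM h1; rewrite mulrA leNgt; move/negP; apply.
by rewrite gtr_pMl.
Qed.

Lemma finite_gap (y : R) : exists2 e, 0 < e & forall i, x i != y -> e <= `|x i - y|.
Proof.
exists (\big[Num.min/1]_(i | x i != y) `|x i - y|) => [|i xi].
  by apply: lt_bigmin => // i xi; rewrite normr_gt0 subr_eq0.
exact: bigmin_le_cond.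
Qed.

(** Off the band a spectral value is one of the finitely many [x i]; it is isolated, and of finite
    multiplicity because its eigenfunctions have [T f = 0] almost everywhere. A point of the band is
    not isolated. *)
Lemma essential_spectrumE : (0 < r)%N -> essential_spectrum lam A = band.
Proof.
move=> r0; apply/seteqP; split=> z.
  move=> [zs zd]; apply: contrapT => zb; apply: zd.
  have [e e0 ez] := band_separation zb.
  have [i xi] : exists i, (x i)%:C%C = z.
    apply: contrapT => nx; apply: (resolvent_set e0 ez _ zs) => i.
    by apply/eqP => xi; apply: nx; exists i.
  split=> //.
  - have [e1 e10 e1P] := finite_gap (x i).
    (* Within this distance of [z] there is neither another eigenvalue [x j] nor a point of the
       band. *)
    pose e2 := Num.min e1 (Num.sqrt e).
    have e20 : 0 < e2 by rewrite lt_min e10 sqrtr_gt0.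
    apply/nbhs_ballP; exists e2%:C%C => /=; first by rewrite ltcR.
    move=> z' /= zz' z'z.
    have {}zz' : nsq (z - z') < e2 ^+ 2.
      have zz1 : (`|(z : C) - z'| : C) < e2%:C%C := zz'.
      rewrite normc_def ltcR in zz1; rewrite -(sqr_sqrtr (nsq_ge0 _)).
      by rewrite ltrXn2r ?nnegrE ?sqrtr_ge0 ?(ltW e20).
    have zb' : ~ band z'.
      move=> [y yb yz]; have := ez (acos (y / (2 * k))).
      have {}yb : - (2 * k) <= y <= 2 * k by move: yb; rewrite /= in_itv.
      have -> : specC (acos (y / (2 * k))) = z'.
        rewrite -yz /specC /spec acosK; first by rewrite mulrC divfK// gt_eqF.
        by rewrite in_itv /= ler_pdivlMr// ler_pdivrMr// mulN1r mul1r.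
      rewrite -nsqN opprB leNgt; move/negP; apply; apply: lt_le_trans zz' _.
      by rewrite -[leRHS](sqr_sqrtr (ltW e0)) lerXn2r ?nnegrE ?(ltW e20) ?sqrtr_ge0// ge_min lexx orbT.
    have [e' e'0 e'P] := band_separation zb'.
    apply: (resolvent_set e'0 e'P) => j; apply/eqP => xj.
    have xij : x j != x i by apply/eqP => h; move/negP: z'z; apply; apply/eqP; rewrite -xj h xi.
    have := e1P j xij; rewrite leNgt => /negP; apply.
    move: zz'; rewrite -xj -xi -(rmorphB (real_complex R)) nsqR => h.
    rewrite -(ltr_pXn2r (ltn0Sn 1)) ?nnegrE ?(ltW e10)// real_normK ?num_real// -sqrrN opprB.
    apply: lt_le_trans h _; rewrite lerXn2r ?nnegrE ?(ltW e20) ?(ltW e10)//.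
    by rewrite ge_min lexx.
  - exists (psi i); first by split; [exact: (sd_L2 SD)|rewrite (sd_eigen SD) xi].
    move=> h; have := sd_ortho SD i i; rewrite eqxx h (inner0l dotP sL.1) => /eqP.
    by rewrite eq_sym oner_eq0.
  - exists m, psi => f [Lf Af]; exists (fun j => dot f (psi j)).
    apply: (T_eq0 G SF SD Lf) => c.
    have KT := sd_K SD Lf.
    have h0 : aeK (T (fun v => A f v - z * f v)) (fun=> 0).
      have -> : (fun v => A f v - z * f v) = fun=> 0.
        by apply/funext => v; rewrite Af subrr.
      apply: (ipK_nondegenerate G) => [||X KX]; [exact: (sd_K SD sL.1)|exact: sK.1|].
      rewrite (sd_dual SD sL.1 KX) (inner0l dotP) ?(inner0l KP)//.
      exact: (synthesis_in_L2 G SF).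
    apply: (ae_mono (ae_and (h0 c) (T_shift z Lf c))) => t [h1 h2] It.
    have := h2 It; rewrite h1// /mult /= => /esym/eqP; rewrite mulf_eq0 => /orP[/eqP s0|/eqP//].
    by exfalso; have := ez t; rewrite s0 nsq0 leNgt e0.
move=> zb; split; first exact: (band_in_spectrum r0 zb).
case: zb => y yb <- [_ iso _ _].
have {}yb : - (2 * k) <= y <= 2 * k by move: yb; rewrite /= in_itv.
move: iso => /nbhs_ballP[[e e'] /= e0 eP].
(* The radius of the ball is a positive element of [R[i]], hence real. *)
have [/eqP e'E er0] : e' == 0 /\ 0 < e by move: e0; rewrite ltcE /= => /andP[/eqP -> ->].
subst e'.
have [y' [y'b y'y yy']] : exists y', [/\ - (2 * k) <= y' <= 2 * k, y' != y & `|y - y'| < e].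
  pose h := Num.min (e / 2) (2 * k).
  have h0 : 0 < h by rewrite lt_min k2 andbT divr_gt0.
  have h1 : h <= e / 2 by rewrite ge_min lexx.
  have h2 : h <= 2 * k by rewrite ge_min lexx orbT.
  case/andP: yb => y1 y2; have [y0|y0] := leP y 0.
    exists (y + h); split; [apply/andP; split; lra|by rewrite gt_eqF// ltrDl|].
    by rewrite opprD addNKr normrN gtr0_norm//; lra.
  exists (y - h); split; [apply/andP; split; lra|by rewrite lt_eqF// ltrBlDr ltrDl|].
  by rewrite opprB addrCA subrr addr0 gtr0_norm//; lra.
apply: (eP y'%:C%C).
- change ((`|y%:C%C - y'%:C%C| : C) < e%:C%C).
  by rewrite -(rmorphB (real_complex R)) normc_def /= expr0n addr0 sqrtr_sqr ltcR.
- by apply/eqP => h; move/eqP: y'y; apply; apply: (@complexI R).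
- by apply: (band_in_spectrum r0); exists y' => //=; rewrite in_itv.
Qed.

End Spectrum.

(** * Multiplicity and the Plancherel formula *)

Section Multiplicity.
Variables (R : realType) (V : choiceType) (lam : V -> R) (nb : V -> seq V)
  (q r : nat) (ray : 'I_r -> nat -> V) (width : 'I_r -> R).
Hypothesis G : cusp_graph lam nb q ray width.
Local Notation C := R[i].
Local Notation A := (@nbop R V nb).
Local Notation k := (Num.sqrt (q%:R : R)).
Local Notation L2 := (L2 lam).
Local Notation I := (`[0, pi]%classic : set R).
Local Notation a := (2 * k).
Local Notation J := (`]- a, a[%classic : set R).
Local Notation mu := (@lebesgue_measure R).
Local Notation mR := (measurableTypeR R).
Variables (E : R -> 'I_r -> V -> C) (S : R -> 'I_r -> 'I_r -> C) (bad : seq R)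
  (d : {poly R}) (P : 'I_r -> 'I_r -> {poly R}).
Hypothesis SF : spectral_family nb q ray width E S bad d P.
Variables (m : nat) (psi : 'I_m -> V -> C) (x : 'I_m -> R) (T : (V -> C) -> 'I_r * R -> C).
Hypothesis SD : spectral_decomposition lam nb q width E psi x T.
Let lam0 := cg_lam G.
Let dotP := dot_inner lam0.
Local Notation kappa := (kappa q width).
Local Notation ipK := (ipK q width).
Local Notation synthesis := (synthesis q width E).
Local Notation specC := (@specC R q).
Local Notation KL2 := (@KL2 R r).
Let KP := ipK_inner G.
Let a0 : 0 < a. Proof. by rewrite mulr_gt0// (k_gt0 G). Qed.
Let mJ : measurable (J : set mR). Proof. exact: measurable_itv. Qed.

Lemma msin : measurable_fun [set: mR] (@sin R).
Proof. by apply: continuous_measurable_fun; exact: continuous_sin. Qed.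

Lemma acos_in y : J y -> [/\ 0 < acos (y / a) < pi, 0 < sin (acos (y / a)) & a * cos (acos (y / a)) = y].
Proof.
rewrite /= in_itv /= => /andP[y1 y2].
have ya : -1 < y / a < 1.
  by rewrite ltr_pdivlMr// ltr_pdivrMr// mulN1r mul1r y1.
have t0 : 0 < acos (y / a) < pi by rewrite acos_gt0 ?acos_ltpi//; case/andP: ya => ? ?; apply/andP; split; rewrite ?(ltW)//.
split=> //; first by rewrite sin_gt0_pi.
have yb : -1 <= y / a <= 1 by case/andP: ya => ? ?; rewrite !ltW.
by rewrite acosK ?in_itv//= mulrC divfK// gt_eqF.
Qed.

(** Null sets of parameters have null images under [a * cos t], by [change_of_variables] for the
    indicator of the image. *)
Lemma acos_ae (Q : R -> Prop) : {ae mu, forall t, I t -> Q t} ->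
  {ae mu, forall y, J y -> Q (acos (y / a))}.
Proof.
move=> [N [mN N0 sN]]; pose B := J `&` (fun y => acos (y / a)) @^-1` N.
have mB : measurable (B : set mR) by exact: (measurable_scaled_acos a0 mJ mN).
exists B; split=> //; last first.
  move=> y /= /not_implyP[Jy nQ]; split=> //; apply: sN => /= h; apply: nQ; apply: h.
  by have [/andP[h1 h2] _ _] := acos_in Jy; rewrite /= in_itv /= !ltW.
have mi : measurable_fun [set: R] (\1_B : R -> R) by exact: measurable_indic.
have := change_of_variables a0 mi (fun y => _ : 0 <= \1_B y).
rewrite integral_indic; [|exact: measurable_itv|exact: mB].
have -> : B `&` `[(- a), a]%classic = B.
  apply/seteqP; split=> [y []//|y By]; split=> //; case: By => /= + _.
  by rewrite !in_itv /= => /andP[h1 h2]; rewrite !ltW.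
move=> ->; last by move=> y; rewrite indicE.
rewrite -[RHS](integral0 mu I); apply: ae_eq_integral => //.
  apply: measurable_funTS; apply/measurable_EFinP; apply: measurable_funM.
    exact: (measurableT_comp mi (measurable_scaled_cos a)).
  by apply: measurable_funM => //; exact: msin.
exists N; split=> // t /= /not_implyP[It h]; apply: contrapT => Nt; apply: h.
rewrite indicE; have [/set_mem[_ /=]|_] := boolP (_ \in B); last by rewrite mul0r.
by rewrite scaled_cosK//; move: It; rewrite /= in_itv.
Qed.

Lemma energy (g : R -> C) : cmeasurable setT g -> (forall y, ~ J y -> g y = 0) ->
  (\int[mu]_y (nsq (g y))%:E = \int[mu]_(t in I) (nsq (g (a * cos t)) * (a * sin t))%:E)%E.
Proof.
move=> mg g0; have mn : measurable_fun [set: R] (fun y => nsq (g y)) by exact: measurable_nsq.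
rewrite -(change_of_variables a0 mn (fun y => nsq_ge0 (g y))) [RHS]integral_mkcond.
apply: eq_integral => y _; rewrite patchE; case: ifPn => // /negP yn; congr EFin.
rewrite g0 ?nsq0// => Jy; apply: yn; apply/mem_set; move: Jy.
by rewrite /= !in_itv /= => /andP[h1 h2]; rewrite !ltW.
Qed.

Lemma kappaV_gt0 c : 0 < (kappa c)^-1.
Proof. by rewrite invr_gt0 (kappa_gt0 G). Qed.

(** The ratio of [dy] to [kappa c dt] for [y = a * cos t], up to sign. *)
Definition jacobian c t : R := (kappa c)^-1 * (a * sin t).

Lemma jacobian_ge0 c t : I t -> 0 <= jacobian c t.
Proof.
rewrite /= in_itv /= => t0; rewrite mulr_ge0 ?(ltW (kappaV_gt0 c))//.
by rewrite mulr_ge0 ?(ltW a0)// sin_ge0_pi.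
Qed.

Lemma measurable_jacobian c p : measurable_fun [set: mR] (fun t => jacobian c t `^ p).
Proof.
apply: (measurableT_comp (@measurable_powR R p)).
by apply: measurable_funM => //; apply: measurable_funM => //; exact: msin.
Qed.

Lemma powR_half_sqr (p : R) : 0 <= p -> (p `^ 2^-1) ^+ 2 = p.
Proof. by move=> p0; rewrite -powR_mulrn ?powR_ge0// -powRrM mulVf// powRr1. Qed.

Lemma powR_Nhalf (p : R) : p `^ (- 2^-1) = (p `^ 2^-1)^-1.
Proof. by rewrite powRN. Qed.

(* Up to the Jacobian, F in the variable y = 2 sqrt q cos t; the square of the
   first weight times |dy/dt| is kappa_c. *)
Definition half_density (F : 'I_r * R -> C) c y : C :=
  (\1_J y)%:C%C * ((jacobian c (acos (y / a)) `^ (- 2^-1))%:C%C * F (c, acos (y / a))).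

Lemma half_density_out F c y : ~ J y -> half_density F c y = 0.
Proof. by move=> Jy; rewrite /half_density indicE memNset// mul0r. Qed.

Lemma cmeasurable_half_density F c : KL2 F -> cmeasurable setT (half_density F c).
Proof.
move=> KF; pose H t : C := (jacobian c t `^ (- 2^-1))%:C%C * F (c, t).
have mH : cmeasurable I H.
  apply: cmeasurableM; last exact: (KF c).1.
  by apply: cmeasurable_real; apply: measurable_funTS; exact: measurable_jacobian.
have sub : (fun y => acos (y / a)) @` J `<=` I.
  by move=> _ [y Jy <-]; have [/andP[h1 h2] _ _] := acos_in Jy; rewrite /= in_itv /= !ltW.
have e (p : C -> R) : p 0 = 0 -> (fun y => p (half_density F c y)) = (fun y => p (H (acos (y / a)))) \_ J.
  move=> p0; apply/funext => y; rewrite patchE; case: ifPn => [yJ|/negP yJ].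
    by rewrite /half_density indicE yJ mul1r.
  by rewrite half_density_out ?p0// => Jy; apply: yJ; exact: mem_set.
split; rewrite e//; apply/(measurable_restrictT _ mJ).
  exact: (measurable_comp (@mI R) sub mH.1 (measurable_scaled_acos a0)).
exact: (measurable_comp (@mI R) sub mH.2 (measurable_scaled_acos a0)).
Qed.

Lemma half_density_norm F c : KL2 F ->
  (\int[mu]_y (nsq (half_density F c y))%:E = (kappa c * inorm (ip I) (fun t => F (c, t)))%:E)%E.
Proof.
move=> KF; have mh := cmeasurable_half_density c KF.
rewrite (energy mh (@half_density_out F c)) EFinM -(sqint_inorm (@mI R) (KF c)) /sqint.
rewrite -integralZl//; last exact: (integrable_nsq (KF c)).
apply: ae_eq_integral; first exact: mI.
- apply/measurable_EFinP; apply: measurable_funM.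
    apply: measurable_funTS; apply: (measurableT_comp (measurable_nsq mh)).
    exact: measurable_scaled_cos.
  by apply: measurable_funTS; apply: measurable_funM => //; exact: msin.
- apply/measurable_EFinP; apply: measurable_funM => //; exact: measurable_nsq (KF c).1.
(* The Jacobian vanishes at both ends, which are therefore excluded. *)
apply: (ae_mono (ae_notin [:: 0; pi])) => t + It.
rewrite !inE negb_or => /andP[t1 t2].
have tI : 0 < t < pi.
  by move: It; rewrite /= in_itv /= => /andP[h1 h2]; rewrite lt_neqAle eq_sym t1 h1 lt_neqAle t2 h2.
have tI' : 0 <= t <= pi by case/andP: tI => h1 h2; rewrite !ltW.
rewrite -EFinM; congr EFin.
have Jt : J (a * cos t) by rewrite /= in_itv /=; exact: scaled_cos_open.
rewrite /half_density indicE mem_set// mul1r scaled_cosK// nsqM nsqR powR_Nhalf exprVn.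
rewrite powR_half_sqr; last exact: jacobian_ge0.
rewrite /jacobian invfM invrK; have s0 : a * sin t != 0 by rewrite mulf_neq0 ?gt_eqF// sin_gt0_pi.
by rewrite -mulrA [nsq _ * _]mulrC mulrA mulfVK.
Qed.

Lemma direct_integral_norm2_finite (H : nat -> R -> C) : (forall j, (r <= j)%N -> H j = fun=> 0) ->
  direct_integral_norm2 H = (\sum_(c < r) \int[mu]_y (nsq (H c y))%:E)%E.
Proof.
move=> H0; rewrite /direct_integral_norm2.
have e j : (\int[mu]_y (ComplexField.Normc.normc (H j y) ^+ 2)%:E = \int[mu]_y (nsq (H j y))%:E)%E.
  by apply: eq_integral => y _; rewrite normc_sqr.
under eq_eseriesr do rewrite e.
rewrite (nneseries_split 0 r); last by move=> j _; apply: integral_ge0 => y _; rewrite lee_fin nsq_ge0.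
rewrite add0n big_mkord eseries0 ?adde0// => j rj _.
by rewrite H0//; under eq_integral do rewrite nsq0; rewrite integral0.
Qed.

(** A direct integral is indexed by all natural numbers; the cusps take the first [r] places. *)
Definition ac_transform (f : V -> C) (j : nat) : R -> C :=
  if insub j is Some c then half_density (T f) c else fun=> 0.

Lemma ac_transform_norm f : L2 f -> direct_integral_norm2 (ac_transform f) = (inorm ipK (T f))%:E.
Proof.
move=> Lf; have KT := sd_K SD Lf; rewrite direct_integral_norm2_finite => [|j rj]; last first.
  by rewrite /ac_transform insubN// -leqNgt.
rewrite (inorm_ipK G)// -sumEFin; apply: eq_bigr => c _.
by rewrite /ac_transform valK half_density_norm.
Qed.

Definition ac_multiplicity (y : R) : \bar R := (r%:R * \1_J y)%:E.

(** [half_density] is an isometry from the parameter side to functions of [y]. Linearity, the action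
    of [A] and surjectivity are those of [T], transported by [acos_ae]. *)
Lemma ac_multiplicityP : is_ac_multiplicity lam A ac_multiplicity.
Proof.
split.
- apply/measurable_EFinP; exact: measurable_funM.
- move=> y; right; exists (r * (y \in J))%N; by rewrite /ac_multiplicity indicE natrM.
exists ac_transform; split.
- move=> f; rewrite (ac_subspaceE G SF SD) => -[Lf f0]; have KT := sd_K SD Lf.
  have e : direct_integral_norm2 (ac_transform f) = l2norm2 lam f.
    rewrite ac_transform_norm// (l2norm2_inorm lam0 Lf); congr EFin; apply: (@complexI R).
    rewrite -(inormE dotP Lf) -(inormE KP KT) (plancherel G SF SD)// big1 ?addr0// => i _.
    by rewrite f0 mul0r.
  split=> //; split.
  + move=> j; rewrite /ac_transform; case: insubP => [c _ _|_]; last exact: cmeasurable_cst.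
    exact: cmeasurable_half_density.
  + move=> j y; rewrite /ac_multiplicity lee_fin /ac_transform; case: insubP => [c jr cj|//].
    rewrite indicE; have [yJ|/negP yJ _] := boolP (y \in J).
      by rewrite mulr1 ler_nat leqNgt jr.
    by apply: half_density_out => Jy; apply: yJ; exact: mem_set.
  + by rewrite e (l2norm2_inorm lam0 Lf) ltry.
- move=> z f g; rewrite (ac_subspaceE G SF SD) => -[Lf _] [Lg _] j.
  rewrite /ac_transform; case: insubP => [c _ _|_]; last by apply: aeW => y; rewrite mulr0 addr0.
  apply: (ae_mono (acos_ae (T_lin G SF SD z Lf Lg c))) => y h.
  have [Jy|Jy] := pselect (J y); last by rewrite !half_density_out// mulr0 addr0.
  by rewrite /half_density h//; ring.
- move=> f; rewrite (ac_subspaceE G SF SD) => -[Lf _] j.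
  rewrite /ac_transform; case: insubP => [c _ _|_]; last by apply: aeW => y; rewrite mulr0.
  apply: (ae_mono (acos_ae (T_nbop G SF SD Lf c))) => y h.
  have [Jy|Jy] := pselect (J y); last by rewrite !half_density_out// mulr0.
  have [_ _ e] := acos_in Jy.
  by rewrite /half_density h// /mult /specC /spec e; ring.
move=> H [mH H0 Hn].
have Hr j : (r <= j)%N -> H j = fun=> 0.
  move=> rj; apply/funext => y; apply: H0; rewrite /ac_multiplicity lee_fin indicE.
  by case: (_ \in _); rewrite ?mulr1 ?mulr0 ?ler_nat.
have HJ j y : ~ J y -> H j y = 0.
  by move=> Jy; apply: H0; rewrite /ac_multiplicity lee_fin indicE memNset// mulr0.
rewrite (direct_integral_norm2_finite Hr) in Hn.
(* The inverse of [half_density]: the Jacobian enters with exponent one half instead of minus one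
   half. *)
pose F (ct : 'I_r * R) : C := (jacobian ct.1 ct.2 `^ 2^-1)%:C%C * H ct.1 (a * cos ct.2).
have mHc (c : 'I_r) : cmeasurable I (fun t => H c (a * cos t)).
  by split; apply: measurable_funTS; [apply: (measurableT_comp (mH c).1)|apply: (measurableT_comp (mH c).2)];
    exact: measurable_scaled_cos.
have KF : KL2 F.
  move=> c; split.
    apply: cmeasurableM; last exact: mHc.
    by apply: cmeasurable_real; apply: measurable_funTS; exact: measurable_jacobian.
  have -> : sqint I (fun t => F (c, t)) = ((kappa c)^-1%:E * \int[mu]_y (nsq (H c y))%:E)%E.
    rewrite (energy (mH c) (HJ c)) -ge0_integralZl//; last 3 first.
    - apply/measurable_EFinP; apply: measurable_funM; first exact: measurable_nsq.
      by apply: measurable_funTS; apply: measurable_funM => //; exact: msin.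
    - move=> t; rewrite /= in_itv /= => t0; rewrite lee_fin mulr_ge0 ?nsq_ge0//.
      by rewrite mulr_ge0 ?(ltW a0)// sin_ge0_pi.
    - by rewrite lee_fin ltW// kappaV_gt0.
    apply: eq_integral => t /set_mem It; rewrite -EFinM; congr EFin.
    rewrite /F /= nsqM nsqR powR_half_sqr; last exact: jacobian_ge0.
    by rewrite /jacobian; ring.
  apply: lte_mul_pinfty => //; first by rewrite lee_fin ltW// kappaV_gt0.
  apply: le_lt_trans Hn; rewrite (bigD1 c)//= leeDl//; apply: sume_ge0 => c' _.
  by apply: integral_ge0 => y _; rewrite lee_fin nsq_ge0.
have Lf := synthesis_in_L2 G SF KF.
exists (synthesis F).
  rewrite (ac_subspaceE G SF SD); split=> // i.
  by rewrite (inner_conj dotP (sd_L2 SD i) Lf) (sd_psi SD)// conjc0.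
move=> j; rewrite /ac_transform; case: insubP => [c _ cj|]; last first.
  by rewrite -leqNgt => rj; apply: aeW => y; rewrite Hr.
apply: (ae_mono (acos_ae (T_synthesis G SF SD KF c))) => y h.
have [Jy|Jy] := pselect (J y); last by rewrite half_density_out// HJ.
have [tI st e] := acos_in Jy.
rewrite /half_density h// indicE mem_set// mul1r /F /= e -cj mulrA.
rewrite -(rmorphM (real_complex R)) powR_Nhalf mulVf ?mul1r//.
rewrite gt_eqF// powR_gt0// mulr_gt0 ?kappaV_gt0// mulr_gt0//.
Qed.

End Multiplicity.

(** * The orthogonal decomposition and the projection onto the discrete spectrum *)

Section Projection.
Variables (R : realType) (V : choiceType) (lam : V -> R) (nb : V -> seq V)
  (q r : nat) (ray : 'I_r -> nat -> V) (width : 'I_r -> R).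
Hypothesis G : cusp_graph lam nb q ray width.
Local Notation C := R[i].
Local Notation A := (@nbop R V nb).
Local Notation dot := (dot lam).
Local Notation L2 := (L2 lam).
Variables (E : R -> 'I_r -> V -> C) (S : R -> 'I_r -> 'I_r -> C) (bad : seq R)
  (d : {poly R}) (P : 'I_r -> 'I_r -> {poly R}).
Hypothesis SF : spectral_family nb q ray width E S bad d P.
Variables (m : nat) (psi : 'I_m -> V -> C) (x : 'I_m -> R) (T : (V -> C) -> 'I_r * R -> C).
Hypothesis SD : spectral_decomposition lam nb q width E psi x T.
Let lam0 := cg_lam G.
Let dotP := dot_inner lam0.
Let sL := L2_subspace lam0.
Local Notation ipK := (ipK q width).
Local Notation synthesis := (synthesis q width E).
Local Notation KL2 := (@KL2 R r).
Let KP := ipK_inner G.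
Let sK := inner_subspace KP.

Lemma T_zero : aeK (T (fun=> 0)) (fun=> 0).
Proof.
apply: (ipK_nondegenerate G) => [||X KX]; [exact: (sd_K SD sL.1)|exact: sK.1|].
by rewrite (sd_dual SD sL.1 KX) (inner0l dotP) ?(inner0l KP)//; exact: (synthesis_in_L2 G SF).
Qed.

Definition discrete_part f v : C := \sum_i dot f (psi i) * psi i v.

Lemma discrete_part_L2 f : L2 (discrete_part f).
Proof. by apply: subspace_sum => // i _; exact: (sd_L2 SD). Qed.

Lemma discrete_part_pp f : pp_subspace lam A (discrete_part f).
Proof.
rewrite (pp_subspaceE G SF SD); split; first exact: discrete_part_L2.
apply: (ipK_nondegenerate G) => [||X KX]; [exact: (sd_K SD (discrete_part_L2 f))|exact: sK.1|].
have LX := synthesis_in_L2 G SF KX.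
rewrite (sd_dual SD (discrete_part_L2 f) KX) (inner0l KP)// (inner_suml dotP)//.
  by rewrite big1// => i _; rewrite (sd_psi SD)// mulr0.
by move=> i _; exact: (sd_L2 SD).
Qed.

Lemma synthesis_ac F : KL2 F -> ac_subspace lam A (synthesis F).
Proof.
move=> KF; have Lf := synthesis_in_L2 G SF KF.
rewrite (ac_subspaceE G SF SD); split=> // i.
by rewrite (inner_conj dotP (sd_L2 SD i) Lf) (sd_psi SD)// conjc0.
Qed.

Lemma pp_orthogonal_ac f g : pp_subspace lam A f -> ac_subspace lam A g -> dot f g = 0.
Proof.
rewrite (pp_subspaceE G SF SD) (ac_subspaceE G SF SD) => -[Lf f0] [Lg g0].
have KTf := sd_K SD Lf; have KTg := sd_K SD Lg.
rewrite (plancherel G SF SD)// (ipK_aeK G KTf sK.1 KTg f0) (inner0l KP)// add0r.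
by rewrite big1// => i _; rewrite g0 conjc0 mulr0.
Qed.

Lemma orthogonal_decomposition :
  orthogonal_direct_sum lam L2 (pp_subspace lam A) (ac_subspace lam A).
Proof.
split.
- split; split.
  + by rewrite (pp_subspaceE G SF SD); split; [exact: sL.1|exact: T_zero].
  + move=> z f g; rewrite (pp_subspaceE G SF SD) => -[Lf f0] [Lg g0]; split; first exact: sL.2.
    apply: (aeK_trans (T_lin G SF SD z Lf Lg)) => c.
    by apply: (ae_mono (ae_and (f0 c) (g0 c))) => t [h1 h2] It; rewrite h1// h2// mulr0 addr0.
  + by rewrite (ac_subspaceE G SF SD); split=> [|i]; [exact: sL.1|rewrite (inner0l dotP)//; exact: (sd_L2 SD)].
  + move=> z f g; rewrite (ac_subspaceE G SF SD) => -[Lf f0] [Lg g0]; split; first exact: sL.2.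
    by move=> i; rewrite (inner_lin dotP)// ?f0 ?g0 ?mulr0 ?addr0//; exact: (sd_L2 SD).
- by split=> f [].
- exact: pp_orthogonal_ac.
- move=> f Lf; exists (discrete_part f), (synthesis (T f)); split.
  + exact: discrete_part_pp.
  + by apply: synthesis_ac; exact: (sd_K SD).
  + by rewrite {1}(sd_expand SD Lf); apply/funext => v; rewrite addrC.
Qed.

Lemma pp_finite_dimensional : finite_dimensional (pp_subspace lam A).
Proof.
exists m, psi => f; rewrite (pp_subspaceE G SF SD) => -[Lf f0].
by exists (fun i => dot f (psi i)); exact: (T_eq0 G SF SD).
Qed.

Variables (N : nat) (phi : 'I_N -> V -> C).
Hypothesis phiP : orthonormal_basis lam (pp_subspace lam A) phi.

(** The projection onto the pure point subspace does not depend on the orthonormal basis, so the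
    given [phi] and the constructed [psi] yield the same operator. *)
Lemma projectorE f : L2 f -> projector lam phi f = discrete_part f.
Proof.
case: phiP => phi_pp phi_on phi_span Lf.
have Lphi i : L2 (phi i) by case: (phi_pp i).
have LS := synthesis_in_L2 G SF (sd_K SD Lf).
have [b e] := phi_span _ (discrete_part_pp f).
have ef j : dot f (phi j) = b j.
  rewrite {1}(sd_expand SD Lf) (innerDl dotP)//; last exact: discrete_part_L2.
  rewrite (inner_conj dotP (Lphi j) LS) (pp_orthogonal_ac (phi_pp j) (synthesis_ac (sd_K SD Lf))).
  rewrite conjc0 add0r -/(discrete_part f) e (inner_suml dotP)//.
  rewrite (bigD1 j)//= phi_on eqxx mulr1 big1 ?addr0// => i ij.
  by rewrite phi_on (negbTE ij) mulr0.
by rewrite e; apply/funext => v; apply: eq_bigr => j _; rewrite ef.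
Qed.

Lemma plancherel_projector f g : L2 f -> L2 g ->
  dot f g = dot (projector lam phi f) g + ipK (T f) (T g).
Proof.
move=> Lf Lg; have KT := sd_K SD Lf; have LS := synthesis_in_L2 G SF KT.
rewrite projectorE// {1}(sd_expand SD Lf) (innerDl dotP)//; last exact: discrete_part_L2.
by rewrite (dot_synthesis G SF SD)// addrC.
Qed.

End Projection.

(** * Finite exceptional sets and the extension to L^2 *)

Section Extension.
Variables (R : realType).
Local Notation C := R[i].
Local Notation I := (`[0, pi]%classic : set R).
Local Notation mu := (@lebesgue_measure R).
(** Equality almost everywhere does not give Borel measurability, so the values on the finite list
    are corrected one at a time. *)
Lemma measurable_off_seq (s : seq R) (u v : R -> R) : measurable_fun I v ->
  (forall t, I t -> t \notin s -> u t = v t) -> measurable_fun I u.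
Proof.
elim: s v => [|b s IH] v mv uv.
  by apply: (eq_measurable_fun v) => // t /set_mem It; rewrite uv.
apply: (IH (fun t => v t + (u b - v b) * \1_[set b] t)) => [|t It ts].
  apply: measurable_funD => //; by apply: measurable_funTS; exact: measurable_funM.
rewrite indicE; have [/set_mem ->|/negP tb] := boolP (t \in [set b]).
  by rewrite mulr1 subrKC.
rewrite mulr0 addr0 uv// inE negb_or ts andbT; apply/eqP => tb'; apply: tb.
by rewrite tb'; exact: mem_set.
Qed.

Lemma ae_off_seq (s : seq R) (T' : Type) (u v : R -> T') : (forall t, I t -> t \notin s -> u t = v t) ->
  {ae mu, forall t, I t -> u t = v t}.
Proof. by move=> uv; apply: (ae_mono (ae_notin s)) => t ts It; exact: uv. Qed.

Lemma integrable_off_seq (s : seq R) (u v : R -> R) : mu.-integrable I (EFin \o v) ->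
  (forall t, I t -> t \notin s -> u t = v t) -> mu.-integrable I (EFin \o u).
Proof.
move=> iv uv; have mv : measurable_fun I v by apply/measurable_EFinP; exact: measurable_int iv.
have mu' := measurable_off_seq mv uv.
apply/integrableP; split; first exact/measurable_EFinP.
have [_] := integrableP _ _ _ iv; congr (_ < _)%E; apply: ae_eq_integral.
- exact: mI.
- by apply/measurable_EFinP; exact: measurableT_comp.
- by apply/measurable_EFinP; exact: measurableT_comp.
by apply: (ae_mono (ae_off_seq uv)) => t h It /=; rewrite h.
Qed.

Lemma cintegrable_off_seq (s : seq R) (f g : R -> C) : cintegrable I g ->
  (forall t, I t -> t \notin s -> f t = g t) ->
  cintegrable I f /\ cintegral I f = cintegral I g.
Proof.
move=> [g1 g2] fg.
have if1 : cintegrable I f.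
  by split; [apply: (integrable_off_seq (s := s) (v := fun t => complex.Re (g t)))
            |apply: (integrable_off_seq (s := s) (v := fun t => complex.Im (g t)))] => // t It ts; rewrite fg.
split=> //; apply: cintegral_off_seq fg => //.
  by split; apply/measurable_EFinP; [exact: measurable_int if1.1|exact: measurable_int if1.2].
by split; apply/measurable_EFinP; [exact: measurable_int g1|exact: measurable_int g2].
Qed.

End Extension.

Section L2Extension.
Variables (R : realType) (V : choiceType) (lam : V -> R) (nb : V -> seq V)
  (q r : nat) (ray : 'I_r -> nat -> V) (width : 'I_r -> R).
Hypothesis G : cusp_graph lam nb q ray width.
Local Notation C := R[i].
Local Notation L2 := (L2 lam).
Local Notation I := (`[0, pi]%classic : set R).
Local Notation mu := (@lebesgue_measure R).
Variables (E : R -> 'I_r -> V -> C) (S : R -> 'I_r -> 'I_r -> C) (bad : seq R)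
  (d : {poly R}) (P : 'I_r -> 'I_r -> {poly R}).
Hypothesis SF : spectral_family nb q ray width E S bad d P.
Variables (m : nat) (psi : 'I_m -> V -> C) (x : 'I_m -> R) (T : (V -> C) -> 'I_r * R -> C).
Hypothesis SD : spectral_decomposition lam nb q width E psi x T.
Let lam0 := cg_lam G.
Let dotP := dot_inner lam0.
Let sL := L2_subspace lam0.
Local Notation kappa := (kappa q width).
Local Notation ipK := (ipK q width).
Local Notation transform := (transform lam E).
Local Notation KL2 := (@KL2 R r).
Let KP := ipK_inner G.
Let sK := inner_subspace KP.

Lemma ipK_integral F H : KL2 F -> KL2 H ->
  cintegrable I (fun t => \sum_c (kappa c)%:C%C * (F (c, t) * conjc (H (c, t)))) /\
  cintegral I (fun t => \sum_c (kappa c)%:C%C * (F (c, t) * conjc (H (c, t)))) = ipK F H.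
Proof.
move=> KF KH; apply: (cintegral_sum (@mI R) (@fI R)) => c; exact: (cintegrable_mul (@mI R) (KF c) (KH c)).
Qed.

Lemma sum_nsq_integral F : KL2 F ->
  (\int[mu]_(t in I) (\sum_c nsq (F (c, t)))%:E = (\sum_c inorm (ip I) (fun t => F (c, t)))%:E)%E.
Proof.
move=> KF; under eq_integral do rewrite -sumEFin.
rewrite ge0_integral_sum//.
- by rewrite -sumEFin; apply: eq_bigr => c _; rewrite -(sqint_inorm (@mI R) (KF c)).
- by move=> c; apply/measurable_EFinP; exact: measurable_nsq (KF c).1.
- by move=> c t _; rewrite lee_fin nsq_ge0.
Qed.

Lemma sum_nsq_le F : KL2 F ->
  (\int[mu]_(t in I) (\sum_c nsq (F (c, t)))%:E <= ((\sum_c (kappa c)^-1) * inorm ipK F)%:E)%E.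
Proof.
move=> KF; rewrite sum_nsq_integral// lee_fin mulr_suml; apply: ler_sum => c _.
have i0 c' : 0 <= kappa c' * inorm (ip I) (fun t => F (c', t)).
  by rewrite mulr_ge0 ?(ltW (kappa_gt0 G _))//; exact: (inorm_ge0 (ip_inner (@mI R) (@fI R)) (KF c')).
rewrite (inorm_ipK G KF) (bigD1 c)//= mulrDr mulKf ?gt_eqF ?(kappa_gt0 G)// lerDl.
by rewrite mulr_ge0 ?sumr_ge0// invr_ge0 ltW// (kappa_gt0 G).
Qed.

Lemma sum_nsq_finite f : L2 f -> (\int[mu]_(t in I) (\sum_c nsq (T f (c, t)))%:E < +oo)%E.
Proof. by move=> Lf; rewrite sum_nsq_integral ?ltry//; exact: (sd_K SD). Qed.

(** [X] stands for the Eisenstein adjoint, which is known to agree with [transform] off the bad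
    parameters. The estimate is the contraction [T_le] applied to [fn n - f]. *)
Lemma extension_continuous (s : seq R) (X : nat -> 'I_r -> R -> C) f (fn : nat -> V -> C) :
  L2 f -> (forall n, finitely_supported (fn n)) ->
  (forall n c t, I t -> t \notin s -> X n c t = transform (fn n) (c, t)) ->
  l2norm2 lam (fun v => fn n v - f v) @[n --> \oo] --> 0%E ->
  (\int[mu]_(t in I) (\sum_c nsq (X n c t - T f (c, t)))%:E)%E @[n --> \oo] --> 0%E.
Proof.
move=> Lf ff XE f0; pose K0 := \sum_c (kappa c)^-1.
have Lfn n : L2 (fn n) by exact: finite_L2.
have Lh n : L2 (fun v => fn n v - f v) by exact: (subspaceB sL (Lfn n) Lf).
have K00 : 0 <= K0 by apply: sumr_ge0 => c _; rewrite invr_ge0 ltW// (kappa_gt0 G).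
have bound n : (\int[mu]_(t in I) (\sum_c nsq (X n c t - T f (c, t)))%:E <=
    K0%:E * l2norm2 lam (fun v => fn n v - f v)%R)%E.
  have KT := sd_K SD (Lh n).
  have Kd : KL2 (fun ct => transform (fn n) ct - T f ct).
    exact: (subspaceB sK (transform_K G SF (ff n)) (sd_K SD Lf)).
  have -> : (\int[mu]_(t in I) (\sum_c nsq (X n c t - T f (c, t)))%:E =
      \int[mu]_(t in I) (\sum_c nsq (transform (fn n) (c, t) - T f (c, t)))%:E)%E.
    have mv : measurable_fun I (fun t => \sum_c nsq (transform (fn n) (c, t) - T f (c, t))).
      by apply: measurable_sum => c; exact: measurable_nsq (Kd c).1.
    have e t : I t -> t \notin s -> \sum_c nsq (X n c t - T f (c, t)) =
        \sum_c nsq (transform (fn n) (c, t) - T f (c, t)).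
      by move=> It ts; apply: eq_bigr => c _; rewrite XE.
    apply: ae_eq_integral.
    - exact: mI.
    - by apply/measurable_EFinP; exact: (measurable_off_seq mv e).
    - exact/measurable_EFinP.
    - by apply: (ae_mono (ae_off_seq e)) => t h It; rewrite h.
  apply: le_trans (sum_nsq_le Kd) _; rewrite (l2norm2_inorm lam0 (Lh n)) -EFinM lee_fin.
  apply: ler_wpM2l => //.
  have -> : inorm ipK (fun ct => transform (fn n) ct - T f ct) = inorm ipK (T (fun v => fn n v - f v)).
    have ae1 : aeK (T (fun v => fn n v - f v)) (fun ct => transform (fn n) ct - T f ct).
      have -> : (fun v => fn n v - f v) = fun v => -1 * f v + fn n v.
        by apply/funext => v; ring.
      apply: (aeK_trans (T_lin G SF SD (-1) Lf (Lfn n))) => c.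
      apply: (ae_mono (T_transform G SF SD (ff n) c)) => t h It; rewrite h//; ring.
    apply/esym; apply: (@complexI R); rewrite -(inormE KP KT) -(inormE KP Kd).
    rewrite (ipK_aeK G KT Kd KT ae1) (inner_conj KP KT Kd) (ipK_aeK G KT Kd Kd ae1).
    by rewrite -(inner_conj KP Kd Kd).
  exact: (T_le G SF SD).
apply: (@squeeze_cvge _ _ _ _ (cst 0%E) _ (fun n => (K0%:E * l2norm2 lam (fun v => fn n v - f v)%R)%E)).
- apply: nearW => n; rewrite bound andbT; apply: integral_ge0 => t _.
  by rewrite lee_fin sumr_ge0// => c _; exact: nsq_ge0.
- exact: cvg_cst.
- by rewrite -(mule0 K0%:E); apply: cvgeZl.
Qed.

End L2Extension.

(** * The Eisenstein family on the critical line *)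

Section CriticalLine.
Variables (R : realType) (q : nat).
Hypothesis q1 : (1 < q)%N.
Local Notation C := R[i].
Local Notation k := (Num.sqrt (q%:R : R)).

Let lnq : 0 < ln (q%:R : R).
Proof. by rewrite ln_gt0// ltr1n. Qed.

Lemma expR_half_ln : expR (2^-1 * ln (q%:R : R)) = k.
Proof.
have q0 : 0 < (q%:R : R) by rewrite ltr0n ltnW.
rewrite -[LHS]ger0_norm ?expR_ge0// -sqrtr_sqr; congr Num.sqrt.
by rewrite -expRM_natl mulrA mulfV// mul1r lnK.
Qed.

(** With [s = 1/2 + i t / ln q], the power [q ^ s] is [k * cis t]. *)
Lemma cpow_critical (n : nat) (t : R) :
  cpow q (n%:R * critical_line q t) = k%:C%C ^+ n * cis t ^+ n.
Proof.
have nC : (n%:R : C) = (n%:R)%:C%C by rewrite -(rmorph_nat (real_complex R)).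
rewrite -cis_natM -(rmorphXn (real_complex R)) /= -expR_half_ln -expRM_natl nC /cpow /cis /=.
have -> : (n%:R / 2 - 0 * (t / ln q%:R)) * ln q%:R = n%:R * (2^-1 * ln q%:R) :> R by ring.
have -> : (n%:R * (t / ln q%:R) + 0 / 2) * ln q%:R = n%:R * t by field; rewrite gt_eqF.
by apply/eqP; rewrite eq_complex /= !mul0r subr0 addr0 !eqxx.
Qed.

Lemma critical_lineN (t : R) : 1 - critical_line q t = critical_line q (- t).
Proof.
rewrite /critical_line; congr Complex => /=; last by rewrite sub0r mulNr.
by rewrite [X in X - _](splitr 1) mul1r addrK.
Qed.

Lemma cpow_critical_dual (n : nat) (t : R) :
  cpow q (n%:R * (1 - critical_line q t)) = k%:C%C ^+ n * (cis t)^-1 ^+ n.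
Proof. by rewrite critical_lineN cpow_critical cisN cis_inv. Qed.

Lemma cpow_spec (t : R) :
  cpow q (critical_line q t) + cpow q (1 - critical_line q t) = (spec q t)%:C%C.
Proof.
have := cpow_critical 1 t; have := cpow_critical_dual 1 t.
rewrite !mul1r !expr1 => -> ->.
by rewrite -mulrDr cis_joukowski -(rmorphM (real_complex R)) /spec; congr (_%:C)%C; ring.
Qed.

(** Every point of the segment has a neighborhood that meets [D] at most in its center; by
    compactness finitely many centers suffice. *)
Lemma discrete_on_critical_line (D : set C) :
  (forall s0 : C^o, \forall s \near s0^', ~ D s) ->
  exists s : seq R, forall t, 0 <= t <= pi -> t \notin s -> ~ D (critical_line q t).
Proof.
move=> Ds.
have /boolp.choice[e eP] : forall t0 : R, exists e : R, 0 < e /\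
    forall t, `|t0 - t| < e -> t != t0 -> ~ D (critical_line q t).
  move=> t0; have /nbhs_ballP[[e e'] /= e0 eP] := Ds (critical_line q t0).
  have [/eqP e'E er0] : e' == 0 /\ 0 < e by move: e0; rewrite ltcE /= => /andP[/eqP -> ->].
  subst e'; exists (e * ln q%:R); split=> [|t tt0 tn]; first by rewrite mulr_gt0.
  apply: eP; last by apply: contra tn => /eqP[] /(mulIf (invr_neq0 (negbT (gt_eqF lnq)))) ->.
  change ((`|critical_line q t0 - critical_line q t| : C) < e%:C%C).
  rewrite normc_def /= subrr expr0n add0r sqrtr_sqr -mulrBl normrM normfV (gtr0_norm lnq).
  by rewrite ltcR ltr_pdivrMr.
have := @segment_compact R 0 pi; rewrite compact_cover.
move=> /(_ R `[0, pi]%classic (fun t0 => ball t0 (e t0))).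
case=> [t0 _||D' _ cD].
- by apply: ball_open; case: (eP t0).
- by move=> t It; exists t => //; apply: ballxx; case: (eP t).
exists (enum_fset D') => t It tD; have [t0 /= t0D tb] := cD t It.
apply: (eP t0).2 => //.
by apply: contra tD => /eqP ->.
Qed.

End CriticalLine.

Lemma plancherel_matrixE (R : realType) (q r : nat) (width : 'I_r -> R) :
  (forall c, 0 < width c) ->
  plancherel_matrix q width = diag_mx (\row_c (kappa q width c)%:C%C).
Proof.
move=> w0; rewrite /plancherel_matrix.
pose D : 'M[R[i]]_r := diag_mx (\row_c (width c)%:C%C).
pose D' : 'M[R[i]]_r := diag_mx (\row_c ((width c)^-1)%:C%C).
have DD : D *m D' = 1%:M.
  rewrite /D /D' mulmx_diag; apply/matrixP => i j; rewrite !mxE; case: (i == j) => //=.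
  by rewrite -(rmorphM (real_complex R)) mulfV ?gt_eqF// (rmorph1 (real_complex R)).
have [uD _] := mulmx1_unit DD.
have -> : invmx D = D' by rewrite -[LHS]mulmx1 -DD mulKmx.
apply/matrixP => i j; rewrite !mxE; case: (i == j); last by rewrite !mulr0n mulr0.
rewrite !mulr1n /kappa.
have -> : (2 * pi%:C%C * (q%:R + 1) : R[i]) = (2 * pi * (q%:R + 1))%:C%C.
  have e n : (n%:R : R[i]) = (n%:R : R)%:C%C by rewrite (rmorph_nat (real_complex R)).
  by rewrite !natr1 (e 2) (e q.+1) -!(rmorphM (real_complex R)).
by rewrite -(fmorphV (real_complex R)) -(rmorphM (real_complex R)) -invfM.
Qed.

(** * The Eisenstein functions as input of the spectral analysis *)

Section EisensteinFamily.
Variables (R : realType) (V : choiceType) (lam : V -> R) (nb : V -> seq V)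
  (q r : nat) (ray : 'I_r -> nat -> V) (width : 'I_r -> R).
Hypothesis G : cusp_graph lam nb q ray width.
Local Notation C := R[i].
Local Notation A := (@nbop R V nb).
Variable Eis : C -> 'cV[C]_r -> V -> C.
Hypothesis EP : is_eisenstein_family A q ray Eis.

Definition eisenstein_basis (t : R) (c : 'I_r) : V -> C :=
  Eis (critical_line q t) (delta_mx c 0).

(** The bad parameters are the ends [0] and [pi], where [z ^+ 2 = 1], and a finite list covering
    those that meet [D]. Linearity in [b] is a consequence of the uniqueness clause. *)
Lemma eisenstein_on_critical_line : exists (S : R -> 'I_r -> 'I_r -> C) (bad : seq R),
  (forall t, 0 <= t <= pi -> t \notin bad -> sin t != 0 /\ forall c,
    ray_expansion q ray (cis t) (eisenstein_basis t c) (fun c' => (c' == c)%:R) (fun c' => S t c' c) /\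
    A (eisenstein_basis t c) = (fun v => (spec q t)%:C%C * eisenstein_basis t c v)) /\
  (forall t, 0 <= t <= pi -> t \notin bad -> forall b,
    Eis (critical_line q t) b = fun v => \sum_c b c 0 * eisenstein_basis t c v).
Proof.
have [[D [Saut [Ddisc EisP]]] _] := EP.
have [s sD] := discrete_on_critical_line (cg_q G) Ddisc.
exists (fun t c' c => Saut (critical_line q t) c' c), (0 :: pi :: s); split=> t t0.
  rewrite !inE !negb_or => /and3P[tn0 tnpi ts]; split.
    rewrite gt_eqF// sin_gt0_pi//; case/andP: t0 => h1 h2.
    by rewrite lt_neqAle eq_sym tn0 h1 lt_neqAle tnpi h2.
  move=> c; have [eg ee _] := EisP _ (sD t t0 ts) (delta_mx c 0); split.
    move=> c' n n0; rewrite /eisenstein_basis (ee c' n n0) (cpow_critical (cg_q G)).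
    rewrite (cpow_critical_dual (cg_q G)) mulrDr -!mulrA !mxE eqxx andbT; congr (_ + _ * (_ * _)).
    rewrite (bigD1 c)//= mxE !eqxx mulr1 big1 ?addr0// => i ic.
    by rewrite mxE (negbTE ic) mulr0.
  by rewrite /eisenstein_basis eg (cpow_spec (cg_q G)).
rewrite !inE !negb_or => /and3P[_ _ ts] b.
have nD := sD t t0 ts; have [_ _ uniq_b] := EisP _ nD b.
apply/esym/(uniq_b _ (Saut (critical_line q t) *m b)).
  rewrite /is_generalized_eigenfunction; have Alin := @nbop_lin R V nb.
  rewrite (linop_sum Alin); apply/funext => v; rewrite mulr_sumr; apply: eq_bigr => c _.
  by have [eg _ _] := EisP _ nD (delta_mx c 0); rewrite /eisenstein_basis eg; ring.
move=> c' n n0; set z1 := cpow q (n%:R * _); set z2 := cpow q (n%:R * (1 - _)).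
have e c : eisenstein_basis t c (ray c' n) = z1 * (c' == c)%:R + z2 * Saut (critical_line q t) c' c.
  have [_ ee _] := EisP _ nD (delta_mx c 0).
  rewrite /eisenstein_basis (ee c' n n0) -/z1 -/z2 !mxE eqxx andbT; congr (_ + _ * _).
  rewrite (bigD1 c)//= mxE !eqxx mulr1 big1 ?addr0// => i ic.
  by rewrite mxE (negbTE ic) mulr0.
under eq_bigr do rewrite e mulrDr.
rewrite big_split /= mxE mulr_sumr; congr (_ + _); last by apply: eq_bigr => c _; ring.
rewrite (bigD1 c')//= eqxx mulr1 mulrC big1 ?addr0// => c cc'.
by rewrite eq_sym (negbTE cc') !mulr0.
Qed.

End EisensteinFamily.

Section Arithmetic.
Variables (R : realType) (F : finFieldType) (k : fieldExtType {fraction {poly F}})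
  (infty : place k) (infty_degree : degree_one infty)
  (kc : forall v : place k, completion v)
  (Kf : set (adelic_PGL2 infty kc)) (Kf_compact_open : compact_open_subgroup Kf)
  (g0 : adelic_PGL2 infty kc)
  (r : nat) (r_gt0 : (0 < r)%N)
  (ray : 'I_r -> nat -> arithmetic_quotient Kf g0) (width : 'I_r -> R)
  (cusps : is_cusp_decomposition #|F| ray width).

Lemma arithmetic_cusp_graph : exists nb : arithmetic_quotient Kf g0 ->
    seq (arithmetic_quotient Kf g0),
  (fun f : arithmetic_quotient Kf g0 -> R[i] => adjacency f) = nbop nb /\
  cusp_graph (fun v : arithmetic_quotient Kf g0 => weight R v) nb #|F| ray width.
Proof.
have [nb [nbE w0 wsym first]] := arithmetic_quotient_graph infty_degree Kf_compact_open r_gt0 cusps.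
have AE : (fun f : arithmetic_quotient Kf g0 -> R[i] => adjacency f) = nbop nb.
  by apply/funext => f; apply/funext => v; rewrite nbE.
exists nb; split=> //; split.
- exact: w0.
- exact: wsym.
- exact: finRing_gt1.
- exact: (ray_inj cusps).
- exact: (core_finite cusps).
- by move=> f c n n1; rewrite -AE (ray_adjacency cusps).
- exact: first.
- exact: (ray_weight cusps).
- exact: (width_gt0 cusps).
Qed.

End Arithmetic.

(** * The Plancherel formulas and the theorem *)

Section Plancherel.
Variables (R : realType) (V : choiceType) (lam : V -> R) (nb : V -> seq V)
  (q r : nat) (ray : 'I_r -> nat -> V) (width : 'I_r -> R).
Hypothesis G : cusp_graph lam nb q ray width.
Local Notation C := R[i].
Local Notation A := (@nbop R V nb).
Local Notation I := (`[0, pi]%classic : set R).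
Local Notation dot := (dot lam).
Variable Eis : C -> 'cV[C]_r -> V -> C.
Local Notation e := (eisenstein_basis q Eis).
Variables (S : R -> 'I_r -> 'I_r -> C) (bad : seq R) (d : {poly R}) (P : 'I_r -> 'I_r -> {poly R}).
Local Notation E := (cutoff_family e bad).
Hypothesis SF : spectral_family nb q ray width E S bad d P.
Hypothesis Elin : forall t, 0 <= t <= pi -> t \notin bad -> forall b,
  Eis (critical_line q t) b = fun v => \sum_c b c 0 * e t c v.
Variables (m : nat) (psi : 'I_m -> V -> C) (x : 'I_m -> R) (T : (V -> C) -> 'I_r * R -> C).
Hypothesis SD : spectral_decomposition lam nb q width E psi x T.
Variables (N : nat) (phi : 'I_N -> V -> C).
Hypothesis phiP : orthonormal_basis lam (pp_subspace lam A) phi.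
Local Notation M := (plancherel_matrix q width).
Local Notation kappa := (kappa q width).
Let lam0 := cg_lam G.

Lemma eisenstein_adjointE f t c : 0 <= t <= pi -> t \notin bad ->
  eisenstein_adjoint lam Eis (critical_line q t) f c 0 = transform lam E f (c, t).
Proof.
move=> t0 tb; rewrite mxE /transform /=; congr Defs.dot.
by apply/funext => v; rewrite /cutoff_family t0 tb.
Qed.

(** Expanding in the basis [e t c] by [Elin] turns the matrix [M] into the diagonal weights
    [kappa c]. *)
Lemma eisenstein_kernel f g t : finitely_supported g -> 0 <= t <= pi -> t \notin bad ->
  dot (Eis (critical_line q t) (M *m eisenstein_adjoint lam Eis (critical_line q t) f)) g =
  \sum_c (kappa c)%:C%C * (transform lam E f (c, t) * conjc (transform lam E g (c, t))).
Proof.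
move=> fg t0 tb; have [s us s0] := (finitely_supportedP g).1 fg.
have dE h : dot h g = \sum_(v <- s) h v * conjc (g v) * (lam v)%:C%C.
  by rewrite (dot_seq lam us)// => v /s0; right.
rewrite dE (Elin t0 tb) (plancherel_matrixE _ (cg_width G)).
under eq_bigr do rewrite !mulr_suml.
rewrite exchange_big; apply: eq_bigr => c _.
have -> : (diag_mx (\row_c (kappa c)%:C%C) *m eisenstein_adjoint lam Eis (critical_line q t) f) c 0 =
    (kappa c)%:C%C * transform lam E f (c, t).
  by rewrite mul_diag_mx mxE [X in X * _]mxE eisenstein_adjointE.
have -> : transform lam E g (c, t) = \sum_(v <- s) g v * conjc (e t c v) * (lam v)%:C%C.
  rewrite /transform (dot_seq lam us) => [|v /s0]; last by left.
  by apply: eq_bigr => v _; rewrite /cutoff_family /= t0 tb.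
rewrite (rmorph_sum conjc) !mulr_sumr; apply: eq_bigr => v _.
transitivity ((kappa c)%:C%C * (transform lam E f (c, t) * (conjc (g v) * e t c v * (lam v)%:C%C))).
  by ring.
congr (_ * (_ * _)); apply/esym.
have cE (a b : C) (l : R) : conjc (a * conjc b * l%:C%C) = conjc a * b * l%:C%C.
  by rewrite !conjcM conjcK conjc_real.
exact: cE.
Qed.

(** The integrand with the Eisenstein family itself can differ from that of the cutoff family only
    on the finite list [bad], which affects neither integrability nor the integral. *)
Lemma plancherel_finite f g : finitely_supported f -> finitely_supported g ->
  let h theta := dot (Eis (critical_line q theta)
    (M *m eisenstein_adjoint lam Eis (critical_line q theta) f)) g in
  cintegrable I h /\ dot f g = dot (projector lam phi f) g + cintegral I h.
Proof.
move=> ff fg h; have KF := transform_K G SF ff; have KH := transform_K G SF fg.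
have Lf : L2 lam f by exact: finite_L2.
have Lg : L2 lam g by exact: finite_L2.
have [c1 c2] := ipK_integral q width KF KH.
have hE t : I t -> t \notin bad ->
    h t = \sum_c (kappa c)%:C%C * (transform lam E f (c, t) * conjc (transform lam E g (c, t))).
  by rewrite /= in_itv /= => t0 tb; exact: eisenstein_kernel.
have [h1 h2] := cintegrable_off_seq c1 hE; split=> //.
rewrite (plancherel_projector G SF SD phiP Lf Lg) h2 c2; congr (_ + _).
have KTf := sd_K SD Lf; have KTg := sd_K SD Lg; have KP := ipK_inner G.
rewrite (ipK_aeK G KTf KF KTg (T_transform G SF SD ff)) (inner_conj KP KTg KF).
by rewrite (ipK_aeK G KTg KH KF (T_transform G SF SD fg)) -(inner_conj KP KH KF).
Qed.

Definition eisenstein_transform (f : V -> C) (t : R) : 'cV[C]_r := \col_c T f (c, t).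

Lemma eisenstein_transformP : is_L2_extension lam q Eis eisenstein_transform.
Proof.
move=> f Lf; have KT := sd_K SD Lf; split=> [c|]; last split.
- have -> : (fun t => eisenstein_transform f t c 0) = fun t => T f (c, t).
    by apply/funext => t; rewrite mxE.
  exact: (KT c).1.
- have -> : (fun t => (\sum_c ComplexField.Normc.normc (eisenstein_transform f t c 0) ^+ 2)%:E) =
      fun t => (\sum_c nsq (T f (c, t)))%:E.
    by apply/funext => t; congr EFin; apply: eq_bigr => c _; rewrite mxE normc_sqr.
  exact: (sum_nsq_finite SD Lf).
move=> fn ff f0.
pose X n c t := eisenstein_adjoint lam Eis (critical_line q t) (fn n) c 0.
have XE n c t : I t -> t \notin bad -> X n c t = transform lam E (fn n) (c, t).
  by rewrite /= in_itv /= => t0 tb; exact: eisenstein_adjointE.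
have := extension_continuous G SF SD Lf ff XE f0.
apply: cvg_trans; apply: near_eq_cvg; apply: nearW => n.
apply: eq_integral => t _; congr EFin.
by apply: eq_bigr => c _; rewrite normc_sqr [eisenstein_transform f t c 0]mxE.
Qed.

Lemma plancherel_L2 f g : L2 lam f -> L2 lam g ->
  let h theta := ((map_mx (@conjc R) (eisenstein_transform g theta))^T *m M *m
    eisenstein_transform f theta) 0 0 in
  cintegrable I h /\ dot f g = dot (projector lam phi f) g + cintegral I h.
Proof.
move=> Lf Lg h; have KTf := sd_K SD Lf; have KTg := sd_K SD Lg.
have -> : h = fun t => \sum_c (kappa c)%:C%C * (T f (c, t) * conjc (T g (c, t))).
  apply/funext => t; rewrite /h (plancherel_matrixE _ (cg_width G)) mul_mx_diag mxE.
  by apply: eq_bigr => c _; rewrite !mxE; ring.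
have [c1 c2] := ipK_integral q width KTf KTg; split=> //.
by rewrite c2; exact: (plancherel_projector G SF SD phiP).
Qed.

End Plancherel.

Theorem corollary2p31
  (R : realType) (F : finFieldType) (k : fieldExtType {fraction {poly F}})
  (k_constants : is_full_constant_field k)
  (infty : place k) (infty_degree : degree_one infty)
  (kc : forall v : place k, completion v)
  (Kf : set (adelic_PGL2 infty kc)) (Kf_compact_open : compact_open_subgroup Kf)
  (g0 : adelic_PGL2 infty kc)
  (r : nat) (r_gt0 : (0 < r)%N)
  (ray : 'I_r -> nat -> arithmetic_quotient Kf g0) (width : 'I_r -> R)
  (cusps : is_cusp_decomposition #|F| ray width)
  (Eis : R[i] -> 'cV[R[i]]_r -> arithmetic_quotient Kf g0 -> R[i])
  (Eis_family : is_eisenstein_family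
     (fun f : arithmetic_quotient Kf g0 -> R[i] => adjacency f) #|F| ray Eis) :
  let q := #|F| in
  let lam : arithmetic_quotient Kf g0 -> R := fun v => weight R v in
  let A : (arithmetic_quotient Kf g0 -> R[i]) -> (arithmetic_quotient Kf g0 -> R[i]) :=
    fun f => adjacency f in
  let s := critical_line q : R -> R[i] in
  let M := plancherel_matrix q width in
  orthogonal_direct_sum lam (L2 lam) (pp_subspace lam A) (ac_subspace lam A) /\
  essential_spectrum lam A =
    [set x%:C%C | x in `[- (2 * Num.sqrt q%:R), 2 * Num.sqrt (q%:R : R)]] /\
  finite_dimensional (pp_subspace lam A) /\
  sc_subspace lam A = [set fun=> 0] /\
  (exists2 m : R -> \bar R, is_ac_multiplicity lam A m &
     {ae lebesgue_measure, forall x : R,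
        - (2 * Num.sqrt q%:R) < x < 2 * Num.sqrt q%:R -> m x = r%:R%:E}) /\
  forall (N : nat) (phi : 'I_N -> arithmetic_quotient Kf g0 -> R[i]),
    orthonormal_basis lam (pp_subspace lam A) phi ->
    (forall f g, finitely_supported f -> finitely_supported g ->
       let h theta :=
         dot lam (Eis (s theta) (M *m eisenstein_adjoint lam Eis (s theta) f)) g in
       cintegrable `[0%R, pi] h /\
       dot lam f g = dot lam (projector lam phi f) g + cintegral `[0%R, pi] h) /\
    (exists2 T : (arithmetic_quotient Kf g0 -> R[i]) -> R -> 'cV[R[i]]_r,
       is_L2_extension lam q Eis T &
       forall f g, L2 lam f -> L2 lam g ->
         let h theta := ((map_mx (@conjc R) (T g theta))^T *m M *m T f theta) 0 0 in
         cintegrable `[0%R, pi] h /\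
         dot lam f g = dot lam (projector lam phi f) g + cintegral `[0%R, pi] h).
Proof.
move=> q lam A s M.
have [nb [AE G]] := arithmetic_cusp_graph infty_degree Kf_compact_open r_gt0 cusps.
have {}AE : A = nbop nb by [].
have {}Eis_family : is_eisenstein_family (nbop nb) q ray Eis by rewrite -AE.
rewrite AE.
have [S [bad [eP Elin]]] := eisenstein_on_critical_line G Eis_family.
have [bad' [d [P [SF sub]]]] := spectral_family_exists G eP.
have {}Elin t : 0 <= t <= pi -> t \notin bad' -> forall b,
    Eis (critical_line q t) b = fun v => \sum_c b c 0 * eisenstein_basis q Eis t c v.
  by move=> t0 tb; apply: Elin => //; apply: contra tb; exact: sub.
have [m [psi [x [T SD]]]] := spectral_decomposition_exists G SF.
split; first exact: (orthogonal_decomposition G SF SD).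
split; first exact: (essential_spectrumE G SF SD).
split; first exact: (pp_finite_dimensional G SF SD).
split; first exact: (sc_subspaceE G SF SD).
split.
  exists (@ac_multiplicity R q r); first exact: (ac_multiplicityP G SF SD).
  (* On the open band the constructed multiplicity equals [r] at every point. *)
  apply: aeW => y yb; rewrite /ac_multiplicity indicE mem_set ?mulr1//.
move=> N phi phiP; split=> [f g ff fg|]; first exact: (plancherel_finite G SF Elin SD phiP).
exists (eisenstein_transform T); first exact: (eisenstein_transformP G SF SD).
by move=> f g Lf Lg; exact: (plancherel_L2 G SF SD phiP).
Qed.
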